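(* Let $$F_1(q)=\sum_{n=0}^\infty F_{1,n}(q),\quad F_{1,n}(q)=\frac{(-1)^nq^{\frac12n(n+1)}}{(q;q)_n};\qquad F_2(q)=\sum_{n=0}^\infty F_{2,n}(q),\quad F_{2,n}(q)=\frac{(-1)^n(-q;q)_n}{(q;q)_n};$$ $$F_3(q)=\sum_{n=0}^\infty F_{3,n}(q),\quad F_{3,n}(q)=\frac{q^n(q;q^2)_n}{(q^2;q^2)_n};\qquad F_4(q)=\sum_{n=0}^\infty F_{4,n}(q),\quad F_{4,n}(q)=\frac{(-1)^nq^{2n+1}(-q;q)_n}{(q;q)_n(1-q^{2n+1})},$$ where for $|q|<1$ the series $F_2(q)$ is interpreted as $F_2(q)=\frac12(1-q)\sum_{n=0}^\infty\frac{(-q)^n(-q;q)_n}{(q;q)_n}$. (A) For $|q|<1$, $$F_1(q)=\sum_{n\in\mathbb{Z}}(-1)^nq^{\frac12n(3n+1)},\qquad F_2(q)=\frac12\sum_{n\in\mathbb{Z}}(-1)^nq^{n^2},$$ $$F_3(q)=\frac12\sum_{n\in\mathbb{Z}}q^{\frac12n(n+1)},\qquad F_4(q)=\frac12\sum_{n\in\mathbb{Z}}(-1)^{n+1}q^{n^2}+\frac12\sum_{n\in\mathbb{Z}}q^{2n^2}.$$ In each case, $F_j(q)$ (with $q=e^{2\pi iz}$) is, up to multiplication by a power of $q$, a holomorphic modular form of weight $1/2$. (B) Take $\mathcal{S}[F_j](q)=0$ for $j=1,2,3,4$, so that $\mathcal{G}[F_j](q)=\sum_{n=0}^\infty\left(F_{j,n}(q^{-1})-F_{j,\infty}(q^{-1})\right)$,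 where $F_{j,\infty}(q^{-1})=\lim_{n\to\infty}F_{j,n}(q^{-1})$. Then for $|q|<1$ $$\mathcal{G}[F_1](q)=\sum_{n=0}^\infty\left(\frac1{(q;q)_n}-\frac1{(q;q)_\infty}\right)=-\frac1{(q;q)_\infty}\sum_{n=1}^\infty\frac{q^n}{1-q^n},$$ $$\mathcal{G}[F_2](q)=\sum_{n=0}^\infty\left(\frac{(-q;q)_n}{(q;q)_n}-\frac{(-q;q)_\infty}{(q;q)_\infty}\right)=-2\frac{(-q;q)_\infty}{(q;q)_\infty}\sum_{n=1}^\infty\frac{q^n}{1-q^{2n}},$$ $$\mathcal{G}[F_3](q)=\sum_{n=0}^\infty\left(\frac{(q;q^2)_n}{(q^2;q^2)_n}-\frac{(q;q^2)_\infty}{(q^2;q^2)_\infty}\right)=\frac{(q;q^2)_\infty}{(q^2;q^2)_\infty}\sum_{n=1}^\infty\frac{(-1)^{n-1}q^n}{1-q^n},$$ $$\mathcal{G}[F_4](q)=-\sum_{n=0}^\infty\left(\frac{(-q;q)_n}{(q;q)_n(1-q^{2n+1})}-\frac{(-q;q)_\infty}{(q;q)_\infty}\right)=\frac{(-q;q)_\infty}{(q;q)_\infty}\left(2\sum_{n=1}^\infty\frac{q^n}{1-q^{2n}}-h(q)\right),$$ where $$h(q)=\sum_{n=0}^\infty q^{n+1}\frac{(q;q)_{2n+1}}{(-q;q)_{2n+2}}\qquad\text{and}\qquad h(q)=-\sum_{\mathfrak{a}\subset\mathbb{Z}[\sqrt2]}(-1)^{N(\mathfrak{a})}q^{|N(\mathfrak{a})|},$$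 the last sum running over the nonzero ideals $\mathfrak{a}$ of $\mathbb{Z}[\sqrt2]$.
   Context: Notation: $(x;q)_n=\prod_{j=0}^{n-1}(1-xq^j)$, $(x;q)_\infty=\prod_{j=0}^\infty(1-xq^j)$. $N(\mathfrak{a})$ is the norm of the ideal $\mathfrak{a}$. Modular forms of weight $1/2$ are with respect to some finite index subgroup of $SL_2(\mathbb{Z})$ and some multiplier system. For a series $H=\sum_nH_n$, the shadow $\mathcal{S}[H]$ and ghost $\mathcal{G}[H]$ are related by $\mathcal{S}[H](q)=\sum_{n\ge0}(H_n(q^{-1})-H_\infty(q^{-1}))-\mathcal{G}[H](q)$ with $H_\infty(q^{-1})=\lim_{n\to\infty}H_n(q^{-1})$; here the shadows are chosen to be $0$ (a modular form being a mock theta function with zero shadow). *)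

(* Defs.v *)
From mathcomp Require Import all_boot all_order all_algebra finmap.
From mathcomp Require Import all_classical all_reals all_analysis.
From mathcomp Require Import complex summability.

Set Implicit Arguments.
Unset Strict Implicit.
Unset Printing Implicit Defensive.

Import Order.TTheory GRing.Theory Num.Theory.
Import numFieldNormedType.Exports.

Local Open Scope classical_set_scope.
Local Open Scope ring_scope.

(* The regular algebra [R[i]^o] is where MathComp-Analysis puts the topology
   and the normed space structure (over itself) of the field [R[i]]. *)
Notation Cplx R := ((complex R)^o) (only parsing).

Section Sums.
Variable R : realType.
Implicit Types (u : nat -> Cplx R).

Definition cvg_sum (m : nat) u : Prop :=
  cvgn (fun N => \sum_(m <= n < N) u n).

(* Only meaningful when [cvg_sum m u] holds. *)
Definition sum_from (m : nat) u : Cplx R :=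
  limn (fun N => \sum_(m <= n < N) u n).

(* Unordered sums: limits along the directed set of finite subsets of [I].
   The value [usum f] is only meaningful when [cvg_usum f] holds. *)
Definition cvg_usum (I : choiceType) (f : I -> Cplx R) : Prop :=
  cvg (partial_sum f @ totally).

Definition usum (I : choiceType) (f : I -> Cplx R) : Cplx R :=
  lim (partial_sum f @ totally).

End Sums.

Section QSeries.
Variable R : realType.
Local Notation C := (Cplx R).
Implicit Types (x q : C) (n : nat).

Definition qpoch x q n : C := \prod_(0 <= j < n) (1 - x * q ^+ j).

Definition qpoch_oo x q : C := limn (qpoch x q).

Definition F1n n q : C :=
  (-1) ^+ n * q ^+ (n * n.+1)./2 / qpoch q q n.

Definition F2n n q : C :=
  (-1) ^+ n * qpoch (- q) q n / qpoch q q n.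

Definition F3n n q : C :=
  q ^+ n * qpoch q (q ^+ 2) n / qpoch (q ^+ 2) (q ^+ 2) n.

Definition F4n n q : C :=
  (-1) ^+ n * q ^+ (2 * n).+1 * qpoch (- q) q n
  / (qpoch q q n * (1 - q ^+ (2 * n).+1)).

(* The terms [F2n n q] do not tend to [0] for [|q| < 1]; this is the general
   term of the convergent series through which the sum of the [F2n n q] is
   interpreted. *)
Definition F2n_reg n q : C :=
  (- q) ^+ n * qpoch (- q) q n / qpoch q q n.

Definition F1 q : C := sum_from 0 (F1n ^~ q).
Definition F2 q : C := 2^-1 * (1 - q) * sum_from 0 (F2n_reg ^~ q).
Definition F3 q : C := sum_from 0 (F3n ^~ q).
Definition F4 q : C := sum_from 0 (F4n ^~ q).

(* For [H = \sum_n H_n]: the limit term [H_oo(1/q)], and the ghost of [H]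
   associated with the choice [S] of a shadow. *)
Definition limit_term (H : nat -> C -> C) q : C :=
  limn (fun n => H n q^-1).

Definition ghost (H : nat -> C -> C) (S : C -> C) q : C :=
  sum_from 0 (fun n => H n q^-1 - limit_term H q) - S q.

Definition h_term n q : C :=
  q ^+ n.+1 * qpoch q q (2 * n).+1 / qpoch (- q) q (2 * n).+2.

Definition h_fun q : C := sum_from 0 (h_term ^~ q).

End QSeries.

Arguments F1n {R}.
Arguments F2n {R}.
Arguments F3n {R}.
Arguments F4n {R}.
Arguments F2n_reg {R}.
Arguments F1 {R}.
Arguments F2 {R}.
Arguments F3 {R}.
Arguments F4 {R}.
Arguments h_term {R}.
Arguments h_fun {R}.

Section ZSqrt2.
Variable R : realType.

Definition zsqrt2 : set R :=
  [set x | exists a b : int, x = a%:~R + b%:~R * Num.sqrt 2].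

Definition is_ideal (I : set R) : Prop :=
  [/\ I `<=` zsqrt2, I 0,
      (forall x y, I x -> I y -> I (x + y)) &
      (forall r x, zsqrt2 r -> I x -> I (r * x))].

Definition nonzero_ideals : set (set R) :=
  [set I | is_ideal I /\ I <> [set 0]].

Definition cosets (I : set R) : set (set R) :=
  [set [set x + y | y in I] | x in zsqrt2].

(* [fset_set] sends infinite sets to the empty set, which only affects the
   zero ideal: all other quotients are finite. *)
Definition ideal_norm (I : set R) : nat := #|` fset_set (cosets I)|.

End ZSqrt2.

Arguments nonzero_ideals {R}.

Section ModularForms.
Variable R : realType.
Local Notation C := (Cplx R).
Implicit Types (z : C) (g : 'M[int]_2) (G : set 'M[int]_2) (f F : C -> C).

Definition cexp z : C :=
  (expR (complex.Re z))%:C%C *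
  (cos (complex.Im z) +i* sin (complex.Im z))%C.

Definition upper_half : set C := [set z | 0 < complex.Im z].

Definition SL2Z : set 'M[int]_2 := [set g | \det g = 1].

Definition subgroup_SL2Z G : Prop :=
  [/\ G `<=` SL2Z, G 1,
      (forall g1 g2, G g1 -> G g2 -> G (g1 * g2)) &
      (forall g, G g -> G g^-1)].

Definition finite_index G : Prop :=
  exists s : seq 'M[int]_2, forall g, SL2Z g ->
    exists g1 g2, [/\ G g1, g2 \in s & g = g1 * g2].

Definition denom g z : C := (g 1 0)%:~R * z + (g 1 1)%:~R.

Definition moebius g z : C :=
  ((g 0 0)%:~R * z + (g 0 1)%:~R) / denom g z.

(* [(c z + d)^(1/2)]; [sqrtc] is the principal branch, with values of argument
   in ]-pi/2, pi/2]. *)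
Definition autfactor g z : C := sqrtc (denom g z).

(* Multiplier systems of weight 1/2. The value at [-1] is [e^(- i pi / 2)]. *)
Definition multiplier_system G (nu : 'M[int]_2 -> C) : Prop :=
  [/\ (forall g, G g -> `|nu g| = 1),
      (forall g1 g2 z, G g1 -> G g2 -> upper_half z ->
         nu (g1 * g2) * autfactor (g1 * g2) z =
         nu g1 * nu g2 * autfactor g1 (moebius g2 z) * autfactor g2 z) &
      (G (-1) -> nu (-1) = (0 -i* 1)%C)].

Definition holomorphic_on_upper_half f : Prop :=
  forall z, upper_half z -> derivable f z 1.

(* Holomorphy at the cusp [g(oo)], for each [g]: the transform of [f] under
   [g] is bounded in some half-plane [A <= Im z]. *)
Definition holomorphic_at_cusps f : Prop :=
  forall g, SL2Z g ->
    exists A B : R, 0 < A /\ forall z, A <= complex.Im z ->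
      `|f (moebius g z) / autfactor g z| <= B%:C%C.

Definition holomorphic_modular_form_half f : Prop :=
  exists (G : set 'M[int]_2) (nu : 'M[int]_2 -> C),
    [/\ subgroup_SL2Z G, finite_index G & multiplier_system G nu] /\
    [/\ holomorphic_on_upper_half f,
        (forall g z, G g -> upper_half z ->
           f (moebius g z) = nu g * autfactor g z * f z) &
        holomorphic_at_cusps f].

(* [q^r F(q)], for [q = e^(2 pi i z)] and [q^r = e^(2 pi i r z)], as a function
   of [z]. *)
Definition q_twist (r : rat) F z : C :=
  let w : C := (0 +i* (2 * pi))%C * z in
  cexp (ratr r * w) * F (cexp w).

Definition modular_up_to_q_power F : Prop :=
  exists r : rat, holomorphic_modular_form_half (q_twist r F).

End ModularForms.

(* Main.v *)
(* Part (A): Euler's identities, the q-binomial theorem and the Jacobi triple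
   product turn F1, F2, F3 into infinite products; F4 is a Lambert-type series
   evaluated by the q-binomial theorem.  On q = e^(2 pi i z) these products are
   eta(z), eta(z)^2/eta(2z) and eta(2z)^2/eta(z), and F4 combines theta4(q) with
   theta4(-q^2).  The law eta(-1/z)^2 = -iz eta(z)^2 comes from the derivative:
   the logarithmic derivative of eta is the weight 2 Eisenstein series, whose
   transformation follows by summing the cotangent expansion in both orders.
   Only squares are tracked: eta(gz)^2 = K (cz+d) eta(z)^2 with K^12 = 1, and a
   continuity argument on the half-plane recovers the multiplier system, whose
   values are 24th roots of unity; hence F4 is modular on the subgroup of
   Gamma(16) where the multipliers of its two summands agree.  The behaviour at
   a cusp is read off from the Hermite normal form of m g.

   Part (B): the ghosts are limits of derivatives of q-binomial sums.  The
   series h(q) is a Hecke-type sum over a cone in Z^2 by a conjugate Bailey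
   pair, and that cone is a fundamental domain for the action of the units on
   the elements of Z[sqrt 2], which is Euclidean. *)

Require Import Defs.
From mathcomp Require Import all_boot all_order all_algebra finmap.
From mathcomp Require Import all_classical all_reals all_analysis.
From mathcomp Require Import complex summability.
From mathcomp Require Import ring lra zify.
Import Order.TTheory GRing.Theory Num.Theory.
Import numFieldNormedType.Exports.

Set Implicit Arguments.
Unset Strict Implicit.
Unset Printing Implicit Defensive.

Local Open Scope classical_set_scope.
Local Open Scope ring_scope.

Import Normc.

(** * Real-valued norm and limits of complex families *)

Section ComplexNorm.
Variable R : realType.
Local Notation C := (Cplx R).
Local Notation nc := (@normc R).
Implicit Types (x y z : C).

(** The analysis is kept elementary: real inequalities, dominated convergence for series, and the
    mean value theorem on segments. Every series is an absolutely summable family over a type, so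
    reordering is Fubini, and limits are taken under one uniform majorant. The expansions behind the
    Eisenstein series come from the duplication formulas of [pi^2/sin^2] and [pi cot]: iterated k
    times, they exhibit each function as a finite sum over points scaled by a power of 1/2, whose
    limit is the lattice series. The double series of weight 2 converges only conditionally; a
    telescoping correction at half-integers makes it absolutely summable and carries the whole
    defect between the two orders of summation. For h, the obstacle is an alternating series whose
    terms do not tend to 0. It is replaced by the sum of two consecutive partial sums, which is also
    what iterating the functional equation of a companion series produces. That companion lives at a
    square root t of q, and the average over t and -t restores h. *)

Lemma ncE x : `|x| = (nc x)%:C%C. Proof. by []. Qed.

Lemma nc_ge0 x : 0 <= nc x.
Proof. by rewrite -lecR; exact: (@normr_ge0 _ C). Qed.

Lemma nc_eq0 x : (nc x == 0) = (x == 0).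
Proof. by rewrite -(inj_eq (@complexI R)); exact: (@normr_eq0 _ C). Qed.

Lemma nc_gt0 x : (0 < nc x) = (x != 0).
Proof. by rewrite lt0r nc_ge0 andbT nc_eq0. Qed.

Lemma nc0 : nc 0 = 0. Proof. exact: normc0. Qed.
Lemma nc1 : nc 1 = 1. Proof. exact: normc1. Qed.

Lemma ncD x y : nc (x + y) <= nc x + nc y. Proof. exact: le_normcD. Qed.

Lemma ncN x : nc (- x) = nc x. Proof. exact: normcN. Qed.

Lemma ncB x y : nc (x - y) <= nc x + nc y.
Proof. by rewrite -(ncN y) ncD. Qed.

Lemma nc_distC x y : nc (x - y) = nc (y - x).
Proof. by rewrite -ncN opprB. Qed.

Lemma ncM x y : nc (x * y) = nc x * nc y. Proof. exact: normcM. Qed.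

Lemma ncV x : nc x^-1 = (nc x)^-1. Proof. exact: normcV. Qed.

Lemma ncX x n : nc (x ^+ n) = nc x ^+ n.
Proof. by elim: n => [|n IH]; rewrite ?expr0 ?nc1 // !exprS ncM IH. Qed.

Lemma nc_sum (I : Type) (r : seq I) (P : pred I) (F : I -> C) :
  nc (\sum_(i <- r | P i) F i) <= \sum_(i <- r | P i) nc (F i).
Proof.
elim/big_rec2 : _ => [|i a b _ h]; first by rewrite nc0.
by rewrite (le_trans (ncD _ _)) // lerD2l.
Qed.

Lemma nc_real (r : R) : nc r%:C%C = `|r|.
Proof. by rewrite /= expr0n addr0 sqrtr_sqr. Qed.

Lemma nc_nat n : nc n%:R = n%:R.
Proof. by rewrite -[n%:R](rmorph_nat (real_complex R)) nc_real ger0_norm. Qed.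

Lemma ReD x y : complex.Re (x + y) = complex.Re x + complex.Re y.
Proof. by case: x y => [? ?] [? ?]. Qed.
Lemma ReN x : complex.Re (- x) = - complex.Re x. Proof. by case: x. Qed.
Lemma ImD x y : complex.Im (x + y) = complex.Im x + complex.Im y.
Proof. by case: x y => [? ?] [? ?]. Qed.
Lemma ImN x : complex.Im (- x) = - complex.Im x. Proof. by case: x. Qed.
Lemma nc_Re x : `|complex.Re x| <= nc x.
Proof. by rewrite -lecR; exact: normc_ge_Re. Qed.

Lemma nc_Im x : `|complex.Im x| <= nc x.
Proof.
case: x => a b /=; rewrite -(@ler_sqr R) ?nnegrE ?sqrtr_ge0 //.
by rewrite sqr_sqrtr ?addr_ge0 ?sqr_ge0 // real_normK ?num_real // lerDr sqr_ge0.
Qed.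

Lemma nc_le_ReIm x : nc x <= `|complex.Re x| + `|complex.Im x|.
Proof.
case: x => a b; have {1}-> : (a +i* b)%C = a%:C%C + (b%:C%C * 'i%C) :> C by simpc.
rewrite (le_trans (ncD _ _)) // ncM !nc_real.
have -> : nc 'i%C = 1 by rewrite /= expr0n /= add0r expr1n sqrtr1.
by rewrite mulr1 lexx.
Qed.

Lemma nc_dist_ge x y : nc x - nc y <= nc (x - y).
Proof. by rewrite lerBlDr -{1}(subrK y x) ncD. Qed.

Lemma nc_lt1 x : (`|x| < 1) = (nc x < 1).
Proof. exact: (ltcR (nc x) 1). Qed.

(** The norm of [R[i]] is itself [R[i]]-valued, and a positive element of [R[i]] has imaginary part
    0; so real epsilons suffice, and every later estimate is made in [R]. *)
Lemma cvgnc (T : Type) (F : set_system T) {FF : Filter F} (f : T -> C) (l : C) :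
  f @ F --> l <-> forall e : R, 0 < e -> \forall t \near F, nc (l - f t) < e.
Proof.
split=> [/cvgrPdist_lt h e e0|h].
  have e0' : 0 < e%:C%C :> C by rewrite (ltcR 0 e).
  by have := h _ e0'; apply: filterS => x; rewrite ncE ltcR.
apply/cvgrPdist_lt => e; rewrite ltcE => /andP[/eqP i0 e0].
have -> : e = (complex.Re e)%:C%C by case: e i0 {e0} => a b /= ->.
by have := h _ e0; apply: filterS => x; rewrite ncE ltcR.
Qed.

Lemma cvg_nc0 (T : Type) (F : set_system T) {FF : Filter F} (f : T -> C) (l : C) (b : T -> R) :
  (forall t, nc (f t - l) <= b t) -> b @ F --> (0 : R) -> f @ F --> l.
Proof.
move=> fb /cvgrPdist_lt b0; apply/cvgnc => e e0.
apply: filterS (b0 _ e0) => x; rewrite sub0r normrN => h.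
by rewrite nc_distC (le_lt_trans (fb x)) // (le_lt_trans _ h) // ler_norm.
Qed.

Lemma cvg_ncr (T : Type) (F : set_system T) {FF : Filter F} (f : T -> C) (l : C) :
  f @ F --> l -> (nc \o f) @ F --> (nc l : R).
Proof.
move/cvgnc => h; apply/cvgrPdist_lt => e e0; apply: filterS (h _ e0) => x /=.
apply: le_lt_trans; rewrite ler_norml nc_dist_ge andbT.
by rewrite lerNl opprB nc_distC nc_dist_ge.
Qed.

Lemma cvg_nc_le (T : Type) (F : set_system T) {FF : ProperFilter F} (f : T -> C) (l : C) (M : R) :
  f @ F --> l -> (\forall t \near F, nc (f t) <= M) -> nc l <= M.
Proof.
move/cvg_ncr => h hM; rewrite -(cvg_lim _ h) //.
by apply: limr_le => //; apply: cvgP h.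
Qed.

Lemma cvg_complex (T : Type) (F : set_system T) {FF : Filter F} (f g : T -> R) (a b : R) :
  f @ F --> a -> g @ F --> b -> (fun t => (f t +i* g t)%C : C) @ F --> ((a +i* b)%C : C).
Proof.
move=> /cvgrPdist_lt ha /cvgrPdist_lt hb; apply/cvgnc => e e0.
have e2 : 0 < e / 2 by rewrite divr_gt0.
apply: filterS2 (ha _ e2) (hb _ e2) => x h1 h2.
rewrite (le_lt_trans (nc_le_ReIm _)) // (splitr e) ltrD //; exact: h1 || exact: h2.
Qed.

End ComplexNorm.

#[local] Arguments normc : simpl never.

(** * Unordered summation: domination, reindexing, Fubini *)

Section Summation.
Variable R : realType.
Local Notation C := (Cplx R).
Local Notation nc := (@normc R).

(* [b] is meant to be nonnegative. *)
Definition rsummable (I : choiceType) (b : I -> R) :=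
  exists M, forall A : {fset I}, \sum_(i <- A) b i <= M.

Definition asummable (I : choiceType) (f : I -> C) := rsummable (nc \o f).

Definition hsum (I : choiceType) (f : I -> C) (s : C) :=
  partial_sum f @ totally --> s.

#[local] Instance totally_proper (I : choiceType) : ProperFilter (@totally I) := totally_filter.

Lemma partial_sumE (I : choiceType) (V : zmodType) (f : I -> V) (A : {fset I}) :
  partial_sum f A = \sum_(i <- A) f i.
Proof. by rewrite /partial_sum (big_seq_fsetE _ A xpredT f). Qed.

Lemma near_totally (I : choiceType) (A : {fset I}) (P : {fset I} -> Prop) :
  (forall B, (A `<=` B)%fset -> P B) -> \forall B \near totally, P B.
Proof. by move=> h; exists A. Qed.

Lemma cvg_sum_seq (K : numFieldType) (V : normedModType K) (T I : Type) (F : set_system T)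
    {FF : Filter F} (s : seq I) (f : T -> I -> V) (l : I -> V) : (forall i, (fun t => f t i) @ F --> l i) ->
  (fun t => \sum_(i <- s) f t i) @ F --> \sum_(i <- s) l i.
Proof.
move=> h; elim: s => [|i s IH].
  by rewrite big_nil; under eq_fun do rewrite big_nil; exact: cvg_cst.
by rewrite big_cons; under eq_fun do rewrite big_cons; exact: (cvgD (h i) IH).
Qed.

Section Generic.
Variable I : choiceType.
Implicit Types (f g : I -> C) (b c : I -> R) (A B : {fset I}).

Lemma ler_sum_fset b A B : (forall i, 0 <= b i) -> (A `<=` B)%fset ->
  \sum_(i <- A) b i <= \sum_(i <- B) b i.
Proof.
move=> b0 AB; rewrite (big_fsetID _ (fun i => i \in A) B) /=.
have -> : [fset x in B | x \in A]%fset = A.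
  apply/fsetP => i; rewrite !inE /= andbC; case: (boolP (i \in A)) => //= iA.
  exact: (fsubsetP AB).
by rewrite lerDl sumr_ge0.
Qed.

Lemma sum_fsetD (V : zmodType) (f : I -> V) A B : (A `<=` B)%fset ->
  \sum_(i <- B) f i - \sum_(i <- A) f i = \sum_(i <- (B `\` A)%fset) f i.
Proof.
move=> AB; rewrite (big_fsetID _ (fun i => i \in A) B) /=.
have -> : [fset x in B | x \in A]%fset = A.
  apply/fsetP => i; rewrite !inE /= andbC; case: (boolP (i \in A)) => //= iA.
  exact: (fsubsetP AB).
rewrite addrAC subrr add0r; apply: eq_fbigl => i; rewrite !inE /= andbC //.
Qed.

Lemma rsummable_sup b : (forall i, 0 <= b i) -> rsummable b ->
  exists s, (forall A, \sum_(i <- A) b i <= s) /\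
            forall e, 0 < e -> exists A, s - e < \sum_(i <- A) b i.
Proof.
move=> b0 [M hM]; set E := [set x | exists A, x = \sum_(i <- A) b i].
have hE : has_sup E.
  split; first by exists (\sum_(i <- (fset0 : {fset I})) b i); exists fset0.
  by exists M => _ [A ->].
exists (sup E); split => [A|e e0].
  by apply: ub_le_sup; [exact: hE.2|exists A].
by have [_ [A ->] h] := sup_adherent e0 hE; exists A.
Qed.

(** A finite set [A] whose sum is within [e] of the supremum leaves at most [e] for anything
    disjoint from it. *)
Lemma rsummable_tail b : (forall i, 0 <= b i) -> rsummable b ->
  forall e, 0 < e -> exists A, forall B, [disjoint B & A]%fset -> \sum_(i <- B) b i <= e.
Proof.
move=> b0 /(rsummable_sup b0) [s [hs he]] e e0; have [A hA] := he _ e0.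
exists A => B dBA; have := hs (A `|` B)%fset.
have -> : \sum_(i <- (A `|` B)%fset) b i = \sum_(i <- A) b i + \sum_(i <- B) b i.
  apply/eqP; rewrite -subr_eq0 opprD addrA sum_fsetD ?fsubsetUl // subr_eq0.
  apply/eqP; apply: eq_fbigl => i; rewrite !inE /=.
  by case: (boolP (i \in B)) => iB; rewrite ?orbT ?orbF ?andbT ?andNb //; apply: (fdisjointP dBA).
lra.
Qed.

Lemma rsummable_cvg b : (forall i, 0 <= b i) -> rsummable b ->
  exists s : R, partial_sum b @ totally --> s.
Proof.
move=> b0 /(rsummable_sup b0) [s [hs he]]; exists s.
apply/cvgrPdist_lt => e e0; have [A hA] := he _ e0.
apply: (near_totally (A := A)) => B AB; rewrite partial_sumE.
have h1 := ler_sum_fset b0 AB; have h2 := hs B; rewrite ger0_norm; lra.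
Qed.

Lemma rsummable_le b c : (forall i, b i <= c i) -> rsummable c -> rsummable b.
Proof. by move=> bc [M hM]; exists M => A; rewrite (le_trans _ (hM A)) // ler_sum. Qed.

Lemma rsummableD b c : rsummable b -> rsummable c -> rsummable (fun i => b i + c i).
Proof.
move=> [M hM] [N hN]; exists (M + N) => A; rewrite big_split /=.
by apply: lerD.
Qed.

Lemma rsummableZ (k : R) b : 0 <= k -> rsummable b -> rsummable (fun i => k * b i).
Proof.
move=> k0 [M hM]; exists (k * M) => A; rewrite -mulr_sumr.
by apply: ler_wpM2l.
Qed.

Lemma asummable_le f b : (forall i, nc (f i) <= b i) -> rsummable b -> asummable f.
Proof. exact: rsummable_le. Qed.

(** Here [h] will be the real or the imaginary part. The family [nc f + h f] is nonnegative and at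
    most [2 nc f], so its partial sums converge by monotonicity; subtracting the sum of [nc f]
    leaves that of [h f]. *)
Lemma rsum_ReIm f : asummable f ->
  forall h : C -> R, (forall x, `|h x| <= nc x) -> (forall x y, h (x + y) = h x + h y) -> h 0 = 0 ->
  exists s : R, (fun A => h (partial_sum f A)) @ totally --> s.
Proof.
move=> sf h hn hD h0.
have e1 A : h (partial_sum f A) = partial_sum (h \o f) A.
  by rewrite /partial_sum (big_morph h hD h0).
have b0 i : 0 <= nc (f i) + h (f i) by have := hn (f i); rewrite ler_norml; lra.
have [s hs] : exists s : R, partial_sum (fun i => nc (f i) + h (f i)) @ totally --> s.
  apply: rsummable_cvg => //.
  apply: (@rsummable_le _ (fun i => nc (f i) + nc (f i))); last exact: rsummableD.
  by move=> i; rewrite lerD2l (le_trans _ (hn _)) // ler_norm.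
have [t ht] : exists s : R, partial_sum (nc \o f) @ totally --> s.
  by apply: rsummable_cvg => // i; exact: nc_ge0.
exists (s - t); rewrite (_ : (fun _ => _) = (fun A => partial_sum (fun i => nc (f i) + h (f i)) A
   - partial_sum (nc \o f) A)); first exact: cvgB.
by apply/funext => A; rewrite e1 !partial_sumE -sumrB; apply: eq_bigr => i _ /=; rewrite addrC addKr.
Qed.

Lemma asummable_cvg f : asummable f -> exists s : C, hsum f s.
Proof.
move=> sf.
have [a ha] : exists s : R, (fun A => complex.Re (partial_sum f A)) @ totally --> s.
  by apply: (rsum_ReIm sf (h := @complex.Re R)) => [x|[? ?] [? ?]|] //; exact: nc_Re.
have [b hb] : exists s : R, (fun A => complex.Im (partial_sum f A)) @ totally --> s.
  by apply: (rsum_ReIm sf (h := @complex.Im R)) => [x|[? ?] [? ?]|] //; exact: nc_Im.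
exists (a +i* b)%C; rewrite /hsum.
rewrite (_ : partial_sum f = fun A => (complex.Re (partial_sum f A) +i* complex.Im (partial_sum f A))%C).
  exact: cvg_complex.
by apply/funext => A; case: (partial_sum f A).
Qed.

Lemma hsumE f s : hsum f s -> usum f = s.
Proof. by rewrite /hsum => h; apply: cvg_lim. Qed.

Lemma asummable_hsum f : asummable f -> hsum f (usum f).
Proof. by move=> /asummable_cvg [s hs]; rewrite (hsumE hs). Qed.

Lemma asummable_cvg_usum f : asummable f -> cvg_usum f.
Proof. by move=> /asummable_hsum h; apply: cvgP h. Qed.

Lemma eq_usum f g : f =1 g -> usum f = usum g.
Proof. by move=> /funext ->. Qed.

Lemma hsumD f g s t : hsum f s -> hsum g t -> hsum (fun i => f i + g i) (s + t).
Proof.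
rewrite /hsum => hs ht; rewrite (_ : partial_sum _ = fun A => partial_sum f A + partial_sum g A).
  exact: (cvgD hs ht).
by apply/funext => A; rewrite !partial_sumE big_split.
Qed.

Lemma hsumZ (k : C) f s : hsum f s -> hsum (fun i => k * f i) (k * s).
Proof.
rewrite /hsum => hs; rewrite (_ : partial_sum _ = fun A => k * partial_sum f A).
  exact: (cvgM (cvg_cst k) hs).
by apply/funext => A; rewrite !partial_sumE mulr_sumr.
Qed.

Lemma asummableD f g : asummable f -> asummable g -> asummable (fun i => f i + g i).
Proof.
by move=> sf sg; apply: asummable_le (rsummableD sf sg) => i; exact: ncD.
Qed.

Lemma asummableZ (k : C) f : asummable f -> asummable (fun i => k * f i).
Proof.
by move=> sf; apply: asummable_le (rsummableZ (nc_ge0 k) sf) => i; rewrite ncM.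
Qed.

Lemma usumD f g : asummable f -> asummable g -> usum (fun i => f i + g i) = usum f + usum g.
Proof. by move=> sf sg; apply: hsumE; apply: hsumD; exact: asummable_hsum. Qed.

Lemma usumZ k f : asummable f -> usum (fun i => k * f i) = k * usum f.
Proof. by move=> sf; apply: hsumE; apply: hsumZ; exact: asummable_hsum. Qed.

Lemma asummableN f : asummable f -> asummable (fun i => - f i).
Proof. by move=> sf; apply: asummable_le sf => i /=; rewrite ncN. Qed.

Lemma usumN f : asummable f -> usum (fun i => - f i) = - usum f.
Proof.
move=> sf; rewrite -mulN1r -usumZ //; apply: eq_usum => i; by rewrite mulN1r.
Qed.

Lemma asummableB f g : asummable f -> asummable g -> asummable (fun i => f i - g i).
Proof. by move=> sf sg; apply: asummableD => //; apply: asummableN. Qed.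

Lemma usumB f g : asummable f -> asummable g -> usum (fun i => f i - g i) = usum f - usum g.
Proof. by move=> sf sg; rewrite usumD ?usumN //; apply: asummableN. Qed.

Lemma usum0 : usum (fun _ : I => 0 : C) = 0.
Proof.
apply: hsumE; rewrite /hsum (_ : partial_sum _ = cst 0); first exact: cvg_cst.
by apply/funext => A; rewrite partial_sumE big1.
Qed.

Lemma hsum_fin f (A : {fset I}) : (forall i, i \notin A -> f i = 0) ->
  hsum f (\sum_(i <- A) f i).
Proof.
move=> f0; apply/cvgnc => e e0; apply: (near_totally (A := A)) => B AB.
rewrite partial_sumE nc_distC sum_fsetD // big_seq big1 ?nc0 // => i.
by rewrite !inE => /andP[/f0].
Qed.

Lemma asummable_fin f (A : {fset I}) : (forall i, i \notin A -> f i = 0) -> asummable f.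
Proof.
move=> f0; exists (\sum_(i <- A) nc (f i)) => B.
rewrite (big_fsetID _ (fun i => i \in A) B) /= [X in _ + X]big_seq [X in _ + X]big1 ?addr0; last first.
  by move=> i; rewrite !inE /= => /andP[_ /f0 ->]; rewrite nc0.
apply: ler_sum_fset => [i|]; first exact: nc_ge0.
by apply/fsubsetP => i; rewrite !inE /= => /andP[].
Qed.

(** Dominated convergence. Outside one finite set [A] all the sums are at most [e / 4], uniformly in
    [N]; on [A] the convergence is that of a finite sum. *)
Lemma tannery (F : nat -> I -> C) f b : rsummable b -> (forall N i, nc (F N i) <= b i) ->
  (forall i, (fun N => F N i) @ \oo --> f i) ->
  asummable f /\ (fun N => usum (F N)) @ \oo --> usum f.
Proof.
move=> sb Fb Ff.
have fb i : nc (f i) <= b i by apply: (cvg_nc_le (Ff i)); apply: nearW => N.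
have sf : asummable f by apply: asummable_le sb.
have sF N : asummable (F N) by apply: asummable_le sb.
split=> //; apply/cvgnc => e e0.
have b0 i : 0 <= b i := le_trans (nc_ge0 _) (fb i).
have e4 : 0 < e / 4 by rewrite divr_gt0.
have [A hA] := rsummable_tail b0 sb e4.
have split_tail g : asummable g -> (forall i, nc (g i) <= b i) ->
    nc (usum g - \sum_(i <- A) g i) <= e / 4.
  move=> sg gb; have h := asummable_hsum sg.
  have h2 : (fun B => partial_sum g B - \sum_(i <- A) g i) @ totally --> usum g - \sum_(i <- A) g i.
    exact: (cvgB h (cvg_cst _)).
  apply: (cvg_nc_le h2); apply: (near_totally (A := A)) => B AB.
  rewrite partial_sumE sum_fsetD // (le_trans (nc_sum _ _ _)) //.
  rewrite (le_trans (ler_sum _ (fun i _ => gb i))) // hA //.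
  by apply/fdisjointP => i; rewrite !inE => /andP[].
have hfin : (fun N => \sum_(i <- A) F N i) @ \oo --> \sum_(i <- A) f i.
  exact: cvg_sum_seq.
move/cvgnc: hfin => /(_ _ e4); apply: filterS => N hN.
have -> : usum f - usum (F N) = (usum f - \sum_(i <- A) f i)
  + (\sum_(i <- A) f i - \sum_(i <- A) F N i) - (usum (F N) - \sum_(i <- A) F N i) by ring.
have h1 := split_tail _ sf fb; have h2 := split_tail _ (sF N) (Fb N).
have h3 := ncB (usum f - \sum_(i <- A) f i + (\sum_(i <- A) f i - \sum_(i <- A) F N i)) (usum (F N) - \sum_(i <- A) F N i).
have h4 := ncD (usum f - \sum_(i <- A) f i) (\sum_(i <- A) f i - \sum_(i <- A) F N i).
lra.
Qed.

Lemma sum_fset_seq (V : zmodType) (f : I -> V) (s : seq I) : uniq s ->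
  \sum_(i <- [fset x in s]%fset) f i = \sum_(i <- s) f i.
Proof.
move=> us; apply: perm_big; apply: uniq_perm => [||i]; rewrite ?fset_uniq //.
by rewrite !inE.
Qed.

End Generic.

Section Reindex.
Variables (I J : choiceType) (phi : I -> J).
Hypothesis phi_inj : injective phi.
Implicit Types (b : J -> R) (f : J -> C).

Lemma sum_imfset (V : zmodType) (f : J -> V) (A : {fset I}) :
  \sum_(i <- A) f (phi i) = \sum_(j <- [fset phi i | i in A]%fset) f j.
Proof. by rewrite big_imfset //= => x y _ _; exact: phi_inj. Qed.

Lemma preim_fset (A : {fset J}) : exists B : {fset I}, forall i, (i \in B) = (phi i \in A).
Proof.
(* A partial left inverse of [phi], obtained by choice; it turns the finite set [A] into a finite
   list of candidate preimages. *)
have [psi hpsi] : exists psi : J -> option I, forall i, psi (phi i) = Some i.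
  exists (fun j => if pselect (exists i, phi i = j) is left h then Some (projT1 (cid h)) else None).
  move=> i; case: pselect => [h|[]]; last by exists i.
  by congr Some; case: (cid h) => k /= /phi_inj.
exists [fset i in pmap psi A | phi i \in A]%fset => i; rewrite !inE /=.
case: (boolP (phi i \in A)) => iA; rewrite ?andbF // andbT.
by rewrite mem_pmap; apply/mapP; exists (phi i).
Qed.

Lemma rsummable_inj b : rsummable b -> rsummable (b \o phi).
Proof. by move=> [M hM]; exists M => A; rewrite sum_imfset. Qed.

(** The slack on both sides serves reindexing: [A] may contain indices outside the image of [phi],
    where [f] is 0, and [B] may contain indices that [phi] sends outside [A], provided [f] vanishes
    there. *)
Lemma sum_supp (V : zmodType) (f : J -> V) (A : {fset J}) (B : {fset I}) :
  (forall j, f j != 0 -> exists i, phi i = j) -> (forall i, phi i \in A -> i \in B) ->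
  (forall i, i \in B -> i \notin [pred i | phi i \in A] -> f (phi i) = 0) ->
  \sum_(j <- A) f j = \sum_(i <- B) f (phi i).
Proof.
move=> f0 hB hA; rewrite sum_imfset.
rewrite (big_fsetID _ (fun j => j \in [fset phi i | i in B]%fset) A) /=.
rewrite [X in _ + X]big_seq [X in _ + X]big1 ?addr0; last first.
  move=> j; rewrite !inE /= => /andP[jA jB]; apply: contraNeq jB => /f0[i ij].
  by apply/imfsetP; exists i => //=; apply: hB; rewrite ij.
rewrite [RHS](big_fsetID _ (fun j => j \in A)) /=.
rewrite [X in _ = _ + X]big_seq [X in _ = _ + X]big1 ?addr0; last first.
  by move=> j; rewrite !inE /= => /andP[/imfsetP[i /= iB ->]] iA; apply: hA.
by apply: eq_fbigl => j; rewrite !inE /= andbC.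
Qed.

Lemma rsummable_supp b : (forall j, b j != 0 -> exists i, phi i = j) ->
  rsummable (b \o phi) -> rsummable b.
Proof.
move=> b0 [M hM]; exists M => A; have [B hB] := preim_fset A.
rewrite (@sum_supp _ b A B) // => [i|i]; first by rewrite hB.
by rewrite hB !inE => ->.
Qed.

Lemma asummable_inj f : asummable f -> asummable (f \o phi).
Proof. exact: rsummable_inj. Qed.

Lemma asummable_supp f : (forall j, f j != 0 -> exists i, phi i = j) ->
  asummable (f \o phi) -> asummable f.
Proof. by move=> f0; apply: rsummable_supp => j /=; rewrite nc_eq0; apply: f0. Qed.

Lemma usum_supp f : (forall j, f j != 0 -> exists i, phi i = j) ->
  asummable f -> usum (f \o phi) = usum f.
Proof.
move=> f0 sf; apply: hsumE; apply/cvgnc => e e0.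
have /cvgnc /(_ _ e0) [A _ hA] := asummable_hsum sf.
have [B hB] := preim_fset A; apply: (near_totally (A := B)) => D BD.
suff <- : partial_sum f (A `|` [fset phi i | i in D])%fset = partial_sum (f \o phi) D.
  by apply: hA; rewrite /= fsubsetUl.
rewrite !partial_sumE; apply: sum_supp => // i.
  rewrite inE => /orP[|/imfsetP[k /= kD /phi_inj ->]] //.
  by rewrite -hB => /(fsubsetP BD).
by move=> iD; rewrite !inE negb_or => /andP[_]; rewrite in_imfset.
Qed.

End Reindex.

Section Fubini.
Variables (I J : choiceType) (f : I * J -> C).
Hypothesis sf : asummable f.

Lemma asummable_slice i : asummable (fun j => f (i, j)).
Proof. by apply: (@asummable_inj J (I * J)%type (pair i) _ f sf) => x y []. Qed.

Let cvg_slices (A : {fset I}) :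
  (fun B : {fset J} => \sum_(i <- A) \sum_(j <- B) f (i, j)) @ totally -->
  \sum_(i <- A) usum (fun j => f (i, j)).
Proof.
apply: cvg_sum_seq => i; have := asummable_hsum (asummable_slice i); rewrite /hsum.
by apply: cvg_trans; apply: near_eq_cvg; apply: nearW => B; rewrite partial_sumE.
Qed.

Let sum_prod (V : zmodType) (g : I * J -> V) (A : {fset I}) (B : {fset J}) :
  \sum_(i <- A) \sum_(j <- B) g (i, j) = \sum_(p <- (A `*` B)%fset) g p.
Proof.
rewrite -(big_allpairs (F := g)); apply: perm_big; apply: uniq_perm.
- by apply: allpairs_uniq => [||[? ?] [? ?] _ _ /=]; rewrite ?fset_uniq.
- exact: fset_uniq.
- move=> [i j]; rewrite in_fsetM /=; apply/allpairsP/andP => [[[? ?] [? ? [-> ->]]]|[? ?]] //.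
  by exists (i, j).
Qed.

Lemma asummable_usum : asummable (fun i => usum (fun j => f (i, j))).
Proof.
have [M hM] := sf; exists M => A.
have h : (fun B : {fset J} => \sum_(i <- A) nc (\sum_(j <- B) f (i, j))) @ totally -->
    (\sum_(i <- A) nc (usum (fun j => f (i, j))) : R).
  apply: cvg_sum_seq => i; have := asummable_hsum (asummable_slice i); rewrite /hsum.
  move=> /cvg_ncr; apply: cvg_trans; apply: near_eq_cvg.
  by apply: nearW => B /=; rewrite partial_sumE.
rewrite -(cvg_lim _ h) //; apply: limr_le; first exact: cvgP h.
apply: (near_totally (A := fset0)) => B _.
apply: le_trans (hM (A `*` B)%fset); rewrite -sum_prod; apply: ler_sum => i _.
exact: nc_sum.
Qed.

(** Finite rectangles containing a set [A0] that carries all but [e / 3] of the total norm differ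
    from the sum over [A0] by at most [e / 3]. Letting the second side of the rectangle grow gives
    the same bound for sums of whole rows. *)
Lemma hsum_fubini : hsum (fun i => usum (fun j => f (i, j))) (usum f).
Proof.
apply/cvgnc => e e0; have e3 : 0 < e / 3 by rewrite divr_gt0.
have [A0 hA0] := rsummable_tail (fun p => nc_ge0 (f p)) sf e3.
have small : forall D, (A0 `<=` D)%fset -> nc (\sum_(p <- D) f p - \sum_(p <- A0) f p) <= e / 3.
  move=> D AD; rewrite sum_fsetD // (le_trans (nc_sum _ _ _)) // hA0 //.
  by apply/fdisjointP => i; rewrite !inE => /andP[].
have h1 : nc (usum f - \sum_(p <- A0) f p) <= e / 3.
  have h := asummable_hsum sf; apply: (cvg_nc_le (cvgB h (cvg_cst (\sum_(p <- A0) f p)))).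
  apply: (near_totally (A := A0)) => D /small.
  by rewrite -(partial_sumE f D).
apply: (near_totally (A := [fset p.1 | p in A0]%fset)) => A hA; rewrite partial_sumE.
have h2 : nc (\sum_(i <- A) usum (fun j => f (i, j)) - \sum_(p <- A0) f p) <= e / 3.
  apply: (cvg_nc_le (cvgB (cvg_slices (A := A)) (cvg_cst (\sum_(p <- A0) f p)))).
  apply: (near_totally (A := [fset p.2 | p in A0]%fset)) => B hB.
  have : nc (\sum_(p <- (A `*` B)%fset) f p - \sum_(p <- A0) f p) <= e / 3; last by rewrite -sum_prod.
  apply: small; apply/fsubsetP => p pA; rewrite in_fsetM.
  by rewrite (fsubsetP hA) ?(fsubsetP hB) //; apply/imfsetP; exists p.
have := ncB (usum f - \sum_(p <- A0) f p) (\sum_(i <- A) usum (fun j => f (i, j)) - \sum_(p <- A0) f p).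
rewrite opprB addrA subrK; lra.
Qed.

Lemma usum_fubini : usum (fun i => usum (fun j => f (i, j))) = usum f.
Proof. exact: hsumE hsum_fubini. Qed.

End Fubini.

Lemma usum_swap (I J : choiceType) (f : I -> J -> C) :
  asummable (fun p : I * J => f p.1 p.2) ->
  usum (fun i => usum (f i)) = usum (fun j => usum (fun i => f i j)).
Proof.
move=> sf; rewrite (@usum_fubini I J (fun p => f p.1 p.2)) //.
pose sw (p : J * I) := (p.2, p.1).
have sw_inj : injective sw by move=> [? ?] [? ?] [-> ->].
have supp j : f j.1 j.2 != 0 -> exists i, sw i = j by case: j => i j _; exists (j, i).
rewrite -(usum_supp sw_inj supp sf) -(@usum_fubini J I (fun p => f p.2 p.1)) //.
exact: (asummable_inj sw_inj sf).
Qed.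

Lemma rsummable_prod (I J : choiceType) (b : I -> R) (c : J -> R) :
  (forall i, 0 <= b i) -> (forall j, 0 <= c j) -> rsummable b -> rsummable c ->
  rsummable (fun p : I * J => b p.1 * c p.2).
Proof.
move=> b0 c0 [M hM] [N hN]; exists (M * N) => A.
pose A1 := [fset p.1 | p in A]%fset; pose A2 := [fset p.2 | p in A]%fset.
apply: (@le_trans _ _ (\sum_(p <- (A1 `*` A2)%fset) b p.1 * c p.2)).
  apply: ler_sum_fset => [p|]; first exact: mulr_ge0.
  by apply/fsubsetP => p pA; rewrite in_fsetM; apply/andP; split; apply/imfsetP; exists p.
have -> : \sum_(p <- (A1 `*` A2)%fset) b p.1 * c p.2 = (\sum_(i <- A1) b i) * (\sum_(j <- A2) c j).
  rewrite mulr_suml; under [RHS]eq_bigr do rewrite mulr_sumr.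
  rewrite -(big_allpairs (F := fun p => b p.1 * c p.2)); apply: perm_big; apply: uniq_perm.
  - exact: fset_uniq.
  - by apply: allpairs_uniq => [||[? ?] [? ?] _ _ /=]; rewrite ?fset_uniq.
  - move=> [i j]; rewrite in_fsetM /=; apply/andP/allpairsP => [[? ?]|[[? ?] [? ? [-> ->]]]] //.
    by exists (i, j).
by apply: ler_pM; rewrite ?sumr_ge0.
Qed.

Lemma fset_iotaE N k : (k \in [fset i in index_iota 0 N]%fset) = (k < N)%N.
Proof. by rewrite !inE mem_index_iota. Qed.

Lemma fset_nat_sub (A : {fset nat}) : exists M, forall N, (M <= N)%N ->
  (A `<=` [fset x in index_iota 0 N])%fset.
Proof.
exists (\max_(n <- A) n).+1 => N hN; apply/fsubsetP => n nA.
have h : (n <= \max_(m <- A) m)%N by exact: (@leq_bigmax_seq _ _ xpredT (fun n => n)).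
by rewrite fset_iotaE; exact: leq_ltn_trans h hN.
Qed.

Lemma rsummable_nat (b : nat -> R) (M : R) : (forall n, 0 <= b n) ->
  (forall N, \sum_(0 <= n < N) b n <= M) -> rsummable b.
Proof.
move=> b0 hM; exists M => A; have [N /(_ N (leqnn _)) hN] := fset_nat_sub A.
apply: le_trans (hM N); rewrite -(sum_fset_seq b (iota_uniq _ _)).
exact: ler_sum_fset.
Qed.

Lemma asummable_cvgn (f : nat -> C) : asummable f ->
  (fun N => \sum_(0 <= n < N) f n) @ \oo --> usum f.
Proof.
move=> sf; apply/cvgnc => e e0; have /cvgnc /(_ _ e0) [A _ hA] := asummable_hsum sf.
have [M hM] := fset_nat_sub A.
exists M => // N /= /hM hN; rewrite -(sum_fset_seq f (iota_uniq _ _)).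
by rewrite -partial_sumE; apply: hA.
Qed.

(** The series are studied as unordered sums; this carries the results over to the limits of partial
    sums in which the theorem is stated. *)
Lemma sum_fromE (m : nat) (f : nat -> C) : asummable (fun n => f (m + n)%N) ->
  cvg_sum m f /\ sum_from m f = usum (fun n => f (m + n)%N).
Proof.
move=> /asummable_cvgn h.
have {}h : (fun N => \sum_(m <= n < N) f n) @ \oo --> usum (fun n => f (m + n)%N).
  rewrite -(cvg_shiftn m); move: h; apply: cvg_trans; apply: near_eq_cvg.
  apply: nearW => N /=; rewrite [RHS](big_addn 0 (N + m) m xpredT f) addnK.
  by apply: eq_bigr => i _; rewrite addnC.
by split; [apply: cvgP h|rewrite /sum_from; apply: cvg_lim].
Qed.

Lemma usum_recl (f : nat -> C) : asummable f -> usum f = f 0%N + usum (fun n => f n.+1).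
Proof.
move=> sf; have sS : asummable (fun n => f n.+1) by apply: (asummable_inj succn_inj sf).
pose g n : C := if n is 0 then f 0%N else 0; pose h n : C := if n is n'.+1 then f n else 0.
have e : f =1 (fun n => g n + h n) by case=> [|n]; rewrite /g /h ?addr0 ?add0r.
have g0 n : n \notin [fset 0%N]%fset -> g n = 0 by rewrite inE; case: n.
have sg : asummable g := asummable_fin g0.
have sh : asummable h.
  by apply: (asummable_le _ sf) => -[|n] //=; rewrite nc0 nc_ge0.
rewrite (eq_usum e) usumD // (hsumE (hsum_fin g0)) big_seq_fset1; congr (_ + _).
rewrite -(usum_supp succn_inj _ sh) // => -[|n] /=; first by rewrite eqxx.
by exists n.
Qed.

Lemma rsummable_geo (K r : R) : 0 <= K -> 0 <= r < 1 -> rsummable (fun n => K * r ^+ n).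
Proof.
move=> K0 /andP[r0 r1]; apply: rsummableZ => //.
apply: (@rsummable_nat _ (1 - r)^-1) => [n|N]; first exact: exprn_ge0.
have r1' : 0 < 1 - r by rewrite subr_gt0.
rewrite big_mkord -[leRHS]mul1r ler_pdivlMr // mulrC.
have -> : (1 - r) * (\sum_(i < N) r ^+ i) = 1 - r ^+ N.
  by rewrite -[in RHS](opprB _ 1) subrX1 -mulNr opprB.
by rewrite lerBlDr lerDl exprn_ge0.
Qed.

End Summation.

Arguments hsumZ {R I} k {f s}.

(** * Summability tests, limits of sequences, sums over the integers *)

Section SummabilityTests.
Variable R : realType.
Local Notation C := (Cplx R).
Local Notation nc := (@normc R).

Lemma rsummable_shift (N : nat) (b : nat -> R) : (forall n, 0 <= b n) ->
  rsummable (fun n => b (n + N)%N) -> rsummable b.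
Proof.
move=> b0 [M hM]; apply: (@rsummable_nat _ _ (\sum_(0 <= n < N) b n + M)) => // K.
apply: (@le_trans _ _ (\sum_(0 <= n < N + K) b n)).
  rewrite [leRHS](@big_cat_nat _ _ _ K) ?leq_addl //= lerDl; exact: sumr_ge0.
rewrite [leLHS](@big_cat_nat _ _ _ N) ?leq_addr //= lerD2l -{1}[N]add0n big_addn addKn.
have := hM [fset x in index_iota 0 K]%fset; rewrite sum_fset_seq ?iota_uniq //.
Qed.

Lemma rsummable_ratio (b : nat -> R) (N : nat) (r : R) : 0 <= r < 1 ->
  (forall n, 0 <= b n) -> (forall n, (N <= n)%N -> b n.+1 <= r * b n) -> rsummable b.
Proof.
move=> r01 b0 h; apply: (rsummable_shift (N := N)) => //.
apply: rsummable_le (rsummable_geo (b0 N) r01) => n; elim: n => [|n IH].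
  by rewrite expr0 mulr1.
rewrite addSn (le_trans (h _ (leq_addl _ _))) // exprS mulrCA ler_wpM2l //.
by case/andP: r01.
Qed.

Lemma expr_small (r K e : R) : 0 <= r < 1 -> 0 < e ->
  exists N, forall n, (N <= n)%N -> K * r ^+ n <= e.
Proof.
move=> /andP[r0 r1] e0.
have : (fun n => K * r ^+ n) @ \oo --> K * 0 by apply: cvgMr; apply: cvg_expr; rewrite ger0_norm.
rewrite mulr0 => /cvgrPdist_lt /(_ _ e0) [N _ h]; exists N => n /h /=.
by rewrite sub0r normrN => /ltW; apply: le_trans; rewrite ler_norm.
Qed.

(** With [t = s^(1/4)], the geometric sum gives [(n+1) t^n <= 1 + t + ... + t^n <= 1/(1-t)]. Of the
    four factors [t^n] in [s^n], two absorb the square of [n+1] and two remain. *)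
Lemma polygeo (s : R) : 0 <= s < 1 ->
  exists K t : R, [/\ 0 <= K, 0 <= t < 1 & forall n, n.+1%:R ^+ 2 * s ^+ n <= K * t ^+ n].
Proof.
move=> /andP[s0 s1]; pose t := Num.sqrt (Num.sqrt s).
have t0 : 0 <= t by exact: sqrtr_ge0.
have t4 : s = t ^+ 4 by rewrite (exprM t 2 2) sqr_sqrtr ?sqrtr_ge0 // sqr_sqrtr.
have t1 : t < 1 by rewrite -(@expr_lt1 _ 4) // -t4.
have h n : n.+1%:R * t ^+ n <= (1 - t)^-1.
  apply: (@le_trans _ _ (\sum_(i < n.+1) t ^+ i)).
    rewrite mulr_natl -[X in _ *+ X](card_ord n.+1) -sumr_const; apply: ler_sum => i _.
    by apply: ler_wiXn2l; rewrite ?(ltW t1) // -ltnS.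
  rewrite -[leRHS]mul1r ler_pdivlMr ?subr_gt0 // mulrC.
  have -> : (1 - t) * (\sum_(i < n.+1) t ^+ i) = 1 - t ^+ n.+1.
    by rewrite -[in RHS](opprB _ 1) subrX1 -mulNr opprB.
  by rewrite lerBlDr lerDl exprn_ge0.
have t2 : 0 <= (1 - t)^-1 by rewrite invr_ge0 subr_ge0 ltW.
exists ((1 - t)^-1 ^+ 2), (t ^+ 2); split=> [||n]; first exact: exprn_ge0.
  by rewrite exprn_ge0 //= expr_lt1.
have -> : n.+1%:R ^+ 2 * s ^+ n = (n.+1%:R * t ^+ n) ^+ 2 * (t ^+ 2) ^+ n.
  rewrite [in LHS]t4 (exprAC t 4) (exprAC t 2); set x := _%:R; set y := t ^+ n; ring.
by rewrite ler_wpM2r ?exprn_ge0 // ler_pXn2r ?nnegrE ?mulr_ge0 ?exprn_ge0.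
Qed.

Lemma cvg_bounded (u : nat -> C) (l : C) : u @ \oo --> l -> exists M, 0 <= M /\ forall n, nc (u n) <= M.
Proof.
move/cvgnc => /(_ 1 ltr01) [N _ h].
exists (\sum_(0 <= n < N) nc (u n) + (nc l + 1)).
have l1 : 0 <= nc l + 1 by rewrite addr_ge0 ?nc_ge0.
split=> [|n]; first by rewrite addr_ge0 // sumr_ge0 // => i _; exact: nc_ge0.
have [nN|nN] := ltnP n N.
  rewrite (bigD1_seq n) ?iota_uniq ?mem_index_iota //= -addrA lerDl.
  by rewrite addr_ge0 // sumr_ge0 // => i _; exact: nc_ge0.
apply: (@le_trans _ _ (nc l + 1)); last by rewrite lerDr sumr_ge0 // => i _; exact: nc_ge0.
have := h n nN; have := nc_dist_ge (u n) l; rewrite nc_distC; lra.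
Qed.

Lemma cvg_shiftS (u : nat -> C) (l : C) : u @ \oo --> l -> (fun n => u n.+1) @ \oo --> l.
Proof. by move=> h; have := h; rewrite -(cvg_shiftS u). Qed.

Lemma cvg_expr0 (q : C) : nc q < 1 -> (fun n => q ^+ n) @ \oo --> (0 : C).
Proof.
move=> q1; apply: (cvg_nc0 (b := fun n => nc q ^+ n)) => [n|]; first by rewrite subr0 ncX.
by apply: cvg_expr; rewrite ger0_norm ?nc_ge0.
Qed.

Section Sequences.
Implicit Types (u v : nat -> C) (l m : C).

Lemma cseqM u v l m : u @ \oo --> l -> v @ \oo --> m -> (fun n => u n * v n) @ \oo --> l * m.
Proof. by move=> hu hv; exact: (cvgM hu hv). Qed.

Lemma cseqD u v l m : u @ \oo --> l -> v @ \oo --> m -> (fun n => u n + v n) @ \oo --> l + m.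
Proof. by move=> hu hv; exact: (cvgD hu hv). Qed.

Lemma cseqB u v l m : u @ \oo --> l -> v @ \oo --> m -> (fun n => u n - v n) @ \oo --> l - m.
Proof. by move=> hu hv; exact: (cvgB hu hv). Qed.

Lemma cseqV u l : l != 0 -> u @ \oo --> l -> (fun n => (u n)^-1) @ \oo --> l^-1.
Proof. by move=> l0 hu; exact: (cvgV l0 hu). Qed.

Lemma cseq_cst l : (fun=> l) @ \oo --> l.
Proof. exact: cvg_cst. Qed.

Lemma cseqZ (k : C) u l : u @ \oo --> l -> (fun n => k * u n) @ \oo --> k * l.
Proof. by apply: cseqM; exact: cvg_cst. Qed.

Lemma cseq_ext u v l : u =1 v -> u @ \oo --> l -> v @ \oo --> l.
Proof. by move=> /funext ->. Qed.

Lemma cseq_unique u l m : u @ \oo --> l -> u @ \oo --> m -> l = m.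
Proof. by move=> h1 h2; rewrite -(cvg_lim _ h1) // -(cvg_lim _ h2). Qed.

Lemma telescope_sum u v : (forall N, u N = v N + u N.+1) ->
  forall N, u 0%N = \sum_(0 <= j < N) v j + u N.
Proof.
move=> h; elim=> [|N IH]; first by rewrite big_nil add0r.
by rewrite IH h addrA big_nat_recr.
Qed.

End Sequences.

Section IntSums.
Implicit Types (f : int -> C) (b : int -> R).

Lemma Posz_inj : injective Posz. Proof. by move=> m n []. Qed.
Lemma Negz_inj : injective Negz. Proof. by move=> m n []. Qed.

Lemma rsummable_int b : (forall n, 0 <= b n) -> rsummable (b \o Posz) -> rsummable (b \o Negz) ->
  rsummable b.
Proof.
move=> b0 sP sN; pose c1 (n : int) := if n is Posz k then b n else 0.
pose c2 (n : int) := if n is Negz k then b n else 0.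
apply: (@rsummable_le _ _ _ (fun n => c1 n + c2 n)).
  by case=> n; rewrite /c1 /c2 ?addr0 ?add0r.
apply: rsummableD.
  by apply: (rsummable_supp Posz_inj) => // -[n|n] /=; [exists n|rewrite eqxx].
by apply: (rsummable_supp Negz_inj) => // -[n|n] /=; [rewrite eqxx|exists n].
Qed.

Lemma usum_int f : asummable f -> usum f = usum (f \o Posz) + usum (f \o Negz).
Proof.
move=> sf; pose c1 (n : int) : C := if n is Posz k then f n else 0.
pose c2 (n : int) : C := if n is Negz k then f n else 0.
have e : f =1 (fun n => c1 n + c2 n) by case=> n; rewrite /c1 /c2 ?addr0 ?add0r.
have s1 : asummable c1.
  by apply: (asummable_le _ sf) => -[n|n] //=; rewrite nc0 nc_ge0.
have s2 : asummable c2.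
  by apply: (asummable_le _ sf) => -[n|n] //=; rewrite nc0 nc_ge0.
rewrite (eq_usum e) usumD //; congr (_ + _).
  by rewrite -(usum_supp Posz_inj _ s1) // => -[n|n] /=; [exists n|rewrite eqxx].
by rewrite -(usum_supp Negz_inj _ s2) // => -[n|n] /=; [rewrite eqxx|exists n].
Qed.

Lemma asummable_int f : asummable (f \o Posz) -> asummable (f \o Negz) -> asummable f.
Proof. by move=> s1 s2; apply: rsummable_int => // n; exact: nc_ge0. Qed.

End IntSums.
End SummabilityTests.

Arguments cseqZ {R} k {u l}.

(** * q-Pochhammer symbols and the q-binomial theorem *)

Section QPochhammer.
Variable R : realType.
Local Notation C := (Cplx R).
Local Notation nc := (@normc R).
Implicit Types (x a z : C).

Lemma qpoch0 x (q : C) : qpoch x q 0 = 1. Proof. by rewrite /qpoch big_nil. Qed.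

Lemma qpochS x (q : C) n : qpoch x q n.+1 = qpoch x q n * (1 - x * q ^+ n).
Proof. by rewrite /qpoch big_nat_recr. Qed.

Lemma qpochSl x (q : C) n : qpoch x q n.+1 = (1 - x) * qpoch (x * q) q n.
Proof.
rewrite /qpoch big_nat_recl // expr0 mulr1; congr (_ * _).
by apply: eq_bigr => i _; rewrite exprS mulrA.
Qed.

Lemma qpochD x (q : C) m n : qpoch x q (m + n) = qpoch x q m * qpoch (x * q ^+ m) q n.
Proof.
elim: n => [|n IH]; first by rewrite addn0 qpoch0 mulr1.
by rewrite addnS !qpochS IH exprD !mulrA.
Qed.

Lemma one_sub_neq0 x : nc x < 1 -> 1 - x != 0.
Proof.
move=> x1; rewrite subr_eq0; apply: contraTneq x1 => <-.
by rewrite nc1 ltxx.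
Qed.

Lemma nc_expr_lt1 x n : nc x < 1 -> nc (x ^+ n.+1) < 1.
Proof. by move=> x1; rewrite ncX exprn_ilt1 ?nc_ge0. Qed.

Section Base.
Variable q : C.
Hypothesis q1 : nc q < 1.
Let r := nc q.
Let r01 : 0 <= r < 1. Proof. by rewrite /r nc_ge0. Qed.

Lemma nc_mulX_lt1 x n : nc x < 1 -> nc (x * q ^+ n) < 1.
Proof.
move=> x1; rewrite ncM ncX (le_lt_trans _ x1) // ler_piMr ?nc_ge0 //.
by rewrite exprn_ile1 ?nc_ge0 ?ltW.
Qed.

Lemma qfactor_neq0 x n : nc x < 1 -> 1 - x * q ^+ n != 0.
Proof. by move=> x1; apply/one_sub_neq0/nc_mulX_lt1. Qed.

Lemma qpoch_neq0 x n : nc x < 1 -> qpoch x q n != 0.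
Proof.
move=> x1; elim: n => [|n IH]; first by rewrite qpoch0 oner_eq0.
by rewrite qpochS mulf_neq0 // qfactor_neq0.
Qed.

Let sum_geo n : \sum_(0 <= j < n) r ^+ j <= (1 - r)^-1.
Proof.
have /andP[r0 r1] := r01.
rewrite big_mkord -[leRHS]mul1r ler_pdivlMr ?subr_gt0 // mulrC.
have -> : (1 - r) * (\sum_(i < n) r ^+ i) = 1 - r ^+ n.
  by rewrite -[in RHS](opprB _ 1) subrX1 -mulNr opprB.
by rewrite lerBlDr lerDl exprn_ge0.
Qed.

(** Each factor is at most [1 + |x| r^j <= exp(|x| r^j)]. The bound does not depend on [n], as the
    passages to the limit under a sum require. *)
Lemma qpoch_bound x n : nc (qpoch x q n) <= expR (nc x / (1 - r)).
Proof.
apply: (@le_trans _ _ (expR (nc x * \sum_(0 <= j < n) r ^+ j))); last first.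
  by rewrite ler_expR ler_wpM2l ?nc_ge0.
elim: n => [|n IH]; first by rewrite qpoch0 nc1 big_nil mulr0 expR0.
rewrite qpochS ncM big_nat_recr //= mulrDr expRD ler_pM ?nc_ge0 //.
apply: le_trans (expR_ge1Dx _); rewrite (le_trans (ncB _ _)) // nc1 ncM ncX //.
Qed.

(** With [y = |x q^j|], [1/(1-y) = 1 + y/(1-y) <= exp(y/(1-y))], and [y/(1-y)] is at most
    [r^j |x|/(1-|x|)]. *)
Lemma qpochV_bound x n : nc x < 1 ->
  nc (qpoch x q n)^-1 <= expR (nc x / (1 - nc x) / (1 - r)).
Proof.
move=> x1; have x0 := nc_ge0 x; have x1' : 0 < 1 - nc x by rewrite subr_gt0.
apply: (@le_trans _ _ (expR (nc x / (1 - nc x) * \sum_(0 <= j < n) r ^+ j))); last first.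
  by rewrite ler_expR ler_wpM2l // divr_ge0 // ltW.
elim: n => [|n IH]; first by rewrite qpoch0 invr1 nc1 big_nil mulr0 expR0.
rewrite qpochS invfM ncM big_nat_recr //= mulrDr expRD ler_pM ?nc_ge0 //.
have y1 := nc_mulX_lt1 n x1; set y := nc (x * q ^+ n) in y1.
have y0 : 0 <= y by exact: nc_ge0.
have yx : y <= nc x by rewrite /y ncM ncX ler_piMr // exprn_ile1 ?nc_ge0 ?ltW.
have y1' : 0 < 1 - y by rewrite subr_gt0.
apply: (@le_trans _ _ (1 - y)^-1).
  rewrite ncV lef_pV2 ?posrE // ?nc_gt0 ?qfactor_neq0 //.
  by have := nc_dist_ge 1 (x * q ^+ n); rewrite nc1.
apply: (@le_trans _ _ (1 + y / (1 - y))).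
  by rewrite le_eqVlt; apply/orP; left; apply/eqP; field; rewrite gt_eqF.
apply: le_trans (expR_ge1Dx _) _; rewrite ler_expR {1}/y ncM ncX -mulrA [X in _ <= X]mulrAC.
rewrite -[leRHS]mulrA ler_wpM2l // ler_wpM2l ?exprn_ge0 ?nc_ge0 //.
by rewrite lef_pV2 ?posrE // lerB.
Qed.

(** The product is 1 plus the partial sum of its increments [- x q^n (x;q)_n], an absolutely
    summable family since the [(x;q)_n] are bounded. *)
Lemma qpoch_cvg x : qpoch x q @ \oo --> qpoch_oo x q.
Proof.
suff : cvgn (qpoch x q) by move=> h; exact: h.
have s : asummable (fun n => - x * q ^+ n * qpoch x q n).
  apply: (asummable_le (b := fun n => (nc x * expR (nc x / (1 - r))) * r ^+ n)); last first.
    by apply: rsummable_geo => //; rewrite mulr_ge0 ?nc_ge0 ?expR_ge0.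
  move=> n; rewrite !ncM ncN ncX mulrAC ler_wpM2r ?exprn_ge0 ?nc_ge0 //.
  by rewrite ler_wpM2l ?nc_ge0 ?qpoch_bound.
rewrite (_ : qpoch x q = fun N => 1 + \sum_(0 <= n < N) (- x * q ^+ n * qpoch x q n)).
  exact: (cvgP _ (cvgD (cvg_cst (1 : C)) (asummable_cvgn s))).
apply/funext; elim=> [|N IH]; first by rewrite big_nil addr0 qpoch0.
by rewrite qpochS big_nat_recr //= addrA -IH; ring.
Qed.

Lemma qpoch_oo_neq0 x : nc x < 1 -> qpoch_oo x q != 0.
Proof.
move=> x1; rewrite -nc_gt0 -(cvg_lim _ (cvg_ncr (qpoch_cvg (x := x)))) //.
set K := expR (nc x / (1 - nc x) / (1 - r)).
apply: (@lt_le_trans _ _ K^-1); first by rewrite invr_gt0 expR_gt0.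
apply: limr_ge; first exact: cvgP (cvg_ncr (qpoch_cvg (x := x))).
apply: nearW => n /=; rewrite -[leRHS]invrK lef_pV2 ?posrE ?expR_gt0 ?invr_gt0 ?nc_gt0 ?qpoch_neq0 //.
by rewrite -ncV; exact: qpochV_bound.
Qed.

Lemma qpoch_oo_split x n : qpoch_oo x q = qpoch x q n * qpoch_oo (x * q ^+ n) q.
Proof.
have h1 : (fun k => qpoch x q n * qpoch (x * q ^+ n) q k) @ \oo --> qpoch x q n * qpoch_oo (x * q ^+ n) q.
  exact: (cvgM (cvg_cst _) (qpoch_cvg (x := _))).
have h2 : (fun k => qpoch x q n * qpoch (x * q ^+ n) q k) @ \oo --> qpoch_oo x q.
  have := qpoch_cvg (x := x); rewrite -(cvg_shiftn n (qpoch x q)).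
  by under eq_fun do rewrite addnC qpochD.
by rewrite -(cvg_lim _ h1) // -(cvg_lim _ h2).
Qed.

Lemma qpoch_ooS x : qpoch_oo x q = (1 - x) * qpoch_oo (x * q) q.
Proof. by rewrite (qpoch_oo_split x 1) qpochSl qpoch0 mulr1 expr1. Qed.

Section Binomial.
Variables (al be : C) (s : R).
Hypotheses (s0 : 0 < s) (als : nc al <= s).

(** Two parameters cover all the uses: [al = 1] gives [(be;q)_k/(q;q)_k], [al = 0] gives Euler's
    coefficients, and [al = q] the increments of [(be;q)_n/(q;q)_n]. The majorant [s] of [|al|] is
    strictly positive so that one can divide by it. *)
Definition qbc k : C := \prod_(0 <= i < k) ((al - be * q ^+ i) / (1 - q ^+ i.+1)).

Lemma qbc0 : qbc 0 = 1. Proof. by rewrite /qbc big_nil. Qed.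

Lemma qbcS k : qbc k.+1 * (1 - q ^+ k.+1) = qbc k * (al - be * q ^+ k).
Proof.
rewrite /qbc big_nat_recr //= -mulrA divfK //.
by apply: one_sub_neq0; apply: nc_expr_lt1.
Qed.

Lemma qbc_bound : exists K, 0 <= K /\ forall k, nc (qbc k) <= K * s ^+ k.
Proof.
exists (expR (nc be / s / (1 - r)) * expR (r / (1 - r) / (1 - r))).
split=> [|k]; first by rewrite mulr_ge0 ?expR_ge0.
have -> : qbc k = (\prod_(0 <= i < k) (al - be * q ^+ i)) * (qpoch q q k)^-1.
  by rewrite /qbc /qpoch -prodfV -big_split; apply: eq_bigr => i _; rewrite exprS.
rewrite ncM mulrAC; apply: ler_pM; rewrite ?nc_ge0 //; last exact: qpochV_bound.
apply: (@le_trans _ _ (expR (nc be / s * \sum_(0 <= j < k) r ^+ j) * s ^+ k)); last first.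
  by rewrite ler_pM2r ?exprn_gt0 // ler_expR ler_wpM2l // divr_ge0 ?nc_ge0 // ltW.
elim: k => [|k IH]; first by rewrite !big_nil mulr0 expR0 nc1 mulr1.
rewrite !big_nat_recr //= ncM mulrDr expRD exprSr mulrACA ler_pM ?nc_ge0 //.
rewrite (le_trans (ncB _ _)) // ncM ncX.
apply: (@le_trans _ _ ((1 + nc be / s * r ^+ k) * s)); last by rewrite ler_pM2r // expR_ge1Dx.
by rewrite mulrDl mul1r lerD // mulrAC divfK ?gt_eqF.
Qed.

Lemma qbc_summable z : s * nc z < 1 -> asummable (fun k => k.+1%:R * (qbc k * z ^+ k)).
Proof.
move=> sz; have sz0 : 0 <= s * nc z by rewrite mulr_ge0 ?nc_ge0 // ltW.
have [|L [t [L0 t01 hL]]] := @polygeo _ (s * nc z); first by rewrite sz0.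
have [K [K0 hK]] := qbc_bound.
apply: (asummable_le (b := fun k => (K * L) * t ^+ k)); last by apply: rsummable_geo => //; rewrite mulr_ge0.
move=> k; rewrite !ncM nc_nat ncX -mulrA.
apply: (@le_trans _ _ (K * (k.+1%:R ^+ 2 * (s * nc z) ^+ k))); last by rewrite ler_wpM2l.
rewrite exprMn (_ : K * _ = k.+1%:R * (k.+1%:R * (K * s ^+ k)) * nc z ^+ k); last by ring.
rewrite mulrA ler_wpM2r ?exprn_ge0 ?nc_ge0 // ler_wpM2l // (le_trans (hK k)) //.
by rewrite ler_peMl ?mulr_ge0 ?exprn_ge0 ?(ltW s0) // ler1n.
Qed.

Lemma qbc_summable0 z : s * nc z < 1 -> asummable (fun k => qbc k * z ^+ k).
Proof.
move=> /qbc_summable; apply: asummable_le => k /=; rewrite (ncM _%:R) nc_nat ler_peMl ?nc_ge0 // ler1n //.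
Qed.

Lemma qbc_summable1 z : s * nc z < 1 -> asummable (fun k => k%:R * (qbc k * z ^+ k)).
Proof.
move=> /qbc_summable; apply: asummable_le => k /=; rewrite !(ncM _%:R) !nc_nat ler_wpM2r ?nc_ge0 //.
by rewrite ler_nat.
Qed.

Definition qbs z := usum (fun k => qbc k * z ^+ k).
(** The operator [z d/dz] applied termwise to [qbs]. *)
Definition qbs' z := usum (fun k => k%:R * (qbc k * z ^+ k)).

Lemma s_mulq z : s * nc z < 1 -> s * nc (q * z) < 1.
Proof.
apply: le_lt_trans; rewrite ler_wpM2l ?(ltW s0) // ncM ler_piMl ?nc_ge0 //.
exact: ltW.
Qed.

Lemma s_mulX z n : s * nc z < 1 -> s * nc (z * q ^+ n) < 1.
Proof.
apply: le_lt_trans; rewrite ler_wpM2l ?(ltW s0) // ncM ncX ler_piMr ?nc_ge0 //.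
by rewrite exprn_ile1 ?nc_ge0 // ltW.
Qed.

Let rec_alg (F G a b z : C) : F - G = z * (a * F - b * G) -> (1 - a * z) * F = (1 - b * z) * G.
Proof.
move=> e; apply/eqP; rewrite -subr_eq0.
have -> : (1 - a * z) * F - (1 - b * z) * G = (F - G) - z * (a * F - b * G) by ring.
by rewrite e subrr.
Qed.

Let rec_alg' (F G F' G' a b z : C) : F' - G' = z * (a * (F' + F) - b * (G' + G)) ->
  (1 - a * z) * F' - a * z * F = (1 - b * z) * G' - b * z * G.
Proof.
move=> e; apply/eqP; rewrite -subr_eq0.
have -> : (1 - a * z) * F' - a * z * F - ((1 - b * z) * G' - b * z * G) =
  (F' - G') - z * (a * (F' + F) - b * (G' + G)) by ring.
by rewrite e subrr.
Qed.

(** The coefficient recursion [qbcS], multiplied by [z^(k+1)] and summed; the term of index 0 drops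
    out of [qbs z - qbs (q * z)]. *)
Lemma qbs_rec z : s * nc z < 1 -> (1 - al * z) * qbs z = (1 - be * z) * qbs (q * z).
Proof.
move=> sz; have h := qbc_summable0 sz; have hq := qbc_summable0 (s_mulq sz).
apply: rec_alg; rewrite /qbs -(usumZ al h) -(usumZ be hq) -(usumB (asummableZ al h) (asummableZ be hq)).
rewrite -(usumZ z (asummableB (asummableZ al h) (asummableZ be hq))) -(usumB h hq).
rewrite (usum_recl (asummableB h hq)) /= !expr0 subrr add0r; apply: eq_usum => k.
have := qbcS k; rewrite !exprMn.
move: (qbc k) (qbc k.+1) => x y e.
rewrite (_ : _ - _ = (y * (1 - q ^+ k.+1)) * z ^+ k.+1); last by ring.
by rewrite e exprS; ring.
Qed.

(** What [z d/dz] makes of [qbs_rec], proved again from [qbcS] so that no derivative has to be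
    taken. *)
Lemma qbs'_rec z : s * nc z < 1 ->
  (1 - al * z) * qbs' z - al * z * qbs z = (1 - be * z) * qbs' (q * z) - be * z * qbs (q * z).
Proof.
move=> sz; have h := qbc_summable0 sz; have hq := qbc_summable0 (s_mulq sz).
have h' := qbc_summable1 sz; have hq' := qbc_summable1 (s_mulq sz).
apply: rec_alg'.
have eL := usumB h' hq'.
have e1 := hsumD (asummable_hsum h') (asummable_hsum h).
have e2 := hsumD (asummable_hsum hq') (asummable_hsum hq).
have eR := hsumE (hsumZ z (hsumD (hsumZ al e1) (hsumZ (- be) e2))).
rewrite [LHS](esym eL); transitivity (z * (al * (qbs' z + qbs z) + - be * (qbs' (q * z) + qbs (q * z)))); last first.
  by congr (z * (_ + _)); rewrite mulNr.
rewrite -[RHS]eR (usum_recl (asummableB h' hq')) /= !mul0r subrr add0r; apply: eq_usum => k.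
have := qbcS k; rewrite !exprMn.
move: (qbc k) (qbc k.+1) => x y e.
rewrite (_ : _ - _ = k.+1%:R * ((y * (1 - q ^+ k.+1)) * z ^+ k.+1)); last by ring.
by rewrite e exprS -natr1; ring.
Qed.

Lemma cvg_pser0 (c : nat -> C) z : asummable (fun k => c k * z ^+ k) ->
  (fun N => usum (fun k => c k * (z * q ^+ N) ^+ k)) @ \oo --> c 0%N.
Proof.
move=> h; have [||_] := @tannery R nat (fun N k => c k * (z * q ^+ N) ^+ k)
  (fun k => if k == 0%N then c 0%N else 0) (fun k => nc (c k * z ^+ k)) h.
- move=> N k; rewrite exprMn mulrA ncM ler_piMr ?nc_ge0 // !ncX -exprM.
  by rewrite exprn_ile1 ?nc_ge0 // ltW.
- move=> [|k] /=; first by under eq_fun do rewrite expr0 mulr1; exact: cvg_cst.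
  have := cseqZ (c k.+1 * z ^+ k.+1) (cvg_expr0 (nc_expr_lt1 k q1)).
  rewrite mulr0; apply: cseq_ext => N.
  by rewrite exprMn mulrA -!exprM mulnC.
- have f0 k : k \notin [fset 0%N]%fset -> (if k == 0%N then c 0%N else 0) = 0.
    by rewrite inE => /negbTE ->.
  by rewrite (hsumE (hsum_fin f0)) big_seq_fset1 eqxx.
Qed.

Lemma nc_alz z : s * nc z < 1 -> nc (al * z) < 1.
Proof. by apply: le_lt_trans; rewrite ncM ler_wpM2r ?nc_ge0. Qed.

(** Iterate [qbs_rec] along [z], [z q], [z q^2] and so on; the remaining factor [qbs (z * q ^+ N)]
    tends to the constant term 1. *)
Theorem qbinomial z : s * nc z < 1 -> qbs z = qpoch_oo (be * z) q / qpoch_oo (al * z) q.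
Proof.
move=> sz; have az := nc_alz sz.
have e N : qpoch (al * z) q N * qbs z = qpoch (be * z) q N * qbs (z * q ^+ N).
  elim: N => [|N IH]; first by rewrite !qpoch0 expr0 mulr1.
  have := qbs_rec (s_mulX N sz); rewrite (_ : q * _ = z * q ^+ N.+1) ?mulrA => [e|]; last first.
    by rewrite exprS mulrCA mulrA.
  by rewrite !qpochS mulrAC IH -mulrA -[RHS]mulrA -e; ring.
have c1 := cseqM (qpoch_cvg (x := al * z)) (cseq_cst (l := qbs z)).
have c2 := cseqM (qpoch_cvg (x := be * z)) (cvg_pser0 (qbc_summable0 sz)).
have := cseq_unique (cseq_ext e c1) c2.
by rewrite qbc0 mulr1 => <-; rewrite mulrAC divff ?mul1r // qpoch_oo_neq0.
Qed.

Lemma lambert_summable w : nc w < 1 -> asummable (fun j => w * q ^+ j / (1 - w * q ^+ j)).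
Proof.
move=> w1; apply: (asummable_le (b := fun j => (nc w / (1 - nc w)) * r ^+ j)); last first.
  by apply: rsummable_geo => //; rewrite divr_ge0 ?nc_ge0 // subr_ge0 ltW.
move=> j; rewrite !ncM ncX ncV mulrAC ler_wpM2r ?exprn_ge0 ?nc_ge0 // ler_wpM2l ?nc_ge0 //.
rewrite lef_pV2 ?posrE ?subr_gt0 // ?nc_gt0 ?qfactor_neq0 //.
apply: le_trans (nc_dist_ge _ _); rewrite nc1 lerD2l lerN2 ncM ncX.
by rewrite ler_piMr ?nc_ge0 // exprn_ile1 ?nc_ge0 // ltW.
Qed.

Let logderiv_alg (F G F' G' x y : C) : (1 - x) * F = (1 - y) * G ->
  (1 - x) * F' - x * F = (1 - y) * G' - y * G -> F != 0 -> G != 0 -> 1 - x != 0 -> 1 - y != 0 ->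
  F' / F = x / (1 - x) - y / (1 - y) + G' / G.
Proof.
move=> e1 e2 F0 G0 x0 y0.
have eF : F = (1 - y) * G / (1 - x) by rewrite -e1 mulrAC divff ?mul1r.
have eF' : F' = ((1 - y) * G' - y * G + x * F) / (1 - x).
  by rewrite -e2 subrK mulrAC divff ?mul1r.
by rewrite eF' eF; field; rewrite G0 x0 y0.
Qed.

(* The logarithmic derivative of the q-binomial theorem. *)
Theorem qbinomial_logderiv z : s * nc z < 1 -> nc (be * z) < 1 ->
  let g j := al * z * q ^+ j / (1 - al * z * q ^+ j) - be * z * q ^+ j / (1 - be * z * q ^+ j) in
  asummable g /\ qbs' z = qbs z * usum g.
Proof.
move=> sz bz g; have az := nc_alz sz.
have sg : asummable g by apply: asummableB; exact: lambert_summable.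
split=> //.
have Fn0 n : qbs (z * q ^+ n) != 0.
  rewrite qbinomial ?s_mulX // mulf_neq0 ?invr_eq0 // mulrA;
  by apply: qpoch_oo_neq0; apply: nc_mulX_lt1.
(* The logarithmic derivative at [z q^N]. Consecutive values differ by [g N], and [rho N] tends to 0
   because its numerator has no constant term while its denominator tends to 1. *)
pose rho N := qbs' (z * q ^+ N) / qbs (z * q ^+ N).
have e : forall N, rho N = g N + rho N.+1.
  move=> N; have h1 := qbs_rec (s_mulX N sz); have h2 := qbs'_rec (s_mulX N sz).
  have ez : q * (z * q ^+ N) = z * q ^+ N.+1 by rewrite exprS mulrCA.
  rewrite ez in h1; rewrite ez in h2; rewrite /g -!(mulrA _ z (q ^+ N)) /rho.
  by apply: (logderiv_alg h1 h2 (Fn0 N) (Fn0 N.+1)); rewrite mulrA qfactor_neq0.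
have s' : asummable (fun k => k%:R * qbc k * z ^+ k).
  by have := qbc_summable1 sz; under eq_fun do rewrite mulrA.
have c1 := cvg_pser0 s'; rewrite mul0r in c1.
have c2 := cvg_pser0 (qbc_summable0 sz); rewrite qbc0 in c2.
have c3 := cseqD (asummable_cvgn sg) (cseqM c1 (cseqV (oner_neq0 _) c2)).
rewrite mul0r addr0 in c3.
have : rho 0%N = usum g.
  apply: cseq_unique (cseq_cst (l := _)) _; apply: cseq_ext c3 => N.
  rewrite (telescope_sum e N) /rho /qbs' /qbs.
  rewrite (_ : (fun k => k%:R * qbc k * (z * q ^+ N) ^+ k) = (fun k => k%:R * (qbc k * (z * q ^+ N) ^+ k))) //.
  by apply/funext => k; rewrite mulrA.
rewrite /rho expr0 mulr1.
have := Fn0 0%N; rewrite expr0 mulr1 => F0 <-; by rewrite mulrC divfK.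
Qed.

End Binomial.
End Base.
End QPochhammer.

(** * Jacobi's triple product *)

Section JacobiTriple.
Variable R : realType.
Local Notation C := (Cplx R).
Local Notation nc := (@normc R).

Lemma cseq_sub (u : nat -> C) (l : C) (f : nat -> nat) : (forall n, (n <= f n)%N) ->
  u @ \oo --> l -> (fun n => u (f n)) @ \oo --> l.
Proof.
move=> hf /cvgnc h; apply/cvgnc => e e0; have [N _ hN] := h _ e0.
by exists N => // n /= nN; apply: hN; rewrite /= (leq_trans nN).
Qed.

Variables a b : C.
Let p := a * b.
Hypothesis p1 : nc p < 1.

(** The general term [(-1)^n a^(n(n+1)/2) b^(n(n-1)/2)] of Ramanujan's theta function [f(-a,-b)]. *)
Definition jt (n : int) : C :=
  match n with
  | Posz m => (-1) ^+ m * a ^+ 'C(m.+1, 2) * b ^+ 'C(m, 2)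
  | Negz m => (-1) ^+ m.+1 * a ^+ 'C(m.+1, 2) * b ^+ 'C(m.+2, 2)
  end.

Lemma jt_PoszS m : jt (Posz m.+1) = jt (Posz m) * (- a * p ^+ m).
Proof. by rewrite /jt /p !binS !bin1 !bin0 !exprD !exprMn !exprS; ring. Qed.

Lemma jt_Negz0 : jt (Negz 0) = jt 0 * - b.
Proof.
by rewrite -[jt 0]/(jt (Posz 0)) /jt (_ : 'C(1, 2) = 0%N) // (_ : 'C(0, 2) = 0%N) // binn; ring.
Qed.

Lemma jt_NegzS m : jt (Negz m.+1) = jt (Negz m) * (- b * p ^+ m.+1).
Proof. by rewrite /jt /p !binS !bin1 !bin0 !exprD !exprMn !exprS; ring. Qed.

#[local] Arguments jt : simpl never.

(** The new factor [1 - a p^M] shifts the index by one at the cost of [p^e] with [e = M - n], which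
    is the weight in one of the two q-Pascal rules; [jt_down] plays the same part for [b] and the
    other rule. *)
Lemma jt_up (n : int) (M e : nat) : Posz M = n + Posz e ->
  - a * p ^+ M * jt n = p ^+ e * jt (n + 1).
Proof.
case: n => [m|[|m]] h.
- have -> : Posz m + 1 = Posz m.+1 by lia.
  have -> : M = (m + e)%N by lia.
  rewrite jt_PoszS exprD; ring.
- have -> : e = M.+1 by lia.
  have -> : Negz 0 + 1 = 0 by lia.
  by rewrite jt_Negz0 exprS /p; ring.
- have -> : Negz m.+1 + 1 = Negz m by lia.
  have -> : e = (M + m.+2)%N by lia.
  rewrite jt_NegzS exprD [p ^+ m.+2]exprS.
  move: (jt _) (p ^+ M) (p ^+ m.+1) => x y w; rewrite /p; ring.
Qed.

Lemma jt_down (n : int) (N e : nat) : Posz N + n = Posz e ->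
  - b * p ^+ N * jt n = p ^+ e * jt (n - 1).
Proof.
case: n => [[|m]|m] h.
- have -> : e = N by lia.
  have -> : Posz 0 - 1 = Negz 0 by lia.
  by rewrite jt_Negz0; ring.
- have -> : e = (N + m.+1)%N by lia.
  have -> : Posz m.+1 - 1 = Posz m by lia.
  rewrite jt_PoszS exprD [p ^+ m.+1]exprS.
  move: (jt _) (p ^+ N) (p ^+ m) => x y w; rewrite /p; ring.
- have -> : Negz m - 1 = Negz m.+1 by lia.
  have -> : N = (m.+1 + e)%N by lia.
  rewrite jt_NegzS exprD; ring.
Qed.

(** Gaussian binomial coefficients; the value 0 beyond [n] lets both Pascal rules hold up to
    [k = n]. *)
Definition gauss n k : C :=
  if (k <= n)%N then qpoch p p n / (qpoch p p k * qpoch p p (n - k)) else 0.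

Let pn0 k : qpoch p p k != 0. Proof. exact: qpoch_neq0. Qed.
Let p10 k : 1 - p ^+ k.+1 != 0. Proof. exact/one_sub_neq0/nc_expr_lt1. Qed.
Let ppS k : qpoch p p k.+1 = qpoch p p k * (1 - p ^+ k.+1).
Proof. by rewrite qpochS exprS. Qed.

Lemma gauss0 n : gauss n 0 = 1.
Proof. by rewrite /gauss leq0n subn0 qpoch0 mul1r divff. Qed.

Lemma gauss_diag n : gauss n n = 1.
Proof. by rewrite /gauss leqnn subnn qpoch0 mulr1 divff. Qed.

Lemma gauss_large n : gauss n n.+1 = 0.
Proof. by rewrite /gauss ltnn. Qed.

Lemma gauss_pascal1 n k : (k <= n)%N -> gauss n.+1 k.+1 = gauss n k.+1 + p ^+ (n - k) * gauss n k.
Proof.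
rewrite leq_eqVlt => /orP[/eqP ->|kn].
  by rewrite subnn expr0 mul1r gauss_large !gauss_diag add0r.
rewrite /gauss ltnS ltnW // kn subSS.
have [d ->] : exists d, n = (k.+1 + d)%N by exists (n - k.+1)%N; lia.
rewrite addKn (_ : (k.+1 + d - k = d.+1)%N); last lia.
rewrite (ppS (k.+1 + d)) (ppS k) (ppS d).
have -> : p ^+ (k.+1 + d).+1 = p ^+ k.+1 * p ^+ d.+1 by rewrite -exprD; congr (_ ^+ _); lia.
have h1 := p10 k; have h2 := p10 d; have h3 := pn0 k; have h4 := pn0 d.
move: (p ^+ k.+1) (p ^+ d.+1) (qpoch p p k) (qpoch p p d) (qpoch p p _) h1 h2 h3 h4 => x y u v w h1 h2 h3 h4.
by field; rewrite h1 h2 h3 h4.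
Qed.

Lemma gauss_pascal2 n k : (k <= n)%N -> gauss n.+1 k.+1 = p ^+ k.+1 * gauss n k.+1 + gauss n k.
Proof.
rewrite leq_eqVlt => /orP[/eqP ->|kn].
  by rewrite gauss_large !gauss_diag mulr0 add0r.
rewrite /gauss ltnS ltnW // kn subSS.
have [d ->] : exists d, n = (k.+1 + d)%N by exists (n - k.+1)%N; lia.
rewrite addKn (_ : (k.+1 + d - k = d.+1)%N); last lia.
rewrite (ppS (k.+1 + d)) (ppS k) (ppS d).
have -> : p ^+ (k.+1 + d).+1 = p ^+ k.+1 * p ^+ d.+1 by rewrite -exprD; congr (_ ^+ _); lia.
have h1 := p10 k; have h2 := p10 d; have h3 := pn0 k; have h4 := pn0 d.
move: (p ^+ k.+1) (p ^+ d.+1) (qpoch p p k) (qpoch p p d) (qpoch p p _) h1 h2 h3 h4 => x y u v w h1 h2 h3 h4.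
by field; rewrite h1 h2 h3 h4.
Qed.

Let gauss_sum0 n (Y : nat -> C) (w : nat -> nat) :
  \sum_(0 <= k < n.+1) p ^+ w k * gauss n k * Y k =
  p ^+ w 0%N * Y 0%N + \sum_(0 <= k < n.+1) p ^+ w k.+1 * gauss n k.+1 * Y k.+1.
Proof.
rewrite -[in RHS](mulr1 (p ^+ w 0%N)) -[in RHS](gauss0 n) -(big_nat_recl n.+1 0 (fun k => p ^+ w k * gauss n k * Y k)) //.
by rewrite [RHS]big_nat_recr //= gauss_large mulr0 mul0r addr0.
Qed.

Lemma gauss_sum1 n (Y : nat -> C) :
  \sum_(0 <= k < n.+1) gauss n k * Y k + \sum_(0 <= k < n.+1) p ^+ (n - k) * gauss n k * Y k.+1 =
  \sum_(0 <= k < n.+2) gauss n.+1 k * Y k.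
Proof.
have := gauss_sum0 n Y (fun=> 0%N); under eq_bigr do rewrite expr0 mul1r; move=> ->.
rewrite [RHS]big_nat_recl // gauss0 expr0 -addrA; congr (_ + _).
rewrite -big_split /=; apply: eq_big_nat => k /andP[_ kn].
by rewrite gauss_pascal1 // mul1r mulrDl.
Qed.

Lemma gauss_sum2 n (Y : nat -> C) :
  \sum_(0 <= k < n.+1) gauss n k * Y k.+1 + \sum_(0 <= k < n.+1) p ^+ k * gauss n k * Y k =
  \sum_(0 <= k < n.+2) gauss n.+1 k * Y k.
Proof.
rewrite (gauss_sum0 n Y id) [RHS]big_nat_recl // gauss0 expr0 addrCA; congr (_ + _).
rewrite -big_split /=; apply: eq_big_nat => k /andP[_ kn].
by rewrite gauss_pascal2 // mulrDl addrC.
Qed.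

(* Cauchy's finite form of the triple product. *)
Lemma finite_triple M N : qpoch a p M * qpoch b p N =
  \sum_(0 <= k < (M + N).+1) gauss (M + N) k * jt (Posz k - Posz N).
Proof.
elim: M => [|M IHM].
  elim: N => [|N IHN].
    by rewrite big_nat1 gauss0 !qpoch0 -[jt _]/(jt (Posz 0)) /jt (_ : 'C(1, 2) = 0%N) //
      (_ : 'C(0, 2) = 0%N) // !expr0 !mulr1.
  rewrite qpochS mulrA IHN !add0n -gauss_sum2 mulrDr mulr1 mulr_suml; congr (_ + _).
    by apply: eq_bigr => k _; congr (_ * jt _); lia.
  apply: eq_bigr => k _; have := @jt_down (Posz k - Posz N) N k.
  rewrite (_ : Posz k - Posz N - 1 = Posz k - Posz N.+1); last by lia.
  move=> h; rewrite -[RHS]mulrA [RHS]mulrCA -h; last by lia.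
  by ring.
rewrite qpochS mulrAC IHM addSn -gauss_sum1 mulrDr mulr1 mulr_suml; congr (_ + _).
apply: eq_big_nat => k /andP[_ kn]; have := @jt_up (Posz k - Posz N) M (M + N - k).
rewrite (_ : Posz k - Posz N + 1 = Posz k.+1 - Posz N); last by lia.
move=> h; rewrite -[RHS]mulrA [RHS]mulrCA -h; last by lia.
by ring.
Qed.

(** On either side the ratio of consecutive terms is a constant times a growing power of [p], hence
    eventually at most 1/2. *)
Lemma jt_summable : asummable jt.
Proof.
have r01 : 0 <= nc p < 1 by rewrite nc_ge0.
have half0 : 0 < 1 / 2 :> R by lra.
have half1 : 1 / 2 < 1 :> R by lra.
have half : is_true (0 <= (1 / 2 : R) < 1) by rewrite (ltW half0) half1.
apply: asummable_int.
  have [N hN] := expr_small (nc a) r01 half0.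
  apply: (rsummable_ratio (N := N) half) => [n|n Nn] /=; first exact: nc_ge0.
  by rewrite jt_PoszS ncM (ncM (- a)) ncN ncX mulrC ler_wpM2r ?nc_ge0 // hN.
have [N hN] := expr_small (nc b) r01 half0.
apply: (rsummable_ratio (N := N) half) => [n|n Nn] /=; first exact: nc_ge0.
by rewrite jt_NegzS ncM (ncM (- b)) ncN ncX mulrC ler_wpM2r ?nc_ge0 // hN // leqW.
Qed.

Let F N (n : int) : C := if 0 <= n + Posz N then gauss (N + N) (absz (n + Posz N)) * jt n else 0.

Let usum_F N : usum (F N) = qpoch a p N * qpoch b p N.
Proof.
pose phi (k : nat) : int := Posz k - Posz N.
have phi_inj : injective phi by move=> k l; rewrite /phi; lia.
have supp n : F N n != 0 -> exists k, phi k = n.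
  rewrite /F; case: ifP => [h _|_]; last by rewrite eqxx.
  by exists (absz (n + Posz N)); rewrite /phi; lia.
have Fphi k : F N (phi k) = gauss (N + N) k * jt (Posz k - Posz N).
  by rewrite /F /phi subrK.
have f0 k : k \notin [fset i in index_iota 0 (N + N).+1]%fset -> (F N \o phi) k = 0.
  rewrite fset_iotaE -leqNgt => kN; rewrite /= Fphi /gauss ifF ?mul0r //; lia.
have sF : asummable (F N).
  by apply: (asummable_supp phi_inj supp); exact: asummable_fin f0.
rewrite -(usum_supp phi_inj supp sF) (hsumE (hsum_fin f0)) sum_fset_seq ?iota_uniq //.
rewrite finite_triple; apply: eq_bigr => k _; exact: Fphi.
Qed.

Let gauss_cvg (u v w : nat -> nat) : (forall n, (n <= u n)%N) -> (forall n, (n <= v n)%N) ->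
  (forall n, u n + v n = w n)%N ->
  (fun n => gauss (w n) (u n)) @ \oo --> (qpoch_oo p p)^-1.
Proof.
move=> hu hv hw; have c := qpoch_cvg p1 (x := p); have n0 := qpoch_oo_neq0 p1 p1.
have hw' n : (n <= w n)%N by rewrite -hw (leq_trans (hu n)) // leq_addr.
have h := cseqM (cseq_sub hw' c) (cseqV (mulf_neq0 n0 n0) (cseqM (cseq_sub hu c) (cseq_sub hv c))).
have el (l : C) : l != 0 -> l / (l * l) = l^-1.
  by move=> l0; rewrite invfM mulrA divff // mul1r.
rewrite -(el _ n0); apply: cseq_ext h => n.
by rewrite /gauss -hw leq_addr addKn.
Qed.

Let F_cvg n : (fun N => F N n) @ \oo --> (qpoch_oo p p)^-1 * jt n.
Proof.
rewrite -(cvg_shiftn (absz n)); set m := absz n.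
have h : (fun N => gauss (N + m + (N + m)) (absz (n + Posz (N + m))) * jt n) @ \oo --> (qpoch_oo p p)^-1 * jt n.
  apply: cseqM (cseq_cst (l := _)).
  refine (@gauss_cvg (fun N => absz (n + Posz (N + m)%N))
    (fun N => subn (N + m + (N + m))%N (absz (n + Posz (N + m)%N))) (fun N => N + m + (N + m))%N _ _ _) => N; lia.
by apply: cseq_ext h => N; rewrite /mk_sequence /= /F ifT //; lia.
Qed.

(** [F N] holds the terms of the finite identity with [M = N], reindexed over the integers. The
    central Gaussian coefficients are bounded by [K] and tend to [1/(p;p)_oo], so the sum passes to
    the limit. *)
Theorem jacobi_triple : usum jt = qpoch_oo a p * qpoch_oo b p * qpoch_oo p p.
Proof.
pose K := expR (nc p / (1 - nc p)) * (expR (nc p / (1 - nc p) / (1 - nc p)) * expR (nc p / (1 - nc p) / (1 - nc p))).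
have K0 : 0 <= K by rewrite !mulr_ge0 ?expR_ge0.
have bound N n : nc (F N n) <= K * nc (jt n).
  rewrite /F; case: ifP => _; last by rewrite nc0 mulr_ge0 ?nc_ge0.
  rewrite ncM ler_wpM2r ?nc_ge0 // /gauss; case: ifP => _; last by rewrite nc0.
  by rewrite ncM invfM ncM !ler_pM ?nc_ge0 ?mulr_ge0 ?nc_ge0 // ?qpoch_bound ?qpochV_bound.
have [_ h1] := tannery (rsummableZ K0 jt_summable) bound F_cvg.
rewrite (usumZ _ jt_summable) in h1.
have h2 := cseqM (qpoch_cvg p1 (x := a)) (qpoch_cvg p1 (x := b)).
rewrite -(cseq_unique (cseq_ext usum_F h1) h2) mulrAC mulVf ?mul1r //.
exact: qpoch_oo_neq0.
Qed.

End JacobiTriple.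

(** * Dissections of infinite products and special q-binomial sums *)

Section QProducts.
Variable R : realType.
Local Notation C := (Cplx R).
Local Notation nc := (@normc R).
Implicit Types (x a z p : C).

Lemma leq_double2 n : (n <= n.*2)%N. Proof. by rewrite -addnn leq_addr. Qed.

Lemma nc_sqr_lt1 p : nc p < 1 -> nc (p ^+ 2) < 1. Proof. exact: nc_expr_lt1. Qed.

Lemma qpoch_oo_sqr x p : nc p < 1 ->
  qpoch_oo x p * qpoch_oo (- x) p = qpoch_oo (x ^+ 2) (p ^+ 2).
Proof.
move=> p1; have h := cseqM (qpoch_cvg p1 (x := x)) (qpoch_cvg p1 (x := - x)).
apply: (cseq_unique h); apply: cseq_ext (qpoch_cvg (nc_sqr_lt1 p1) (x := x ^+ 2)).
elim=> [|n IH]; first by rewrite !qpoch0 mulr1.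
rewrite !qpochS IH -exprM mulnC exprM; move: (qpoch _ _ n) (qpoch _ _ n) (p ^+ n) => u v w; ring.
Qed.

Lemma qpoch_oo_bisect x p : nc p < 1 ->
  qpoch_oo x p = qpoch_oo x (p ^+ 2) * qpoch_oo (x * p) (p ^+ 2).
Proof.
move=> p1; have p2 := nc_sqr_lt1 p1.
have h := cseqM (qpoch_cvg p2 (x := x)) (qpoch_cvg p2 (x := x * p)).
apply: (cseq_unique _ h); apply: cseq_ext (cseq_sub leq_double2 (qpoch_cvg p1 (x := x))).
elim=> [|n IH]; first by rewrite !qpoch0 mulr1.
rewrite doubleS !qpochS IH -!exprM mul2n (exprS p n.*2).
move: (qpoch _ _ n) (qpoch _ _ n) (p ^+ n.*2) => u v w; ring.
Qed.

Lemma qpoch_oo_trisect x p : nc p < 1 ->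
  qpoch_oo x p = qpoch_oo x (p ^+ 3) * qpoch_oo (x * p) (p ^+ 3) * qpoch_oo (x * p ^+ 2) (p ^+ 3).
Proof.
move=> p1; have p2 : nc (p ^+ 3) < 1 by exact: nc_expr_lt1.
have h := cseqM (cseqM (qpoch_cvg p2 (x := x)) (qpoch_cvg p2 (x := x * p))) (qpoch_cvg p2 (x := x * p ^+ 2)).
have l3 n : (n <= 3 * n)%N by lia.
apply: (cseq_unique _ h); apply: cseq_ext (cseq_sub l3 (qpoch_cvg p1 (x := x))).
elim=> [|n IH]; first by rewrite muln0 !qpoch0 !mulr1.
rewrite (_ : 3 * n.+1 = (3 * n).+3)%N; last lia.
rewrite !qpochS IH -!exprM.
move: (qpoch _ _ n) (qpoch _ _ n) (qpoch _ _ n) => u v t; rewrite !exprS.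
move: (p ^+ (3 * n)) => w; ring.
Qed.

Section Base.
Variable q : C.
Hypothesis q1 : nc q < 1.

Let q2 : nc (q ^+ 2) < 1. Proof. exact: nc_sqr_lt1. Qed.
Let Nq1 : nc (- q) < 1. Proof. by rewrite ncN. Qed.

Lemma qpoch_oo_q_neq0 : qpoch_oo q q != 0. Proof. exact: qpoch_oo_neq0. Qed.
Lemma qpoch_oo_Nq_neq0 : qpoch_oo (- q) q != 0. Proof. exact: qpoch_oo_neq0. Qed.
Lemma qpoch_oo_q2 : qpoch_oo (q ^+ 2) (q ^+ 2) = qpoch_oo q q * qpoch_oo (- q) q.
Proof. by rewrite qpoch_oo_sqr. Qed.

(** Bisection gives [(q;q)_oo = (q;q^2)_oo (q^2;q^2)_oo], and the last factor is
    [(q;q)_oo (-q;q)_oo]; cancel [(q;q)_oo]. *)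
Lemma euler_odd_distinct : qpoch_oo q (q ^+ 2) * qpoch_oo (- q) q = 1.
Proof.
have h := qpoch_oo_bisect q q1.
rewrite (_ : q * q = q ^+ 2) ?qpoch_oo_q2 in h; last by rewrite expr2.
move: (qpoch_oo q (q ^+ 2)) (qpoch_oo q q) (qpoch_oo (- q) q) qpoch_oo_q_neq0 h => x y z y0 h.
by apply: (mulfI y0); rewrite mulr1 mulrCA -h.
Qed.

Lemma qpoch_oo_odd : qpoch_oo q (q ^+ 2) = (qpoch_oo (- q) q)^-1.
Proof.
move: (qpoch_oo q (q ^+ 2)) (qpoch_oo (- q) q) qpoch_oo_Nq_neq0 euler_odd_distinct => x y y0 h.
by rewrite -[RHS]mul1r -h mulfK.
Qed.

Lemma qbc1E a n : qbc q 1 a n = qpoch a q n / qpoch q q n.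
Proof.
rewrite /qbc /qpoch -prodfV -big_split; apply: eq_bigr => i _; by rewrite exprS.
Qed.

Lemma qpoch_oo0 : qpoch_oo 0 q = 1.
Proof.
apply: (cseq_unique (qpoch_cvg q1 (x := 0))); apply: cseq_ext (cseq_cst (l := 1)) => n.
by rewrite /qpoch big1 // => i _; rewrite mul0r subr0.
Qed.

Lemma nc1_le1 : nc 1 <= 1. Proof. by rewrite nc1. Qed.

Lemma qbinomial1 a z : nc z < 1 ->
  asummable (fun n => qpoch a q n / qpoch q q n * z ^+ n) /\
  usum (fun n => qpoch a q n / qpoch q q n * z ^+ n) = qpoch_oo (a * z) q / qpoch_oo z q.
Proof.
move=> z1; have z1' : 1 * nc z < 1 by rewrite mul1r.
have h1 := qbc_summable0 q1 a ltr01 nc1_le1 z1'.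
have h2 := qbinomial q1 a ltr01 nc1_le1 z1'.
rewrite mul1r /qbs in h2.
have e : (fun n => qpoch a q n / qpoch q q n * z ^+ n) = (fun k => qbc q 1 a k * z ^+ k).
  by apply/funext => n; rewrite qbc1E.
by rewrite e.
Qed.

(** The q-binomial theorem with [al = 0] and [be = 1] at [z = q], which raises the exponent
    [n(n-1)/2] of Euler's coefficients to [n(n+1)/2]. *)
Lemma euler_partial_theta : asummable (F1n ^~ q) /\ usum (F1n ^~ q) = qpoch_oo q q.
Proof.
have z1 : 1 * nc q < 1 by rewrite mul1r.
have n0 : nc (0 : C) <= 1 by rewrite nc0.
have h1 := qbc_summable0 q1 1 ltr01 n0 z1.
have h2 := qbinomial q1 1 ltr01 n0 z1.
rewrite mul1r mul0r qpoch_oo0 divr1 /qbs in h2.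
have e : (F1n ^~ q) = (fun k => qbc q 0 1 k * q ^+ k).
  apply/funext => n; rewrite /F1n (_ : (n * n.+1)./2 = 'C(n.+1, 2)); last by rewrite bin2 mulnC.
  have -> : qbc q 0 1 n = (-1) ^+ n * q ^+ 'C(n, 2) / qpoch q q n.
    rewrite /qbc /qpoch -[X in _ / X]mul1r.
    elim: n => [|n IH]; first by rewrite !big_nil bin0n expr0 !mulr1 divr1.
    rewrite !big_nat_recr //= mul1r IH binS bin1 exprD !exprS !mul1r.
    rewrite !invfM; ring.
  rewrite binS bin1 exprD; ring.
by rewrite e.
Qed.

End Base.
End QProducts.

(** * Theta series as infinite products *)

Section ThetaSums.
Variable R : realType.
Local Notation C := (Cplx R).
Local Notation nc := (@normc R).

Lemma exprz_ge0E (x : C) (n : int) : 0 <= n -> x ^ n = x ^+ absz n.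
Proof. by case: n. Qed.

Lemma exprN1z (n : int) : (-1 : C) ^ n = (-1) ^+ absz n.
Proof.
case: n => [n|n] //=; rewrite -[LHS]/(((-1) ^+ n.+1)^-1) -exprVn.
by rewrite invrN1.
Qed.

Lemma mulzz_ge0 (n : int) : 0 <= n * n.
Proof. by rewrite -expr2 sqr_ge0. Qed.

Lemma mul2zz_ge0 (n : int) : 0 <= 2 * (n * n).
Proof. by rewrite mulr_ge0 // mulzz_ge0. Qed.

Lemma bin2D m : 'C(m.+1, 2) = ('C(m, 2) + m)%N.
Proof. by rewrite binS bin1. Qed.

Lemma bin2_dbl m : (2 * 'C(m, 2) + m = m * m)%N.
Proof. by elim: m => [|m IH] //; rewrite bin2D; lia. Qed.

Lemma bin2S_dbl m : (2 * 'C(m.+1, 2) = m * m + m)%N.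
Proof. have := bin2_dbl m; rewrite bin2D; lia. Qed.

Lemma signX_sqr (m : nat) : (-1 : C) ^+ (m * m) = (-1) ^+ m.
Proof. by rewrite -[LHS]signr_odd oddM andbb signr_odd. Qed.

(* [jt] has non-negative exponents, so these forms have no junk value at 0. *)
Lemma jt_diag (x : C) (n : int) : jt x x n = (-1) ^ n * x ^ (n * n).
Proof.
rewrite exprN1z exprz_ge0E ?mulzz_ge0 //.
case: n => m; rewrite /jt -mulrA -exprD; congr (_ * x ^+ _).
  by have := bin2_dbl m; rewrite bin2D; lia.
by have := bin2_dbl m; rewrite !bin2D; lia.
Qed.

Lemma jt_pentagonal (q : C) (n : int) :
  jt (q ^+ 2) q n = (-1) ^ n * q ^ (n * (3 * n + 1) %/ 2)%Z.
Proof.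
rewrite exprN1z.
have -> : (n * (3 * n + 1) %/ 2)%Z = match n with
    | Posz m => Posz (2 * 'C(m.+1, 2) + 'C(m, 2))%N | Negz m => Posz (2 * 'C(m.+1, 2) + 'C(m.+2, 2))%N end.
  rewrite (_ : n * (3 * n + 1) = (match n with
    | Posz m => Posz (2 * 'C(m.+1, 2) + 'C(m, 2))%N | Negz m => Posz (2 * 'C(m.+1, 2) + 'C(m.+2, 2))%N end) * 2) ?mulzK //.
  case: n => m; have h := bin2_dbl m; rewrite !bin2D; lia.
by case: n => m; rewrite /jt -mulrA -exprM -exprD.
Qed.

Lemma jt_triangular (q : C) (n : int) : jt (- q) (-1) n = q ^ (n * (n + 1) %/ 2)%Z.
Proof.
have -> : (n * (n + 1) %/ 2)%Z = match n with
    | Posz m => Posz 'C(m.+1, 2) | Negz m => Posz 'C(m.+1, 2) end.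
  rewrite (_ : n * (n + 1) = (match n with
    | Posz m => Posz 'C(m.+1, 2) | Negz m => Posz 'C(m.+1, 2) end) * 2) ?mulzK //.
  case: n => m; have h := bin2_dbl m; rewrite !bin2D; lia.
have e m : (-1) ^+ 'C(m, 2) * (-1) ^+ 'C(m, 2) = 1 :> C by rewrite -expr2 sqrr_sign.
case: n => m; rewrite /jt (exprNn q).
  transitivity ((-1) ^+ m * (-1) ^+ 'C(m.+1, 2) * (-1) ^+ 'C(m, 2) * q ^+ 'C(m.+1, 2) : C); first by ring.
  rewrite (_ : (-1) ^+ m * _ * _ = 1 :> C) ?mul1r // bin2D addnC exprD mulrA -expr2.
  by rewrite sqrr_sign mul1r e.
transitivity ((-1) ^+ m.+1 * (-1) ^+ 'C(m.+1, 2) * (-1) ^+ 'C(m.+2, 2) * q ^+ 'C(m.+1, 2) : C); first by ring.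
rewrite (_ : (-1) ^+ m.+1 * _ * _ = 1 :> C) ?mul1r // (bin2D m.+1) exprD.
by rewrite -mulrA (mulrA (_ ^+ 'C(_, 2))) e mul1r -expr2 sqrr_sign.
Qed.

Section Theta.
Variable q : C.
Hypothesis q1 : nc q < 1.

(** The triple product with [a = q^2] and [b = q]; its three products in base [q^3] reassemble by
    trisection. *)
Lemma pentagonal_number : asummable (fun n : int => (-1) ^ n * q ^ (n * (3 * n + 1) %/ 2)%Z) /\
  usum (fun n : int => (-1) ^ n * q ^ (n * (3 * n + 1) %/ 2)%Z) = qpoch_oo q q.
Proof.
have e : (fun n : int => (-1) ^ n * q ^ (n * (3 * n + 1) %/ 2)%Z) = jt (q ^+ 2) q.
  by apply/funext => n; rewrite jt_pentagonal.
have e3 : q ^+ 2 * q = q ^+ 3 by rewrite -exprSr.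
have p1 : nc (q ^+ 2 * q) < 1 by rewrite e3 nc_expr_lt1.
rewrite e; split; first exact: jt_summable.
rewrite jacobi_triple // e3 [RHS]qpoch_oo_trisect //.
rewrite (_ : q * q = q ^+ 2) ?expr2 // (_ : q * (q * q) = q ^+ 3) ?exprS ?expr0 ?mulr1 //.
by congr (_ * _); rewrite mulrC.
Qed.

Lemma theta_diag (x : C) : nc (x * x) < 1 -> asummable (fun n : int => (-1) ^ n * x ^ (n * n)) /\
  usum (fun n : int => (-1) ^ n * x ^ (n * n)) =
  qpoch_oo x (x ^+ 2) * qpoch_oo x (x ^+ 2) * qpoch_oo (x ^+ 2) (x ^+ 2).
Proof.
move=> x1; have e : (fun n : int => (-1) ^ n * x ^ (n * n)) = jt x x.
  by apply/funext => n; rewrite jt_diag.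
rewrite e; split; first exact: jt_summable.
by rewrite jacobi_triple // expr2.
Qed.

Lemma theta4 : asummable (fun n : int => (-1) ^ n * q ^ (n * n)) /\
  usum (fun n : int => (-1) ^ n * q ^ (n * n)) = qpoch_oo q q / qpoch_oo (- q) q.
Proof.
have [|s e] := @theta_diag q; first by have := nc_sqr_lt1 q1; rewrite expr2.
split=> //; rewrite e -mulrA qpoch_oo_q2 // qpoch_oo_odd //.
have := qpoch_oo_Nq_neq0 q1; move: (qpoch_oo q q) (qpoch_oo (- q) q) => u v v0.
by field.
Qed.

(** The triple product with [a = -q] and [b = -1]: it asks only for [|ab| < 1], and all signs
    cancel. The 2 is the first factor of [(-1;q)_oo]. *)
Lemma theta_triangular : asummable (fun n : int => q ^ (n * (n + 1) %/ 2)%Z) /\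
  usum (fun n : int => q ^ (n * (n + 1) %/ 2)%Z) =
  2 * (qpoch_oo (q ^+ 2) (q ^+ 2) / qpoch_oo q (q ^+ 2)).
Proof.
have e : (fun n : int => q ^ (n * (n + 1) %/ 2)%Z) = jt (- q) (-1).
  by apply/funext => n; rewrite jt_triangular.
have ep : - q * -1 = q by ring.
have p1 : nc (- q * -1) < 1 by rewrite ep.
rewrite e; split; first exact: jt_summable.
rewrite jacobi_triple // ep (qpoch_ooS q1 (-1)) mulN1r opprK qpoch_oo_q2 // qpoch_oo_odd // invrK.
by move: (qpoch_oo _ _) (qpoch_oo _ _) => u v; ring.
Qed.

Lemma usum_parity (f : nat -> C) : asummable f ->
  [/\ asummable (fun k => f k.*2), asummable (fun k => f k.*2.+1) &
      usum f = usum (fun k => f k.*2) + usum (fun k => f k.*2.+1)].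
Proof.
move=> sf; have i1 : injective double by exact: double_inj.
have i2 : injective (fun k => k.*2.+1) by move=> k l [] /double_inj.
split; [exact: (asummable_inj i1 sf)|exact: (asummable_inj i2 sf)|].
pose g (n : nat) : C := if odd n then 0 else f n; pose h (n : nat) : C := if odd n then f n else 0.
have e : f =1 (fun n => g n + h n) by move=> n; rewrite /g /h; case: ifP; rewrite ?addr0 ?add0r.
have sg : asummable g.
  by apply: (asummable_le _ sf) => n; rewrite /g; case: ifP; rewrite ?nc0 ?nc_ge0.
have sh : asummable h.
  by apply: (asummable_le _ sf) => n; rewrite /h; case: ifP; rewrite ?nc0 ?nc_ge0.
rewrite (eq_usum e) usumD // -(usum_supp i1 _ sg) => [|n]; last first.
  rewrite /g; case: ifP => [_|o _]; first by rewrite eqxx.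
  by exists n./2; rewrite even_halfK ?o.
rewrite -(usum_supp i2 _ sh) => [|n]; last first.
  rewrite /h; case: ifP => on; last by rewrite eqxx.
  by move=> _; exists n./2; rewrite -[RHS]odd_double_half on.
congr (_ + _); apply: eq_usum => k /=; first by rewrite /g odd_double.
by rewrite /h /= odd_double.
Qed.

Lemma usum_even (f : nat -> C) : asummable f ->
  usum f + usum (fun n => (-1) ^+ n * f n) = 2 * usum (fun k => f k.*2).
Proof.
move=> sf; have sg : asummable (fun n => (-1) ^+ n * f n).
  by apply: (asummable_le _ sf) => n; rewrite ncM ncX ncN nc1 expr1n mul1r.
have [h1 h2 ->] := usum_parity sf; have [_ _ ->] := usum_parity sg.
rewrite (_ : (fun k => (-1) ^+ k.*2 * f k.*2) = (fun k => f k.*2)); last first.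
  by apply/funext => k; rewrite -signr_odd odd_double mul1r.
rewrite (_ : (fun k => (-1) ^+ k.*2.+1 * f k.*2.+1) = (fun k => - f k.*2.+1)); last first.
  by apply/funext => k; rewrite -signr_odd /= odd_double mulN1r.
by rewrite usumN //; move: (usum _) (usum _) => u v; ring.
Qed.

Lemma usum_even_int (f : int -> C) : asummable f ->
  usum f + usum (fun n => (-1) ^ n * f n) = 2 * usum (fun k => f (2 * k)).
Proof.
move=> sf; have sg : asummable (fun n => (-1) ^ n * f n).
  by apply: (asummable_le _ sf) => n; rewrite ncM exprN1z ncX ncN nc1 expr1n mul1r.
rewrite -(usumD sf sg); pose g n := f n + (-1) ^ n * f n.
have i1 : injective (fun k : int => 2 * k) by move=> k l; lia.
have s : asummable g by exact: asummableD.
rewrite -(usum_supp i1 _ s) => [|n]; last first.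
  move=> h; exists (n %/ 2)%Z; apply/eqP; apply: contraNT h => h.
  rewrite /g exprN1z -signr_odd (_ : odd _ = true) ?mulN1r ?subrr //.
  lia.
rewrite -(usumZ 2 (asummable_inj i1 sf)); apply: eq_usum => k.
by rewrite /g /= exprN1z -signr_odd (_ : odd _ = false) ?mul1r /= ?expr0 ?mul1r; [ring|lia].
Qed.

Lemma theta3_double : asummable (fun n : int => q ^ (2 * (n * n))).
Proof.
have q2 := nc_sqr_lt1 q1.
have [|s _] := @theta_diag (q ^+ 2); first by have := nc_sqr_lt1 q2; rewrite expr2.
apply: (asummable_le _ s) => n /=.
rewrite ncM exprN1z ncX ncN nc1 expr1n mul1r !exprz_ge0E ?mulzz_ge0 ?mul2zz_ge0 //.
by rewrite -exprM abszM.
Qed.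

(* The sum over all squares in [x = q^(1/2)] keeps only the even [n] after
   averaging over [x] and [-x]. *)
Lemma theta3_double_prod (x : C) : x ^+ 2 = q ->
  2 * usum (fun n : int => q ^ (2 * (n * n))) =
  qpoch_oo q q * (qpoch_oo x q * qpoch_oo x q + qpoch_oo (- x) q * qpoch_oo (- x) q).
Proof.
move=> xq; have x1 : nc (x * x) < 1 by rewrite -expr2 xq.
have Nx1 : nc (- x * - x) < 1 by rewrite mulrNN.
have [s1 e1] := theta_diag x1; have [s2 e2] := theta_diag Nx1.
rewrite sqrrN xq in e2; rewrite xq in e1.
have s3 : asummable (fun n : int => x ^ (n * n)).
  apply: (asummable_le _ s1) => n /=.
  by rewrite ncM exprN1z ncX ncN nc1 expr1n mul1r.
have e3 : (fun n : int => (-1) ^ n * (- x) ^ (n * n)) = (fun n : int => x ^ (n * n)).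
  apply/funext => n; rewrite exprN1z !exprz_ge0E ?mulzz_ge0 ?mul2zz_ge0 //.
  rewrite abszM (exprNn x) mulrA -exprD; move: (absz n) => m.
  by rewrite exprD signX_sqr -expr2 sqrr_sign mul1r.
rewrite e3 in e2.
have := usum_even_int s3; rewrite e1 e2 => h.
rewrite (_ : (fun n : int => q ^ (2 * (n * n))) = (fun k : int => x ^ (2 * k * (2 * k)))); last first.
  apply/funext => n; rewrite !exprz_ge0E ?mulzz_ge0 ?mul2zz_ge0 //.
  by rewrite -xq -exprM; congr (_ ^+ _); lia.
rewrite -h; move: (qpoch_oo _ _) (qpoch_oo _ _) (qpoch_oo _ _) => u v w; ring.
Qed.

End Theta.
End ThetaSums.

(** * Evaluation of the four series *)

Section Evaluations.
Variable R : realType.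
Local Notation C := (Cplx R).
Local Notation nc := (@normc R).
Variable q : C.
Hypothesis q1 : nc q < 1.

Let q2 : nc (q ^+ 2) < 1. Proof. exact: nc_sqr_lt1. Qed.
Let Nq1 : nc (- q) < 1. Proof. by rewrite ncN. Qed.

Lemma sum0E (f : nat -> C) : asummable f -> cvg_sum 0 f /\ sum_from 0 f = usum f.
Proof. exact: (@sum_fromE R 0 f). Qed.

Lemma F1_sum : cvg_sum 0 (F1n ^~ q) /\ F1 q = qpoch_oo q q.
Proof. by have [s <-] := euler_partial_theta q1; exact: sum0E s. Qed.

(** The q-binomial theorem with [a = z = -q] gives [(q^2;q)_oo/(-q;q)_oo]; the factor [1 - q] of the
    interpretation completes the numerator to [(q;q)_oo]. *)
Lemma F2_sum : cvg_sum 0 (F2n_reg ^~ q) /\ F2 q = 2^-1 * (qpoch_oo q q / qpoch_oo (- q) q).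
Proof.
have [s e] := qbinomial1 q1 (- q) Nq1.
have eF : (F2n_reg ^~ q) = (fun n => qpoch (- q) q n / qpoch q q n * (- q) ^+ n).
  by apply/funext => n; rewrite /F2n_reg -mulrA mulrC.
rewrite /F2 eF; have [h ->] := sum0E s; split=> //; rewrite e (qpoch_ooS q1 q).
rewrite (_ : - q * - q = q * q); last by ring.
by move: (qpoch_oo _ _) (qpoch_oo _ _)^-1 => u v; ring.
Qed.

(** The q-binomial theorem in base [q^2], with [a = z = q]. *)
Lemma F3_sum : cvg_sum 0 (F3n ^~ q) /\
  F3 q = qpoch_oo (q ^+ 2) (q ^+ 2) / qpoch_oo q (q ^+ 2).
Proof.
have [s e] := qbinomial1 q2 q q1.
have eF : (F3n ^~ q) = (fun n => qpoch q (q ^+ 2) n / qpoch (q ^+ 2) (q ^+ 2) n * q ^+ n).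
  by apply/funext => n; rewrite /F3n -mulrA mulrC.
rewrite /F3 eF; have [h ->] := sum0E s; by split.
Qed.

Let c n : C := qpoch (- q) q n / qpoch q q n.

Lemma geo_sum (x : C) : nc x < 1 -> asummable (fun k => x ^+ k.+1) /\ usum (fun k => x ^+ k.+1) = x / (1 - x).
Proof.
move=> x1; have s : asummable (fun k => x ^+ k.+1).
  have x01 : 0 <= nc x < 1 by rewrite nc_ge0.
  apply: (asummable_le _ (rsummable_geo (nc_ge0 x) x01)) => k.
  by rewrite ncX exprS.
split=> //; have e := usum_recl s.
have e2 : usum (fun k => x ^+ k.+2) = x * usum (fun k => x ^+ k.+1).
  by rewrite -(usumZ x s); apply: eq_usum => k; rewrite [LHS]exprS.
move: e; rewrite e2 expr1; move: (usum _) => S e; have n0 := one_sub_neq0 x1.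
by apply: (mulIf n0); rewrite divfK // mulrBr mulr1 {1}e; ring.
Qed.

(* Expanding [1 / (1 - q^(2n+1))] and summing over [n] first. *)
Lemma odd_lambert_qbinomial (ep : C) : nc ep <= 1 ->
  let f n := ep ^+ n * c n * (q ^+ (2 * n).+1 / (1 - q ^+ (2 * n).+1)) in
  let g k := q ^+ k.+1 * (qpoch_oo (- q * (ep * q ^+ (2 * k.+1))) q / qpoch_oo (ep * q ^+ (2 * k.+1)) q) in
  [/\ asummable f, asummable g & usum f = usum g].
Proof.
move=> e1 f g.
pose F (p : nat * nat) : C := ep ^+ p.1 * c p.1 * q ^+ ((2 * p.1).+1 * p.2.+1).
have r01 : 0 <= nc q < 1 by rewrite nc_ge0.
pose K := expR (nc (- q) / (1 - nc q)) * expR (nc q / (1 - nc q) / (1 - nc q)).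
have K0 : 0 <= K by rewrite mulr_ge0 ?expR_ge0.
have ep0 n : nc ep ^+ n <= 1 by rewrite exprn_ile1 ?nc_ge0.
have cK n : nc (c n) <= K by rewrite ncM ler_pM ?nc_ge0 ?qpoch_bound ?qpochV_bound.
have sF : asummable F.
  have s1 := rsummable_prod (fun n => mulr_ge0 K0 (exprn_ge0 n (nc_ge0 q)))
    (fun n => mulr_ge0 ler01 (exprn_ge0 n (nc_ge0 q))) (rsummable_geo K0 r01) (rsummable_geo ler01 r01).
  apply: (asummable_le _ s1) => -[n k] /=; rewrite /F /= mul1r (ncM (ep ^+ n * c n)) (ncM (ep ^+ n)) !ncX.
  rewrite -[K * _ * _]mulrA -exprD; apply: ler_pM; rewrite ?mulr_ge0 ?exprn_ge0 ?nc_ge0 //.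
    by rewrite -[leRHS]mul1r; apply: ler_pM; rewrite ?exprn_ge0 ?nc_ge0.
  by apply: ler_wiXn2l; rewrite ?nc_ge0 ?ltW //; nia.
have fE n : f n = usum (fun k => F (n, k)).
  have [s e] := geo_sum (nc_expr_lt1 (2 * n) q1).
  rewrite /f -e -usumZ //; apply: eq_usum => k; by rewrite /F /= exprM.
(* For fixed [k] the sum over [n] is the q-binomial series with [a = -q] at [ep q^(2(k+1))]. The
   sign [ep] will be -1 for [F4] and 1 for its ghost. *)
have gE k : g k = usum (fun n => F (n, k)).
  have z1 : nc (ep * q ^+ (2 * k.+1)) < 1.
    rewrite ncM (le_lt_trans (ler_piMl (nc_ge0 _) e1)) //.
    by rewrite (_ : (2 * k.+1 = (2 * k).+2)%N) ?nc_expr_lt1 //; lia.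
  have [s e] := qbinomial1 q1 (- q) z1.
  rewrite /g -e -usumZ //; apply: eq_usum => n; rewrite /F /c /= exprMn -exprM.
  rewrite (_ : ((2 * n).+1 * k.+1 = k.+1 + 2 * k.+1 * n)%N); last by lia.
  rewrite exprD; move: (qpoch (- q) q n) (qpoch q q n)^-1 => u v; ring.
pose sw (p : nat * nat) := (p.2, p.1).
have sw_inj : injective sw by move=> [? ?] [? ?] [-> ->].
have sF' : asummable (F \o sw) := asummable_inj sw_inj sF.
split.
- rewrite (_ : f = fun n => usum (fun k => F (n, k))); [exact: asummable_usum|exact/funext].
- rewrite (_ : g = fun k => usum (fun n => F (n, k))); [exact: (asummable_usum sF')|exact/funext].
- rewrite (eq_usum fE) (eq_usum gE); exact: (@usum_swap R nat nat (fun n k => F (n, k)) sF).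
Qed.

(** After the exchange of sums the terms are, up to the factor [Q/(2M)], those of index [2(k+1)] in
    the q-binomial series with parameter -1 at a square root [x] of [q]. The average of that series
    over [x] and [-x] is given by products, and [theta3_double_prod] recognises them. *)
Lemma F4_sum : cvg_sum 0 (F4n ^~ q) /\
  F4 q = 2^-1 * usum (fun n : int => (-1) ^ (n + 1) * q ^ (n * n))
         + 2^-1 * usum (fun n : int => q ^ (2 * (n * n))).
Proof.
have N1 : nc (-1 : C) <= 1 by rewrite ncN nc1.
have [sf sg e] := odd_lambert_qbinomial N1.
have eF : (F4n ^~ q) = (fun n => (-1) ^+ n * c n * (q ^+ (2 * n).+1 / (1 - q ^+ (2 * n).+1))).
  apply/funext => n; rewrite /F4n /c invfM.
  by move: (qpoch (- q) q n) (qpoch q q n)^-1 (1 - q ^+ (2 * n).+1)^-1 => u v w; ring.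
rewrite /F4 eF; have [h ->] := sum0E sf; split=> //; rewrite {}e.
pose x := sqrtc q : C; have xq : x ^+ 2 = q by exact: sqr_sqrtc.
have x1 : nc x < 1.
  by rewrite -(@expr_lt1 _ 2) ?nc_ge0 // -ncX xq.
have Nx1 : nc (- x) < 1 by rewrite ncN.
pose e m : C := qpoch (-1) q m / qpoch q q m * x ^+ m.
have [se ee] := qbinomial1 q1 (-1) x1.
have [_ ee'] := qbinomial1 q1 (-1) Nx1.
have ev := usum_even se; rewrite ee (_ : (fun n => (-1) ^+ n * _) =
   (fun n => qpoch (-1) q n / qpoch q q n * (- x) ^+ n)) in ev; last first.
  by apply/funext => n; rewrite (exprNn x) mulrCA.
rewrite ee' in ev.
have [se2 _ _] := usum_parity se.
rewrite (usum_recl se2) /= !qpoch0 expr0 divr1 mulr1 in ev.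
pose M := qpoch_oo (- q) q; pose Q := qpoch_oo q q.
have M0 : M != 0 by exact: qpoch_oo_Nq_neq0.
have Q0 : Q != 0 by exact: qpoch_oo_q_neq0.
have gE : (fun k => q ^+ k.+1 * (qpoch_oo (- q * (-1 * q ^+ (2 * k.+1))) q / qpoch_oo (-1 * q ^+ (2 * k.+1)) q)) =
   (fun k => Q / M * 2^-1 * (qpoch (-1) q k.+1.*2 / qpoch q q k.+1.*2 * x ^+ k.+1.*2)).
  apply/funext => k.
  have -> : x ^+ k.+1.*2 = q ^+ k.+1 by rewrite -mul2n exprM xq.
  have e1 := qpoch_oo_split q1 q k.+1.*2; have e2 := qpoch_oo_split q1 (- q) k.*2.+1.
  rewrite -mul2n (_ : k.*2.+1 = (2 * k).+1) -?mul2n // in e1 e2.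
  have e3 : qpoch (-1) q (2 * k.+1) = 2 * qpoch (- q) q (2 * k).+1.
    rewrite (_ : (2 * k.+1 = (2 * k).+2)%N); last lia.
    by rewrite qpochSl mulN1r opprK.
  rewrite -!mul2n e3.
  rewrite (_ : - q * (-1 * q ^+ (2 * k.+1)) = q * q ^+ (2 * k.+1)); last by ring.
  rewrite (_ : -1 * q ^+ (2 * k.+1) = - q * q ^+ (2 * k).+1); last first.
    by rewrite (_ : (2 * k.+1 = (2 * k).+2)%N) ?[q ^+ (2 * k).+2]exprS; [ring|lia].
  have n1 := qpoch_neq0 q1 (2 * k.+1) q1; have n2 := qpoch_neq0 q1 (2 * k).+1 Nq1.
  have n3 : qpoch_oo (- q * q ^+ (2 * k).+1) q != 0.
    by apply: qpoch_oo_neq0 => //; apply: nc_mulX_lt1.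
  rewrite /Q /M e1 e2.
  have alg (z u v w y : C) : u != 0 -> v != 0 -> y != 0 ->
      z * (w / y) = u * w / (v * y) / 2 * (2 * v / u * z).
    by move=> u0 v0 y0; field; rewrite u0 v0 y0.
  exact: alg.
have se2' := asummable_inj succn_inj se2.
rewrite gE (usumZ (Q / M * 2^-1) se2').
have [s4 e4] := theta4 q1; have e3 := theta3_double_prod q1 xq.
rewrite (_ : (fun n : int => (-1) ^ (n + 1) * q ^ (n * n)) = (fun n : int => - ((-1) ^ n * q ^ (n * n)))); last first.
  by apply/funext => n; rewrite exprzDr ?unitrN1 // expr1z; ring.
rewrite usumN // e4 -/M -/Q.
have p := qpoch_oo_sqr x q1; rewrite xq in p.
rewrite !mulN1r opprK in ev.
have X1 : qpoch_oo x q != 0 by exact: qpoch_oo_neq0.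
have X2 : qpoch_oo (- x) q != 0 by exact: qpoch_oo_neq0.
move: ev e3 p; rewrite qpoch_oo_odd // -/M -/Q.
move: (usum _) (usum _) (qpoch_oo x q) (qpoch_oo (- x) q) X1 X2 => V U X Y X1 X2 ev e3 p.
(* [U] lacks the term of index 0 of the even part, hence the -1; multiplied by [Q/(2M)] it becomes
   the alternating theta series. *)
have {}ev : U = 2^-1 * (Y / X + X / Y) - 1.
  apply: (mulfI (x := 2)); first by rewrite pnatr_eq0.
  by rewrite mulrBr mulrA mulfV ?pnatr_eq0 // mul1r ev; ring.
have {}e3 : V = 2^-1 * (Q * (X * X + Y * Y)) by rewrite -e3 mulrA mulVf ?pnatr_eq0 ?mul1r.
have eM : M = (X * Y)^-1 by rewrite p invrK.
by rewrite ev e3 eM; field; rewrite X1 X2.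
Qed.

End Evaluations.

(** * Ghosts as sums of tails *)

Section Ghosts.
Variable R : realType.
Local Notation C := (Cplx R).
Local Notation nc := (@normc R).

Section AbelSum.
Variables (D : nat -> C) (K s : R).
Hypotheses (K0 : 0 <= K) (s01 : 0 <= s < 1) (DK : forall n, nc (D n) <= K * s ^+ n).

(* Summation by parts: [c_n - c_oo] is minus the tail of [sum_k D_k]. *)
Lemma usum_tails : let c n := \sum_(0 <= k < n.+1) D k in
  [/\ asummable D, asummable (fun n => c n - usum D) &
      usum (fun n => c n - usum D) = - usum (fun m => m%:R * D m)].
Proof.
move=> c; have sD : asummable D := asummable_le DK (rsummable_geo K0 s01).
pose f (p : nat * nat) : C := if (p.1 < p.2)%N then D p.2 else 0.
(* Parametrises the pairs [n < m] on which [f] lives; with [m = n + k + 1] one has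
   [|D_m| <= K s^n s^k], a product of two summable families. *)
pose phi (p : nat * nat) := (p.1, (p.1 + p.2.+1)%N).
have phi_inj : injective phi by move=> [a b] [a' b'] [-> /addnI [->]].
have supp p : f p != 0 -> exists i, phi i = p.
  case: p => n m; rewrite /f /=; case: ifP => [nm _|]; last by rewrite eqxx.
  by exists (n, (m - n.+1)%N); rewrite /phi /=; congr (_, _); lia.
have /andP[s0 s1] := s01.
have sfphi : asummable (f \o phi).
  have h := rsummable_prod (fun n => mulr_ge0 K0 (exprn_ge0 n s0))
    (fun n => mulr_ge0 ler01 (exprn_ge0 n s0)) (rsummable_geo K0 s01) (rsummable_geo ler01 s01).
  apply: (asummable_le _ h) => -[n k]; rewrite /f /phi /= addnS ltnS leq_addr mul1r.
  rewrite (le_trans (DK _)) // -mulrA -exprD ler_wpM2l //.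
  by apply: ler_wiXn2l; rewrite // ltW.
have sf : asummable f by exact: (asummable_supp phi_inj supp sfphi).
have tail n : c n - usum D = - usum (fun m => f (n, m)).
  have {1}-> : usum D = c n + usum (fun m => f (n, m)); last by ring.
  have g0 m : m \notin [fset i in index_iota 0 n.+1]%fset ->
      (if (m <= n)%N then D m else 0) = 0.
    by rewrite fset_iotaE ltnS => /negbTE ->.
  have sg := asummable_fin g0.
  have e : D =1 (fun m => (if (m <= n)%N then D m else 0) + f (n, m)).
    by move=> m; rewrite /f /= leqNgt; case: ltnP; rewrite ?add0r ?addr0.
  rewrite (eq_usum e) usumD //; last exact: asummable_slice.
  congr (_ + _); rewrite (hsumE (hsum_fin g0)) sum_fset_seq ?iota_uniq //.
  by apply: eq_big_nat => m /andP[_]; rewrite ltnS => ->.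
have sf1 : asummable (fun n => usum (fun m => f (n, m))) by exact: asummable_usum.
have eT : (fun n => c n - usum D) = (fun n => - usum (fun m => f (n, m))) by exact/funext.
rewrite eT; split; [by []|exact: asummableN|rewrite usumN //; congr (- _)].
rewrite (@usum_swap R nat nat (fun n m => f (n, m))); last first.
  by rewrite (_ : (fun p : nat * nat => _) = f) //; apply/funext => -[].
apply: eq_usum => m; have f0 n : n \notin [fset i in index_iota 0 m]%fset -> f (n, m) = 0.
  by rewrite fset_iotaE /f /= => /negbTE ->.
rewrite (hsumE (hsum_fin f0)) sum_fset_seq ?iota_uniq //.
rewrite (eq_big_nat _ _ (F2 := fun=> D m)); last by move=> n; rewrite /f /= => ->.
by rewrite sumr_const_nat subn0 mulr_natl.
Qed.

End AbelSum.

Section Base.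
Variable q : C.
Hypothesis q1 : nc q < 1.

(** A radius strictly between [|q|] and 1, positive even for [q = 0]: the q-binomial series with
    [al = q] then converges at [z = 1]. *)
Let s : R := (1 + nc q) / 2.
Let s0 : 0 < s. Proof. by rewrite /s; have := nc_ge0 q; lra. Qed.
Let s01 : is_true (0 <= s < 1). Proof. by rewrite ltW //= /s; move: q1; lra. Qed.
Let qs : nc q <= s. Proof. by rewrite /s; move: q1; lra. Qed.

(** The increments of [c] are the coefficients [qbc q q a]. Hence [coo] is [qbs] at 1, and by
    [usum_tails] the sum of the [c n - coo] is minus [qbs'] at 1, that is [- coo] times a
    logarithmic derivative. *)
Theorem qratio_ghost a : nc a < 1 ->
  let c n := qpoch a q n / qpoch q q n in let coo := qpoch_oo a q / qpoch_oo q q in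
  let g j := q * q ^+ j / (1 - q * q ^+ j) - a * q ^+ j / (1 - a * q ^+ j) in
  [/\ c @ \oo --> coo, asummable (fun n => c n - coo), asummable g &
      usum (fun n => c n - coo) = - coo * usum g].
Proof.
move=> a1 c coo g; have z1 : s * nc (1 : C) < 1 by rewrite nc1 mulr1; case/andP: s01.
have a1' : nc (a * 1) < 1 by rewrite mulr1.
have ec := qbinomial q1 a s0 qs z1.
have [sg eg] := qbinomial_logderiv q1 s0 qs z1 a1'.
have [K [K0 hK]] := qbc_bound q1 a s0 qs.
have eD n : qbc q q a n.+1 = c n * q ^+ n * (q - a) / (1 - q ^+ n.+1).
  elim: n => [|n IH].
    rewrite /qbc big_nat1 /c !qpoch0 divr1 !expr0 !mulr1 mul1r //.
  have n1 : 1 - q ^+ n.+1 != 0 by exact/one_sub_neq0/nc_expr_lt1.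
  have n2 : 1 - q ^+ n.+2 != 0 by exact/one_sub_neq0/nc_expr_lt1.
  have n3 := qpoch_neq0 q1 n q1.
  apply: (mulIf n2); rewrite qbcS // IH /c !qpochS.
  move: n1 n2 n3; rewrite !exprS; move: (q ^+ n) (qpoch a q n) (qpoch q q n) => x y z n1 n2 n3.
  by field; rewrite n1 n2 n3.
have cE n : c n = \sum_(0 <= k < n.+1) qbc q q a k.
  elim: n => [|n IH]; first by rewrite big_nat1 qbc0 /c !qpoch0 divr1.
  rewrite big_nat_recr //= -IH eD /c !qpochS.
  have n1 : 1 - q ^+ n.+1 != 0 by exact/one_sub_neq0/nc_expr_lt1.
  have n3 := qpoch_neq0 q1 n q1.
  move: n1 n3; rewrite !exprS; move: (q ^+ n) (qpoch a q n) (qpoch q q n) => x y z n1 n3.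
  by field; rewrite n1 n3.
have [sD sT eT] := usum_tails K0 s01 hK.
have eq1 : (fun k => qbc q q a k * 1 ^+ k) = qbc q q a.
  by apply/funext => k; rewrite expr1n mulr1.
have eS : usum (qbc q q a) = coo.
  by move: ec; rewrite /qbs !mulr1 eq1.
have egj : (fun j => q * 1 * q ^+ j / (1 - q * 1 * q ^+ j) - a * 1 * q ^+ j / (1 - a * 1 * q ^+ j)) = g.
  by apply/funext => j; rewrite !mulr1.
have cT : (fun n => \sum_(0 <= k < n.+1) qbc q q a k - usum (qbc q q a)) = (fun n => c n - coo).
  by apply/funext => n; rewrite -cE eS.
rewrite cT in sT eT; split=> //.
- exact: (cseqM (qpoch_cvg q1 (x := a)) (cseqV (qpoch_oo_q_neq0 q1) (qpoch_cvg q1 (x := q)))).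
- by move: sg; rewrite egj.
- rewrite eT mulNr; congr (- _); move: eg; rewrite egj /qbs eq1 eS => <-.
  by rewrite /qbs'; apply: eq_usum => k; rewrite expr1n mulr1.
Qed.

End Base.

Section Evaluation.
Variable q : C.
Hypothesis q1 : nc q < 1.

Let q2 : nc (q ^+ 2) < 1. Proof. exact: nc_sqr_lt1. Qed.
Let Nq1 : nc (- q) < 1. Proof. by rewrite ncN. Qed.
Let qn0 n : 1 - q ^+ n.+1 != 0. Proof. exact/one_sub_neq0/nc_expr_lt1. Qed.

(** The case [a = 0], where only the Lambert series of the denominator remains. *)
Lemma ghost1 :
  [/\ cvg_sum 0 (fun n => 1 / qpoch q q n - 1 / qpoch_oo q q),
      cvg_sum 1 (fun n => q ^+ n / (1 - q ^+ n)) &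
      sum_from 0 (fun n => 1 / qpoch q q n - 1 / qpoch_oo q q) =
      - (1 / qpoch_oo q q) * sum_from 1 (fun n => q ^+ n / (1 - q ^+ n))].
Proof.
have n0 : nc (0 : C) < 1 by rewrite nc0.
have [_ s1 s2 e] := qratio_ghost q1 n0.
have p0 n : qpoch 0 q n = 1 by rewrite /qpoch big1 // => i _; rewrite mul0r subr0.
have e1 : (fun n => qpoch 0 q n / qpoch q q n - qpoch_oo 0 q / qpoch_oo q q) =
   (fun n => 1 / qpoch q q n - 1 / qpoch_oo q q).
  by apply/funext => n; rewrite p0 qpoch_oo0.
have e2 : (fun j => q * q ^+ j / (1 - q * q ^+ j) - 0 * q ^+ j / (1 - 0 * q ^+ j)) =
   (fun n => q ^+ (1 + n) / (1 - q ^+ (1 + n))).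
  by apply/funext => j; rewrite !mul0r subr0 add1n exprS.
rewrite e1 e2 qpoch_oo0 // in s1 e; rewrite e2 in s2.
have [c1 ->] := sum0E s1; have [c2 ->] := @sum_fromE R 1 (fun n => q ^+ n / (1 - q ^+ n)) s2.
by split.
Qed.

(** The case [a = -q]: with [x = q^(n+1)] the two Lambert terms add up to
    [x/(1-x) + x/(1+x) = 2x/(1-x^2)]. *)
Lemma ghost2_usum :
  [/\ asummable (fun n => qpoch (- q) q n / qpoch q q n - qpoch_oo (- q) q / qpoch_oo q q),
      asummable (fun n => q ^+ n.+1 / (1 - q ^+ (2 * n.+1))) &
      usum (fun n => qpoch (- q) q n / qpoch q q n - qpoch_oo (- q) q / qpoch_oo q q) =
      - 2 * (qpoch_oo (- q) q / qpoch_oo q q) * usum (fun n => q ^+ n.+1 / (1 - q ^+ (2 * n.+1)))].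
Proof.
have [_ s1 s2 e] := qratio_ghost q1 Nq1.
have e2 : (fun j => q * q ^+ j / (1 - q * q ^+ j) - - q * q ^+ j / (1 - - q * q ^+ j)) =
   (fun n => 2 * (q ^+ n.+1 / (1 - q ^+ (2 * n.+1)))).
  apply/funext => j; rewrite mulNr -!exprS opprK mulNr opprK mulnC exprM.
  have n1 := qn0 j; have n2 : 1 + q ^+ j.+1 != 0.
    by rewrite -[q ^+ _]opprK; apply: one_sub_neq0; rewrite ncN nc_expr_lt1.
  move: (q ^+ j.+1) n1 n2 => x n1 n2; have n3 : 1 - x ^+ 2 != 0.
    by rewrite (_ : 1 - x ^+ 2 = (1 - x) * (1 + x)) ?mulf_neq0 //; ring.
  by field; rewrite n1 n2 n3.
rewrite e2 in s2 e.
have s3 : asummable (fun n => q ^+ n.+1 / (1 - q ^+ (2 * n.+1))).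
  have := asummableZ (2^-1) s2; rewrite (_ : (fun i => _) = (fun n => q ^+ n.+1 / (1 - q ^+ (2 * n.+1)))) //.
  by apply/funext => n; rewrite mulrA mulVf ?mul1r ?pnatr_eq0.
split=> //; rewrite e (usumZ 2 s3); move: (_ / _) (usum _) => u v; ring.
Qed.

Lemma ghost2 :
  [/\ cvg_sum 0 (fun n => qpoch (- q) q n / qpoch q q n - qpoch_oo (- q) q / qpoch_oo q q),
      cvg_sum 1 (fun n => q ^+ n / (1 - q ^+ (2 * n))) &
      sum_from 0 (fun n => qpoch (- q) q n / qpoch q q n - qpoch_oo (- q) q / qpoch_oo q q) =
      - 2 * (qpoch_oo (- q) q / qpoch_oo q q) * sum_from 1 (fun n => q ^+ n / (1 - q ^+ (2 * n)))].
Proof.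
have [s1 s2 e] := ghost2_usum.
have [c1 ->] := sum0E s1; have [c2 ->] := @sum_fromE R 1 (fun n => q ^+ n / (1 - q ^+ (2 * n))) s2.
split; [exact: c1|exact: c2|exact: e].
Qed.

(** Base [q^2] with [a = q]: the two Lambert series run over the even and the odd exponents and
    interleave into one alternating series. *)
Lemma ghost3 :
  [/\ cvg_sum 0 (fun n => qpoch q (q ^+ 2) n / qpoch (q ^+ 2) (q ^+ 2) n
                 - qpoch_oo q (q ^+ 2) / qpoch_oo (q ^+ 2) (q ^+ 2)),
      cvg_sum 1 (fun n => (-1) ^+ n.-1 * q ^+ n / (1 - q ^+ n)) &
      sum_from 0 (fun n => qpoch q (q ^+ 2) n / qpoch (q ^+ 2) (q ^+ 2) n
                 - qpoch_oo q (q ^+ 2) / qpoch_oo (q ^+ 2) (q ^+ 2)) =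
      qpoch_oo q (q ^+ 2) / qpoch_oo (q ^+ 2) (q ^+ 2)
      * sum_from 1 (fun n => (-1) ^+ n.-1 * q ^+ n / (1 - q ^+ n))].
Proof.
have [_ s1 s2 e] := qratio_ghost q2 q1.
pose u n : C := (-1) ^+ n * q ^+ n.+1 / (1 - q ^+ n.+1).
have su : asummable u.
  have h := lambert_summable q1 q1; apply: (asummable_le _ h) => n /=.
  by rewrite /u -mulrA ncM ncX ncN nc1 expr1n mul1r exprS.
have [su1 su2 eu] := usum_parity su.
have e2 : (fun j => q ^+ 2 * (q ^+ 2) ^+ j / (1 - q ^+ 2 * (q ^+ 2) ^+ j) -
     q * (q ^+ 2) ^+ j / (1 - q * (q ^+ 2) ^+ j)) = (fun j => - (u j.*2 + u j.*2.+1)).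
  apply/funext => j; rewrite /u -exprM mul2n -exprS -exprD (_ : 2 + j.*2 = j.*2.+2)%N; last by lia.
  rewrite -[(-1) ^+ j.*2]signr_odd -[(-1) ^+ j.*2.+1]signr_odd /= odd_double /= expr0 expr1 mul1r mulN1r.
  move: (_ / _) (q ^+ _.+1) => x y; by rewrite opprD mulNr opprK addrC.
rewrite e2 (usumN (asummableD su1 su2)) (usumD su1 su2) -eu mulrNN in e.
have [c1 ->] := sum0E s1.
have [c2 ->] := @sum_fromE R 1 (fun n => (-1) ^+ n.-1 * q ^+ n / (1 - q ^+ n)) su.
split; [exact: c1|exact: c2|exact: e].
Qed.

(** Since [1/(1-z) = 1 + z/(1-z)], the terms are those of the second ghost plus those of the double
    series with sign [ep = 1], and the latter sums to [M/Q] times [h]. *)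
Lemma ghost4 :
  [/\ cvg_sum 0 (fun n => qpoch (- q) q n / (qpoch q q n * (1 - q ^+ (2 * n).+1))
                 - qpoch_oo (- q) q / qpoch_oo q q),
      cvg_sum 0 (h_term ^~ q) &
      - sum_from 0 (fun n => qpoch (- q) q n / (qpoch q q n * (1 - q ^+ (2 * n).+1))
                 - qpoch_oo (- q) q / qpoch_oo q q) =
      qpoch_oo (- q) q / qpoch_oo q q
      * (2 * sum_from 1 (fun n => q ^+ n / (1 - q ^+ (2 * n))) - h_fun q)].
Proof.
have [s1 s2 e] := ghost2_usum; have n1 : nc (1 : C) <= 1 by rewrite nc1.
have [sf sg efg] := odd_lambert_qbinomial q1 n1.
pose M := qpoch_oo (- q) q; pose Q := qpoch_oo q q.
have M0 : M != 0 by exact: qpoch_oo_Nq_neq0.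
have Q0 : Q != 0 by exact: qpoch_oo_q_neq0.
have ef : (fun n => qpoch (- q) q n / (qpoch q q n * (1 - q ^+ (2 * n).+1)) - M / Q) =
  (fun n => (qpoch (- q) q n / qpoch q q n - M / Q) +
            1 ^+ n * (qpoch (- q) q n / qpoch q q n) * (q ^+ (2 * n).+1 / (1 - q ^+ (2 * n).+1))).
  apply/funext => n; have n2 := qn0 (2 * n); have n3 := qpoch_neq0 q1 n q1.
  rewrite expr1n mul1r.
  have alg (x y z w : C) : y != 0 -> 1 - z != 0 -> x / (y * (1 - z)) - w = (x / y - w) + x / y * (z / (1 - z)).
    by move=> y0 z0; field; rewrite y0 z0.
  exact: alg.
have eg : (fun k => q ^+ k.+1 * (qpoch_oo (- q * (1 * q ^+ (2 * k.+1))) q / qpoch_oo (1 * q ^+ (2 * k.+1)) q)) =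
  (fun k => M / Q * h_term k q).
  apply/funext => k; rewrite /h_term.
  have e1 := qpoch_oo_split q1 (- q) (2 * k.+1); have e2 := qpoch_oo_split q1 q (2 * k).+1.
  rewrite mul1r (_ : q ^+ (2 * k.+1) = q * q ^+ (2 * k).+1); last first.
    by rewrite -exprS; congr (_ ^+ _); lia.
  rewrite (_ : - q * (q * q ^+ (2 * k).+1) = - q * q ^+ (2 * k.+1)); last first.
    by rewrite -exprS; congr (_ * _ ^+ _); lia.
  rewrite (_ : (2 * k).+2 = (2 * k.+1)%N); last by lia.
  have m1 := qpoch_neq0 q1 (2 * k).+1 q1; have m2 := qpoch_neq0 q1 (2 * k.+1) Nq1.
  have m3 : qpoch_oo (q * q ^+ (2 * k).+1) q != 0.
    by apply: qpoch_oo_neq0 => //; apply: nc_mulX_lt1.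
  rewrite /M /Q e1 e2.
  have alg (z u v w y : C) : u != 0 -> v != 0 -> y != 0 -> z * (w / y) = v * w / (u * y) * (z * u / v).
    by move=> u0 v0 y0; field; rewrite u0 v0 y0.
  exact: alg.
rewrite eg in sg efg.
have sh : asummable (h_term ^~ q).
  have := asummableZ ((M / Q)^-1) sg; rewrite (_ : (fun i => _) = (h_term ^~ q)) //.
  by apply/funext => n; rewrite mulrA mulVf ?mul1r // mulf_neq0 ?invr_eq0.
rewrite (usumZ _ sh) in efg.
have sF := asummableD s1 sf; rewrite -ef in sF.
have [c1 ->] := sum0E sF; have [c2 eh] := sum0E sh.
have [c3 ->] := @sum_fromE R 1 (fun n => q ^+ n / (1 - q ^+ (2 * n))) s2.
split; [exact: c1|exact: c2|].
rewrite /h_fun eh ef (usumD s1 sf) efg e -/M -/Q.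
have alg (u v w : C) : - (- 2 * u * v + u * w) = u * (2 * v - w) by ring.
exact: alg.
Qed.

End Evaluation.
End Ghosts.

(** * Inversion of [q] and the limit terms *)

Section LimitTerms.
Variable R : realType.
Local Notation C := (Cplx R).
Local Notation nc := (@normc R).

Lemma sum_fromN (m : nat) (u : nat -> C) : cvg_sum m u ->
  cvg_sum m (fun n => - u n) /\ sum_from m (fun n => - u n) = - sum_from m u.
Proof.
move=> h; have {}h : (fun N => \sum_(m <= n < N) u n) @ \oo --> sum_from m u by exact: h.
have h2 : (fun N => \sum_(m <= n < N) - u n) @ \oo --> - sum_from m u.
  rewrite (_ : (fun N => _) = (fun N => - \sum_(m <= n < N) u n)); first exact: (cvgN h).
  by apply/funext => N; rewrite sumrN.
by split; [apply: cvgP h2|apply: (cvg_lim _ h2)].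
Qed.

Section Inversion.
Variable q : C.
Hypotheses (q0 : q != 0) (q1 : nc q < 1).

(** A factor [- q^(-j-1)] comes out of each factor of the product; in the inverted terms of the
    series these signs and powers cancel against the numerators. *)
Lemma qpoch_inv n : qpoch q^-1 q^-1 n = (-1) ^+ n * qpoch q q n / q ^+ 'C(n.+1, 2).
Proof.
elim: n => [|n IH]; first by rewrite !qpoch0 bin2 muln0 !expr0 !mulr1 divr1.
rewrite !qpochS IH (bin2D n.+1) exprD exprVn !exprS.
have x0 : q ^+ n != 0 by rewrite expf_neq0.
have y0 : q ^+ 'C(n.+1, 2) != 0 by rewrite expf_neq0.
move: ((-1) ^+ n) (qpoch q q n) (q ^+ n) (q ^+ 'C(n.+1, 2)) x0 y0 => u v x y x0 y0.
by field; rewrite q0 x0 y0.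
Qed.

Lemma qpochN_inv n : qpoch (- q^-1) q^-1 n = qpoch (- q) q n / q ^+ 'C(n.+1, 2).
Proof.
elim: n => [|n IH]; first by rewrite !qpoch0 bin2 muln0 !expr0 divr1.
rewrite !qpochS IH (bin2D n.+1) exprD exprVn !exprS.
have x0 : q ^+ n != 0 by rewrite expf_neq0.
have y0 : q ^+ 'C(n.+1, 2) != 0 by rewrite expf_neq0.
move: (qpoch (- q) q n) (q ^+ n) (q ^+ 'C(n.+1, 2)) x0 y0 => v x y x0 y0.
by field; rewrite q0 x0 y0.
Qed.

Lemma qpoch_odd_inv n :
  qpoch q^-1 (q^-1 ^+ 2) n = (-1) ^+ n * qpoch q (q ^+ 2) n / q ^+ (n * n).
Proof.
elim: n => [|n IH]; first by rewrite !qpoch0 !expr0 !mulr1 divr1.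
rewrite !qpochS IH -!exprM (_ : n.+1 * n.+1 = (n * n + 2 * n).+1)%N; last by lia.
rewrite exprVn (exprS (-1) n) (exprS q (n * n + 2 * n)) (exprD q (n * n) (2 * n)).
have x0 : q ^+ (2 * n) != 0 by rewrite expf_neq0.
have y0 : q ^+ (n * n) != 0 by rewrite expf_neq0.
move: ((-1) ^+ n) (qpoch q (q ^+ 2) n) (q ^+ (2 * n)) (q ^+ (n * n)) x0 y0 => u v x y x0 y0.
by field; rewrite q0 x0 y0.
Qed.

Let sgn0 n : (-1 : C) ^+ n != 0. Proof. by rewrite signr_eq0. Qed.
Let T0 n : q ^+ n != 0. Proof. by rewrite expf_neq0. Qed.

Lemma F1n_inv n : F1n n q^-1 = 1 / qpoch q q n.
Proof.
rewrite /F1n qpoch_inv (_ : (n * n.+1)./2 = 'C(n.+1, 2)); last by rewrite bin2 mulnC.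
rewrite exprVn; have := sgn0 n; have := T0 'C(n.+1, 2); have := qpoch_neq0 q1 n q1.
move: ((-1) ^+ n) (qpoch q q n) (q ^+ _) => u v x v0 x0 u0.
by field; rewrite u0 v0 x0.
Qed.

Lemma F2n_inv n : F2n n q^-1 = qpoch (- q) q n / qpoch q q n.
Proof.
rewrite /F2n qpoch_inv qpochN_inv.
have := sgn0 n; have := T0 'C(n.+1, 2); have := qpoch_neq0 q1 n q1.
move: ((-1) ^+ n) (qpoch q q n) (qpoch (- q) q n) (q ^+ _) => u v w x v0 x0 u0.
by field; rewrite u0 v0 x0.
Qed.

(** The sign comes from [x^-1/(1 - x^-1) = - 1/(1 - x)] with [x = q^(2n+1)]. *)
Lemma F4n_inv n :
  F4n n q^-1 = - (qpoch (- q) q n / (qpoch q q n * (1 - q ^+ (2 * n).+1))).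
Proof.
rewrite /F4n qpoch_inv qpochN_inv exprVn.
have := sgn0 n; have := T0 'C(n.+1, 2); have := T0 (2 * n).+1; have := qpoch_neq0 q1 n q1.
have := one_sub_neq0 (nc_expr_lt1 (2 * n) q1).
move: ((-1) ^+ n) (qpoch q q n) (qpoch (- q) q n) (q ^+ 'C(_, 2)) (q ^+ _) => u v w x y y1 v0 y0 x0 u0.
have y1' : y - 1 != 0 by rewrite -opprB oppr_eq0.
by field; rewrite u0 v0 x0 y0 y1 y1'.
Qed.

End Inversion.

Lemma F3n_inv (q : C) n : q != 0 -> nc q < 1 ->
  F3n n q^-1 = qpoch q (q ^+ 2) n / qpoch (q ^+ 2) (q ^+ 2) n.
Proof.
move=> q0 q1; have q20 : q ^+ 2 != 0 by rewrite expf_neq0.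
have q2 := nc_sqr_lt1 q1; have h := qpoch_inv q20 n.
rewrite /F3n qpoch_odd_inv // -!(exprVn q 2) in h *; rewrite h exprVn -exprM bin2S_dbl exprD.
have := signr_eq0 C n; have x0 : q ^+ (n * n) != 0 by rewrite expf_neq0.
have y0 : q ^+ n != 0 by rewrite expf_neq0.
have := qpoch_neq0 q2 n q2.
move: ((-1) ^+ n) (qpoch _ _ _) (qpoch _ _ _) (q ^+ (n * n)) (q ^+ n) x0 y0 => u v w x y x0 y0 w0 /negbT u0.
by field; rewrite u0 w0 x0 y0.
Qed.

Lemma limit_termE (H : nat -> C -> C) (q l : C) (v : nat -> C) :
  (forall n, H n q^-1 = v n) -> v @ \oo --> l -> cvg_sum 0 (fun n => v n - l) ->
  [/\ cvgn (fun n => H n q^-1), cvg_sum 0 (fun n => H n q^-1 - limit_term H q) &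
      ghost H (fun=> 0) q = sum_from 0 (fun n => v n - l)].
Proof.
move=> /funext e c s; rewrite /ghost /limit_term subr0.
have el : limn (fun n => H n q^-1) = l by rewrite e; apply: (cvg_lim _ c).
rewrite el (_ : (fun n => H n q^-1 - l) = (fun n => v n - l)); last first.
  by apply/funext => n; rewrite -[H n _]/((fun n => H n q^-1) n) e.
by split; [rewrite e; exact: c|exact: s|].
Qed.

Theorem limit_terms (q : C) : q != 0 -> nc q < 1 ->
  [/\ [/\ cvgn (fun n => F1n n q^-1),
          cvg_sum 0 (fun n => F1n n q^-1 - limit_term F1n q) &
          ghost F1n (fun=> 0) q =
          sum_from 0 (fun n => 1 / qpoch q q n - 1 / qpoch_oo q q)],
      [/\ cvgn (fun n => F2n n q^-1),
          cvg_sum 0 (fun n => F2n n q^-1 - limit_term F2n q) &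
          ghost F2n (fun=> 0) q =
          sum_from 0 (fun n => qpoch (- q) q n / qpoch q q n
                               - qpoch_oo (- q) q / qpoch_oo q q)],
      [/\ cvgn (fun n => F3n n q^-1),
          cvg_sum 0 (fun n => F3n n q^-1 - limit_term F3n q) &
          ghost F3n (fun=> 0) q =
          sum_from 0 (fun n =>
            qpoch q (q ^+ 2) n / qpoch (q ^+ 2) (q ^+ 2) n
            - qpoch_oo q (q ^+ 2) / qpoch_oo (q ^+ 2) (q ^+ 2))] &
      [/\ cvgn (fun n => F4n n q^-1),
          cvg_sum 0 (fun n => F4n n q^-1 - limit_term F4n q) &
          ghost F4n (fun=> 0) q =
          - sum_from 0 (fun n =>
              qpoch (- q) q n / (qpoch q q n * (1 - q ^+ (2 * n).+1))
              - qpoch_oo (- q) q / qpoch_oo q q)]].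
Proof.
move=> q0 q1; have q2 := nc_sqr_lt1 q1.
have cQ := cseqV (qpoch_oo_q_neq0 q1) (qpoch_cvg q1 (x := q)).
have cM := qpoch_cvg q1 (x := - q).
split.
- apply: (@limit_termE F1n q _ (fun n => 1 / qpoch q q n)) => [n||]; first exact: F1n_inv.
    exact: (cseqZ 1 cQ).
  have [s _ _] := ghost1 q1; exact: s.
- apply: (@limit_termE F2n q _ (fun n => qpoch (- q) q n / qpoch q q n)) => [n||]; first exact: F2n_inv.
    exact: (cseqM cM cQ).
  have [s _ _] := ghost2 q1; exact: s.
- apply: (@limit_termE F3n q _ (fun n => qpoch q (q ^+ 2) n / qpoch (q ^+ 2) (q ^+ 2) n)) => [n||].
  + exact: F3n_inv.
  + exact: (cseqM (qpoch_cvg q2 (x := q)) (cseqV (qpoch_oo_q_neq0 q2) (qpoch_cvg q2 (x := q ^+ 2)))).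
  + have [s _ _] := ghost3 q1; exact: s.
have [s4 _ _] := ghost4 q1.
have [s4' <-] := sum_fromN s4.
rewrite (_ : (fun n => - (_ - _)) = (fun n =>
  - (qpoch (- q) q n / (qpoch q q n * (1 - q ^+ (2 * n).+1))) - (- (qpoch_oo (- q) q / qpoch_oo q q)))) in s4' *; last first.
  by apply/funext => n; rewrite opprB opprK addrC.
apply: (@limit_termE F4n q _ (fun n => - (qpoch (- q) q n / (qpoch q q n * (1 - q ^+ (2 * n).+1))))).
- by move=> n; exact: F4n_inv.
- have q2n : (fun n => q ^+ (2 * n).+1) @ \oo --> (0 : C).
    have l2 n : (n <= (2 * n).+1)%N by lia.
    exact: (cseq_sub l2 (cvg_expr0 q1)).
  have c3 := cseqB (cseq_cst (l := 1)) q2n; rewrite subr0 in c3.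
  have n0 : qpoch_oo q q * 1 != 0 by rewrite mulr1 qpoch_oo_q_neq0.
  have c4 := cseqM cM (cseqV n0 (cseqM (qpoch_cvg q1 (x := q)) c3)).
  by rewrite mulr1 in c4; exact: (cvgN c4).
- exact: s4'.
Qed.

End LimitTerms.

(** * A conjugate Bailey sequence and its averaged alternating sums *)

Section HeckeSum.
Variable R : realType.
Local Notation C := (Cplx R).
Local Notation nc := (@normc R).

Variable q : C.
Hypotheses (q0 : q != 0) (q1 : nc q < 1).

Let Nq1 : nc (- q) < 1. Proof. by rewrite ncN. Qed.
Let q2 : nc (q ^+ 2) < 1. Proof. exact: nc_sqr_lt1. Qed.
Let Q n : C := qpoch q q n.
Let Q2 n : C := qpoch (q ^+ 2) (q ^+ 2) n.
Let Q0 n : Q n != 0. Proof. exact: qpoch_neq0. Qed.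
Let QS n : Q n.+1 = Q n * (1 - q ^+ n.+1).
Proof. by rewrite /Q qpochS exprS. Qed.
Let Q2S n : Q2 n.+1 = Q2 n * (1 - q ^+ n.+1) * (1 + q ^+ n.+1).
Proof.
rewrite /Q2 qpochS (_ : q ^+ 2 * (q ^+ 2) ^+ n = (q ^+ n.+1) ^+ 2); last by rewrite -exprS -!exprM mulnC.
rewrite -mulrA; congr (_ * _); move: (q ^+ n.+1) => x; ring.
Qed.
Let qn0 n : 1 - q ^+ n.+1 != 0. Proof. exact/one_sub_neq0/nc_expr_lt1. Qed.

(* The conjugate Bailey sequence and its telescoping partner [V]. *)
Definition cbailey n r : C := if (r <= n)%N then qpoch (q ^+ 2) (q ^+ 2) n / (qpoch q q (n - r) * qpoch q q (n + r).+1) else 0.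
Let v := cbailey.
Let vE n r : v n r = if (r <= n)%N then Q2 n / (Q (n - r) * Q (n + r).+1) else 0.
Proof. by []. Qed.
Let V n r : C := if (r < n)%N then Q2 n / (Q (n - r).-1 * Q (n + r).+1) else 0.
Let V0 n : C := Q2 n / (Q n * Q n).

Let K : R := expR (nc (q ^+ 2) / (1 - nc (q ^+ 2))) *
  (expR (nc q / (1 - nc q) / (1 - nc q)) * expR (nc q / (1 - nc q) / (1 - nc q))).
Let K0 : 0 <= K. Proof. by rewrite !mulr_ge0 ?expR_ge0. Qed.
Let bound n k l : nc (Q2 n / (Q k * Q l)) <= K.
Proof.
rewrite ncM invfM ncM /K ler_pM ?nc_ge0 ?mulr_ge0 ?nc_ge0 //; first exact: qpoch_bound.
by rewrite ler_pM ?nc_ge0 //; exact: qpochV_bound.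
Qed.

(** The sum of two neighbours in [r] is a sum of two neighbours in [n] of another sequence, so its
    alternating sum over [n] telescopes. On the diagonal [r = n] both [v n r.+1] and [V n r] are
    0. *)
Let vV n r : v n r + v n r.+1 = V n r + V n.+1 r.
Proof.
have [rn|rn|->] := ltngtP r n.
- have [d en] : exists d, n = (r + d).+1 by exists (n - r).-1; lia.
  pose M := (r + d + r).+1.
  have -> : v n r = Q2 n / (Q d.+1 * Q M.+1).
    by rewrite !vE ifT; [congr (_ / (Q _ * Q _)); rewrite /M|]; lia.
  have -> : v n r.+1 = Q2 n / (Q d * Q M.+2).
    by rewrite !vE ifT; [congr (_ / (Q _ * Q _)); rewrite /M|]; lia.
  have -> : V n r = Q2 n / (Q d * Q M.+1).
    by rewrite /V ifT; [congr (_ / (Q _ * Q _)); rewrite /M|]; lia.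
  have -> : V n.+1 r = Q2 n.+1 / (Q d.+1 * Q M.+2).
    by rewrite /V ifT; [congr (_ / (Q _ * Q _)); rewrite /M|]; lia.
  rewrite (QS d) (QS M.+1) Q2S.
  have n1 := Q0 d; have n2 := Q0 M.+1; have n3 := qn0 d; have n4 := qn0 M.+1.
  rewrite (_ : q ^+ M.+2 = q ^+ d.+1 * q ^+ r.+1 * q ^+ r.+1) in n4 *; last first.
    by rewrite -!exprD; congr (_ ^+ _); rewrite /M; lia.
  have -> : q ^+ n.+1 = q ^+ d.+1 * q ^+ r.+1 by rewrite -exprD; congr (_ ^+ _); lia.
  move: (q ^+ d.+1) (q ^+ r.+1) (Q d) (Q M.+1) (Q2 n) n1 n2 n3 n4 => x y a b c n1 n2 n3 n4.
  by field; rewrite n1 n2 n3 n4.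
- by rewrite !vE /V !ifF ?addr0 //; lia.
- rewrite !vE /V ltnS leqnn !ltnn subSnn subnn /= addr0 add0r addSn (QS (n + n).+1) Q2S.
  have n2 := Q0 (n + n).+1; have n3 := qn0 (n + n).+1; have n4 := Q0 0.
  have e : q ^+ (n + n).+2 = q ^+ n.+1 * q ^+ n.+1 by rewrite -exprD; congr (_ ^+ _); lia.
  rewrite e in n3 *.
  move: (q ^+ n.+1) (Q 0) (Q _) (Q2 _) n2 n3 n4 => x a b c n2 n3 n4.
  by field; rewrite n2 n3 n4.
Qed.

(** Starts the induction on [r]: for [r = 0] the alternating sum telescopes by itself, from
    [V0 0 = 1]. *)
Let vV0 n : 2 * v n 0 = V0 n + V0 n.+1.
Proof.
rewrite !vE /V0 leq0n subn0 addn0 QS Q2S; have n1 := Q0 n; have n2 := qn0 n.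
move: (q ^+ n.+1) (Q n) (Q2 n) n1 n2 => x a c n1 n2.
by field; rewrite n1 n2.
Qed.

(** The sum of the partial sums of lengths [N] and [N + 1] of the alternating series. The sequence
    has a nonzero limit in [n], so a single partial sum does not converge. *)
Definition altsum_cbailey N r : C :=
  2 * \sum_(0 <= n < N) (-1) ^+ n * cbailey n r + (-1) ^+ N * cbailey N r.
Let P := altsum_cbailey.

Let altsum (u : nat -> C) N :
  \sum_(0 <= n < N) (-1) ^+ n * (u n + u n.+1) = u 0%N - (-1) ^+ N * u N.
Proof.
elim: N => [|N IH]; first by rewrite big_nil expr0 mul1r subrr.
by rewrite big_nat_recr //= IH exprS; ring.
Qed.

Let PS N r : P N r.+1 = - P N r + (-1) ^+ N * (v N r + v N r.+1 - 2 * V N r).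
Proof.
have h : \sum_(0 <= n < N) (-1) ^+ n * v n r + \sum_(0 <= n < N) (-1) ^+ n * v n r.+1 =
    - ((-1) ^+ N * V N r).
  rewrite -big_split /= (eq_bigr (fun n => (-1) ^+ n * (V n r + V n.+1 r))) => [|n _]; last first.
    by rewrite -mulrDr vV.
  by rewrite (altsum (V ^~ r)) {1}/V ltn0 sub0r.
rewrite /P /altsum_cbailey -/v; move: (\sum_(0 <= n < N) _) (\sum_(0 <= n < N) _) h => A B.
move: (v N r) (v N r.+1) (V N r) ((-1) ^+ N) => x y z w h.
have {}h : A = - B - w * z by rewrite -h; ring.
by rewrite h; ring.
Qed.

Let P0 N : P N 0 = 1 + (-1) ^+ N * (v N 0 - V0 N).
Proof.
have h : 2 * \sum_(0 <= n < N) (-1) ^+ n * v n 0 = 1 - (-1) ^+ N * V0 N.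
  rewrite mulr_sumr (eq_bigr (fun n => (-1) ^+ n * (V0 n + V0 n.+1))) => [|n _]; last first.
    by rewrite -vV0 mulrCA.
  by rewrite (altsum V0) {1}/V0 /Q /Q2 !qpoch0 mulr1 divr1.
by rewrite /P /altsum_cbailey -/v h; move: (v N 0) (V0 N) => x y; ring.
Qed.

Let rho := nc q.
Let r0 : 0 <= rho. Proof. exact: nc_ge0. Qed.
Let r1 : 0 < 1 - rho. Proof. by rewrite subr_gt0. Qed.

(** The three quantities have a common limit in [N]; once the symbols are reduced to the same
    indices, what remains carries a power of [q] of exponent at least [N - r]. *)
Let eps_bound N r : (r <= N)%N -> nc (v N r + v N r.+1 - 2 * V N r) <= 2 * K * rho ^+ (N - r).
Proof.
rewrite leq_eqVlt => /orP[/eqP ->|rN].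
  rewrite !vE /V leqnn ltnn subnn expr0 mulr1 addr0 mulr0 subr0.
  by apply: le_trans (bound _ _ _) _; rewrite ler_peMl // ler1n.
have [d eN] : exists d, N = (r + d).+1 by exists (N - r).-1; lia.
pose M := (r + d + r).+1.
have -> : v N r = Q2 N / (Q d.+1 * Q M.+1).
  by rewrite !vE ifT; [congr (_ / (Q _ * Q _)); rewrite /M|]; lia.
have -> : v N r.+1 = Q2 N / (Q d * Q M.+2).
  by rewrite !vE ifT; [congr (_ / (Q _ * Q _)); rewrite /M|]; lia.
have -> : V N r = Q2 N / (Q d * Q M.+1).
  by rewrite /V ifT; [congr (_ / (Q _ * Q _)); rewrite /M|]; lia.
have -> : (N - r)%N = d.+1 by lia.
have e : Q2 N / (Q d.+1 * Q M.+1) + Q2 N / (Q d * Q M.+2) - 2 * (Q2 N / (Q d * Q M.+1)) =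
    q ^+ d.+1 * (Q2 N / (Q d.+1 * Q M.+1)) + q ^+ M.+2 * (Q2 N / (Q d * Q M.+2)).
  rewrite (QS d) (QS M.+1).
  have n1 := Q0 d; have n2 := Q0 M.+1; have n3 := qn0 d; have n4 := qn0 M.+1.
  move: (q ^+ d.+1) (q ^+ M.+2) (Q d) (Q M.+1) (Q2 N) n1 n2 n3 n4 => x y a b c n1 n2 n3 n4.
  by field; rewrite n1 n2 n3 n4.
rewrite e (le_trans (ncD _ _)) // (ncM (q ^+ d.+1)) (ncM (q ^+ M.+2)) !ncX -/rho.
have h1 := bound N d.+1 M.+1; have h2 := bound N d M.+2.
have h3 : 0 <= rho ^+ d.+1 by rewrite exprn_ge0.
have h4 : rho ^+ M.+2 <= rho ^+ d.+1.
  by apply: ler_wiXn2l; [exact: r0|exact: ltW|rewrite /M; lia].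
have h5 : 0 <= rho ^+ M.+2 by rewrite exprn_ge0.
have h6 : rho ^+ d.+1 * nc (Q2 N / (Q d.+1 * Q M.+1)) <= rho ^+ d.+1 * K by rewrite ler_wpM2l.
have h7 : rho ^+ M.+2 * nc (Q2 N / (Q d * Q M.+2)) <= rho ^+ d.+1 * K.
  by rewrite ler_pM ?nc_ge0.
by rewrite (_ : 2 * K * rho ^+ d.+1 = rho ^+ d.+1 * K + rho ^+ d.+1 * K) ?lerD //; ring.
Qed.

(** Chosen so that the induction on [r] in [P_dist] closes:
    [(K' + 2 K) rho = K' (2 - rho) rho <= K']. *)
Let K' := 2 * K / (1 - rho).
Let K'0 : 0 <= K'. Proof. by rewrite divr_ge0 ?mulr_ge0 // ltW. Qed.

Let P_dist N r : (r <= N)%N -> nc (P N r - (-1) ^+ r) <= K' * rho ^+ (N - r).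
Proof.
elim: r => [_|r IH rN].
  rewrite P0 subn0 expr0 addrC addKr ncM ncX ncN nc1 expr1n mul1r.
  have -> : v N 0 - V0 N = q ^+ N.+1 * (Q2 N / (Q N * Q N.+1)).
    rewrite !vE /V0 leq0n subn0 addn0 QS; have n1 := Q0 N; have n2 := qn0 N.
    move: (q ^+ N.+1) (Q N) (Q2 N) n1 n2 => x a c n1 n2.
    by field; rewrite n1 n2.
  rewrite ncM ncX -/rho exprS mulrC mulrA ler_wpM2r ?exprn_ge0 //.
  have h1 := bound N N N.+1; have h2 := nc_ge0 (Q2 N / (Q N * Q N.+1)).
  apply: (@le_trans _ _ K).
    by apply: le_trans h1; rewrite ler_piMr // ltW.
  rewrite /K' ler_pdivlMr // ; have := K0; have := r0; nra.
rewrite PS (_ : - P N r + _ - (-1) ^+ r.+1 = - (P N r - (-1) ^+ r) +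
  (-1) ^+ N * (v N r + v N r.+1 - 2 * V N r)); last by rewrite exprS; ring.
rewrite (le_trans (ncD _ _)) // ncN ncM ncX ncN nc1 expr1n mul1r.
have h1 := IH (ltnW rN); have h2 := eps_bound (ltnW rN).
have eN : (N - r = (N - r.+1).+1)%N by lia.
rewrite eN exprS in h1 h2; move: (rho ^+ (N - r.+1)) (exprn_ge0 (N - r.+1) r0) h1 h2 => y y0 h1 h2.
apply: (@le_trans _ _ ((K' + 2 * K) * (rho * y))); first by rewrite [leRHS]mulrDl lerD.
rewrite [leLHS]mulrA ler_wpM2r // /K'.
rewrite (_ : (2 * K / (1 - rho) + 2 * K) * rho = 2 * K / (1 - rho) * ((2 - rho) * rho)); last first.
  by field; rewrite gt_eqF.
rewrite ler_piMr ?K'0 //; move: r0 r1; nra.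
Qed.

Lemma altsum_cbailey_cvg r : (fun N => altsum_cbailey N r) @ \oo --> ((-1) ^+ r : C).
Proof.
rewrite -(cvg_shiftn r); apply: (cvg_nc0 (b := fun N => K' * rho ^+ N)).
  by move=> N; rewrite /mk_sequence /=; have := P_dist (leq_addl N r); rewrite addnK.
rewrite -[X in _ --> X](mulr0 K'); apply: cvgMr; apply: cvg_expr.
by rewrite ger0_norm.
Qed.

Lemma altsum_cbailey_large N r : (N < r)%N -> altsum_cbailey N r = 0.
Proof.
move=> Nr; rewrite /altsum_cbailey -/v (vE N r) ifF; last by lia.
rewrite mulr0 addr0 big_nat big1 ?mulr0 // => n /andP[_ nN].
by rewrite !vE ifF ?mulr0 //; lia.
Qed.

Lemma altsum_cbailey_bound : exists B, forall N r, nc (altsum_cbailey N r) <= B.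
Proof.
exists (K' + 1) => N r; have [rN|Nr] := leqP r N; last first.
  by rewrite altsum_cbailey_large // nc0; have := K'0; lra.
rewrite -/(P N r) -[P N r](subrK ((-1) ^+ r)) (le_trans (ncD _ _)) // [X in _ + X]ncX ncN nc1 expr1n lerD2r.
apply: le_trans (P_dist rN) _; rewrite ler_piMr //.
by rewrite exprn_ile1 // ltW.
Qed.

End HeckeSum.

(** In [q^(r^2) t^(-j^2)] with [q = t^2] and [j <= r] the exponent [2 r^2 - j^2] of [t] stays at
    least [r]; the summability of the partial theta sums rests on this. *)
Lemma sqr_split j r : (j <= r)%N ->
  (2 * (r * r) = (2 * (r * r) - j * j) + j * j)%N /\ (r <= 2 * (r * r) - j * j)%N.
Proof. by move=> jr; split; nia. Qed.

(** * A Bailey transform with finite theta sums *)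

Section ThetaBailey.
Variable R : realType.
Local Notation C := (Cplx R).
Local Notation nc := (@normc R).

Variable q : C.
Hypotheses (q0 : q != 0) (q1 : nc q < 1).

Let Nq1 : nc (- q) < 1. Proof. by rewrite ncN. Qed.
Let q2 : nc (q ^+ 2) < 1. Proof. exact: nc_sqr_lt1. Qed.
Let Q n : C := qpoch q q n.
Let Q2 n : C := qpoch (q ^+ 2) (q ^+ 2) n.
Let Q0 n : Q n != 0. Proof. exact: qpoch_neq0. Qed.
Let QS n : Q n.+1 = Q n * (1 - q ^+ n.+1).
Proof. by rewrite /Q qpochS exprS. Qed.
Let qn0 n : 1 - q ^+ n.+1 != 0. Proof. exact/one_sub_neq0/nc_expr_lt1. Qed.
Let v := cbailey q.
Let vE n r : v n r = if (r <= n)%N then Q2 n / (Q (n - r) * Q (n + r).+1) else 0.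
Proof. by []. Qed.

(** At the even index [2(n+1)] this is the coefficient of [q^(n+1)] in [h], so that [h] is the even
    part of [Rs] at a square root of [q]. *)
Definition cR m : C := if m is m'.+1 then qpoch q q m' / qpoch (- q) q m else 0.

Let cR_bound : exists K, 0 <= K /\ forall m, nc (cR m) <= K.
Proof.
exists (expR (nc q / (1 - nc q)) * expR (nc (- q) / (1 - nc (- q)) / (1 - nc q))).
split=> [|[|m]]; rewrite ?mulr_ge0 ?expR_ge0 //= ?nc0 ?mulr_ge0 ?expR_ge0 //.
by rewrite ncM ler_pM ?nc_ge0 ?qpoch_bound ?qpochV_bound.
Qed.

Arguments cR : simpl never.

Let cR0 : cR 0 = 0. Proof. by []. Qed.

Lemma cR_summable x : nc x < 1 -> asummable (fun m => cR m * x ^+ m).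
Proof.
move=> x1; have [K [K0 hK]] := cR_bound; have x01 : 0 <= nc x < 1 by rewrite nc_ge0.
apply: (asummable_le _ (rsummable_geo K0 x01)) => m.
by rewrite ncM ncX ler_wpM2r ?exprn_ge0 ?nc_ge0.
Qed.

Definition Rs x : C := usum (fun m => cR m * x ^+ m).

Let cR_rec m : cR m.+2 * (1 + q ^+ m.+2) = (1 - q ^+ m.+1) * cR m.+1.
Proof.
rewrite /cR (qpochS (- q) q m.+1) -/(Q m.+1) QS -/(Q m).
have n1 := qpoch_neq0 q1 m.+1 Nq1.
have n2 : 1 + q ^+ m.+2 != 0.
  by rewrite -[q ^+ _]opprK; apply: one_sub_neq0; rewrite ncN nc_expr_lt1.
rewrite mulNr opprK -exprS.
move: (q ^+ m.+2) (q ^+ m.+1) (Q m) (qpoch (- q) q m.+1) n1 n2 => x y a b n1 n2.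
by field; rewrite n1 n2.
Qed.

(** The recursion [cR_rec] summed against [x^(m+2)]; index 1 contributes the isolated [x], because
    [cR 1] is [1/(1 + q)]. *)
Let Rs_rec x : nc x < 1 -> (1 - x) * Rs x = x - (1 + x) * Rs (x * q).
Proof.
move=> x1; have xq1 : nc (x * q) < 1 by have := nc_mulX_lt1 q1 1 x1; rewrite expr1.
have s1 := cR_summable x1; have s2 := cR_summable xq1.
have e : Rs x + Rs (x * q) = x + x * (Rs x - Rs (x * q)).
  rewrite /Rs -(usumB s1 s2) -(usumZ x (asummableB s1 s2)) -(usumD s1 s2).
  have sD := asummableD s1 s2; have sZ := asummableZ x (asummableB s1 s2).
  rewrite (usum_recl sD) (usum_recl sZ) /= !cR0 !mul0r subrr mulr0 addr0 !add0r.
  have sD1 := asummable_inj succn_inj sD; rewrite (usum_recl sD1) /=.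
  congr (_ + _).
    rewrite /cR qpoch0 !qpochS qpoch0 !expr1 expr0 mulr1 mul1r opprK.
    have n2 : 1 + q != 0 by rewrite -[q]opprK; apply: one_sub_neq0; rewrite ncN.
    by field.
  apply: eq_usum => m; rewrite !exprMn; have := cR_rec m; rewrite !exprS => h.
  move: (x ^+ m) (q ^+ m) (cR m.+1) (cR m.+2) h => a b c d h.
  have -> : d * (x * (x * a)) + d * (x * (x * a) * (q * (q * b))) = x * x * a * (d * (1 + q * (q * b))).
    by ring.
  by rewrite h; ring.
move: (Rs x) (Rs (x * q)) e => a b e; apply/eqP; rewrite -subr_eq0.
have -> : (1 - x) * a - (x - (1 + x) * b) = (a + b) - (x + x * (a - b)) by ring.
by rewrite e subrr.
Qed.

Section Sqrt.
Variable t : C.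
Hypothesis tq : t ^+ 2 = q.

Let t0 : t != 0. Proof. by apply: contra_neq q0 => t0; rewrite -tq t0 expr0n. Qed.
Let t1 : nc t < 1.
Proof. by rewrite -(@expr_lt1 _ 2) ?nc_ge0 // -ncX tq. Qed.
Let Nt1 : nc (- t) < 1. Proof. by rewrite ncN. Qed.

(** The product of the quotients [(1 + t q^j)/(1 - t q^j)] that appear when [Rs_rec] is iterated
    from [t]. *)
Let w n : C := qpoch (- t) q n / qpoch t q n.

(** The finite theta sum of [t^(-j^2)] over [|j| <= r]. *)
Definition theta_inv r : C := 1 + 2 * \sum_(0 <= j < r) t^-1 ^+ (j.+1 * j.+1).

Let B n r : C := if (r <= n)%N then q ^+ (r * r) / (Q (n - r) * Q (n + r)) else 0.

(** Differences in [r] turn the symmetric denominators of the finite triple product into those of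
    [cbailey]. Summation by parts in [abel_theta] therefore trades theta terms for finite theta
    sums. *)
Let B_diff n r : B n r - B n r.+1 = (1 - q ^+ (2 * r).+1) * q ^+ (r * r) *
   (if (r <= n)%N then (Q (n - r) * Q (n + r).+1)^-1 else 0).
Proof.
have [rn|rn|->] := ltngtP r n.
- have [d en] : exists d, n = (r + d).+1 by exists (n - r).-1; lia.
  pose M := (r + d + r).+1.
  have -> : B n r = q ^+ (r * r) / (Q d.+1 * Q M).
    by rewrite /B ifT; [congr (_ / (Q _ * Q _)); rewrite /M|]; lia.
  have -> : B n r.+1 = q ^+ (r.+1 * r.+1) / (Q d * Q M.+1).
    by rewrite /B ifT; [congr (_ / (Q _ * Q _)); rewrite /M|]; lia.
  have -> : Q (n - r) * Q (n + r).+1 = Q d.+1 * Q M.+1 by congr (Q _ * Q _); rewrite /M; lia.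
  rewrite (QS d) (QS M) (_ : r.+1 * r.+1 = r * r + (2 * r).+1)%N; last by lia.
  have n1 := Q0 d; have n2 := Q0 M; have n3 := qn0 d; have n4 := qn0 M.
  rewrite (_ : q ^+ M.+1 = q ^+ d.+1 * q ^+ (2 * r).+1) in n4 *; last first.
    by rewrite -!exprD; congr (_ ^+ _); rewrite /M; lia.
  rewrite exprD; move: (q ^+ d.+1) (q ^+ (2 * r).+1) (Q d) (Q M) (q ^+ (r * r)) n1 n2 n3 n4 => x y a b c n1 n2 n3 n4.
  by field; rewrite n1 n2 n3 n4.
- by rewrite /B !ifF ?subrr ?mulr0 //; lia.
- rewrite /B leqnn ltnn subnn subr0 QS addnn -mul2n.
  have n1 := Q0 0; have n2 := Q0 (2 * n); have n3 := qn0 (2 * n).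
  move: (q ^+ (2 * n).+1) (q ^+ (n * n)) (Q 0) (Q _) n1 n2 n3 => x y a b n1 n2 n3.
  by field; rewrite n1 n2 n3.
Qed.

Let abel_theta n m : \sum_(0 <= r < m) theta_inv r * (B n r - B n r.+1) =
  B n 0 + 2 * \sum_(0 <= r < m) t^-1 ^+ (r.+1 * r.+1) * B n r.+1 - theta_inv m * B n m.
Proof.
elim: m => [|m IH]; first by rewrite !big_nil /theta_inv big_nil; ring.
rewrite !big_nat_recr //= IH /theta_inv big_nat_recr //=.
by move: (\sum_(0 <= _ < m) _) (\sum_(0 <= _ < m) _) (_ ^+ _) (B _ _) (B _ _) (B _ _) => *; ring.
Qed.

(** The finite triple product with [a = b = -t] and [M = N = n]: the indices [n + k] and [n - k]
    give equal terms, and [t^(k^2)] is written [t^(-k^2) q^(k^2)]. *)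
Let w_sym n : qpoch (- t) q n * qpoch (- t) q n =
  Q (2 * n) * (B n 0 + 2 * \sum_(0 <= r < n) t^-1 ^+ (r.+1 * r.+1) * B n r.+1).
Proof.
have ep : - t * - t = q by rewrite mulrNN -expr2.
have p1 : nc (- t * - t) < 1 by rewrite ep.
have := finite_triple p1 n n; rewrite ep => ->.
pose G k : C := gauss (- t) (- t) (n + n) k * jt (- t) (- t) (Posz k - Posz n).
have eG k : (k <= n)%N -> G (n + k)%N = Q (2 * n) * (t^-1 ^+ (k * k) * B n k) /\
                          G (n - k)%N = Q (2 * n) * (t^-1 ^+ (k * k) * B n k).
  move=> kn; have et : t^-1 ^+ (k * k) * q ^+ (k * k) = t ^+ (k * k).
    rewrite -tq -exprMn; congr (_ ^+ _); rewrite expr2 mulrA mulVf ?mul1r //.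
  have ej (z : int) : absz z = k -> jt (- t) (- t) z = t ^+ (k * k).
    move=> zk; rewrite jt_diag exprN1z exprz_ge0E ?mulzz_ge0 // abszM zk.
    by rewrite (exprNn t) mulrA signX_sqr -expr2 sqrr_sign mul1r.
  rewrite /G !ej /gauss ?ep; try lia.
  rewrite !ifT; try lia.
  rewrite /B kn (mulrA (t^-1 ^+ _)) et mul2n -addnn.
  rewrite (_ : n + n - (n + k) = n - k)%N; last lia.
  rewrite (_ : n + n - (n - k) = n + k)%N; last lia.
  rewrite -/(Q (n + n)) -/(Q (n + k)) -/(Q (n - k)) [Q (n + k) * _]mulrC.
  by move: (Q (n + n)) (_^-1) (t ^+ _) => a b c; split; ring.
rewrite -/(\sum_(0 <= k < (n + n).+1) G k).
have l1 : (n <= (n + n).+1)%N by lia.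
have e3 : G n = Q (2 * n) * B n 0.
  by have := (eG 0%N (leq0n _)).1; rewrite addn0 muln0 expr0 mul1r.
have e1 : \sum_(0 <= k < n) G k = Q (2 * n) * \sum_(0 <= r < n) t^-1 ^+ (r.+1 * r.+1) * B n r.+1.
  rewrite big_nat_rev /= add0n mulr_sumr; apply: eq_big_nat => k /andP[_ kn].
  by rewrite (eG _ kn).2.
have e2 : \sum_(n <= k < (n + n).+1) G k =
    G n + Q (2 * n) * \sum_(0 <= r < n) t^-1 ^+ (r.+1 * r.+1) * B n r.+1.
  rewrite big_ltn ?ltnS ?leq_addr //; congr (_ + _).
  rewrite (big_addn 0 _ n.+1) (_ : (n + n).+1 - n.+1 = n)%N; last by lia.
  rewrite mulr_sumr; apply: eq_big_nat => k /andP[_ kn].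
  by rewrite -(eG _ kn).1 addnC addSnnS.
rewrite (big_cat_nat (leq0n n) l1) /= e1 e2 e3.
by move: (\sum_(0 <= _ < n) _) => S; ring.
Qed.

Let q_split n : Q (2 * n) = qpoch q (q ^+ 2) n * Q2 n.
Proof.
elim: n => [|n IH]; first by rewrite /Q /Q2 !qpoch0 mulr1.
rewrite (_ : 2 * n.+1 = (2 * n).+2)%N; last by lia.
rewrite !QS IH /Q2 !qpochS -!exprM -!exprS.
by rewrite -exprD (_ : 2 + 2 * n = (2 * n).+2)%N //; move: (qpoch _ _ _) (qpoch _ _ _) => x y; ring.
Qed.

Let t_split n : qpoch q (q ^+ 2) n = qpoch t q n * qpoch (- t) q n.
Proof.
elim: n => [|n IH]; first by rewrite !qpoch0 mulr1.
rewrite !qpochS IH -exprM mulnC exprM.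
by move: (qpoch t q n) (qpoch (- t) q n) (q ^+ n) => x y z; rewrite -tq; ring.
Qed.

(* [w_n] is the Bailey transform of the partial theta sums [theta_inv]. *)
Let w_bailey n m : (n < m)%N ->
  w n = \sum_(0 <= r < m) (1 - q ^+ (2 * r).+1) * q ^+ (r * r) * theta_inv r * v n r.
Proof.
move=> nm.
have T0 : qpoch t q n != 0 by exact: qpoch_neq0.
have N0 : qpoch (- t) q n != 0 by exact: qpoch_neq0.
have e := w_sym n.
have eW : w n = Q2 n * (B n 0 + 2 * \sum_(0 <= r < n) t^-1 ^+ (r.+1 * r.+1) * B n r.+1).
  move: e; rewrite q_split t_split; move: (B n 0 + _) => S; rewrite /w.
  move: (qpoch t q n) (qpoch (- t) q n) (Q2 n) T0 N0 => x y z x0 y0 h.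
  have -> : z * S = (x * y * z * S) / (x * y) by field; rewrite x0 y0.
  by rewrite -h; field; rewrite x0 y0.
have Bl r : (n < r)%N -> B n r = 0 by move=> h; rewrite /B ifF //; lia.
have := abel_theta n m; rewrite [B n m]Bl // mulr0 subr0.
rewrite (_ : \sum_(0 <= r < m) t^-1 ^+ (r.+1 * r.+1) * B n r.+1 =
             \sum_(0 <= r < n) t^-1 ^+ (r.+1 * r.+1) * B n r.+1); last first.
  rewrite (big_cat_nat (leq0n n) (ltnW nm)) /=.
  rewrite [X in _ + X]big_nat [X in _ + X]big1 ?addr0 // => r /andP[nr _].
  by rewrite Bl ?mulr0.
move=> h; rewrite eW -h mulr_sumr; apply: eq_bigr => r _; rewrite B_diff vE.
case: ifP => _; rewrite ?mulr0 //.
by move: (_^-1) => x; ring.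
Qed.

Let alpha r : C := (1 - q ^+ (2 * r).+1) * q ^+ (r * r) * theta_inv r.

(** By [sqr_split], [q^(r^2) theta_inv r] consists of [2r + 1] terms of modulus at most [|t|^r]. *)
Lemma theta_inv_summable : asummable (fun r => (1 - q ^+ (2 * r).+1) * q ^+ (r * r) * theta_inv r).
Proof.
rewrite -/alpha.
have tau0 := nc_ge0 t; have tau0' : 0 < nc t by rewrite nc_gt0.
have t01 : 0 <= nc t < 1 by rewrite tau0.
have [L [y [L0 y01 hL]]] := polygeo t01.
apply: (asummable_le (b := fun r => (4 * L) * y ^+ r)); last first.
  by apply: rsummable_geo => //; rewrite mulr_ge0.
move=> r; rewrite /alpha -mulrA ncM.
have h1 : nc (1 - q ^+ (2 * r).+1) <= 2.
  rewrite (le_trans (ncB _ _)) // nc1 ncX (_ : 2 = 1 + 1 :> R) // lerD2l.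
  by rewrite exprn_ile1 ?nc_ge0 // ltW.
have h2 : nc (q ^+ (r * r) * theta_inv r) <= (2 * r).+1%:R * nc t ^+ r.
  have e j : (j <= r)%N -> nc (q ^+ (r * r)) * nc t^-1 ^+ (j * j) <= nc t ^+ r.
    move=> jr; rewrite -tq -exprM ncX ncV.
    have [l1 l2] := sqr_split jr.
    rewrite l1 exprD exprVn mulfK ?expf_neq0 ?gt_eqF //.
    by apply: ler_wiXn2l; rewrite ?ltW.
  rewrite /theta_inv mulrDr mulr1 (le_trans (ncD _ _)) // [leLHS]addrC -(natr1 (2 * r)) [leRHS]mulrDl mul1r.
  apply: lerD; last by have := e 0%N (leq0n _); rewrite muln0 expr0 mulr1.
  rewrite mulrCA ncM nc_nat natrM -mulrA ler_wpM2l // ncM.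
  rewrite (le_trans (ler_wpM2l (nc_ge0 _) (nc_sum _ _ _))) // mulr_sumr.
  rewrite mulr_natl -[X in _ *+ X]subn0 -sumr_const_nat; apply: ler_sum_nat => j /andP[_ jr].
  by rewrite [X in _ * X]ncX e.
have h3 := hL r; have h4 := exprn_ge0 r tau0.
apply: (@le_trans _ _ (2 * ((2 * r).+1%:R * nc t ^+ r))); first by rewrite ler_pM ?nc_ge0.
apply: (@le_trans _ _ (4 * (r.+1%:R ^+ 2 * nc t ^+ r))); last by rewrite -mulrA ler_wpM2l.
rewrite mulrA [leRHS]mulrA ler_wpM2r // -!natrM -natrX -natrM ler_nat.
by clear; nia.
Qed.

Let alpha_summable : asummable alpha := theta_inv_summable.

(** Inserting [w_bailey] and exchanging finite sums turns each column into [altsum_cbailey], which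
    is bounded and tends to [(-1)^r]; a multiple of [|alpha|] is the majorant. *)
Let altsum_w_cvg :
  (fun N => 2 * \sum_(0 <= n < N) (-1) ^+ n * w n + (-1) ^+ N * w N) @ \oo -->
  usum (fun r => (-1) ^+ r * alpha r).
Proof.
have [K hK] := altsum_cbailey_bound q0 q1.
have K0 : 0 <= K := le_trans (nc_ge0 _) (hK 0%N 0%N).
have [|||_ h] := @tannery R nat (fun N r => altsum_cbailey q N r * alpha r)
  (fun r => (-1) ^+ r * alpha r) (fun r => K * nc (alpha r)).
- exact: rsummableZ.
- by move=> N r; rewrite ncM ler_wpM2r ?nc_ge0.
- by move=> r; apply: cseqM (cseq_cst (l := _)); exact: (altsum_cbailey_cvg q0 q1).
apply: cseq_ext h => N.
have f0 r : r \notin [fset i in index_iota 0 N.+1]%fset -> altsum_cbailey q N r * alpha r = 0.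
  by rewrite fset_iotaE ltnS -ltnNge => Nr; rewrite (altsum_cbailey_large q0 q1) // mul0r.
have eS : \sum_(0 <= n < N) (-1) ^+ n * w n =
    \sum_(0 <= r < N.+1) alpha r * \sum_(0 <= n < N) (-1) ^+ n * v n r.
  rewrite (eq_big_nat _ _ (F2 := fun n => \sum_(0 <= r < N.+1) (-1) ^+ n * (alpha r * v n r))).
    rewrite exchange_big /=; apply: eq_bigr => r _.
    by rewrite mulr_sumr; apply: eq_bigr => n _; rewrite mulrCA.
  by move=> n /andP[_ nN]; rewrite (w_bailey (leqW nN)) mulr_sumr.
rewrite (hsumE (hsum_fin f0)) sum_fset_seq ?iota_uniq //.
rewrite (w_bailey (ltnSn N)) eS mulr_sumr mulr_sumr -big_split /=.
apply: eq_bigr => r _; rewrite /altsum_cbailey -/v -/(alpha r).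
by move: (\sum_(0 <= _ < N) _) (v N r) (alpha r) => x y z; ring.
Qed.

(** For [mu N = 1 - 2 Rs (t q^N)] the functional equation reads [mu N = 2 - (w (N+1)/w N) mu (N+1)].
    Iterated, it gives [mu 0 = 2 S_N + (-1)^N w N mu N], with [S_N] the alternating sum of the
    [w n]. As [mu N] tends to 1 and [w] is bounded, this has the limit found in [altsum_w_cvg]. *)
Lemma Rs_hecke : 1 - 2 * Rs t =
  usum (fun r => (-1) ^+ r * ((1 - q ^+ (2 * r).+1) * q ^+ (r * r) * theta_inv r)).
Proof.
have et : t * q ^+ 0 = t by rewrite expr0 mulr1.
pose mu N := 1 - 2 * Rs (t * q ^+ N).
have mu_rec N : mu N = 2 - (1 + t * q ^+ N) / (1 - t * q ^+ N) * mu N.+1.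
  have tN : nc (t * q ^+ N) < 1 by exact: nc_mulX_lt1.
  have := Rs_rec tN; have n1 := one_sub_neq0 tN.
  rewrite /mu exprSr (mulrA t); move: (t * q ^+ N) n1 => x n1.
  move: (Rs x) (Rs (x * q)) => a b h; apply: (mulfI n1).
  rewrite mulrBr mulr1 mulrCA h.
  by field.
have e N : mu 0%N = 2 * \sum_(0 <= n < N) (-1) ^+ n * w n + (-1) ^+ N * w N * mu N.
  elim: N => [|N IH].
    by rewrite big_nil /w !qpoch0 divr1 expr0; ring.
  have eS (F : nat -> C) : \sum_(0 <= n < N.+1) F n = \sum_(0 <= n < N) F n + F N.
    by rewrite big_nat_recr.
  have ew : w N.+1 = (1 + t * q ^+ N) / (1 - t * q ^+ N) * w N.
    by rewrite /w !qpochS mulNr opprK invfM mulrACA mulrC.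
  rewrite IH (mu_rec N) eS ew (exprS (-1) N).
  move: (\sum_(0 <= n < N) _) (mu N.+1) ((1 + t * q ^+ N) / _) (w N) ((-1) ^+ N) => S m x a c.
  by ring.
have c1 := altsum_w_cvg.
have mu1 : mu @ \oo --> (1 : C).
  have := cvg_pser0 q1 (cR_summable t1) => h.
  by have := cseqB (cseq_cst (l := 1)) (cseqZ 2 h); rewrite /= mulr0 subr0.
have cw := cseqM (qpoch_cvg q1 (x := - t)) (cseqV (qpoch_oo_neq0 q1 t1) (qpoch_cvg q1 (x := t))).
have [Kw [Kw0 hKw]] := cvg_bounded cw.
have z0 : (fun N => (-1) ^+ N * w N * (mu N - 1)) @ \oo --> (0 : C).
  apply: (cvg_nc0 (b := fun N => Kw * nc (mu N - 1))) => [N|].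
    rewrite subr0 (ncM _ (mu N - 1)) (ncM _ (w N)) ncX ncN nc1 expr1n mul1r.
    exact: ler_wpM2r (nc_ge0 _) _ _ (hKw N).
  have h := cvg_ncr (cseqB mu1 (cseq_cst (l := 1))); rewrite subrr nc0 in h.
  by rewrite -[X in _ --> X](mulr0 Kw); apply: cvgMr; exact: h.
have := cseqD c1 z0; rewrite addr0 => c2.
have c3 : (fun N => mu 0%N) @ \oo --> usum (fun r => (-1) ^+ r * alpha r).
  by apply: cseq_ext c2 => N; rewrite (e N); ring.
have em : mu 0%N = 1 - 2 * Rs t := congr1 (fun y => 1 - 2 * Rs y) et.
rewrite -em; exact: cseq_unique (cseq_cst (l := mu 0%N)) c3.
Qed.

End Sqrt.
End ThetaBailey.

Lemma usum_eq0 (R : realType) (I : choiceType) (f : I -> Cplx R) :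
  (forall i, f i = 0) -> usum f = 0.
Proof. by move=> f0; rewrite (eq_usum f0) usum0. Qed.

(** * The series [h] as a sum over a cone *)

Section HeckeSum.
Variable R : realType.
Local Notation C := (Cplx R).
Local Notation nc := (@normc R).

Variable q : C.
Hypotheses (q1 : nc q < 1).

Let g x k : C := (-1) ^+ x * q ^+ (x * x - 2 * (k * k)).

(** The sector [|2y| <= x] without its apex and the ray [2y = -x]: multiplication by [3 + 2 sqrt 2]
    carries that ray to [2y = x], so only one of the two may be kept. *)
Definition in_cone (p : nat * int) :=
  (0 < p.1)%N && (- p.1%:Z < 2 * p.2 <= p.1%:Z).

Definition cone_term (p : nat * int) : C :=
  if in_cone p then (-1) ^+ p.1 * q ^+ (p.1 * p.1 - 2 * (absz p.2 * absz p.2)) else 0.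

Let fle p : C := if (2 * absz p.2 <= p.1)%N then g p.1 (absz p.2) else 0.
Let flt p : C := if (2 * absz p.2 < p.1)%N then g p.1 (absz p.2) else 0.

Lemma cone_exponent x k : (2 * k <= x)%N -> (x + k <= 4 * (x * x - 2 * (k * k)))%N.
Proof. by nia. Qed.

(** With [tau = |q|^(1/4)], [cone_exponent] bounds the terms by [tau^x tau^|y|], a product of two
    summable families. *)
Let majorant : exists2 b : nat * int -> R, rsummable b /\ (forall p, 0 <= b p) &
  forall x y, (2 * absz y <= x)%N -> nc (g x (absz y)) <= b (x, y).
Proof.
pose tau := Num.sqrt (Num.sqrt (nc q)).
have tau0 : 0 <= tau by exact: sqrtr_ge0.
have t4 : nc q = tau ^+ 4 by rewrite (exprM tau 2 2) sqr_sqrtr ?sqrtr_ge0 // sqr_sqrtr ?nc_ge0.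
have tau1 : tau < 1 by rewrite -(@expr_lt1 _ 4) // -t4.
have s1 : rsummable (fun n => 1 * tau ^+ n) by apply: rsummable_geo; rewrite ?tau0.
have s2 : rsummable (fun n : int => 1 * tau ^+ absz n).
  apply: rsummable_int => [n||]; first by rewrite mul1r exprn_ge0.
    exact: s1.
  by apply: rsummable_le s1 => n /=; rewrite !mul1r exprS ler_piMl ?exprn_ge0 // ltW.
exists (fun p => (1 * tau ^+ p.1) * (1 * tau ^+ absz p.2)).
  split; last by move=> p; rewrite !mul1r mulr_ge0 ?exprn_ge0.
  by apply: (rsummable_prod _ _ s1 s2) => i; rewrite mul1r exprn_ge0.
move=> x y yx; rewrite /g ncM !ncX ncN nc1 expr1n !mul1r t4 -exprM -exprD.
by apply: ler_wiXn2l => //; [exact: ltW|exact: cone_exponent].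
Qed.

Let summable_below (P : pred (nat * int)) (f : nat * int -> C) :
  (forall p, P p -> (2 * absz p.2 <= p.1)%N) ->
  (forall p, f p = if P p then g p.1 (absz p.2) else 0) -> asummable f.
Proof.
have [b [sb b0] hb] := majorant => hP fE; apply: (asummable_le _ sb) => -[x y].
rewrite fE; case: ifP => [/hP /= h|_]; last by rewrite nc0.
exact: hb.
Qed.

Let fle_summable : asummable fle.
Proof. by apply: (@summable_below (fun p => 2 * absz p.2 <= p.1)%N). Qed.

Let flt_summable : asummable flt.
Proof. by apply: (@summable_below (fun p => 2 * absz p.2 < p.1)%N) => // p /ltnW. Qed.

Lemma cone_term_summable : asummable cone_term.
Proof.
apply: (@summable_below in_cone) => // -[x y]; rewrite /in_cone /= => /andP[_ /andP[h1 h2]].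
by clear -h1 h2; lia.
Qed.

Section NonZero.
Hypothesis q0 : q != 0.

(** The sum of [q^(-2 j^2)] over [|j| <= m/2]. *)
Let E m : C := 1 + 2 * \sum_(0 <= j < m./2) q^-1 ^+ (2 * (j.+1 * j.+1)).

Let hsum_finZ (c : C) (F G : nat -> C) N : (forall k, (N <= k)%N -> F k = 0) ->
  (forall k, (k < N)%N -> F k = c * G k) -> hsum F (c * \sum_(0 <= k < N) G k).
Proof.
move=> F0 FG; have f0 k : k \notin [fset i in index_iota 0 N]%fset -> F k = 0.
  by rewrite fset_iotaE -leqNgt; exact: F0.
have := hsum_fin f0; rewrite (sum_fset_seq _ (iota_uniq _ _)) mulr_sumr.
by rewrite (eq_big_nat _ _ (F2 := fun k => c * G k)) // => k /andP[_]; exact: FG.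
Qed.

Let slice x m : (m <= x)%N ->
  usum (fun y : int => if (2 * absz y <= m)%N then g x (absz y) else 0) =
  (-1) ^+ x * q ^+ (x * x) * E m.
Proof.
move=> mx; pose f y : C := if (2 * absz y <= m)%N then g x (absz y) else 0.
have gE k : (2 * k <= m)%N -> g x k = (-1) ^+ x * q ^+ (x * x) * q^-1 ^+ (2 * (k * k)).
  move=> km; rewrite /g -mulrA; congr (_ * _); have l : (2 * (k * k) <= x * x)%N.
    by clear -km mx; nia.
  by rewrite -{2}(subnK l) exprD exprVn mulfK // expf_neq0.
have hP : hsum (f \o Posz) ((-1) ^+ x * q ^+ (x * x) * \sum_(0 <= k < m./2.+1) q^-1 ^+ (2 * (k * k))).
  apply: hsum_finZ => k h; rewrite /f /=.
    by rewrite ifF //; clear -h; lia.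
  by have km' : (2 * k <= m)%N by [clear -h; lia]; rewrite km' gE.
have hN : hsum (f \o Negz) ((-1) ^+ x * q ^+ (x * x) * \sum_(0 <= k < m./2) q^-1 ^+ (2 * (k.+1 * k.+1))).
  apply: hsum_finZ => k h; rewrite /f /=.
    by rewrite ifF //; clear -h; lia.
  by have km' : (2 * k.+1 <= m)%N by [clear -h; lia]; rewrite km' gE.
have sf : asummable f.
  have [b [sb b0] hb] := majorant; pose phi (y : int) := (x, y).
  have phi_inj : injective phi by move=> a b' [].
  apply: (asummable_le _ (rsummable_inj phi_inj sb)) => y; rewrite /f /=.
  by case: ifP => [h|_]; rewrite ?nc0 ?b0 //; apply: hb; apply: leq_trans mx.
rewrite (usum_int sf) (hsumE hP) (hsumE hN) -mulrDr /E big_ltn // muln0 expr0.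
rewrite (big_addn 0 _ 1) subn1 /=; congr (_ * _).
rewrite (eq_bigr (fun k => q^-1 ^+ (2 * (k.+1 * k.+1)))) => [|k _]; last by rewrite addn1.
by move: (\sum_(0 <= _ < _) _) => S; ring.
Qed.

(** The odd indices cancel between [t] and [-t], and an even index [2j] contributes
    [t^(-4 j^2) = q^(-2 j^2)]. *)
Let theta_inv_even t r : t ^+ 2 = q -> theta_inv t r + theta_inv (- t) r = 2 * E r.
Proof.
move=> tq; rewrite /theta_inv /E.
have -> : \sum_(0 <= j < r./2) q^-1 ^+ (2 * (j.+1 * j.+1)) =
    2^-1 * \sum_(0 <= j < r) (t^-1 ^+ (j.+1 * j.+1) + (- t)^-1 ^+ (j.+1 * j.+1)).
  have two0 : (2 : C) != 0 by rewrite pnatr_eq0.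
  elim: r => [|r IH]; first by rewrite !big_nil mulr0.
  rewrite big_nat_recr //= mulrDr -IH uphalf_half.
  rewrite invrN (exprNn (t^-1)) signX_sqr exprS.
  have [od|ev] := boolP (odd r).
    rewrite big_nat_recr //= -signr_odd od expr1 mulrNN !mul1r; congr (_ + _).
    have half (a : C) : 2^-1 * (a + a) = a by field.
    rewrite half.
    rewrite -tq -exprVn -exprM; congr (_ ^+ _).
    have := odd_double_half r; rewrite od; clear; nia.
  by rewrite add0n -signr_odd (negbTE ev) expr0 mulr1 mulN1r subrr mulr0 addr0.
rewrite big_split /=; move: (\sum_(0 <= _ < r) _) (\sum_(0 <= _ < r) _) => a b.
by field.
Qed.

Let S1 x : C := usum (fun y => fle (x, y)).
Let S2 x : C := usum (fun y => flt (x, y)).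

Let S1E x : S1 x = (-1) ^+ x * q ^+ (x * x) * E x.
Proof. exact: slice. Qed.

Let S2E x : S2 x.+1 = (-1) ^+ x.+1 * q ^+ (x.+1 * x.+1) * E x.
Proof. exact: (slice (leqnSn x)). Qed.

Let S20 : S2 0 = 0.
Proof. by apply: usum_eq0 => y; rewrite /flt. Qed.

Let hS1 : asummable S1. Proof. exact: asummable_usum fle_summable. Qed.
Let hS2 : asummable S2. Proof. exact: asummable_usum flt_summable. Qed.

(** Away from the origin, the closed and the open sector together count interior points twice and
    points of the two boundary rays once; so do the cone and its mirror image. The origin, which is
    outside the cone, gives the 1. *)
Let fle_flt : usum fle + usum flt = 1 + 2 * usum cone_term.
Proof.
pose ng (p : nat * int) := (p.1, - p.2).
have ngK : involutive ng by move=> [x y]; rewrite /ng /= opprK.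
have ng_inj : injective ng := inv_inj ngK.
pose d (p : nat * int) : C := if p == (0%N, 0) then 1 else 0.
have d0 p : p \notin [fset (0%N, 0 : int)]%fset -> d p = 0.
  by rewrite inE /d => /negbTE ->.
have hd := hsum_fin d0; rewrite big_seq_fset1 in hd.
have sd : asummable d := asummable_fin d0.
have sc := cone_term_summable; have sn : asummable (cone_term \o ng) := asummable_inj ng_inj sc.
have en : usum (cone_term \o ng) = usum cone_term.
  by apply: (usum_supp ng_inj _ sc) => p _; exists (ng p); exact: ngK.
rewrite -(usumD fle_summable flt_summable).
have -> : usum (fun p => fle p + flt p) = usum (fun p => d p + (cone_term p + (cone_term \o ng) p)).
  apply: eq_usum => -[x y].
  rewrite /fle /flt /d /cone_term /in_cone /ng /= xpair_eqE abszN -/(g x (absz y)).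
  have gz : g 0 (absz 0) = 1 by rewrite /g !expr0 mulr1.
  have [l|l] := leqP (2 * absz y) x; last first.
    by rewrite !ifF ?addr0 //; clear -l; lia.
  have [l2|l2] := ltnP (2 * absz y) x.
    by rewrite ifF; [rewrite !ifT; [by rewrite add0r| |]|]; clear -l2; lia.
  case: x l l2 => [|x] l l2.
    have -> : y = 0 by clear -l; lia.
    by rewrite !addr0 gz.
  rewrite /= add0r addr0; case: (ltrP 0 y) => y0.
    by rewrite ifT ?ifF ?addr0 //; clear -l l2 y0; lia.
  by rewrite ifF ?ifT ?add0r //; clear -l l2 y0; lia.
rewrite (usumD sd (asummableD sc sn)) (usumD sc sn) en (hsumE hd).
by rewrite /d eqxx mulr2n mulrDl mul1r.
Qed.

(** Add [Rs_hecke] for the two square roots [t] and [-t]. In the term of index [r], the two parts of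
    [1 - q^(2r+1)] are the row [x = r] of the closed sector and the row [x = r + 1] of the open
    one. *)
Lemma h_fun_cone_neq0 : h_fun q = - usum cone_term.
Proof.
have tq : sqrtc q ^+ 2 = q by exact: sqr_sqrtc.
have tq' : (- sqrtc q) ^+ 2 = q by rewrite sqrrN.
move: (sqrtc q) tq tq' => t tq tq'.
have t1 : nc t < 1 by rewrite -(@expr_lt1 _ 2) ?nc_ge0 // -ncX tq.
have s := cR_summable q1 t1.
have e1 : Rs q t + Rs q (- t) = 2 * h_fun q.
  have -> : Rs q (- t) = usum (fun n => (-1) ^+ n * (cR q n * t ^+ n)).
    by apply: eq_usum => n; rewrite (exprNn t) mulrCA.
  rewrite (usum_even s); congr (2 * _); have [sE _ _] := usum_parity s.
  rewrite (usum_recl sE) mul0r add0r.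
  have eh n : cR q n.+1.*2 * t ^+ n.+1.*2 = h_term n q.
    have et : t ^+ n.+1.*2 = q ^+ n.+1 by rewrite -mul2n exprM tq.
    by rewrite et doubleS /cR -mul2n /h_term mulrC mulrA.
  rewrite (eq_usum eh).
  have sh : asummable (fun n => h_term n q).
    by apply: (asummable_le _ (asummable_inj succn_inj sE)) => n; rewrite /= eh.
  by rewrite /h_fun (sum0E sh).2.
have e2 := Rs_hecke q0 q1 tq; have e3 := Rs_hecke q0 q1 tq'.
have s2 := theta_inv_summable q0 q1 tq; have s3 := theta_inv_summable q0 q1 tq'.
have sgn (f : nat -> C) : asummable f -> asummable (fun r => (-1) ^+ r * f r).
  by move=> sf; apply: (asummable_le _ sf) => n; rewrite ncM ncX ncN nc1 expr1n mul1r.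
have := usumD (sgn _ s2) (sgn _ s3); rewrite -e2 -e3 => e4.
have sS : asummable (fun x => S2 x.+1) := asummable_inj succn_inj hS2.
have e5 : 2 * (usum S1 + usum S2) = (1 - 2 * Rs q t) + (1 - 2 * Rs q (- t)).
  rewrite -e4 (usum_recl hS2) S20 add0r -(usumD hS1 sS) -(usumZ 2 (asummableD hS1 sS)).
  apply: eq_usum => r; rewrite S1E S2E.
  have h := theta_inv_even r tq.
  rewrite -mulrDr -mulrDr h (_ : r.+1 * r.+1 = r * r + (2 * r).+1)%N; last by clear; lia.
  rewrite exprD (exprS (-1) r); move: (q ^+ (r * r)) (q ^+ (2 * r).+1) (E r) => a b c.
  by ring.
have e6 : usum S1 = usum fle := usum_fubini fle_summable.
have e7 : usum S2 = usum flt := usum_fubini flt_summable.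
have e8 : 2 * (1 + 2 * usum cone_term) = 2 - 2 * (2 * h_fun q).
  rewrite -fle_flt -e6 -e7 e5 -e1; move: (Rs q t) (Rs q (- t)) => a b; ring.
move: (usum cone_term) (h_fun q) e8 => a b e8.
have alg (x y : C) : 2 * (1 + 2 * x) = 2 - 2 * (2 * y) -> y = - x.
  move=> h; have : 4 * (x + y) = 0.
    have -> : 4 * (x + y) = 2 * (1 + 2 * x) - (2 - 2 * (2 * y)) by ring.
    by rewrite h subrr.
  by move=> /eqP; rewrite mulf_eq0 pnatr_eq0 /= addrC addr_eq0 => /eqP.
exact: alg.
Qed.

End NonZero.

(** The finite theta sums contain negative powers of [q], so [q = 0] is treated apart; there both
    sides are 0. *)
Lemma h_fun_cone : h_fun q = - usum cone_term.
Proof.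
have [q0|] := eqVneq q 0; last exact: h_fun_cone_neq0.
rewrite (_ : usum cone_term = 0); last first.
  apply: usum_eq0 => -[x y]; rewrite /cone_term; case: ifP => //= h.
  have [n ->] : exists n, (x * x - 2 * (absz y * absz y) = n.+1)%N.
    have : (0 < x * x - 2 * (absz y * absz y))%N.
      move: h; rewrite /in_cone /= => /andP[x0 /andP[h1 h2]].
      have hy : (2 * absz y <= x)%N by clear -h1 h2; lia.
      by clear -x0 hy; nia.
    by case: (_ - _)%N => // n _; exists n.
  by rewrite q0 exprS mul0r mulr0.
have h0 n : h_term n q = 0 by rewrite /h_term q0 expr0n /= !mul0r.
have sh : asummable (fun n => h_term n q).
  by apply: (asummable_fin (A := fset0)).
by rewrite /h_fun (sum0E sh).2 oppr0; exact: usum_eq0.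
Qed.

End HeckeSum.

(** * Ideals of [Z[sqrt 2]] and their generators *)

Section ZSqrt2Ideals.

(** A pair [(a, b)] stands for [a + b sqrt 2]. In these coordinates norms and inequalities are
    integer arithmetic, and the reals enter only through [emb]. *)
Definition mulp (p w : int * int) : int * int :=
  (p.1 * w.1 + 2 * (p.2 * w.2), p.1 * w.2 + p.2 * w.1).

Definition Np (p : int * int) : int := p.1 * p.1 - 2 * (p.2 * p.2).

Lemma mulpA p v w : mulp p (mulp v w) = mulp (mulp p v) w.
Proof. by rewrite /mulp /=; congr pair; ring. Qed.

Lemma mulpC p w : mulp p w = mulp w p.
Proof. by rewrite /mulp; congr pair; ring. Qed.

Lemma mulp1 p : mulp p (1, 0) = p.
Proof. by case: p => a b; rewrite /mulp /=; congr pair; ring. Qed.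

Lemma NpM p w : Np (mulp p w) = Np p * Np w.
Proof. by rewrite /Np /mulp /=; ring. Qed.

(** The 2-adic valuation would be even on the left and odd on the right. *)
Lemma sqr_eq_double (m n : nat) : (m * m = 2 * (n * n))%N -> n = 0%N.
Proof.
case: n => // n; case: m => [|m] h; first by move: h; nia.
have := congr1 (logn 2) h; rewrite !lognM //.
by rewrite (_ : logn 2 2 = 1%N) //; lia.
Qed.

Lemma Np_eq0 p : Np p = 0 -> p = (0, 0).
Proof.
case: p => a b /= /eqP; rewrite /Np /= subr_eq0 => /eqP h.
have hn : (absz a * absz a = 2 * (absz b * absz b))%N by rewrite -!abszM h !abszM.
have /eqP b0 := sqr_eq_double hn; rewrite absz_eq0 in b0.
move: hn; rewrite (eqP b0) !muln0 => /eqP; rewrite muln_eq0 orbb absz_eq0 => /eqP -> //.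
Qed.

Lemma NpV (u w : int * int) : mulp u w = (1, 0) -> Np u = 1 \/ Np u = -1.
Proof.
move=> uw; have h : Np u * Np w = 1 by rewrite -NpM uw.
have : (absz (Np u) * absz (Np w))%N = 1%N by rewrite -abszM h.
by move=> /eqP; rewrite muln_eq1 => /andP[/eqP h1 _]; lia.
Qed.

Lemma nearest_quotient (u n : int) : n != 0 -> exists w, 2 * `|u - n * w| <= `|n|.
Proof.
move=> n0; have e := divz_eq u n; have m0 := modz_ge0 u n0; have m1 := ltz_mod u n0.
move: (u %/ n)%Z (u %% n)%Z e m0 m1 => d m e m0 m1.
have [h|h] := lerP (2 * m) `|n|.
  by exists d; rewrite e (_ : d * n + m - n * d = m); [rewrite ger0_norm|ring].
have [n1|n1] := ltrP 0 n.
  exists (d + 1); rewrite e (_ : d * n + m - n * (d + 1) = m - n); last by ring.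
  by move: h m1; rewrite gtr0_norm // => h m1; rewrite ltr0_norm; lia.
exists (d - 1); rewrite e (_ : d * n + m - n * (d - 1) = m + n); last by ring.
by move: h m1; rewrite ler0_norm // => h m1; rewrite ltr0_norm; lia.
Qed.

Lemma sqr_le_of_norm (u n : int) : 2 * `|u| <= `|n| -> 4 * (u * u) <= n * n.
Proof.
move=> h; have -> : 4 * (u * u) = (2 * `|u|) * (2 * `|u|).
  rewrite mulrACA -normrM ger0_norm //; nia.
have -> : n * n = `|n| * `|n| by rewrite -normrM ger0_norm //; nia.
by rewrite ler_pM // mulr_ge0.
Qed.

(** Round both coordinates of [z/g] to nearest integers. The errors [U/n] and [V/n] are at most 1/2,
    and the remainder has norm [(U^2 - 2 V^2)/n], of absolute value at most [|n|/2]. *)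
Lemma Np_euclid (z g : int * int) : Np g != 0 -> exists w,
  (absz (Np (z.1 - (mulp g w).1, z.2 - (mulp g w).2)%R) < absz (Np g))%N.
Proof.
case: z => a b; case: g => c d n0; rewrite /=.
have [w1 h1] := nearest_quotient (a * c - 2 * (b * d)) n0.
have [w2 h2] := nearest_quotient (b * c - a * d) n0.
exists (w1, w2); move: n0 h1 h2; rewrite /mulp /=.
set n := Np (c, d); set A := Np _; set U := (X in 2 * `|X| <= _ -> _).
move=> n0 h1; set V := (X in 2 * `|X| <= _ -> _) => h2.
have e : A * n = U * U - 2 * (V * V) by rewrite /A /U /V /n /Np /=; ring.
have k1 := sqr_le_of_norm h1; have k2 := sqr_le_of_norm h2.
have U0 : 0 <= U * U by nia.
have V0 : 0 <= V * V by nia.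
have nn : 0 < n * n by rewrite lt_neqAle eq_sym mulf_neq0 //=; nia.
move: (U * U) (V * V) e k1 k2 U0 V0 => x y e k1 k2 x0 y0.
rewrite ltnNge; apply/negP => h.
have h' : `|n| <= `|A| by lia.
have : `|n| * `|n| <= `|A| * `|n| by rewrite ler_wpM2r.
rewrite -!normrM e (ger0_norm (ltW nn)) => h3.
by move: h3 k1 k2 nn x0 y0; clear; move: (n * n) => k; lia.
Qed.

Variable R : realType.
Local Notation s := (Num.sqrt (2 : R)).

Definition emb (p : int * int) : R := p.1%:~R + p.2%:~R * s.

Lemma sqrt2_sqr : s * s = 2.
Proof. by rewrite -expr2 sqr_sqrtr. Qed.

Lemma embM p w : emb (mulp p w) = emb p * emb w.
Proof.
rewrite /emb /mulp /= !(intrD, intrM) (_ : 1%:~R + 1%:~R = 2 :> R) //.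
move: (p.1%:~R : R) (p.2%:~R : R) (w.1%:~R : R) (w.2%:~R : R) => a b c d.
have -> : (a + b * s) * (c + d * s) = a * c + (s * s) * (b * d) + (a * d + b * c) * s by ring.
by rewrite sqrt2_sqr.
Qed.

Lemma embD p w : emb p + emb w = emb (p.1 + w.1, p.2 + w.2).
Proof. by rewrite /emb /= !intrD; ring. Qed.

Lemma embB p w : emb p - emb w = emb (p.1 - w.1, p.2 - w.2).
Proof. by rewrite /emb /= !intrB; ring. Qed.

Lemma emb_eq0 p : emb p = 0 -> p = (0, 0).
Proof.
case: p => a b /eqP; rewrite /emb /= addr_eq0 => /eqP h; apply: Np_eq0; rewrite /Np /=.
apply/eqP; rewrite -(intr_eq0 R) intrB !intrM subr_eq0 h.
rewrite mulrNN mulrACA sqrt2_sqr mulrC.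
by apply/eqP; have -> : (2%:~R : R) = 2 by [].
Qed.

Lemma emb_inj : injective emb.
Proof.
move=> [a b] [c d] /eqP; rewrite -subr_eq0 embB => /eqP /emb_eq0 [] /=.
by move=> /eqP; rewrite subr_eq0 => /eqP -> /eqP; rewrite subr_eq0 => /eqP ->.
Qed.

Lemma zsqrt2_emb p : zsqrt2 (emb p).
Proof. by exists p.1, p.2. Qed.

Definition pideal g : set R := [set emb (mulp g w) | w in setT].

Lemma pideal_ideal g : is_ideal (pideal g).
Proof.
split.
- by move=> _ [w _ <-]; exact: zsqrt2_emb.
- by exists (0, 0) => //; rewrite /mulp /= !mulr0 addr0 /emb /= mul0r addr0.
- move=> _ _ [w _ <-] [v _ <-]; exists (w.1 + v.1, w.2 + v.2) => //.
  by rewrite embD /mulp /=; congr emb; congr pair; ring.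
- move=> _ _ [a [b ->]] [w _ <-]; exists (mulp (a, b) w) => //.
  by rewrite -[_ + _]/(emb (a, b)) -embM; congr emb; rewrite mulpA (mulpC g) -mulpA.
Qed.

Lemma pideal_gen g : pideal g (emb g).
Proof. by exists (1, 0); rewrite ?mulp1. Qed.

Lemma pideal_unit g u w : mulp u w = (1, 0) -> pideal (mulp g u) = pideal g.
Proof.
move=> uw; apply/seteqP; split => _ [v _ <-].
  by exists (mulp u v); rewrite ?mulpA.
by exists (mulp w v) => //; rewrite -mulpA (mulpA u) uw (mulpC (1, 0)) mulp1.
Qed.

Lemma idealB (I : set R) x y : is_ideal I -> I x -> I y -> I (x - y).
Proof.
move=> [_ _ hD hM] Ix Iy; apply: hD => //.
rewrite -mulN1r; apply: hM => //.
by exists (-1), 0; rewrite mul0r addr0.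
Qed.

Lemma ideal_principal (I : set R) : is_ideal I -> I <> [set 0] ->
  exists g, Np g != 0 /\ I = pideal g.
Proof.
move=> iI In0; have [hZ h0 hD hM] := iI.
have [p0 [Ip0 p00]] : exists p, I (emb p) /\ Np p != 0.
  apply: contrapT => h; apply: In0; apply/seteqP; split => [x Ix|x ->] //=.
  have [a [b e]] := hZ _ Ix; apply: contrapT => x0; apply: h; exists (a, b).
  rewrite -[_ + _]/(emb (a, b)) in e; rewrite -e; split => //.
  by apply: contra_notN x0 => /eqP/Np_eq0 h; rewrite e h /emb /= mul0r addr0.
pose P k := `[< exists p, [/\ I (emb p), Np p != 0 & absz (Np p) = k] >].
have exP : exists k, P k by exists (absz (Np p0)); apply/asboolP; exists p0.
case: (ex_minnP exP) => k /asboolP[g [Ig g0 gk]] kmin; exists g; split => //.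
apply/seteqP; split => [x Ix|_ [w _ <-]]; last first.
  by rewrite embM mulrC; apply: hM => //; exact: zsqrt2_emb.
have [a [b e]] := hZ _ Ix; have [w hw] := Np_euclid (a, b) g0.
exists w => //; set r := (_, _) in hw.
have er : emb r = x - emb (mulp g w) by rewrite e -embB.
have Ir : I (emb r).
  rewrite er; apply: (idealB iI Ix).
  by rewrite embM mulrC; apply: hM => //; exact: zsqrt2_emb.
have [r0|r0] := eqVneq (Np r) 0.
  move: er; rewrite (Np_eq0 r0) /emb /= mul0r addr0 => /esym/eqP.
  by rewrite subr_eq0 => /eqP.
have := kmin (absz (Np r)); rewrite leqNgt -gk hw => h.
by have /h : P (absz (Np r)) by apply/asboolP; exists r.
Qed.

Definition gen_of (p : nat * int) : int * int := (p.1%:Z, p.2).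

(** The unit [1 + sqrt 2] of norm -1 makes the norm positive, and -1 makes [x] positive. Among such
    generators take [x] minimal: comparison with the products by [3 + 2 sqrt 2] and [3 - 2 sqrt 2]
    gives [- x <= 2 y <= x]. *)
Lemma cone_generator g : Np g != 0 -> exists p, in_cone p /\ pideal (gen_of p) = pideal g.
Proof.
move=> g0; have [g1 [e1 n1]] : exists p, pideal p = pideal g /\ 0 < Np p.
  have [h|h] := ltrP 0 (Np g); first by exists g.
  exists (mulp g (1, 1)); split; first by apply: (@pideal_unit g (1, 1) (-1, 1)).
  by rewrite NpM (_ : Np (1, 1) = -1) //; move: g0 h; lia.
have [g2 [e2 n2 x2]] : exists p, [/\ pideal p = pideal g, 0 < Np p & 0 < p.1].
  have [h|h] := ltrP 0 g1.1; first by exists g1.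
  exists (mulp g1 (-1, 0)); split.
  - by rewrite -e1; apply: (@pideal_unit g1 (-1, 0) (-1, 0)).
  - by rewrite NpM (_ : Np (-1, 0) = 1) // mulr1.
  - have : g1.1 != 0 by apply: contraTneq n1; case: (g1) => a b /= ->; rewrite /Np /=; nia.
    by rewrite /mulp /=; move: h; lia.
pose P k := `[< exists p, [/\ pideal p = pideal g, 0 < Np p, 0 < p.1 & absz p.1 = k] >].
have exP : exists k, P k by exists (absz g2.1); apply/asboolP; exists g2.
case: (ex_minnP exP) => k /asboolP[[x y] [e n x0 xk]] kmin.
rewrite /= in x0 xk; have n' : 2 * (y * y) < x * x by move: n; rewrite /Np /= subr_gt0.
(* Follows from [2 y^2 < x^2]; it makes the first coordinates of both products positive, so that
   minimality applies to them. *)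
have yx : 4 * y < 3 * x /\ - (4 * y) < 3 * x by split; nia.
have min (u w : int * int) : mulp u w = (1, 0) -> Np u = 1 -> 0 < (mulp (x, y) u).1 ->
    x <= (mulp (x, y) u).1.
  move=> uw nu h; have := kmin (absz (mulp (x, y) u).1); rewrite -xk.
  suff hP : P (absz (mulp (x, y) u).1) by move=> /(_ hP); move: h x0; lia.
  apply/asboolP; exists (mulp (x, y) u); split => //; first by rewrite (pideal_unit _ uw).
  by rewrite NpM nu mulr1.
have m1 : x <= 3 * x + 4 * y.
  have := min (3, 2) (3, -2) erefl erefl; rewrite /mulp /= => h.
  by apply: le_trans (h _) _; move: yx; lia.
have m2 : x <= 3 * x - 4 * y.
  have := min (3, -2) (3, 2) erefl erefl; rewrite /mulp /= => h.
  by apply: le_trans (h _) _; move: yx; lia.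
(* On the excluded ray the unit [3 + 2 sqrt 2] replaces [(x, y)] by [(x, -y)]. *)
have [h|h] := eqVneq (- x) (2 * y).
  exists (absz x, - y); rewrite /in_cone /=; split; first by move: h m1 m2 x0; lia.
  rewrite -e -(@pideal_unit (x, y) (3, 2) (3, -2)) //; congr pideal.
  by rewrite /gen_of /mulp /=; congr pair; move: h x0; lia.
exists (absz x, y); rewrite /in_cone /=; split; first by move: h m1 m2 x0; lia.
by rewrite -e; congr pideal; rewrite /gen_of /=; congr pair; lia.
Qed.

Lemma cone_Np p : in_cone p -> 0 < Np (gen_of p).
Proof.
case: p => x y; rewrite /in_cone /Np /= => /andP[x0 /andP[h1 h2]].
have hy : (2 * absz y <= x)%N by lia.
have -> : y * y = (absz y * absz y)%N :> int by rewrite PoszM; lia.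
by nia.
Qed.

(* For [b >= 2] and [a^2 - 2 b^2 = 1], multiplication by [a + b sqrt 2] leaves the cone. *)
Lemma cone_step (x y a b : int) : 0 < x -> - x < 2 * y <= x -> 0 < b -> 0 < a ->
  a * a = 2 * (b * b) + 1 -> a * x + 2 * (y * b) < 2 * (x * b + y * a).
Proof.
move=> x0 /andP[y1 y2] b0 a0 e.
have b2 : 2 <= b.
  have [//|b1] := lerP 2 b; have eb : b = 1 by lia.
  by move: e; rewrite eb => e; have [a1|a1] := lerP a 1; nia.
have ba : b < a by nia.
have ab : 2 * a <= 3 * b by nia.
have h1 : 0 <= x * (3 * b - 2 * a) by rewrite mulr_ge0; lia.
have h2 : 0 < (2 * y + x) * (a - b) by rewrite mulr_gt0; lia.
rewrite -subr_gt0 (_ : _ - _ = x * (3 * b - 2 * a) + (2 * y + x) * (a - b)); last by ring.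
by lia.
Qed.

(** The generators differ by a unit [a + b sqrt 2], of norm 1 since both have positive norm, and
    with [a > 0] since both lie in the cone. If [b] is not 0, [cone_step] pushes one of them out of
    the cone. *)
Lemma cone_unique p p' : in_cone p -> in_cone p' ->
  pideal (gen_of p) = pideal (gen_of p') -> p = p'.
Proof.
move=> cp cp' e.
have N0 := cone_Np cp; have N0' := cone_Np cp'.
have [u _ /emb_inj eu] : pideal (gen_of p) (emb (gen_of p')) by rewrite e; exact: pideal_gen.
have [v _ /emb_inj ev] : pideal (gen_of p') (emb (gen_of p)) by rewrite -e; exact: pideal_gen.
have uv : mulp u v = (1, 0).
  apply: emb_inj; have h : emb (gen_of p) * emb (mulp u v) = emb (gen_of p) * emb (1, 0).
    by rewrite -!embM mulp1 mulpA eu ev.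
  apply: mulfI h; apply: contraTneq N0 => /emb_eq0 ->.
  by rewrite /Np.
have u1 : Np u = 1.
  have [//|h] := NpV uv; move: N0'; rewrite -eu NpM h; move: N0; lia.
case: p p' cp cp' N0 N0' e eu ev => x y [x' y']; rewrite /in_cone /gen_of /=.
move=> /andP[x0 cy] /andP[x0' cy'] _ _ _; case: u u1 uv => a b; rewrite /Np /= => u1 uv [e1 e2] ev.
have e3 : (x : int) = a * x' - 2 * (b * y') by rewrite -e1 -e2; nia.
have e4 : y = a * y' - b * x' by rewrite -e1 -e2; nia.
have a0 : 0 < a.
  rewrite ltNge; apply/negP => a0.
  have ab : `|b| <= - a by nia.
  have h : b * (2 * y) <= - a * x.
    apply: le_trans (ler_norm _) _; rewrite normrM ler_pM //.
    by move: cy; lia.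
  by move: e1 x0' h; nia.
have aa : a * a = 2 * (b * b) + 1 by lia.
have [b0|b0|b0] := ltrgtP b 0.
(* For [b < 0] it is the inverse unit [a - b sqrt 2], applied to the other generator, that leaves
   the cone. *)
- have := @cone_step x' y' a (- b) _ cy' _ a0 _; rewrite ltNge => /(_ _ _ _)/negP [] //; try lia.
- have := @cone_step x y a b _ cy b0 a0 aa; rewrite ltNge => /(_ _)/negP [] //; try lia.
- have a1 : a = 1 by move: aa a0; rewrite b0; nia.
  by move: e1 e2; rewrite a1 b0 => e1 e2; congr pair; lia.
Qed.

Definition coset (I : set R) (x : R) : set R := [set x + y | y in I].

Lemma coset_eq (I : set R) x y : is_ideal I -> coset I x = coset I y <-> I (x - y).
Proof.
move=> iI; have [_ h0 hD _] := iI; split => [e|h].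
  have : coset I y x by rewrite -e; exists 0; rewrite ?addr0.
  by move=> [z Iz <-]; rewrite addrC addKr.
apply/seteqP; split => _ [z Iz <-].
  by exists (x - y + z); [exact: hD|ring].
exists (z - (x - y)); last by ring.
exact: idealB.
Qed.

Lemma pideal_coords (x y a b : int) : pideal (x, y) (emb (a, b)) <->
  exists c d, a = x * c + 2 * (y * d) /\ b = x * d + y * c.
Proof.
split=> [[[c d] _ /emb_inj [<- <-]]|[c [d [-> ->]]]]; first by exists c, d.
by exists (c, d).
Qed.

(* With [e = gcd(x, y)], the [a + b sqrt 2] with [0 <= a < N / e] and [0 <= b < e] represent the
   cosets of the ideal generated by [x + y sqrt 2], of norm [N]. *)
Lemma ideal_norm_cone p : in_cone p -> ideal_norm (pideal (gen_of p)) = absz (Np (gen_of p)).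
Proof.
case: p => x y cp; have N0 := cone_Np cp; rewrite /gen_of /= in N0 *.
have iI := pideal_ideal (x%:Z, y).
have x0 : 0 < x%:Z by move: cp; rewrite /in_cone /= => /andP[].
have [u [v bez]] := Bezoutz x y.
move: (gcdz_eq0 x y); have := dvdz_gcdl x y; have := dvdz_gcdr x y.
have : 0 <= gcdz x y by [].
move: (gcdz x y) bez => e bez e0 /dvdzP[y1 ey] /dvdzP[x1 ex] ee.
have {e0 ee} e0 : 0 < e by move: e0 ee x0; case: ltrgtP => //; rewrite ?lt0r; lia.
have Ne : Np (x%:Z, y) = e * (e * (x1 * x1 - 2 * (y1 * y1))) by rewrite /Np /= ex ey; ring.
set M := e * (x1 * x1 - 2 * (y1 * y1)) in Ne.
have M0 : 0 < M by move: N0; rewrite Ne pmulr_rgt0.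
have bez1 : u * x1 + v * y1 = 1.
  apply: (mulfI (lt0r_neq0 e0)); rewrite mulr1 -[RHS]bez ex ey; ring.
pose rep (ij : 'I_(absz M) * 'I_(absz e)) := coset (pideal (x%:Z, y)) (emb (ij.1%:Z, ij.2%:Z)).
(* The ideal as a lattice in triangular form, with basis [M] and [(x v + 2 y u) + e sqrt 2]. The
   first is the generator times [x1 - y1 sqrt 2], the second the generator times [v + u sqrt 2]. *)
have memP a b : pideal (x%:Z, y) (emb (a, b)) <-> exists k l : int, b = e * k /\ a = (x%:Z * v + 2 * (y * u)) * k + M * l.
  rewrite pideal_coords; split=> [[c [d [-> ->]]]|[k [l [-> ->]]]].
    exists (x1 * d + y1 * c), (u * c - v * d); split; first by rewrite ex ey; ring.
    have -> : x%:Z * c + 2 * (y * d) = (u * x1 + v * y1) * (x%:Z * c + 2 * (y * d)) by rewrite bez1 mul1r.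
    by rewrite /M ex ey; ring.
  exists (v * k + x1 * l), (u * k - y1 * l); split.
    by rewrite /M ex ey; ring.
  have -> : e * k = e * (u * x1 + v * y1) * k by rewrite bez1 mulr1.
  by rewrite ex ey; ring.
have rep_inj : injective rep.
  move=> [i j] [i' j']; rewrite /rep /= => /(coset_eq _ _ iI); rewrite embB /=.
  move=> /memP[k [l [ek el]]].
  have hj := ltn_ord j; have hj' := ltn_ord j'; have hi := ltn_ord i; have hi' := ltn_ord i'.
  have k0 : k = 0 by clear -e0 ek hj hj'; nia.
  have l0 : l = 0 by rewrite k0 in el; clear -M0 el hi hi'; nia.
  by congr pair; apply: val_inj => /=; move: ek el; rewrite k0 l0; lia.
have cosetsE : cosets (pideal (x%:Z, y)) = [set` [fset rep ij | ij in [set: 'I_(absz M) * 'I_(absz e)]%SET]%fset].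
  apply/seteqP; split => [_ [z [a [b ->]] <-]|_ /= /imfsetP[ij _ ->]]; last first.
    by exists (emb (ij.1%:Z, ij.2%:Z)) => //; exact: zsqrt2_emb.
  pose k := (b %/ e)%Z; pose j := (b %% e)%Z.
  pose a' := a - (x%:Z * v + 2 * (y * u)) * k; pose l := (a' %/ M)%Z; pose i := (a' %% M)%Z.
  have j0 : 0 <= j by rewrite modz_ge0 // gt_eqF.
  have j1 : j < e by rewrite ltz_pmod.
  have i0 : 0 <= i by rewrite modz_ge0 // gt_eqF.
  have i1 : i < M by rewrite ltz_pmod.
  have hi : (absz i < absz M)%N by lia.
  have hj : (absz j < absz e)%N by lia.
  apply/imfsetP; exists (Ordinal hi, Ordinal hj); first by rewrite inE.
  rewrite -[_ + _]/(emb (a, b)); apply/(coset_eq _ _ iI); rewrite embB /=.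
  apply/memP; exists k, l; rewrite !gez0_abs //.
  have eb := divz_eq b e; have ea := divz_eq a' M.
  split; first by rewrite {1}eb /j /k; ring.
  have -> : a = a' + (x%:Z * v + 2 * (y * u)) * k by rewrite /a'; ring.
  by rewrite {1}ea /i /l; ring.
rewrite /ideal_norm cosetsE set_fsetK card_imfset //= -cardE cardsT card_prod !card_ord.
by rewrite Ne abszM mulnC.
Qed.

End ZSqrt2Ideals.

(** * From the cone to the ideals *)

Section HeckeIdeals.
Variable R : realType.
Local Notation C := (Cplx R).
Local Notation nc := (@normc R).

(** Sending an ideal to a generator in the cone is injective, and by [cone_unique] every point of
    the cone is reached; the sum over the cone is thus reindexed by ideals. *)
Lemma h_fun_ideals (q : C) : nc q < 1 ->
  cvg_usum (fun I : @nonzero_ideals R => (-1) ^+ ideal_norm (val I) * q ^+ ideal_norm (val I)) /\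
  h_fun q = - usum (fun I : @nonzero_ideals R => (-1) ^+ ideal_norm (val I) * q ^+ ideal_norm (val I)).
Proof.
move=> q1.
have gen (I : @nonzero_ideals R) : exists p, in_cone p /\ @pideal R (gen_of p) = val I.
  have [iI I0] := set_valP I; have [g [g0 ->]] := ideal_principal iI I0.
  exact: cone_generator.
pose phi I := projT1 (cid (gen I)).
have phiP I : in_cone (phi I) /\ @pideal R (gen_of (phi I)) = val I by exact: projT2 (cid (gen I)).
have phi_inj : injective phi.
  by move=> I J e; apply: val_inj; rewrite /= -(phiP I).2 -(phiP J).2 e.
have sc := cone_term_summable q1.
have e I : (-1) ^+ ideal_norm (val I) * q ^+ ideal_norm (val I) = cone_term q (phi I).
  have [cI <-] := phiP I; rewrite ideal_norm_cone // /cone_term cI.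
  move: (phi I) cI => [x y]; rewrite /in_cone /Np /gen_of /= => /andP[x0 /andP[h1 h2]].
  have hy : (2 * absz y <= x)%N by clear -h1 h2; lia.
  have -> : absz (x%:Z * x%:Z - 2 * (y * y))%R = (x * x - 2 * (absz y * absz y))%N.
    have -> : y * y = (absz y * absz y)%N :> int by rewrite PoszM; clear; lia.
    by clear -hy; nia.
  (* [x] and [x^2 - 2 y^2] have the same parity, so the sign of the cone term is that of the
     norm. *)
  congr (_ * _); rewrite -signr_odd -[RHS]signr_odd; congr (_ ^+ _).
  have l : (2 * (absz y * absz y) <= x * x)%N by clear -hy; nia.
  by rewrite oddB // oddM andbb mul2n odd_double addbF.
rewrite (_ : (fun I => _) = cone_term q \o phi); last by apply/funext => I; rewrite e.
split; first by apply: asummable_cvg_usum; exact: asummable_inj.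
rewrite (h_fun_cone q1) (usum_supp phi_inj _ sc) // => p p0.
have cp : in_cone p by move: p0; rewrite /cone_term; case: ifP; rewrite ?eqxx.
have hI : nonzero_ideals (@pideal R (gen_of p)).
  split; first exact: pideal_ideal.
  move=> h; have /= := @pideal_gen R (gen_of p); rewrite h => /= /emb_eq0 e0.
  by have := cone_Np cp; rewrite e0.
exists (SigSub (mem_set hI)); apply: (cone_unique (R := R) (phiP _).1 cp).
by rewrite (phiP _).2.
Qed.

End HeckeIdeals.

(** * Elementary bounds on sine, cosine and the exponential *)

Section TrigBounds.
Variable R : realType.
Implicit Types x y t : R.

Lemma deriv_mono (f df : R -> R) (a b : R) : (forall x : R, is_derive x 1 f (df x)) ->
  (forall x, a < x < b -> 0 <= df x) -> a <= b -> f a <= f b.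
Proof.
move=> fd df0; rewrite le_eqVlt => /predU1P[->//|ab].
have fc : {within `[a, b], continuous f}.
  by apply: derivable_within_continuous => x _; exact: ex_derive.
have [c cab e] := MVT ab (fun x _ => fd x) fc.
rewrite -subr_ge0 e mulr_ge0 ?subr_ge0 ?(ltW ab) // df0 //.
Qed.

Lemma sin_le_id t : 0 <= t -> sin t <= t.
Proof.
move=> t0; have d1 x : is_derive x 1 (fun x => x - sin x) (1 - cos x) by exact: is_deriveB.
have d2 x : 0 < x < t -> 0 <= 1 - cos x by rewrite subr_ge0 cos_le1.
by have := deriv_mono d1 d2 t0; rewrite sin0 subr0 subr_ge0.
Qed.

Lemma norm_sin_le t : `|sin t| <= `|t|.
Proof.
wlog t0 : t / 0 <= t.
  move=> h; have [t0|t0] := lerP 0 t; first exact: h.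
  by rewrite -(normrN t) -(normrN (sin t)) -sinN h // oppr_ge0 ltW.
rewrite [leRHS]ger0_norm // ler_norml; have [t1|t1] := lerP t 1.
  have s0 : 0 <= sin t.
    apply: sin_ge0_pi; rewrite t0 (le_trans t1) // (le_trans _ (pi_ge2 R)) //.
    by rewrite ler1n.
  by rewrite sin_le_id // andbT (le_trans _ s0) // oppr_le0.
by have := sin_geN1 t; have := sin_le1 t; move: t1; lra.
Qed.

Lemma one_sub_cos t : 1 - cos t = 2 * sin (t / 2) ^+ 2.
Proof.
have -> : cos t = cos ((t / 2) *+ 2) by rewrite -mulr_natr divfK.
by rewrite cos_mulr2n -mulr_natl cos2sin2; ring.
Qed.

Lemma one_sub_cos_le t : 1 - cos t <= t ^+ 2.
Proof.
rewrite one_sub_cos; have := norm_sin_le (t / 2) => h.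
have : sin (t / 2) ^+ 2 <= (t / 2) ^+ 2.
  by rewrite -[leLHS]real_normK ?num_real // -[leRHS]real_normK ?num_real // lerXn2r ?nnegrE.
by move: (sin (t / 2) ^+ 2) => s hs; have := sqr_ge0 t; move: hs; nra.
Qed.

Lemma sin_ge_sub_sqr t : 0 <= t -> t - t ^+ 2 <= sin t.
Proof.
move=> t0; have d1 (x : R) : is_derive x 1 (fun x => sin x - x + x ^+ 2) (cos x - 1 + 2 * x).
  have h1 : is_derive x 1 (fun x : R => x ^+ 2) (2 * x).
    by apply: is_derive_eq; rewrite /GRing.scale /=; ring.
  by apply: is_deriveD.
have d2 x : 0 < x < t -> 0 <= cos x - 1 + 2 * x.
  move=> /andP[x0 _]; suff : 1 - cos x <= 2 * x by lra.
  have [x1|x1] := lerP x 1; last by have := cos_geN1 x; move: x1; lra.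
  by apply: le_trans (one_sub_cos_le x) _; move: x0 x1; nra.
have := deriv_mono d1 d2 t0; rewrite sin0 expr0n /= !addr0 subr0; lra.
Qed.

Lemma norm_sin_sub_le t : `|sin t - t| <= t ^+ 2.
Proof.
wlog t0 : t / 0 <= t.
  move=> h; have [t0|t0] := lerP 0 t; first exact: h.
  rewrite -sqrrN -normrN opprB addrC -[t in _ + t]opprK -sinN.
  by rewrite h // oppr_ge0 ltW.
rewrite ler_norml; have := sin_le_id t0; have := sin_ge_sub_sqr t0; have := sqr_ge0 t.
by move=> h1 h2 h3; apply/andP; split; lra.
Qed.

Lemma norm_cos_sub_le t : `|cos t - 1| <= t ^+ 2.
Proof. by rewrite distrC ger0_norm ?one_sub_cos_le // subr_ge0 cos_le1. Qed.

(** Only [e^t >= 1 + t], at [t] and at [-t], is used; the second gives [e^t (1 - t) <= 1]. *)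
Lemma norm_expR_sub_le t : `|t| <= 1 / 2 -> `|expR t - 1 - t| <= 2 * t ^+ 2.
Proof.
rewrite ler_norml => /andP[t1 t2]; have h1 := expR_ge1Dx t; have h2 := expR_ge1Dx (- t).
have e1 : expR t * expR (- t) = 1 by rewrite expRN mulfV // gt_eqF // expR_gt0.
have e0 := expR_gt0 t; rewrite ger0_norm; last by lra.
have : expR t * (1 - t) <= 1 by rewrite -[leRHS]e1 ler_pM2l.
move: (expR t) h1 e0 => x h1 x0 h3.
have : (1 - t) * (x - 1 - t - 2 * t ^+ 2) <= 0.
  have -> : (1 - t) * (x - 1 - t - 2 * t ^+ 2) = (x * (1 - t) - 1) + t ^+ 2 * (2 * t - 1) by ring.
  have := sqr_ge0 t; nra.
by rewrite pmulr_rle0; lra.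
Qed.

(** With [u = t/2], [sin t = 2 sin u cos u], and [u cos u <= sin u] because [sin u - u cos u] has
    derivative [u sin u]. *)
Lemma sin_ge_cos_half t : 0 <= t <= pi -> t * cos (t / 2) ^+ 2 <= sin t.
Proof.
move=> /andP[t0 t1]; pose u := t / 2.
have u0 : 0 <= u by rewrite divr_ge0.
have u1 : u <= pi / 2 by rewrite ler_pM2r.
have c0 : 0 <= cos u.
  by apply: cos_ge0_pihalf; rewrite u1 andbT (le_trans _ u0) // oppr_le0 divr_ge0 // pi_ge0.
have h : u * cos u <= sin u.
  have d1 (x : R) : is_derive x 1 (fun x => sin x - x * cos x) (x * sin x).
    by apply: is_derive_eq; rewrite /GRing.scale /=; ring.
  have d2 x : 0 < x < u -> 0 <= x * sin x; last first.
    by have := deriv_mono d1 d2 u0; rewrite sin0 mul0r subr0 subr_ge0.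
  move=> /andP[x0 xu]; rewrite mulr_ge0 ?(ltW x0) // sin_ge0_pi // ltW //= (le_trans (ltW xu)) //.
  by rewrite (le_trans u1) // ler_pdivrMr // ler_peMr ?pi_ge0 // ler1n.
have -> : sin t = 2 * (sin u * cos u).
  by rewrite -[in LHS](divfK (_ : (2 : R) != 0) t) ?pnatr_eq0 // mulr_natr sin_mulr2n -/u -mulr_natl mulrC; ring.
have -> : t = 2 * u by rewrite /u; field.
rewrite -/u -[2 * u / 2]/(2 * u / 2) (_ : 2 * u / 2 = u); last by field.
by rewrite -mulrA ler_wpM2l // expr2 mulrA ler_wpM2r.
Qed.

(** The constant is [cos(3 pi/8)^2], the worst case of [sin_ge_cos_half] on the range. The bound 3/4
    leaves room for the points met in the duplication argument, whose real parts are at most 1/2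
    plus a small term. *)
Lemma sin_pi_ge : exists2 k : R, 0 < k <= 1 & forall a : R, `|a| <= 3 / 4 -> k * `|a| <= `|sin (pi * a)|.
Proof.
pose b : R := 3 / 8 * pi; have p0 := pi_gt0 R; have p2 := pi_ge2 R.
have cb : 0 < cos b by apply: cos_gt0_pihalf; rewrite /b; apply/andP; split; lra.
exists (cos b ^+ 2) => [|a ha].
  by rewrite exprn_gt0 //= exprn_ile1 // ?ltW // cos_le1.
have -> : `|sin (pi * a)| = `|sin (pi * `|a|)|.
  have [a0|a0] := lerP 0 a; first by rewrite (ger0_norm a0).
  by rewrite (ltr0_norm a0) mulrN sinN normrN.
move: (`|a|) (normr_ge0 a) ha => x x0 x1.
have t0 : 0 <= pi * x by rewrite mulr_ge0 // ltW.
have t1 : pi * x <= pi by nra.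
apply: le_trans (ler_norm _); apply: le_trans (sin_ge_cos_half (introT andP (conj t0 t1))).
have hb : cos b <= cos (pi * x / 2).
  have d1 (y : R) : is_derive y 1 (fun y => - cos y) (sin y).
    by apply: is_derive_eq; rewrite opprK.
  have hx : pi * x / 2 <= b by rewrite /b; nra.
  have d2 y : pi * x / 2 < y < b -> 0 <= sin y; last first.
    by have := deriv_mono d1 d2 hx; rewrite lerN2.
  move=> /andP[y0 y1]; apply: sin_ge0_pi; apply/andP; split; move: y0 y1; rewrite /b; nra.
rewrite mulrC ler_pM //; first by rewrite exprn_ge0 // ltW.
  by nra.
by rewrite lerXn2r // nnegrE ?(ltW cb) // (le_trans (ltW cb)).
Qed.

End TrigBounds.

(** * The complex exponential near its period lattice *)

Section ComplexExp.
Variable R : realType.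
Local Notation C := (Cplx R).
Local Notation nc := (@normc R).

Lemma nc_sqr (x : C) : nc x ^+ 2 = complex.Re x ^+ 2 + complex.Im x ^+ 2.
Proof. by case: x => a b; rewrite /normc sqr_sqrtr // addr_ge0 ?sqr_ge0. Qed.

Lemma cexp0 : cexp (0 : C) = 1.
Proof. by rewrite /cexp /= expR0 cos0 sin0; simpc. Qed.

Lemma cexpD (a b : C) : cexp (a + b) = cexp a * cexp b.
Proof.
case: a b => [a1 a2] [b1 b2]; rewrite /cexp /= expRD cosD sinD; simpc.
by congr Complex; ring.
Qed.

Lemma nc_cexp (z : C) : nc (cexp z) = expR (complex.Re z).
Proof.
have e : nc (cexp z) ^+ 2 = expR (complex.Re z) ^+ 2.
  rewrite nc_sqr /cexp; simpc => /=; rewrite !exprMn -mulrDr cos2Dsin2 mulr1 //.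
by apply/eqP; rewrite -(eqrXn2 (n := 2)) ?nc_ge0 ?expR_ge0 // e.
Qed.

Lemma cexp_neq0 (z : C) : cexp z != 0.
Proof. by rewrite -nc_gt0 nc_cexp expR_gt0. Qed.

(** A quadratic remainder is all that [cderiv_bound] asks for; the constant is not sharp. *)
Lemma cexp_taylor (h : C) : nc h <= 1 / 2 -> nc (cexp h - 1 - h) <= 10 * nc h ^+ 2.
Proof.
case: h => x y h1; set r := nc (x +i* y)%C in h1 *.
have hx : `|x| <= r by exact: (@nc_Re R (x +i* y)%C).
have hy : `|y| <= r by exact: (@nc_Im R (x +i* y)%C).
have r0 : 0 <= r by exact: nc_ge0.
have -> : cexp (x +i* y)%C - 1 - (x +i* y)%C =
   ((expR x * cos y - 1 - x) +i* (expR x * sin y - y))%C.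
  by rewrite /cexp /=; simpc.
apply: le_trans (nc_le_ReIm _) _; rewrite /=.
have k1 := norm_expR_sub_le (le_trans hx h1).
have k2 := norm_cos_sub_le y; have k3 := norm_sin_sub_le y.
have x2 : x ^+ 2 <= r ^+ 2 by rewrite -[leLHS]real_normK ?num_real // lerXn2r ?nnegrE.
have y2 : y ^+ 2 <= r ^+ 2 by rewrite -[leLHS]real_normK ?num_real // lerXn2r ?nnegrE.
have e0 := expR_gt0 x.
have e2 : expR x <= 2.
  move: k1; rewrite ler_norml => /andP[_ k1]; move: hx; rewrite ler_norml => /andP[_ hx].
  by nra.
have e3 : `|expR x - 1| <= 2 * r.
  have -> : expR x - 1 = (expR x - 1 - x) + x by ring.
  apply: le_trans (ler_normD _ _) _; nra.
have i1 : `|expR x * cos y - 1 - x| <= 2 * r ^+ 2 + 2 * r ^+ 2.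
  have -> : expR x * cos y - 1 - x = (expR x - 1 - x) + expR x * (cos y - 1) by ring.
  apply: le_trans (ler_normD _ _) _; apply: lerD; first by apply: le_trans k1 _; lra.
  by rewrite normrM; apply: ler_pM => //; [rewrite ger0_norm // ltW|exact: le_trans k2 y2].
have i2 : `|expR x * sin y - y| <= 2 * r ^+ 2 + 2 * r * r.
  have -> : expR x * sin y - y = expR x * (sin y - y) + (expR x - 1) * y by ring.
  apply: le_trans (ler_normD _ _) _; apply: lerD; rewrite normrM; apply: ler_pM => //.
    by rewrite ger0_norm // ltW.
  exact: le_trans k3 y2.
by move: i1 i2; rewrite -mulrA -expr2; have := sqr_ge0 r; lra.
Qed.

Definition ez (z : C) : C := cexp ((0 +i* (2 * pi))%C * z).

Lemma ezD (a b : C) : ez (a + b) = ez a * ez b.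
Proof. by rewrite /ez mulrDr cexpD. Qed.

Lemma ez0 : ez 0 = 1. Proof. by rewrite /ez mulr0 cexp0. Qed.

Lemma ez_nat (n : nat) (z : C) : ez (n%:R * z) = ez z ^+ n.
Proof.
elim: n => [|n IH]; first by rewrite mul0r ez0.
by rewrite mulrSr mulrDl mul1r ezD IH exprSr.
Qed.

Lemma ez_half : ez 2^-1 = -1.
Proof.
have e : (0 +i* (2 * pi))%C * 2^-1 = (0 +i* pi)%C :> C.
  apply: (mulIf (_ : 2 != 0)); rewrite ?pnatr_eq0 // mulfVK ?pnatr_eq0 //.
  by rewrite mulr_natr mulr2n -[RHS]/(Complex (0 + 0) (pi + pi)); congr Complex; ring.
by rewrite /ez e /cexp /= expR0 cospi sinpi; simpc.
Qed.

Lemma ez1 : ez 1 = 1.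
Proof. by rewrite (_ : 1 = 2%:R * 2^-1) ?ez_nat ?ez_half ?sqrrN ?expr1n // mulfV ?pnatr_eq0. Qed.

Lemma ez_neq0 (z : C) : ez z != 0. Proof. exact: cexp_neq0. Qed.

Lemma ezN (z : C) : ez (- z) = (ez z)^-1.
Proof. by apply: (mulIf (ez_neq0 z)); rewrite mulVf ?ez_neq0 // -ezD addNr ez0. Qed.

Let ezE (a b : R) : (0 +i* (2 * pi))%C * (a +i* b)%C = ((- (2 * pi * b)) +i* (2 * pi * a))%C :> C.
Proof. by simpc. Qed.

Lemma nc_ez (z : C) : nc (ez z) = expR (- (2 * pi * complex.Im z)).
Proof. by case: z => a b; rewrite /ez ezE nc_cexp. Qed.

Lemma nc_ez_lt1 (z : C) : 0 < complex.Im z -> nc (ez z) < 1.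
Proof. by move=> z0; rewrite nc_ez -expR0 ltr_expR oppr_lt0 !mulr_gt0 // pi_gt0. Qed.

Lemma nc_one_sub_ez (z : C) : nc (1 - ez z) ^+ 2 =
  (1 - nc (ez z)) ^+ 2 + 4 * nc (ez z) * sin (pi * complex.Re z) ^+ 2.
Proof.
rewrite nc_sqr nc_ez; set r := expR _.
have -> : ez z = (r * cos (2 * (pi * complex.Re z)) +i* (r * sin (2 * (pi * complex.Re z))))%C.
  rewrite /r; case: z {r} => a b; rewrite /ez ezE /cexp /= mulrA; simpc.
  by [].
rewrite /=; set t := pi * _.
have hc : cos (2 * t) = 2 * cos t ^+ 2 - 1 by rewrite (mulr_natl t 2) cos_mulr2n mulr_natl.
have hs : sin (2 * t) = 2 * (cos t * sin t) by rewrite (mulr_natl t 2) sin_mulr2n mulr_natl.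
rewrite hc hs.
have := cos2Dsin2 t; move: (cos t) (sin t) => c s e.
have -> : c ^+ 2 = 1 - s ^+ 2 by rewrite -e addrK.
have c2 : c ^+ 2 = 1 - s ^+ 2 by rewrite -e addrK.
have -> : (0 - r * (2 * (c * s))) ^+ 2 = 4 * r ^+ 2 * s ^+ 2 * c ^+ 2 by ring.
by rewrite c2; ring.
Qed.

(** In [nc_one_sub_ez] the term in the modulus controls [Im z] and the sine controls [Re z]; the
    bound [Y] on [Im z] keeps [|ez z|] away from 0. *)
Lemma one_sub_ez_lb (Y : R) : exists2 c : R, 0 < c & forall z : C,
  `|complex.Re z| <= 3 / 4 -> 0 <= complex.Im z <= Y -> c * nc z <= nc (1 - ez z).
Proof.
have [k /andP[k0 k1] hk] := sin_pi_ge R; pose rY := expR (- (2 * pi * `|Y|)).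
have p0 := pi_gt0 R; have p2 := pi_ge2 R.
have rY0 : 0 < rY by exact: expR_gt0.
have rY1 : rY <= 1 by rewrite -expR0 ler_expR oppr_le0 !mulr_ge0 // ltW.
exists (rY * k) => [|z hx /andP[y0 y1]]; first by rewrite mulr_gt0.
rewrite -(@ler_pXn2r _ 2) ?nnegrE ?nc_ge0 ?mulr_ge0 ?nc_ge0 ?(ltW rY0) ?(ltW k0) //.
rewrite nc_one_sub_ez exprMn nc_sqr; set r := nc (ez z).
have r0 : 0 < r by rewrite /r nc_ez expR_gt0.
have hr : rY <= r.
  rewrite /r nc_ez ler_expR lerN2 ler_wpM2l ?mulr_ge0 ?(ltW p0) //.
  exact: le_trans y1 (ler_norm Y).
have h1 : r * complex.Im z <= 1 - r.
  have := expR_ge1Dx (2 * pi * complex.Im z) => h.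
  have e : r * expR (2 * pi * complex.Im z) = 1.
    by rewrite /r nc_ez expRN mulVf // gt_eqF // expR_gt0.
  have : r * (1 + 2 * pi * complex.Im z) <= 1 by rewrite -[leRHS]e ler_pM2l.
  have : 0 <= (2 * pi - 1) * (r * complex.Im z) by rewrite mulr_ge0 ?mulr_ge0 ?(ltW r0) //; lra.
  lra.
have h2 : (rY * complex.Im z) ^+ 2 <= (1 - r) ^+ 2.
  rewrite lerXn2r ?nnegrE //; [by rewrite mulr_ge0 // ltW| |].
    by apply: le_trans h1; rewrite mulr_ge0 // ltW.
  by apply: le_trans h1; rewrite ler_wpM2r.
have h3 : (k * `|complex.Re z|) ^+ 2 <= sin (pi * complex.Re z) ^+ 2.
  rewrite -[leRHS]real_normK ?num_real // lerXn2r ?nnegrE // ?hk //.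
  by rewrite mulr_ge0 // ltW.
rewrite exprMn real_normK ?num_real // in h3; rewrite exprMn in h2.
rewrite exprMn mulrDr.
have k2 : k ^+ 2 <= 1 by rewrite exprn_ile1 // ltW.
have rr : rY ^+ 2 <= 4 * r by nra.
have x0 := sqr_ge0 (complex.Re z); have y20 := sqr_ge0 (complex.Im z).
move: (complex.Re z ^+ 2) (complex.Im z ^+ 2) (sin _ ^+ 2) x0 y20 h2 h3 => x y s x0 yy0 h2 h3.
have kk := sqr_ge0 k; have rr0 := sqr_ge0 rY.
rewrite addrC; apply: lerD.
  apply: le_trans h2; rewrite ler_wpM2r // -[leRHS]mulr1 ler_wpM2l //.
rewrite -mulrA; apply: (@le_trans _ _ (rY ^+ 2 * s)); first by rewrite ler_wpM2l.
by rewrite ler_wpM2r // (le_trans _ h3) // mulr_ge0.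
Qed.

End ComplexExp.

(** * Complex differentiability *)

Section ComplexDerivative.
Variable R : realType.
Local Notation C := (Cplx R).
Local Notation nc := (@normc R).
Implicit Types f g : C -> C.

(** The limit is not punctured: [h = 0] is included and forces [phi 0 = l], so that limits compose
    without side conditions. *)
Definition clim0 (phi : C -> C) (l : C) := forall e : R, 0 < e ->
  exists2 d : R, 0 < d & forall h, nc h < d -> nc (phi h - l) < e.

Lemma clim0_cst c : clim0 (fun=> c) c.
Proof. by move=> e e0; exists 1 => // h _; rewrite subrr nc0. Qed.

Lemma clim0_id : clim0 id 0.
Proof. by move=> e e0; exists e => // h; rewrite subr0. Qed.

Lemma clim0D (f g : C -> C) (l m : C) : clim0 f l -> clim0 g m -> clim0 (fun h => f h + g h) (l + m).
Proof.
move=> hf hg e e0; have e2 : 0 < e / 2 by rewrite divr_gt0.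
have [d1 d10 h1] := hf _ e2; have [d2 d20 h2] := hg _ e2.
exists (Num.min d1 d2) => [|h]; first by rewrite lt_min d10.
rewrite lt_min => /andP[/h1 k1 /h2 k2]; rewrite opprD addrACA.
by apply: le_lt_trans (ncD _ _) _; move: k1 k2; lra.
Qed.

Lemma clim0M (f g : C -> C) (l m : C) : clim0 f l -> clim0 g m -> clim0 (fun h => f h * g h) (l * m).
Proof.
move=> hf hg e e0; have m0 : 0 < nc m + 1 by rewrite ltr_wpDl ?nc_ge0.
have l0 : 0 < nc l + 1 by rewrite ltr_wpDl ?nc_ge0.
have e1 : 0 < e / 2 / (nc m + 1) by rewrite !divr_gt0.
have e2 : 0 < Num.min 1 (e / 2 / (nc l + 1)) by rewrite lt_min ltr01 !divr_gt0.
have [d1 d10 h1] := hf _ e1; have [d2 d20 h2] := hg _ e2.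
exists (Num.min d1 d2) => [|h]; first by rewrite lt_min d10.
rewrite lt_min => /andP[/h1 k1 /h2]; rewrite lt_min => /andP[k2 k3].
have -> : f h * g h - l * m = (f h - l) * g h + l * (g h - m) by ring.
apply: le_lt_trans (ncD _ _) _; rewrite (ncM (f h - l)) (ncM l).
have k4 : nc (g h) <= nc m + 1.
  by rewrite -[g h](subrK m) (le_trans (ncD _ _)) // addrC lerD2l ltW.
rewrite ltr_pdivlMr // in k1; rewrite ltr_pdivlMr // in k3.
have i1 : nc (f h - l) * nc (g h) <= nc (f h - l) * (nc m + 1) by rewrite ler_wpM2l ?nc_ge0.
have i2 : nc l * nc (g h - m) <= nc (g h - m) * (nc l + 1).
  by rewrite mulrC ler_wpM2l ?nc_ge0 // lerDl.
by move: k1 k3 i1 i2; lra.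
Qed.

Lemma clim0_comp (f g : C -> C) (l : C) : clim0 f 0 -> clim0 g l -> clim0 (fun h => g (f h)) l.
Proof.
move=> hf hg e /hg[d d0 h1]; have [d' d'0 h2] := hf _ d0.
by exists d' => // h /h2; rewrite subr0; exact: h1.
Qed.

(* Caratheodory's form of complex differentiability. *)
Definition cderiv f (z l : C) := exists phi : C -> C,
  [/\ forall h, f (z + h) = f z + phi h * h, phi 0 = l & clim0 phi l].

Lemma cderiv_bound f z l (K d : R) : 0 < d ->
  (forall h, nc h < d -> nc (f (z + h) - f z - l * h) <= K * nc h ^+ 2) -> cderiv f z l.
Proof.
move=> d0 hK; exists (fun h => if h == 0 then l else (f (z + h) - f z) / h); split.
- move=> h; case: eqVneq => [->|h0]; first by rewrite mulr0 !addr0.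
  by rewrite divfK // [RHS]addrC subrK.
- by rewrite eqxx.
move=> e e0; exists (Num.min d (e / (`|K| + 1))) => [|h hd].
  by rewrite lt_min d0 divr_gt0 // ltr_wpDl.
case: eqVneq => [_|h0]; first by rewrite subrr nc0.
have h0' : 0 < nc h by rewrite nc_gt0.
have -> : (f (z + h) - f z) / h - l = (f (z + h) - f z - l * h) / h by field.
move: hd; rewrite lt_min => /andP[hd he].
rewrite ncM ncV ltr_pdivrMr //; apply: le_lt_trans (hK _ hd) _.
rewrite expr2 mulrA ltr_pM2r //; apply: (@le_lt_trans _ _ ((`|K| + 1) * nc h)).
  by rewrite ler_pM2r // (le_trans (ler_norm _)) // lerDl.
by rewrite mulrC -ltr_pdivlMr // ltr_wpDl.
Qed.

Lemma cderiv_cst c z : cderiv (fun=> c) z 0.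
Proof. by exists (fun=> 0); split=> [h||]; [rewrite mul0r addr0| |exact: clim0_cst]. Qed.

Lemma cderiv_id z : cderiv id z 1.
Proof. by exists (fun=> 1); split=> [h||]; [rewrite mul1r| |exact: clim0_cst]. Qed.

Lemma cderivD f g z l m : cderiv f z l -> cderiv g z m -> cderiv (fun x => f x + g x) z (l + m).
Proof.
move=> [p [p1 p2 p3]] [r [r1 r2 r3]]; exists (fun h => p h + r h); split=> [h||].
- by rewrite p1 r1; ring.
- by rewrite p2 r2.
- exact: clim0D.
Qed.

Lemma cderivM f g z l m : cderiv f z l -> cderiv g z m ->
  cderiv (fun x => f x * g x) z (l * g z + f z * m).
Proof.
move=> [p [p1 p2 p3]] [r [r1 r2 r3]].
exists (fun h => p h * g z + f z * r h + p h * r h * h); split=> [h||].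
- by rewrite p1 r1; ring.
- by rewrite p2 r2 mulr0 addr0.
rewrite -[X in clim0 _ X]addr0 -[X in clim0 _ (_ + X)](mulr0 (l * m)).
apply: clim0D (clim0M (clim0M p3 r3) clim0_id).
by apply: clim0D; [apply: clim0M p3 _|apply: clim0M _ r3]; exact: clim0_cst.
Qed.

Lemma cderiv_comp f g z l m : cderiv f z l -> cderiv g (f z) m -> cderiv (g \o f) z (m * l).
Proof.
move=> [p [p1 p2 p3]] [r [r1 r2 r3]]; exists (fun h => r (p h * h) * p h); split=> [h||].
- by rewrite /= p1 r1 mulrA.
- by rewrite mulr0 p2 r2.
apply: (clim0M _ p3); apply: clim0_comp r3; rewrite -[X in clim0 _ X](mulr0 l).
exact: clim0M p3 clim0_id.
Qed.

Lemma cderiv_inv z : z != 0 -> cderiv GRing.inv z (- z^-1 ^+ 2).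
Proof.
move=> z0; have z0' : 0 < nc z by rewrite nc_gt0.
apply: (@cderiv_bound _ _ _ (2 / nc z ^+ 3) (nc z / 2)); first by rewrite divr_gt0.
move=> h hz; have zh : nc z / 2 <= nc (z + h).
  by have := nc_dist_ge z (- h); rewrite ncN opprK; lra.
have zh0 : z + h != 0 by rewrite -nc_gt0; apply: lt_le_trans zh; rewrite divr_gt0.
have -> : (z + h)^-1 - z^-1 - - z^-1 ^+ 2 * h = h ^+ 2 / (z ^+ 2 * (z + h)).
  by field; rewrite z0 zh0.
rewrite ncM ncX ncV ncM ncX mulrC ler_wpM2r ?exprn_ge0 ?nc_ge0 //.
rewrite -[leRHS]invrK lef_pV2 ?posrE ?invr_gt0 ?divr_gt0 ?exprn_gt0 ?mulr_gt0 ?exprn_gt0 ?(lt_le_trans _ zh) ?divr_gt0 //.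
rewrite invf_div exprSr -mulrA ler_wpM2l ?exprn_ge0 ?nc_ge0 //.
Qed.

Lemma cderivV f z l : f z != 0 -> cderiv f z l -> cderiv (fun x => (f x)^-1) z (- (f z)^-1 ^+ 2 * l).
Proof. by move=> f0 fl; apply: (cderiv_comp fl); exact: cderiv_inv. Qed.

Lemma cderiv_conv f z l : cderiv f z l -> clim0 (fun h => f (z + h)) (f z).
Proof.
move=> [p [p1 _ p3]]; rewrite (_ : (fun h => _) = (fun h => f z + p h * h)).
  rewrite -[X in clim0 _ X]addr0 -[X in clim0 _ (_ + X)](mulr0 l).
  by apply: clim0D (clim0_cst _) _; exact: clim0M p3 clim0_id.
by apply/funext => h; rewrite p1.
Qed.

Lemma cderiv_derivable f z l : cderiv f z l -> derivable f z 1.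
Proof.
move=> [p [p1 p2 p3]]; apply/cvg_ex; exists l.
apply/cvgrPdist_lt => e e0.
have e1 : 0 < complex.Re e by move: e0; case: (e) => a b; rewrite ltcE /= => /andP[].
have eE : e = (complex.Re e)%:C%C.
  by move: e0; case: (e) => a b; rewrite ltcE /= => /andP[/eqP ->].
have [d d0 hd] := p3 _ e1.
have d0' : 0 < d%:C%C :> C by rewrite ltcR.
near=> h.
have h0 : h != 0 by near: h; exact: nbhs_dnbhs_neq.
have hh : `|h| < d%:C%C by near: h; exact: dnbhs0_lt.
rewrite /= (_ : h *: (1 : C) = h); last by rewrite /GRing.scale /= mulr1.
rewrite [h + z]addrC p1 addrAC subrr add0r /GRing.scale /=.
rewrite [h^-1 * _]mulrC mulfK // distrC ncE eE ltcR; apply: hd.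
by rewrite -ltcR -ncE.
Unshelve. all: by end_near. Qed.

Lemma cderiv_cexp z : cderiv (@cexp R) z (cexp z).
Proof.
apply: (@cderiv_bound _ _ _ (nc (cexp z) * 10) (1 / 2)); first by rewrite divr_gt0.
move=> h hh; rewrite cexpD -{2}[cexp z]mulr1 -mulrBr -mulrBr ncM -mulrA ler_wpM2l ?nc_ge0 //.
by apply: cexp_taylor; exact: ltW.
Qed.

Lemma cderiv_scale k z : cderiv (fun x => k * x) z k.
Proof. by have := cderivM (cderiv_cst k z) (cderiv_id z); rewrite mul0r mulr1 add0r. Qed.

Lemma cderiv_ez z : cderiv (@ez R) z ((0 +i* (2 * pi))%C * ez z).
Proof. by rewrite mulrC; apply: (cderiv_comp (cderiv_scale _ z)); exact: cderiv_cexp. Qed.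

(* The real mean value theorem on the segment applies to the real and imaginary parts. *)
Lemma cderiv0_cst f z w : (forall t : R, 0 <= t <= 1 -> cderiv f (z + t%:C%C * (w - z)) 0) -> f z = f w.
Proof.
move=> fd; pose g (u : C -> R) (t : R) := u (f (z + t%:C%C * (w - z))).
have gd (u : C -> R) : (forall x y, u (x - y) = u x - u y) -> (forall x, `|u x| <= nc x) ->
    (forall (r : R) x, u (r%:C%C * x) = r * u x) ->
    g u 0 = g u 1.
  move=> uB ub uZ.
  have dg (t : R) : 0 <= t <= 1 -> is_derive t 1 (g u) 0; last first.
    have gc : {within `[0, 1], continuous (g u)}.
      apply: derivable_within_continuous => t; rewrite in_itv /= => t01.
      by have h := dg _ t01; exact: ex_derive.
    have hd (t : R) : t \in `]0, 1[ -> is_derive t 1 (g u) 0.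
      by rewrite in_itv /= => /andP[t0 t1]; apply: dg; rewrite !ltW.
    have [c _] := @MVT R (g u) (fun=> 0) 0 1 ltr01 hd gc.
    by rewrite mul0r => /eqP; rewrite subr_eq0 => /eqP.
  move=> /fd[p [p1 _ p3]].
  have dc : (fun h : R => h^-1 *: (g u (h *: 1 + t) - g u t)) @ 0^' --> (0 : R).
    apply/cvgrPdist_lt => e e0.
    have : 0 < e / (nc (w - z) + 1) by rewrite divr_gt0 // ltr_wpDl ?nc_ge0.
    move=> /p3[d d0 hd].
    near=> h.
    have h0 : h != 0 by near: h; exact: nbhs_dnbhs_neq.
    have hh : `|h| < d / (nc (w - z) + 1).
      near: h; apply: dnbhs0_lt; rewrite divr_gt0 // ltr_wpDl ?nc_ge0 //.
    have hw : nc (h%:C%C * (w - z)) < d.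
      rewrite ncM nc_real; move: hh; rewrite ltr_pdivlMr ?ltr_wpDl ?nc_ge0 // => hh.
      by apply: le_lt_trans hh; rewrite ler_wpM2l // lerDl.
    have hb := hd _ hw.
    rewrite subr0 in hb; rewrite sub0r normrN /GRing.scale /= mulr1 /g.
    have -> : z + (h + t)%:C%C * (w - z) = (z + t%:C%C * (w - z)) + h%:C%C * (w - z).
      by rewrite rmorphD /=; ring.
    rewrite p1 -uB addrC addKr (mulrCA (p _)) uZ mulKf //.
    apply: le_lt_trans (ub _) _; rewrite ncM.
    apply: le_lt_trans (_ : nc (p (h%:C%C * (w - z))) * (nc (w - z) + 1) < e).
      by rewrite ler_wpM2l ?nc_ge0 // lerDl.
    by rewrite -ltr_pdivlMr // ltr_wpDl ?nc_ge0.
  split; first by apply/cvg_ex; exists 0.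
  exact: cvg_lim dc.
have h0 : z + (0 : R)%:C%C * (w - z) = z by rewrite mul0r addr0.
have h1 : z + (1 : R)%:C%C * (w - z) = w by rewrite mul1r addrC subrK.
have eR : complex.Re (f z) = complex.Re (f w).
  have := gd (@complex.Re R); rewrite /g h0 h1; apply.
  - by move=> x y; rewrite ReD ReN.
  - exact: nc_Re.
  - by move=> r [a b] /=; rewrite mul0r subr0.
have eI : complex.Im (f z) = complex.Im (f w).
  have := gd (@complex.Im R); rewrite /g h0 h1; apply.
  - by move=> x y; rewrite ImD ImN.
  - exact: nc_Im.
  - by move=> r [a b] /=; rewrite mul0r addr0.
by move: eR eI; case: (f z) (f w) => a b [c d] /= -> ->.
Unshelve. all: by end_near. Qed.

End ComplexDerivative.

(** * Lattice expansions of [pi^2/sin^2] and [pi cot] by duplication *)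

Section LatticeSeries.
Variable R : realType.
Local Notation C := (Cplx R).
Local Notation nc := (@normc R).
Local Notation tpi := ((0 +i* (2 * pi))%C : C).

Lemma tpi_neq0 : tpi != 0.
Proof. by rewrite eq_complex /= eqxx /= mulf_neq0 ?pnatr_eq0 // gt_eqF // pi_gt0. Qed.

Lemma ReZ (r : R) (x : C) : complex.Re (r%:C%C * x) = r * complex.Re x.
Proof. by case: x => a b /=; rewrite mul0r subr0. Qed.

Lemma ImZ (r : R) (x : C) : complex.Im (r%:C%C * x) = r * complex.Im x.
Proof. by case: x => a b /=; rewrite mul0r addr0. Qed.

Lemma natC n : (n%:R : C) = (n%:R : R)%:C%C.
Proof. by rewrite rmorph_nat. Qed.

Lemma halfC k : (2^-1 : C) ^+ k = ((2^-1 : R) ^+ k)%:C%C.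
Proof. by rewrite rmorphXn /= fmorphV rmorph_nat. Qed.

Lemma rsummable_inv_sqr : rsummable (fun n => (n.+1%:R ^+ 2)^-1 : R).
Proof.
apply: (@rsummable_nat _ _ 2) => [n|N]; first by rewrite invr_ge0 exprn_ge0.
suff h : \sum_(0 <= n < N) (n.+1%:R ^+ 2)^-1 <= 2 * (1 - N.+1%:R^-1) :> R.
  by apply: le_trans h _; rewrite ler_piMr // lerBlDr lerDl invr_ge0.
elim: N => [|N IH]; first by rewrite big_nil invr1 subrr mulr0.
rewrite big_nat_recr //=; apply: (@le_trans _ _ (2 * (1 - N.+1%:R^-1) + (N.+1%:R ^+ 2)^-1)).
  by rewrite lerD2r.
rewrite -(natr1 N.+1); have : 1 <= N.+1%:R :> R by rewrite ler1n.
move: (N.+1%:R : R) => x x1; have x0 : 0 < x by exact: lt_le_trans x1.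
have x10 : 0 < x + 1 by rewrite ltr_wpDl // ltW.
rewrite -subr_ge0.
have -> : 2 * (1 - (x + 1)^-1) - (2 * (1 - x^-1) + (x ^+ 2)^-1) = (x - 1) / (x ^+ 2 * (x + 1)).
  by field; rewrite !gt_eqF.
by rewrite divr_ge0 ?subr_ge0 // mulr_ge0 ?exprn_ge0 // ltW.
Qed.

Lemma usum_trunc (f : nat -> C) M :
  usum (fun j => if (j < M)%N then f j else 0) = \sum_(0 <= j < M) f j.
Proof.
have f0 j : j \notin [fset i in index_iota 0 M]%fset -> (if (j < M)%N then f j else 0) = 0.
  by rewrite fset_iotaE => /negbTE ->.
rewrite (hsumE (hsum_fin f0)) (sum_fset_seq _ (iota_uniq _ _)).
by apply: eq_big_nat => j /andP[_ ->].
Qed.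

Section Doubling.
Variables (H : C -> C) (s : C).
Hypothesis Hd : forall z, ez z != 1 -> H z = s * (H (2^-1 * z) + H (2^-1 * (z + 1))).
Hypothesis H1 : forall z, H (z + 1) = H z.

Lemma ez_divide (z : C) k j : ez z != 1 -> ez (2^-1 ^+ k * (z + j%:R)) != 1.
Proof.
apply: contra_neq => h; have : ez ((2 ^ k)%:R * (2^-1 ^+ k * (z + j%:R))) = 1.
  by rewrite ez_nat h expr1n.
rewrite natrX mulrA -exprMn mulfV ?pnatr_eq0 // expr1n mul1r ezD -[j%:R]mulr1 ez_nat.
by rewrite ez1 expr1n mulr1.
Qed.

Lemma doubling_iter z k : ez z != 1 ->
  H z = s ^+ k * \sum_(0 <= j < 2 ^ k) H (2^-1 ^+ k * (z + j%:R)).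
Proof.
move=> z1; elim: k => [|k IH]; first by rewrite expn0 big_nat1 !expr0 !mul1r addr0.
rewrite IH expnS mul2n -addnn [in RHS](@big_cat_nat _ _ _ (2 ^ k)) ?leq_addr //=.
rewrite (big_addn 0 (2 ^ k + 2 ^ k)%N (2 ^ k)%N) addnK -big_split (exprSr s k) -[RHS]mulrA; congr (_ * _).
rewrite mulr_sumr /=; apply: eq_bigr => j _; rewrite (Hd (ez_divide k j z1)); congr (s * (H _ + H _)).
  by rewrite mulrA exprS.
rewrite exprS -mulrA; congr (_ * _); rewrite natrD natrX addrA [RHS]mulrDr; congr (_ + _).
by rewrite -exprMn mulVf ?pnatr_eq0 // expr1n.
Qed.

(** Periodicity moves half of the points to the left: the translates [z + j] now run over
    [-2^k <= j < 2^k], and after scaling they stay near the segment from -1/2 to 1/2, where 0 is the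
    only singularity of [H] in the applications. *)
Lemma doubling_centered z k : ez z != 1 ->
  H z = s ^+ k.+1 * (\sum_(0 <= j < 2 ^ k) H (2^-1 ^+ k.+1 * (z + j%:R)) +
                     \sum_(0 <= i < 2 ^ k) H (2^-1 ^+ k.+1 * (z - i.+1%:R))).
Proof.
move=> z1; rewrite {1}(doubling_iter k.+1 z1) expnS mul2n -addnn.
rewrite [in LHS](@big_cat_nat _ _ _ (2 ^ k)) ?leq_addr //=; congr (_ * (_ + _)).
rewrite (big_addn 0 _ (2 ^ k)) addnK big_nat_rev /= add0n.
apply: eq_big_nat => i /andP[_ ik]; rewrite -[RHS]H1; congr H.
have -> : (2 ^ k - i.+1 + 2 ^ k)%N%:R = 2 ^+ k.+1 - i.+1%:R :> C.
  by rewrite natrD natrB // natrX exprS; ring.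
have ab : 2^-1 ^+ k.+1 * 2 ^+ k.+1 = 1 :> C by rewrite -exprMn mulVf ?pnatr_eq0 // expr1n.
by rewrite -[X in _ = _ + X]ab; ring.
Qed.

End Doubling.

(** This is [pi^2/sin(pi z)^2], and [cotB] below is [pi cot(pi z)], both as rational functions of
    [ez z]. They duplicate with [s = 1/4] and [s = 1/2]. *)
Definition lipA (z : C) : C := tpi ^+ 2 * (ez z / (1 - ez z) ^+ 2).
Definition cotB (z : C) : C := tpi / 2 * ((ez z + 1) / (ez z - 1)).

Let ez_half_shift (z : C) : ez (2^-1 * (z + 1)) = - ez (2^-1 * z).
Proof. by rewrite mulrDr mulr1 ezD ez_half mulrN1. Qed.

Let ez_sqr (z : C) : ez z = ez (2^-1 * z) ^+ 2.
Proof. by rewrite -ez_nat mulrA mulfV ?pnatr_eq0 // mul1r. Qed.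

Let sqr_neq1 (x : C) : x ^+ 2 != 1 -> 1 - x != 0 /\ 1 + x != 0.
Proof.
move=> h; split; apply: contraNneq h => /eqP; first by rewrite subr_eq0 => /eqP <-; rewrite expr1n.
by rewrite addr_eq0 => /eqP e; rewrite -sqrrN -e expr1n.
Qed.

Lemma lipA_double z : ez z != 1 -> lipA z = 4^-1 * (lipA (2^-1 * z) + lipA (2^-1 * (z + 1))).
Proof.
rewrite /lipA ez_half_shift (ez_sqr z); move: (ez _) => x /[dup] h /sqr_neq1[h1 h2].
rewrite opprK; have h3 : 1 - x ^+ 2 != 0 by rewrite subr_eq0 eq_sym.
by field; rewrite h1 h2 h3.
Qed.

Lemma cotB_double z : ez z != 1 -> cotB z = 2^-1 * (cotB (2^-1 * z) + cotB (2^-1 * (z + 1))).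
Proof.
rewrite /cotB ez_half_shift (ez_sqr z); move: (ez _) => x /[dup] h /sqr_neq1[h1 h2].
have h3 : x ^+ 2 - 1 != 0 by rewrite subr_eq0.
have h4 : x - 1 != 0 by rewrite -opprB oppr_eq0.
have h5 : - x - 1 != 0 by rewrite -opprD oppr_eq0 addrC.
by field; rewrite h3 h4 h5.
Qed.

Lemma lipA_periodic z : lipA (z + 1) = lipA z.
Proof. by rewrite /lipA ezD ez1 mulr1. Qed.

Lemma cotB_periodic z : cotB (z + 1) = cotB z.
Proof. by rewrite /cotB ezD ez1 mulr1. Qed.

Let w_ k (zeta : C) : C := 2^-1 ^+ k.+1 * zeta.

Let w_cvg0 zeta : (fun k => w_ k zeta) @ \oo --> (0 : C).
Proof.
rewrite -[X in _ --> X](mul0r zeta); apply: cseqM (cseq_cst (l := zeta)).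
apply: cvg_shiftS; apply: cvg_expr0; rewrite ncV nc_nat; lra.
Qed.

Let clim0_seq (phi : C -> C) l zeta : clim0 phi l -> (fun k => phi (w_ k zeta)) @ \oo --> l.
Proof.
move=> h; apply/cvgnc => e /h[d d0 hd]; have /cvgnc /(_ _ d0) := w_cvg0 zeta.
by apply: filterS => k; rewrite sub0r ncN => /hd; rewrite nc_distC.
Qed.

Let w_small (zeta : C) (d : R) : 0 < d -> exists K, forall k, (K <= k)%N -> nc (w_ k zeta) < d.
Proof.
move=> d0; have /cvgnc /(_ _ d0)[K _ hK] := w_cvg0 zeta.
by exists K => k Kk; have := hK k Kk; rewrite sub0r ncN.
Qed.

Let ez_quot : exists p : C -> C, (forall h, ez h = 1 + p h * h) /\ clim0 p tpi.
Proof.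
have [p [p1 p2 p3]] := cderiv_ez (0 : C); rewrite ez0 mulr1 in p2 p3.
by exists p; split => // h; have := p1 h; rewrite add0r ez0.
Qed.

Section Point.
(** A real [z] is allowed, because the value at 1/2 gives zeta(2); [c0] keeps [z] away from the
    integers, at a distance proportional to their size. *)
Variables (z : C) (c0 : R).
Hypotheses (c00 : 0 < c0) (y0 : 0 <= complex.Im z) (z1 : ez z != 1).
Hypothesis hP : forall j, c0 * j.+1%:R <= nc (z + j%:R).
Hypothesis hN : forall j, c0 * j.+1%:R <= nc (z - j.+1%:R).

Let w_dom : exists K, forall k (t : R), (K <= k)%N -> `|t| <= 2 ^+ k ->
  `|complex.Re (w_ k (z + t%:C%C))| <= 3 / 4 /\ 0 <= complex.Im (w_ k (z + t%:C%C)) <= complex.Im z.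
Proof.
have [|K hK] := @w_small z (1 / 4); first by rewrite divr_gt0.
have p2 k : 0 < (2^-1 : R) ^+ k by rewrite exprn_gt0.
exists K => k t /hK hw ht; split.
  rewrite /w_ mulrDr ReD halfC !ReZ /=.
  apply: le_trans (ler_normD _ _) _.
  have h1 : `|2^-1 ^+ k.+1 * complex.Re z| <= 1 / 4.
    by rewrite -ReZ -halfC; apply: le_trans (nc_Re _) (ltW hw).
  have h2 : `|2^-1 ^+ k.+1 * t| <= 1 / 2.
    rewrite normrM gtr0_norm ?p2 //.
    apply: le_trans (ler_wpM2l (ltW (p2 _)) ht) _.
    by rewrite exprSr mulrAC -exprMn mulVf ?pnatr_eq0 // expr1n mul1r; lra.
  by move: h1 h2; lra.
rewrite /w_ mulrDr ImD halfC !ImZ /= mulr0 addr0 mulr_ge0 ?(ltW (p2 _)) //=.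
by rewrite ler_piMl // exprn_ile1 // ?invr_ge0 // invf_le1 // ler1n.
Qed.

Let lb : exists2 c, 0 < c & exists K, forall k (t : R), (K <= k)%N -> `|t| <= 2 ^+ k ->
  c * nc (w_ k (z + t%:C%C)) <= nc (1 - ez (w_ k (z + t%:C%C))).
Proof.
have [c c1 hc] := one_sub_ez_lb (complex.Im z); have [K hK] := w_dom.
by exists c => //; exists K => k t Kk ht; have [h1 h2] := hK _ _ Kk ht; exact: hc.
Qed.

Let sjC j : (j%:R : C) = (j%:R : R)%:C%C. Proof. exact: natC. Qed.
Let siC i : (- i%:R : C) = (- i%:R : R)%:C%C. Proof. by rewrite natC rmorphN. Qed.
Let le_pow j k : (j <= 2 ^ k)%N -> `|j%:R : R| <= 2 ^+ k.
Proof. by move=> h; rewrite ger0_norm // -natrX ler_nat. Qed.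
Let zP0 j : 0 < nc (z + j%:R). Proof. by apply: lt_le_trans (hP j); rewrite mulr_gt0. Qed.
Let zN0 j : 0 < nc (z - j.+1%:R). Proof. by apply: lt_le_trans (hN j); rewrite mulr_gt0. Qed.

Let TA k zeta := 4^-1 ^+ k.+1 * lipA (w_ k zeta).
Let TB k zeta := 2^-1 ^+ k.+1 * cotB (w_ k zeta).

Let pow4 k : (4^-1 : C) ^+ k = (2^-1 ^+ k) ^+ 2.
Proof. by rewrite -exprM mulnC exprM; congr (_ ^+ _); rewrite expr2 -invfM; congr (_^-1); rewrite -natrM. Qed.

Let half0 k : (2^-1 : C) ^+ k != 0. Proof. by rewrite expf_neq0 // invr_neq0 // pnatr_eq0. Qed.

Let algA (t P X a y : C) : a != 0 -> y != 0 ->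
  a ^+ 2 * (t ^+ 2 * (X / (1 - (1 + P * (a * y))) ^+ 2)) = t ^+ 2 * (X * (P^-1 ^+ 2 * (y ^+ 2)^-1)).
Proof.
move=> a0 n0; rewrite (_ : 1 - (1 + P * (a * y)) = - (P * (a * y))); last by ring.
have [->|P0] := eqVneq P 0; first by rewrite mul0r oppr0 invr0 !expr0n /= invr0 !(mul0r, mulr0).
by field; rewrite P0 a0 n0.
Qed.

Let algB (t P X a y : C) : a != 0 -> y != 0 ->
  a * (t / 2 * ((X + 1) / (1 + P * (a * y) - 1))) = t / 2 * ((X + 1) * (P^-1 * y^-1)).
Proof.
move=> a0 n0; rewrite (_ : 1 + P * (a * y) - 1 = P * (a * y)); last by ring.
have [->|P0] := eqVneq P 0; first by rewrite mul0r invr0 !(mul0r, mulr0).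
by field; rewrite P0 a0 n0.
Qed.

Let TA_cvg zeta : zeta != 0 -> (fun k => TA k zeta) @ \oo --> (zeta ^+ 2)^-1.
Proof.
move=> n0; have [p [p1 p3]] := ez_quot; have hp := clim0_seq zeta p3.
have e k : TA k zeta = tpi ^+ 2 * ((1 + p (w_ k zeta) * w_ k zeta) * ((p (w_ k zeta)) ^-1 ^+ 2 * (zeta ^+ 2)^-1)).
  by rewrite /TA /lipA p1 pow4; exact: (algA tpi (p (w_ k zeta)) _ (half0 k.+1) n0).
have e2 : (zeta ^+ 2)^-1 = tpi ^+ 2 * ((1 + tpi * 0) * (tpi^-1 ^+ 2 * (zeta ^+ 2)^-1)).
  by rewrite mulr0 addr0 mul1r mulrA -exprMn mulfV ?tpi_neq0 // expr1n mul1r.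
rewrite e2; apply: cseq_ext (fun k => esym (e k)) _.
apply: cseqZ; apply: cseqM; first by apply: cseqD (cseq_cst (l := 1)) _; exact: cseqM hp (w_cvg0 zeta).
apply: cseqM (cseq_cst (l := _)); have h := cseqV tpi_neq0 hp.
by have := cseqM h h; apply: cseq_ext => k; rewrite expr2.
Qed.

Let TB_cvg zeta : zeta != 0 -> (fun k => TB k zeta) @ \oo --> zeta^-1.
Proof.
move=> n0; have [p [p1 p3]] := ez_quot; have hp := clim0_seq zeta p3.
have e k : TB k zeta = tpi / 2 * ((1 + p (w_ k zeta) * w_ k zeta + 1) * ((p (w_ k zeta))^-1 * zeta^-1)).
  by rewrite /TB /cotB p1; exact: (algB tpi (p (w_ k zeta)) _ (half0 k.+1) n0).
have e2 : zeta^-1 = tpi / 2 * ((1 + tpi * 0 + 1) * (tpi^-1 * zeta^-1)).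
  have t0 := tpi_neq0; move: (tpi) t0 => t t0; by field; rewrite t0 n0.
rewrite e2; apply: cseq_ext (fun k => esym (e k)) _.
apply: cseqZ; apply: cseqM.
  apply: cseqD (cseq_cst (l := 1)); apply: cseqD (cseq_cst (l := 1)) _; exact: cseqM hp (w_cvg0 zeta).
by apply: cseqM (cseq_cst (l := _)); exact: cseqV tpi_neq0 hp.
Qed.

Let if_cvg (f : nat -> C) (l : C) K j : f @ \oo --> l ->
  (fun N => if (j < 2 ^ (N + K))%N then f (N + K)%N else 0) @ \oo --> l.
Proof.
move=> h; have h2 := cseq_sub (f := fun N => (N + K)%N) (leq_addr K) h.
apply: cvg_trans h2; apply: near_eq_cvg; exists j => // N /= jN.
by rewrite ifT // (leq_trans _ (leq_pexp2l _ (leq_addr K N))) // (leq_ltn_trans jN) // ltn_expl.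
Qed.

Let nc_w k zeta : nc (w_ k zeta) = 2^-1 ^+ k.+1 * nc zeta.
Proof. by rewrite /w_ ncM halfC nc_real ger0_norm // exprn_ge0 // invr_ge0. Qed.

(* [nc x < 1] or [nc x = 1] both occur, according to [Im z]. *)
Let nc_ez_le1 (u : C) : 0 <= complex.Im u -> nc (ez u) <= 1.
Proof. by move=> h; rewrite nc_ez -expR0 ler_expR oppr_le0 !mulr_ge0 // pi_ge0. Qed.

(** In [doubling_centered] each scaled term tends to [1/(z+j)^2] and, by [lb], is dominated by a
    constant times [1/(j+1)^2] as soon as [k >= K]; [tannery] passes to the limit. *)
Lemma lipschitz_sum :
  [/\ asummable (fun j => ((z + j%:R) ^+ 2)^-1), asummable (fun j => ((z - j.+1%:R) ^+ 2)^-1) &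
      lipA z = usum (fun j => ((z + j%:R) ^+ 2)^-1) + usum (fun j => ((z - j.+1%:R) ^+ 2)^-1)].
Proof.
have [c cp [K1 hK1]] := lb; have [K2 hK2] := w_dom; pose K := maxn K1 K2.
have bound k (t : R) : (K <= k)%N -> `|t| <= 2 ^+ k -> 0 < nc (z + t%:C%C) ->
    nc (TA k (z + t%:C%C)) <= nc tpi ^+ 2 / c ^+ 2 / nc (z + t%:C%C) ^+ 2.
  rewrite geq_max => /andP[k1 k2] ht zt0; have h := hK1 _ _ k1 ht; have [_ /andP[h0 _]] := hK2 _ _ k2 ht.
  rewrite /TA /lipA; have hx := nc_ez_le1 h0.
  move: (ez _) h hx => x h hx; rewrite nc_w in h.
  have a0 : 0 < (2^-1 : R) ^+ k.+1 by rewrite exprn_gt0 // invr_gt0.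
  rewrite pow4 halfC (ncM (_ ^+ 2)) (ncX _%:C%C) nc_real gtr0_norm // (ncM (tpi ^+ 2)) (ncX tpi) (ncM x) ncV (ncX (1 - x)).
  move: (2^-1 ^+ k.+1) (nc (z + _)) a0 zt0 h => a zt a0 zt0 h.
  have d0 : 0 < nc (1 - x) by apply: lt_le_trans h; rewrite !mulr_gt0.
  apply: (@le_trans _ _ (a ^+ 2 * (nc tpi ^+ 2 * (1 / (c * (a * zt)) ^+ 2)))).
    rewrite ler_wpM2l ?exprn_ge0 ?(ltW a0) // ler_wpM2l ?exprn_ge0 ?nc_ge0 // ler_pM ?nc_ge0 ?invr_ge0 ?exprn_ge0 ?nc_ge0 //.
    rewrite lef_pV2 ?posrE ?exprn_gt0 ?mulr_gt0 // lerXn2r ?nnegrE ?nc_ge0 // !mulr_ge0 // ltW //.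
  rewrite le_eqVlt; apply/orP; left; apply/eqP; field.
  by rewrite !gt_eqF.
have b1 j : nc tpi ^+ 2 / c ^+ 2 / nc (z + j%:R) ^+ 2 <= nc tpi ^+ 2 / c ^+ 2 / c0 ^+ 2 * (j.+1%:R ^+ 2)^-1.
  rewrite -[leRHS]mulrA -invfM -exprMn ler_wpM2l ?divr_ge0 ?exprn_ge0 ?nc_ge0 ?(ltW cp) //.
  by rewrite lef_pV2 ?posrE ?exprn_gt0 ?mulr_gt0 // lerXn2r ?nnegrE ?nc_ge0 // mulr_ge0 // ltW.
have b2 j : nc tpi ^+ 2 / c ^+ 2 / nc (z - j.+1%:R) ^+ 2 <= nc tpi ^+ 2 / c ^+ 2 / c0 ^+ 2 * (j.+1%:R ^+ 2)^-1.
  rewrite -[leRHS]mulrA -invfM -exprMn ler_wpM2l ?divr_ge0 ?exprn_ge0 ?nc_ge0 ?(ltW cp) //.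
  by rewrite lef_pV2 ?posrE ?exprn_gt0 ?mulr_gt0 // lerXn2r ?nnegrE ?nc_ge0 // mulr_ge0 // ltW.
have KK0 : 0 <= nc tpi ^+ 2 / c ^+ 2 / c0 ^+ 2 by rewrite !divr_ge0 ?exprn_ge0 ?nc_ge0 // ltW.
have sb := rsummableZ KK0 rsummable_inv_sqr.
have bb0 j : 0 <= nc tpi ^+ 2 / c ^+ 2 / c0 ^+ 2 * (j.+1%:R ^+ 2)^-1.
  by rewrite mulr_ge0 // invr_ge0 exprn_ge0.
have nz1 j : z + j%:R != 0 by rewrite -nc_gt0.
have nz2 j : z - j.+1%:R != 0 by rewrite -nc_gt0.
have Fb1 N j : nc (if (j < 2 ^ (N + K))%N then TA (N + K) (z + j%:R) else 0) <=
    nc tpi ^+ 2 / c ^+ 2 / c0 ^+ 2 * (j.+1%:R ^+ 2)^-1.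
  case: ifP => [jN|_]; last by rewrite nc0.
  have := bound _ _ (leq_addl N K) (le_pow (ltnW jN)); rewrite -sjC => h.
  exact: le_trans (h (zP0 j)) (b1 j).
have Fb2 N j : nc (if (j < 2 ^ (N + K))%N then TA (N + K) (z - j.+1%:R) else 0) <=
    nc tpi ^+ 2 / c ^+ 2 / c0 ^+ 2 * (j.+1%:R ^+ 2)^-1.
  case: ifP => [jN|_]; last by rewrite nc0.
  have tn : `|- j.+1%:R : R| <= 2 ^+ (N + K) by rewrite normrN; exact: le_pow.
  have := bound _ _ (leq_addl N K) tn; rewrite -siC => h.
  exact: le_trans (h (zN0 j)) (b2 j).
have Ff1 j : (fun N => if (j < 2 ^ (N + K))%N then TA (N + K) (z + j%:R) else 0) @ \oo --> ((z + j%:R) ^+ 2)^-1.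
  by apply: (if_cvg (f := fun k => TA k (z + j%:R))); exact: TA_cvg.
have Ff2 j : (fun N => if (j < 2 ^ (N + K))%N then TA (N + K) (z - j.+1%:R) else 0) @ \oo --> ((z - j.+1%:R) ^+ 2)^-1.
  by apply: (if_cvg (f := fun k => TA k (z - j.+1%:R))); exact: TA_cvg.
have [s1 t1] := tannery sb Fb1 Ff1; have [s2 t2] := tannery sb Fb2 Ff2.
split; [exact: s1|exact: s2|]; have c3 := cseqD t1 t2.
apply: cseq_unique (cseq_cst (l := lipA z)) _.
apply: cseq_ext c3 => N; rewrite !usum_trunc.
by rewrite (doubling_centered lipA_double lipA_periodic (N + K) z1) mulrDr !mulr_sumr.
Qed.

Let nc_TB k (t : R) c : 0 < c -> 0 <= complex.Im (w_ k (z + t%:C%C)) ->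
  c * nc (w_ k (z + t%:C%C)) <= nc (1 - ez (w_ k (z + t%:C%C))) -> 0 < nc (z + t%:C%C) ->
  nc (TB k (z + t%:C%C)) <= nc tpi / c / nc (z + t%:C%C).
Proof.
move=> cp h0 h zt0; rewrite /TB /cotB; have hx := nc_ez_le1 h0.
move: (ez _) h hx => x h hx; rewrite nc_w in h.
have a0 : 0 < (2^-1 : R) ^+ k.+1 by rewrite exprn_gt0 // invr_gt0.
rewrite halfC ncM nc_real gtr0_norm // !ncM !ncV nc_nat nc_distC.
move: (2^-1 ^+ k.+1) (nc (z + _)) a0 zt0 h => a zt a0 zt0 h.
have d0 : 0 < nc (1 - x) by apply: lt_le_trans h; rewrite !mulr_gt0.
apply: (@le_trans _ _ (a * (nc tpi / 2 * (2 * (c * (a * zt))^-1)))).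
  rewrite ler_wpM2l ?(ltW a0) // ler_wpM2l ?divr_ge0 ?nc_ge0 // ler_pM ?nc_ge0 ?invr_ge0 ?nc_ge0 //.
    by apply: le_trans (ncD _ _) _; rewrite nc1; move: hx; lra.
  by rewrite lef_pV2 ?posrE ?mulr_gt0.
rewrite le_eqVlt; apply/orP; left; apply/eqP; field.
by rewrite !gt_eqF.
Qed.

(** Single terms decay only like [1/i], so [z + i] and [z - i] are taken together. With [x] and [y]
    their scaled exponentials, the pair is proportional to [(x y - 1)/((x - 1)(y - 1))]; as
    [x y = ez (w_ k (z + z))] is within [O(2^-k)] of 1, the scaled pair is [O(1/i^2)]. *)
Lemma cot_expansion :
  asummable (fun i => (z + i.+1%:R)^-1 + (z - i.+1%:R)^-1) /\
  cotB z = z^-1 + usum (fun i => (z + i.+1%:R)^-1 + (z - i.+1%:R)^-1).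
Proof.
have [c cp [K1 hK1]] := lb; have [K2 hK2] := w_dom.
have [p [p1 p3]] := ez_quot; have [d d0 hd] := p3 _ ltr01.
have [K3 hK3] := @w_small (z + z) d d0.
pose K := maxn K1 (maxn K2 K3); pose M := nc tpi + 1.
have M0 : 0 <= M by rewrite addr_ge0 ?nc_ge0.
have hM u : nc u < d -> nc (p u) <= M.
  by move=> /hd h; rewrite -[p u](subrK tpi) (le_trans (ncD _ _)) // addrC lerD2l ltW.
pose L := nc tpi * M * (2 * nc z) / c ^+ 2.
have L0 : 0 <= L by rewrite divr_ge0 ?mulr_ge0 ?nc_ge0 // ltW.
have pair k i : (K <= k)%N -> (i < 2 ^ k)%N ->
    nc (TB k (z + i.+1%:R) + TB k (z - i.+1%:R)) <= L / c0 ^+ 2 * (i.+1%:R ^+ 2)^-1.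
  rewrite !geq_max => /and3P[k1 k2 k3] ik.
  have tp := le_pow ik; have tn : `|- i.+1%:R : R| <= 2 ^+ k by rewrite normrN.
  have := hK1 _ _ k1 tp; have := hK1 _ _ k1 tn; rewrite -siC -sjC !nc_w.
  have exy : ez (w_ k (z + i.+1%:R)) * ez (w_ k (z - i.+1%:R)) = 1 + p (w_ k (z + z)) * w_ k (z + z).
    by rewrite -p1 -ezD; congr ez; rewrite /w_ -mulrDr; congr (_ * _); ring.
  have hu := hM _ (hK3 _ k3); have eu := nc_w k (z + z).
  have z2 : nc (z + z) <= 2 * nc z by rewrite mulr_natl mulr2n ncD.
  have b1 := hP i.+1; have b2 := hN i.
  have a0 : 0 < (2^-1 : R) ^+ k.+1 by rewrite exprn_gt0 // invr_gt0.
  have q1 := zP0 i.+1; have q2 := zN0 i.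
  rewrite /TB /cotB; move: exy hu eu.
  move: (w_ k (z + z)) (ez (w_ k (z + i.+1%:R))) (ez (w_ k (z - i.+1%:R))) => u x y exy hu eu h2 h1.
  have x1 : 0 < nc (1 - x) by apply: lt_le_trans h1; rewrite !mulr_gt0.
  have y1 : 0 < nc (1 - y) by apply: lt_le_trans h2; rewrite !mulr_gt0.
  have x1' : x - 1 != 0 by rewrite -nc_gt0 nc_distC.
  have y1' : y - 1 != 0 by rewrite -nc_gt0 nc_distC.
  have -> : 2^-1 ^+ k.+1 * (tpi / 2 * ((x + 1) / (x - 1))) + 2^-1 ^+ k.+1 * (tpi / 2 * ((y + 1) / (y - 1))) =
      2^-1 ^+ k.+1 * (tpi * ((p u * u) / ((x - 1) * (y - 1)))).
    have -> : p u * u = x * y - 1 by rewrite exy addrC addKr.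
    move: (2^-1 ^+ k.+1) (tpi) => a t; field; by rewrite x1' y1'.
  rewrite halfC ncM nc_real gtr0_norm // (ncM tpi) (ncM (p u * u)) ncV (ncM (p u)) (ncM (x - 1)) (nc_distC x) (nc_distC y) eu.
  move: (2^-1 ^+ k.+1) a0 h1 h2 => a a0 h1 h2.
  apply: (@le_trans _ _ (a * (nc tpi * ((M * (a * (2 * nc z))) / ((c * (a * nc (z + i.+1%:R))) * (c * (a * nc (z - i.+1%:R)))))))).
    rewrite ler_wpM2l ?(ltW a0) // ler_wpM2l ?nc_ge0 // ler_pM ?mulr_ge0 ?invr_ge0 ?mulr_ge0 ?nc_ge0 ?(ltW a0) //.
      apply: ler_pM => //; rewrite ?nc_ge0 ?mulr_ge0 ?nc_ge0 ?(ltW a0) //.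
      by rewrite ler_wpM2l // ltW.
    rewrite lef_pV2 ?posrE ?mulr_gt0 // ler_pM ?mulr_ge0 ?nc_ge0 ?(ltW a0) ?(ltW cp) //.
  apply: (@le_trans _ _ (L * (nc (z + i.+1%:R) * nc (z - i.+1%:R))^-1)).
    rewrite le_eqVlt; apply/orP; left; apply/eqP; rewrite /L.
    move: (nc (z + _)) (nc (z - _)) q1 q2 => g1 g2 q1 q2; field; by rewrite !gt_eqF.
  rewrite -[leRHS]mulrA -invfM -exprMn ler_wpM2l // lef_pV2 ?posrE ?exprn_gt0 ?mulr_gt0 //.
  rewrite expr2 ler_pM ?mulr_ge0 ?(ltW c00) //; apply: le_trans b1.
  by rewrite ler_wpM2l ?(ltW c00) // ler_nat.
have sb : rsummable (fun i => L / c0 ^+ 2 * (i.+1%:R ^+ 2)^-1).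
  by apply: rsummableZ rsummable_inv_sqr; rewrite divr_ge0 // exprn_ge0 // ltW.
have nz1 i : z + i%:R != 0 by rewrite -nc_gt0.
have nz2 i : z - i.+1%:R != 0 by rewrite -nc_gt0.
have Fb N i : nc (if (i < 2 ^ (N + K))%N then TB (N + K) (z + i.+1%:R) + TB (N + K) (z - i.+1%:R) else 0)
    <= L / c0 ^+ 2 * (i.+1%:R ^+ 2)^-1.
  case: ifP => [h|_]; first exact: pair (leq_addl _ _) h.
  rewrite nc0; apply: mulr_ge0; last by rewrite invr_ge0 exprn_ge0.
  by apply: divr_ge0 => //; rewrite exprn_ge0 // ltW.
have Ff i : (fun N => if (i < 2 ^ (N + K))%N then TB (N + K) (z + i.+1%:R) + TB (N + K) (z - i.+1%:R) else 0)
    @ \oo --> (z + i.+1%:R)^-1 + (z - i.+1%:R)^-1.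
  by apply: (if_cvg (f := fun k => TB k (z + i.+1%:R) + TB k (z - i.+1%:R))); exact: cseqD (TB_cvg (nz1 _)) (TB_cvg (nz2 _)).
have [s1 t1] := tannery sb Fb Ff; split => //.
have z0 : z != 0 by have := nz1 0%N; rewrite addr0.
have t0 := cseq_sub (f := fun N => (N + K)%N) (leq_addr K) (TB_cvg z0).
(* The centred sum runs from [-2^k] to [2^k - 1]; completing the pairs adds one term at [z + 2^k],
   which tends to 0. *)
have last0 : (fun N => TB (N + K) (z + (2 ^ (N + K))%:R)) @ \oo --> (0 : C).
  apply: (cvg_nc0 (b := fun N => nc tpi / c / c0 * 2^-1 ^+ N)) => [N|]; last first.
    rewrite -[X in _ --> X](mulr0 (nc tpi / c / c0)); apply: cvgMr; apply: cvg_expr.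
    by rewrite ger0_norm ?invr_ge0 // invf_lt1 // ltr1n.
  rewrite subr0; set k := (N + K)%N; have tp := le_pow (leqnn (2 ^ k)).
  have Kk : (K <= k)%N by exact: leq_addl.
  have [k1 k2] : (K1 <= k)%N /\ (K2 <= k)%N by move: Kk; rewrite !geq_max => /and3P[].
  have [_ /andP[h0 _]] := hK2 _ _ k2 tp.
  have := nc_TB cp h0 (hK1 _ _ k1 tp); rewrite -sjC => h; apply: le_trans (h (zP0 _)) _.
  rewrite -[leRHS]mulrA ler_wpM2l ?divr_ge0 ?nc_ge0 ?(ltW cp) // exprVn -invfM lef_pV2 ?posrE ?mulr_gt0 ?exprn_gt0 //.
  apply: le_trans (hP _); rewrite ler_wpM2l ?(ltW c00) // -natrX ler_nat.
  by rewrite ltnW // ltnS leq_pexp2l // leq_addr.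
apply: cseq_unique (cseq_cst (l := cotB z)) _.
have := cseqB (cseqD t0 t1) last0; rewrite subr0; apply: cseq_ext => N.
have hc : cotB z = \sum_(0 <= j < 2 ^ (N + K)) TB (N + K) (z + j%:R) +
    \sum_(0 <= j < 2 ^ (N + K)) TB (N + K) (z - j.+1%:R).
  by rewrite {1}(doubling_centered cotB_double cotB_periodic (N + K) z1) mulrDr !mulr_sumr.
rewrite usum_trunc hc big_split /=.
have e2 : \sum_(0 <= j < (2 ^ (N + K)).+1) TB (N + K) (z + j%:R) =
   TB (N + K) (z + 0%:R) + \sum_(0 <= j < 2 ^ (N + K)) TB (N + K) (z + j.+1%:R).
  by rewrite big_nat_recl.
have e3 : \sum_(0 <= j < (2 ^ (N + K)).+1) TB (N + K) (z + j%:R) =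
   \sum_(0 <= j < 2 ^ (N + K)) TB (N + K) (z + j%:R) + TB (N + K) (z + (2 ^ (N + K))%:R).
  by rewrite big_nat_recr.
rewrite e3 addr0 in e2.
have {e2}-> : \sum_(0 <= i < 2 ^ (N + K)) TB (N + K) (z + i.+1%:R) =
   \sum_(0 <= j < 2 ^ (N + K)) TB (N + K) (z + j%:R) + TB (N + K) (z + (2 ^ (N + K))%:R) - TB (N + K) z.
  by rewrite e2 [RHS]addrC addKr.
move: (\sum_(0 <= _ < _) _) (\sum_(0 <= _ < _) _) (TB _ _) (TB _ _) => a b e f; ring.
Qed.

End Point.

(** At [z = 1/2] the expansion of [lipA] is eight times the sum over odd squares, which is 3/4 of
    the whole sum. The value is [pi^2/6], written with [2 pi i]. *)
Lemma zeta2 : usum (fun n => (n.+1%:R ^+ 2)^-1 : C) = - (tpi ^+ 2 / 24).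
Proof.
have r1 j : (2^-1 + j%:R : C) = (2^-1 + j%:R : R)%:C%C by rewrite rmorphD fmorphV !rmorph_nat.
have r2 j : (2^-1 - j.+1%:R : C) = (- (2^-1 + j%:R) : R)%:C%C.
  by rewrite rmorphN rmorphD fmorphV !rmorph_nat -(natr1 j); field.
have nr j : nc (2^-1 + j%:R : C) = 2^-1 + j%:R.
  by rewrite r1 nc_real ger0_norm // addr_ge0 // invr_ge0.
have nr2 j : nc (2^-1 - j.+1%:R : C) = 2^-1 + j%:R.
  by rewrite r2 nc_real normrN ger0_norm // addr_ge0 // invr_ge0.
have hb (j : nat) : 2^-1 * j.+1%:R <= 2^-1 + j%:R :> R.
  by rewrite -(natr1 j); have : 0 <= j%:R :> R by []; lra.
have i0 : 0 <= complex.Im (2^-1 : C).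
  by have := r1 0%N; rewrite !addr0 => ->.
have e1 : ez (2^-1 : C) != 1.
  by rewrite ez_half eq_sym -subr_eq0 opprK (_ : 1 + 1 = 2%:R) ?pnatr_eq0.
have c0 : 0 < 2^-1 :> R by rewrite invr_gt0.
have b1 j : 2^-1 * j.+1%:R <= nc (2^-1 + j%:R : C) by rewrite nr.
have b2 j : 2^-1 * j.+1%:R <= nc (2^-1 - j.+1%:R : C) by rewrite nr2.
have [s1 _] := lipschitz_sum c0 i0 e1 b1 b2.
have e2 j : (2^-1 - j.+1%:R : C) = - (2^-1 + j%:R) by rewrite r2 r1 rmorphN.
have -> : (fun j => ((2^-1 - j.+1%:R : C) ^+ 2)^-1) = (fun j => ((2^-1 + j%:R) ^+ 2)^-1).
  by apply/funext => j; rewrite e2 sqrrN.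
have sf : asummable (fun n => (n%:R ^+ 2)^-1 : C).
  apply: (@rsummable_shift R 1) => [n|]; first exact: nc_ge0.
  by apply: rsummable_le rsummable_inv_sqr => n /=; rewrite ncV ncX nc_nat addn1.
have [p1 p2 p3] := usum_parity sf.
have -> : usum (fun n => (n.+1%:R ^+ 2)^-1 : C) = usum (fun n => (n%:R ^+ 2)^-1 : C).
  by rewrite (usum_recl sf) expr0n /= invr0 add0r.
have q1 : usum (fun k => (k.*2%:R ^+ 2)^-1 : C) = 4^-1 * usum (fun n => (n%:R ^+ 2)^-1 : C).
  rewrite -(usumZ 4^-1 sf); apply: eq_usum => n; rewrite -invfM; congr (_^-1).
  by rewrite -mul2n natrM exprMn; congr (_ * _); rewrite -natrX.
have q2 : usum (fun j => ((2^-1 + j%:R) ^+ 2)^-1 : C) = 4 * usum (fun k => (k.*2.+1%:R ^+ 2)^-1 : C).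
  rewrite -(usumZ 4 p2); apply: eq_usum => n.
  have -> : 2^-1 + n%:R = 2^-1 * n.*2.+1%:R :> C.
    by rewrite -(natr1 n.*2) -mul2n natrM; field.
  by rewrite exprMn invfM; congr (_ * _); rewrite exprVn invrK -natrX.
rewrite q2 /lipA ez_half => e3; rewrite q1 in p3.
move: (usum _) (usum _) e3 p3 => a b e3 p3.
have -> : a = 4 / 3 * (a - 4^-1 * a) by field.
rewrite {1}p3 addrC addKr.
have -> : b = 8^-1 * (4 * b + 4 * b) by field.
by rewrite -e3 opprK; field.
Qed.

End LatticeSeries.

(** * The weight 2 Eisenstein series under inversion *)

Section EisensteinTwo.
Variable R : realType.
Local Notation C := (Cplx R).
Local Notation nc := (@normc R).
Local Notation tpi := ((0 +i* (2 * pi))%C : C).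

Lemma im_inv (z : C) : 0 < complex.Im z -> 0 < complex.Im (- z^-1).
Proof.
case: z => a b /= b0; rewrite opprK divr_gt0 //.
by rewrite ltr_wpDl ?sqr_ge0 // exprn_gt0.
Qed.

Lemma im_neq0 (z : C) : 0 < complex.Im z -> z != 0.
Proof. by apply: contraTneq => ->; rewrite ltxx. Qed.

Lemma im_natmul (z : C) m : 0 < complex.Im z -> 0 < complex.Im (m.+1%:R * z).
Proof. by move=> z0; rewrite natC ImZ mulr_gt0. Qed.

Lemma ez_neq1 (z : C) : 0 < complex.Im z -> ez z != 1.
Proof. by move=> /nc_ez_lt1; apply: contraTneq => ->; rewrite nc1 ltxx. Qed.

Lemma lipA_summable (z : C) : 0 < complex.Im z -> asummable (fun m => lipA (m.+1%:R * z)).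
Proof.
move=> z0; have r1 := nc_ez_lt1 z0; have r01 : 0 <= nc (ez z) < 1 by rewrite nc_ge0.
have d0 : 0 < 1 - nc (ez z) by rewrite subr_gt0.
have K0 : 0 <= nc tpi ^+ 2 / (1 - nc (ez z)) ^+ 2.
  by rewrite divr_ge0 ?exprn_ge0 ?nc_ge0 // ltW.
apply: (asummable_le _ (rsummable_geo K0 r01)) => m.
rewrite /lipA ez_nat (ncM (tpi ^+ 2)) (ncX tpi) (ncM (_ ^+ m.+1)) ncV (ncX (1 - _)) (ncX (ez z)).
rewrite -[leRHS]mulrA ler_wpM2l ?exprn_ge0 ?nc_ge0 // [leLHS]mulrC ler_pM ?invr_ge0 ?exprn_ge0 ?nc_ge0 //.
  rewrite lef_pV2 ?posrE ?exprn_gt0 //; last first.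
    by rewrite nc_gt0 one_sub_neq0 // nc_expr_lt1.
  rewrite lerXn2r ?nnegrE ?nc_ge0 ?(ltW d0) //.
  have := nc_dist_ge 1 (ez z ^+ m.+1); rewrite nc1 ncX => h; apply: le_trans h.
  by rewrite lerD2l lerN2 exprS ler_piMr ?nc_ge0 // exprn_ile1 ?nc_ge0 // ltW.
by rewrite exprS ler_piMl ?exprn_ge0 ?nc_ge0 // ltW.
Qed.

Variable z : C.
Hypothesis z0 : 0 < complex.Im z.

Let zn0 : z != 0. Proof. exact: im_neq0. Qed.
Let ncz0 : 0 < nc z. Proof. by rewrite nc_gt0. Qed.

(** The imaginary part of [m z + b] controls [m]; the triangle inequality then controls [b]. *)
Let lattice : exists2 c : R, 0 < c & forall (m : nat) (b : R),
  c * (m%:R + `|b|) <= nc (m%:R * z + b%:C%C).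
Proof.
pose y := complex.Im z; have y0 : 0 < y := z0; pose D := y^-1 + 1 + nc z / y.
have D0 : 0 < D by rewrite /D !addr_gt0 ?divr_gt0 ?invr_gt0.
exists D^-1 => [|m b]; first by rewrite invr_gt0.
rewrite mulrC ler_pdivrMr //; set X := nc _.
have h1 : m%:R * y <= X.
  apply: le_trans (nc_Im _); rewrite ImD natC ImZ /= addr0; exact: ler_norm.
have h2 : `|b| <= X + m%:R * nc z.
  rewrite -nc_real -[b%:C%C](addKr (m%:R * z)) addrC (le_trans (ncB _ _)) //.
  by rewrite lerD2l ncM nc_nat.
have h3 : m%:R <= X / y by rewrite ler_pdivlMr.
have h4 : m%:R * nc z <= X / y * nc z by rewrite ler_wpM2r // ltW.
rewrite /D !mulrDr mulr1 mulrA; rewrite mulrAC in h4.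
by move: h1 h2 h3 h4; rewrite [X * nc z / y]mulrAC; lra.
Qed.

Let g m n : C := ((m.+1%:R * z + n.+1%:R) ^+ 2)^-1 + ((m.+1%:R * z - n.+1%:R) ^+ 2)^-1.
Let uu m (s : R) : C := (m.+1%:R * z + s%:C%C)^-1 - (m.+1%:R * z - s%:C%C)^-1.
Let sR n : R := n%:R + 2^-1.
(** A telescoping approximation of [g]: for each of its two terms [1/d^2] it contains
    [1/(d - 1/2) - 1/(d + 1/2)]. The difference is of fourth order in [1/d], so [gt] is absolutely
    summable, and rows and columns of [g] can differ only through [tau]. *)
Let tau m n : C := uu m (sR n) - uu m (sR n.+1).
Let gt m n : C := g m n - tau m n.

Let negC (s : R) : - (s%:C%C) = (- s)%:C%C :> C. Proof. by rewrite rmorphN. Qed.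
Let s0 n : 2^-1 <= sR n. Proof. by rewrite lerDr. Qed.
Let s0' n : 0 < sR n. Proof. by apply: lt_le_trans (s0 n); rewrite invr_gt0. Qed.

Let g_row m : asummable (g m) /\ lipA (m.+1%:R * z) = ((m.+1%:R * z) ^+ 2)^-1 + usum (g m).
Proof.
have [c c0 hc] := lattice; have mz0 := im_natmul m z0.
have b1 j : c * j.+1%:R <= nc (m.+1%:R * z + j%:R).
  rewrite [X in _ + X]natC; apply: le_trans (hc _ _); rewrite ler_wpM2l ?(ltW c0) //.
  by rewrite ger0_norm // -natrD ler_nat addSn ltnS leq_addl.
have b2 j : c * j.+1%:R <= nc (m.+1%:R * z - j.+1%:R).
  rewrite [X in _ - X]natC negC; apply: le_trans (hc _ _); rewrite ler_wpM2l ?(ltW c0) //.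
  by rewrite normrN ger0_norm // lerDr.
have [s1 s2 ->] := lipschitz_sum c0 (ltW mz0) (ez_neq1 mz0) b1 b2.
have s1' := asummable_inj succn_inj s1.
split; first exact: asummableD.
rewrite (usum_recl s1) addr0 -addrA; congr (_ + _); rewrite /g.
by rewrite (usumD s1' s2).
Qed.

(** For fixed [n], the bases [m z + n] and [m z - n] are, up to sign, [z] times integer translates
    of [-n/z]; the column is the lattice series of [lipA] at that point. *)
Let g_col n : asummable (fun m => g m n) /\
  lipA (n.+1%:R * - z^-1) = z ^+ 2 * (n.+1%:R ^+ 2)^-1 + z ^+ 2 * usum (fun m => g m n).
Proof.
have [c c0 hc] := lattice; have mz0 := im_natmul n (im_inv z0).
have c1 : 0 < c / nc z by rewrite divr_gt0.
have e1 j : n.+1%:R * - z^-1 + j%:R = (j%:R * z - n.+1%:R) / z.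
  by move: (n.+1%:R : C) (j%:R : C) => a b; field.
have e2 j : n.+1%:R * - z^-1 - j.+1%:R = - (j.+1%:R * z + n.+1%:R) / z.
  by move: (n.+1%:R : C) (j.+1%:R : C) => a b; field.
have b1 j : c / nc z * j.+1%:R <= nc (n.+1%:R * - z^-1 + j%:R).
  rewrite e1 (ncM (_ - _)) ncV mulrAC ler_pM2r ?invr_gt0 // [X in _ - X]natC negC.
  apply: le_trans (hc _ _); rewrite ler_wpM2l ?(ltW c0) // normrN ger0_norm //.
  by rewrite -natrD ler_nat addnS ltnS leq_addr.
have b2 j : c / nc z * j.+1%:R <= nc (n.+1%:R * - z^-1 - j.+1%:R).
  rewrite e2 (ncM (- _)) ncN ncV mulrAC ler_pM2r ?invr_gt0 // [X in _ + X]natC.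
  by apply: le_trans (hc _ _); rewrite ler_wpM2l ?(ltW c0) // ger0_norm // lerDl.
have [s1 s2 ->] := lipschitz_sum c1 (ltW mz0) (ez_neq1 mz0) b1 b2.
have s1' := asummable_inj succn_inj s1; have sD := asummableD s1' s2.
have eg m : z ^+ 2 * g m n = ((n.+1%:R * - z^-1 + m.+1%:R) ^+ 2)^-1 + ((n.+1%:R * - z^-1 - m.+1%:R) ^+ 2)^-1.
  rewrite e1 e2 mulNr sqrrN !expr_div_n !invf_div /g addrC mulrDr.
  by rewrite addrC.
have sg : asummable (fun m => g m n).
  have h := asummableZ (z ^+ 2)^-1 sD; apply: (asummable_le _ h) => m /=.
  by rewrite -eg mulKf // expf_neq0.
split => //; rewrite (usum_recl s1) -addrA; congr (_ + _).
  by rewrite addr0 mulrN sqrrN exprMn exprVn invfM invrK mulrC.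
rewrite -(usumD s1' s2) -(usumZ (z ^+ 2) sg); apply: eq_usum => m.
by rewrite eg.
Qed.

Let half_bound (d : C) (B : R) : 0 < B -> B <= nc d -> B <= nc (d - 2^-1) -> B <= nc (d + 2^-1) ->
  nc ((d ^+ 2)^-1 - ((d - 2^-1)^-1 - (d + 2^-1)^-1)) <= (B ^+ 4)^-1.
Proof.
move=> B0 h1 h2 h3.
have d1 : d != 0 by rewrite -nc_gt0 (lt_le_trans B0).
have d2 : d - 2^-1 != 0 by rewrite -nc_gt0 (lt_le_trans B0).
have d3 : d + 2^-1 != 0 by rewrite -nc_gt0 (lt_le_trans B0).
have -> : (d ^+ 2)^-1 - ((d - 2^-1)^-1 - (d + 2^-1)^-1) = - 4^-1 / (d * d * ((d - 2^-1) * (d + 2^-1))).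
  move: d2 d3; rewrite -(mulrI_eq0 _ (mulfI (_ : (2 : C) != 0))) ?pnatr_eq0 // => d2.
  rewrite -(mulrI_eq0 _ (mulfI (_ : (2 : C) != 0))) ?pnatr_eq0 // => d3.
  rewrite mulrBr mulfV ?pnatr_eq0 // in d2; rewrite mulrDr mulfV ?pnatr_eq0 // in d3.
  have -> : d - 2^-1 = (2 * d - 1) / 2 by field.
  have -> : d + 2^-1 = (2 * d + 1) / 2 by field.
  by field; rewrite d1 d2 d3.
rewrite ncM ncN ncV nc_nat ncV; apply: (@le_trans _ _ (1 * (B ^+ 4)^-1)); last by rewrite mul1r.
apply: ler_pM; rewrite ?invr_ge0 ?nc_ge0 //; first by rewrite invf_le1 // ler1n.
have BB : 0 <= B * B by rewrite mulr_ge0 // ltW.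
rewrite lef_pV2 ?posrE ?exprn_gt0 ?nc_gt0 ?mulf_neq0 //.
rewrite (_ : B ^+ 4 = B * B * (B * B)); last by ring.
rewrite (ncM (d * d)) (ncM d) (ncM (d - _)); apply: ler_pM => //; by apply: ler_pM => //; exact: ltW.
Qed.

Let gt_bound : exists2 K : R, 0 <= K & forall m n,
  nc (gt m n) <= K * ((m.+1%:R ^+ 2)^-1 * (n.+1%:R ^+ 2)^-1).
Proof.
have [c c0 hc] := lattice; exists (2 * ((c / 2) ^+ 4)^-1) => [|m n].
  by rewrite mulr_ge0 // invr_ge0 exprn_ge0 // divr_ge0 // ltW.
have N1 : 1 <= n.+1%:R :> R by rewrite ler1n.
have M1 : 1 <= m.+1%:R :> R by rewrite ler1n.
pose B := c / 2 * (m.+1%:R + n.+1%:R).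
have B0 : 0 < B by rewrite mulr_gt0 ?divr_gt0 ?addr_gt0.
have hb (b : R) : (m.+1%:R + n.+1%:R) / 2 <= m.+1%:R + `|b| -> B <= nc (m.+1%:R * z + b%:C%C).
  move=> h; apply: le_trans (hc _ _); rewrite /B -mulrA (mulrC 2^-1).
  by rewrite ler_wpM2l // ltW.
have hC : (2^-1 : C) = (2^-1 : R)%:C%C by rewrite fmorphV rmorph_nat.
have sE (k : nat) : (sR k : R)%:C%C = k%:R + 2^-1 :> C by rewrite rmorphD rmorph_nat fmorphV rmorph_nat.
have e1 : m.+1%:R * z + (sR n)%:C%C = (m.+1%:R * z + n.+1%:R) - 2^-1.
  by rewrite sE -(natr1 n); field.
have e2 : m.+1%:R * z + (sR n.+1)%:C%C = (m.+1%:R * z + n.+1%:R) + 2^-1.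
  by rewrite sE addrA.
have e3 : m.+1%:R * z - (sR n)%:C%C = (m.+1%:R * z - n.+1%:R) + 2^-1.
  by rewrite sE -(natr1 n); field.
have e4 : m.+1%:R * z - (sR n.+1)%:C%C = (m.+1%:R * z - n.+1%:R) - 2^-1.
  by rewrite sE opprD addrA.
have k1 : B <= nc (m.+1%:R * z + (sR n)%:C%C).
  apply: hb; rewrite ger0_norm ?(ltW (s0' n)) // /sR; move: N1; rewrite -(natr1 n); lra.
have k2 : B <= nc (m.+1%:R * z + (sR n.+1)%:C%C).
  by apply: hb; rewrite ger0_norm ?(ltW (s0' _)) // /sR; lra.
have k3 : B <= nc (m.+1%:R * z - (sR n)%:C%C).
  rewrite negC; apply: hb; rewrite normrN ger0_norm ?(ltW (s0' n)) // /sR; move: N1; rewrite -(natr1 n); lra.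
have k4 : B <= nc (m.+1%:R * z - (sR n.+1)%:C%C).
  by rewrite negC; apply: hb; rewrite normrN ger0_norm ?(ltW (s0' _)) // /sR; lra.
have k5 : B <= nc (m.+1%:R * z + n.+1%:R) by rewrite [X in _ + X]natC; apply: hb; rewrite ger0_norm //; lra.
have k6 : B <= nc (m.+1%:R * z - n.+1%:R).
  by rewrite [X in _ - X]natC negC; apply: hb; rewrite normrN ger0_norm //; lra.
rewrite e1 in k1; rewrite e2 in k2; rewrite e3 in k3; rewrite e4 in k4.
have i1 := half_bound B0 k5 k1 k2; have i2 := half_bound B0 k6 k4 k3.
have -> : gt m n =
   (((m.+1%:R * z + n.+1%:R) ^+ 2)^-1 - ((m.+1%:R * z + n.+1%:R - 2^-1)^-1 - (m.+1%:R * z + n.+1%:R + 2^-1)^-1)) +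
   (((m.+1%:R * z - n.+1%:R) ^+ 2)^-1 - ((m.+1%:R * z - n.+1%:R - 2^-1)^-1 - (m.+1%:R * z - n.+1%:R + 2^-1)^-1)).
  rewrite /gt /tau /uu /g e1 e2 e3 e4.
  move: (((m.+1%:R * z + n.+1%:R) ^+ 2)^-1) (((m.+1%:R * z - n.+1%:R) ^+ 2)^-1) (_^-1) (_^-1) (_^-1) (_^-1).
  by move=> a b d e f h; ring.
apply: le_trans (ncD _ _) _; apply: (@le_trans _ _ ((B ^+ 4)^-1 + (B ^+ 4)^-1)); first exact: lerD.
rewrite (_ : (B ^+ 4)^-1 + (B ^+ 4)^-1 = 2 * (B ^+ 4)^-1); last by ring.
rewrite -[leRHS]mulrA ler_wpM2l // -invfM -invfM.
have P0 : 0 < (c / 2) ^+ 4 by rewrite exprn_gt0 // divr_gt0.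
rewrite lef_pV2 ?posrE ?exprn_gt0 //; last by rewrite mulr_gt0 // mulr_gt0 // exprn_gt0.
rewrite /B [X in _ <= X]exprMn; apply: ler_wpM2l; first exact: ltW.
move: (m.+1%:R : R) (n.+1%:R : R) N1 M1 => x y y1 x1.
rewrite (_ : (x + y) ^+ 4 = (x + y) ^+ 2 * (x + y) ^+ 2); last by ring.
have x0 : 0 <= x by lra.
have y0 : 0 <= y by lra.
by apply: ler_pM; rewrite ?exprn_ge0 // lerXn2r ?nnegrE ?addr_ge0 ?lerDl ?lerDr.
Qed.

Let gt_summable : asummable (fun p : nat * nat => gt p.1 p.2).
Proof.
have [K K0 hK] := gt_bound.
have i0 (i : nat) : 0 <= (i.+1%:R ^+ 2)^-1 :> R by rewrite invr_ge0 exprn_ge0.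
apply: (asummable_le (b := fun p => K * ((p.1.+1%:R ^+ 2)^-1 * (p.2.+1%:R ^+ 2)^-1))) => [p|].
  exact: hK.
apply: (rsummableZ K0).
exact: (rsummable_prod i0 i0 (rsummable_inv_sqr R) (rsummable_inv_sqr R)).
Qed.

Let harm_cvg (K : R) : (fun N => K * N.+1%:R^-1 : R) @ \oo --> (0 : R).
Proof. by rewrite -[X in _ --> X](mulr0 K); apply: cvgMr; exact: cvg_harmonic. Qed.

Let sR_inv N : (sR N)^-1 <= 2 * N.+1%:R^-1.
Proof.
rewrite -[leRHS]invrK invfM invrK lef_pV2 ?posrE ?s0' ?mulr_gt0 ?invr_gt0 //.
by rewrite /sR -(natr1 N) mulrDr mulr1 lerD2r ler_piMl // invf_le1 // ler1n.
Qed.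

Let uu_cvg0 m : (fun N => uu m (sR N)) @ \oo --> (0 : C).
Proof.
have [c c0 hc] := lattice.
apply: (cvg_nc0 (b := fun N => (4 / c) * N.+1%:R^-1)) => [N|]; last exact: harm_cvg.
rewrite subr0 /uu (le_trans (ncB _ _)) // !ncV.
have cs : 0 < c * sR N by rewrite mulr_gt0.
have k1 : c * sR N <= nc (m.+1%:R * z + (sR N)%:C%C).
  by apply: le_trans (hc _ _); rewrite ler_wpM2l ?(ltW c0) // ger0_norm ?lerDr // ltW.
have k2 : c * sR N <= nc (m.+1%:R * z - (sR N)%:C%C).
  by rewrite negC; apply: le_trans (hc _ _); rewrite ler_wpM2l ?(ltW c0) // normrN ger0_norm ?lerDr // ltW.
apply: (@le_trans _ _ ((c * sR N)^-1 + (c * sR N)^-1)).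
  by apply: lerD; rewrite lef_pV2 ?posrE ?(lt_le_trans cs).
rewrite (_ : (c * sR N)^-1 + (c * sR N)^-1 = c^-1 * (2 * (sR N)^-1)); last by rewrite invfM; ring.
rewrite (_ : 4 / c * N.+1%:R^-1 = c^-1 * (2 * (2 * N.+1%:R^-1))); last by ring.
by rewrite ler_wpM2l ?invr_ge0 ?(ltW c0) // ler_wpM2l.
Qed.

Let U s : C := usum (fun m => uu m s).
Let v n : C := (sR n)%:C%C * - z^-1.

Let v_im n : 0 < complex.Im (v n). Proof. by rewrite /v ImZ mulr_gt0 // im_inv. Qed.

(** Summed over [m], the [uu m s] form the paired cotangent series at [-s/z], without its leading
    term. *)
Let U_cot n : asummable (fun m => uu m (sR n)) /\ U (sR n) = - z^-1 * (cotB (v n) - (v n)^-1).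
Proof.
have [c c0 hc] := lattice; have c1 : 0 < c / 2 / nc z by rewrite !divr_gt0.
have e1 j : v n + j%:R = (j%:R * z - (sR n)%:C%C) / z.
  by rewrite /v; move: ((sR n)%:C%C : C) (j%:R : C) => a b; field.
have e2 j : v n - j.+1%:R = - (j.+1%:R * z + (sR n)%:C%C) / z.
  by rewrite /v; move: ((sR n)%:C%C : C) (j.+1%:R : C) => a b; field.
have hs := s0 n; have hs' : 1 / 2 <= sR n by rewrite div1r.
have b1 j : c / 2 / nc z * j.+1%:R <= nc (v n + j%:R).
  rewrite e1 (ncM (_ - _)) ncV mulrAC ler_pM2r ?invr_gt0 // negC.
  apply: le_trans (hc _ _); rewrite -mulrA ler_wpM2l ?(ltW c0) // normrN ger0_norm ?(ltW (s0' n)) //.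
  by rewrite -(natr1 j); have : 0 <= j%:R :> R by []; move: hs'; lra.
have b2 j : c / 2 / nc z * j.+1%:R <= nc (v n - j.+1%:R).
  rewrite e2 (ncM (- _)) ncN ncV mulrAC ler_pM2r ?invr_gt0 //.
  apply: le_trans (hc _ _); rewrite -mulrA ler_wpM2l ?(ltW c0) // ger0_norm ?(ltW (s0' n)) //.
  have : 0 <= j.+1%:R :> R by []; move: hs'; lra.
have [s1 s2] := cot_expansion c1 (ltW (v_im n)) (ez_neq1 (v_im n)) b1 b2.
have eu m : uu m (sR n) = - z^-1 * ((v n + m.+1%:R)^-1 + (v n - m.+1%:R)^-1).
  rewrite e1 e2 !invf_div invrN /uu.
  move: ((m.+1%:R * z + (sR n)%:C%C)^-1) ((m.+1%:R * z - (sR n)%:C%C)^-1) => a b.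
  by move: zn0 => h; field.
have su : asummable (fun m => uu m (sR n)).
  by apply: (asummable_le _ (asummableZ (- z^-1) s1)) => m /=; rewrite eu.
split=> //; rewrite /U s2 addrAC subrr add0r -(usumZ (- z^-1) s1); apply: eq_usum => m.
exact: eu.
Qed.

(** The imaginary part of [v N] goes to infinity, so [ez (v N)] tends to 0 and [cotB (v N)] to
    [- pi i]. This limit is the anomaly of the weight 2 series. *)
Let U_cvg : (fun N => U (sR N)) @ \oo --> tpi / (2 * z).
Proof.
have ev N : ez (v N) = ez (- z^-1) ^+ N * ez (2^-1 * - z^-1).
  rewrite -ez_nat -ezD /v; congr ez; rewrite rmorphD rmorph_nat fmorphV rmorph_nat.
  by rewrite mulrDl.
have x0 : (fun N => ez (v N)) @ \oo --> (0 : C).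
  rewrite -[X in _ --> X](mul0r (ez (2^-1 * - z^-1))).
  apply: cseq_ext (fun N => esym (ev N)) _; apply: cseqM (cseq_cst (l := _)).
  by apply: cvg_expr0; exact: nc_ez_lt1 (im_inv z0).
have i0 : (fun N => (v N)^-1) @ \oo --> (0 : C).
  apply: (cvg_nc0 (b := fun N => (nc z * 2) * N.+1%:R^-1)) => [N|]; last exact: harm_cvg.
  rewrite subr0 /v ncV ncM ncN ncV nc_real gtr0_norm ?s0' // invfM invrK mulrC -mulrA.
  by rewrite ler_wpM2l ?nc_ge0.
have n1 : (0 - 1 : C) != 0 by rewrite sub0r oppr_eq0 oner_eq0.
have c1 : (fun N => cotB (v N)) @ \oo --> tpi / 2 * ((0 + 1) / (0 - 1)).
  apply: cseqZ; apply: cseqM; first exact: cseqD x0 (cseq_cst (l := 1)).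
  by apply: (cseqV n1); exact: cseqB x0 (cseq_cst (l := 1)).
have := cseqZ (- z^-1) (cseqB c1 i0).
have -> : - z^-1 * (tpi / 2 * ((0 + 1) / (0 - 1)) - 0) = tpi / (2 * z).
  by rewrite sub0r add0r; move: (tpi) => t; field.
by apply: cseq_ext => N; rewrite (U_cot N).2.
Qed.

(** Both orders of summation agree on [gt], whereas [tau] contributes [U (1/2)] by rows and
    [U (1/2) - pi i/z] by columns. Multiplied by [z^2], the discrepancy is the last term. *)
Lemma eisenstein_two_S :
  usum (fun m => lipA (m.+1%:R * - z^-1)) =
  z ^+ 2 * usum (fun m => lipA (m.+1%:R * z)) - (z ^+ 2 - 1) * (tpi ^+ 2 / 24) - z * (tpi / 2).
Proof.
have sgt := gt_summable.
have sgtr m : asummable (gt m) by exact: (asummable_slice sgt).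
have sgtc n : asummable (fun m => gt m n).
  by apply: (@asummable_inj _ _ _ (fun m => (m, n)) _ (fun p => gt p.1 p.2) sgt) => a b [].
have e0 : usum (fun m => usum (gt m)) = usum (fun n => usum (fun m => gt m n)) by exact: usum_swap.
have sr : asummable (fun m => usum (gt m)) by exact: asummable_usum sgt.
have str m : asummable (tau m).
  apply: (asummable_le _ (asummableB (g_row m).1 (sgtr m))) => n /=.
  by rewrite /gt opprB addrC subrK.
have tele m : usum (tau m) = uu m (sR 0).
  apply: cseq_unique (asummable_cvgn (str m)) _.
  have := cseqB (cseq_cst (l := uu m (sR 0))) (uu_cvg0 m); rewrite subr0; apply: cseq_ext => N.
  have ht k : uu m (sR k) = tau m k + uu m (sR k.+1) by rewrite subrK.
  by have := telescope_sum ht N => /= ->; rewrite addrK.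
have rowE m : usum (g m) = usum (gt m) + uu m (sR 0).
  rewrite -tele -(usumD (sgtr m) (str m)); apply: eq_usum => n.
  by rewrite /gt subrK.
have s_inv : asummable (fun n => (n.+1%:R ^+ 2)^-1 : C).
  by apply: (asummable_le _ (rsummable_inv_sqr R)) => n; rewrite ncV ncX nc_nat.
have s_invz : asummable (fun m => ((m.+1%:R * z) ^+ 2)^-1).
  apply: (asummable_le _ (asummableZ (z ^+ 2)^-1 s_inv)) => n /=.
  by rewrite exprMn invfM mulrC.
have su := (U_cot 0).1.
have rows : usum (fun m => lipA (m.+1%:R * z)) =
    (z ^+ 2)^-1 * - (tpi ^+ 2 / 24) + (usum (fun m => usum (gt m)) + U (sR 0)).
  rewrite -(zeta2 R) -(usumZ (z ^+ 2)^-1 s_inv) -(usumD sr su).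
  have sD := asummableD sr su; have sZ := asummableZ (z ^+ 2)^-1 s_inv.
  rewrite -(usumD sZ sD); apply: eq_usum => m.
  by rewrite (g_row m).2 rowE exprMn invfM [X in X + _]mulrC.
have sc : asummable (fun n => usum (fun m => gt m n)).
  apply: (@asummable_usum _ _ _ (fun p : nat * nat => gt p.2 p.1)).
  have ii : injective (fun p : nat * nat => (p.2, p.1)) by move=> [a b] [a' b'] [-> ->].
  exact: (asummable_inj ii sgt).
have colE n : usum (fun m => g m n) = usum (fun m => gt m n) + (U (sR n) - U (sR n.+1)).
  rewrite -(usumB (U_cot n).1 (U_cot n.+1).1).
  have sB := asummableB (U_cot n).1 (U_cot n.+1).1.
  by rewrite -(usumD (sgtc n) sB); apply: eq_usum => m; rewrite /gt subrK.
have sl := lipA_summable (im_inv z0).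
have z2 : z ^+ 2 != 0 by rewrite expf_neq0.
have shc : asummable (fun n => usum (fun m => g m n)).
  apply: (asummable_le _ (asummableB (asummableZ (z ^+ 2)^-1 sl) s_inv)) => n /=.
  by rewrite (g_col n).2 mulrDr !mulKf // addrC addKr.
have sU : asummable (fun n => U (sR n) - U (sR n.+1)).
  apply: (asummable_le _ (asummableB shc sc)) => n /=.
  by rewrite colE [X in _ <= nc X]addrC addKr.
have eU : usum (fun n => U (sR n) - U (sR n.+1)) = U (sR 0) - tpi / (2 * z).
  apply: cseq_unique (asummable_cvgn sU) _.
  have := cseqB (cseq_cst (l := U (sR 0))) U_cvg; apply: cseq_ext => N.
  have ht k : U (sR k) = U (sR k) - U (sR k.+1) + U (sR k.+1) by rewrite subrK.
  by have := telescope_sum ht N => /= h; rewrite [X in X - _]h addrK.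
have cols : usum (fun n => lipA (n.+1%:R * - z^-1)) = z ^+ 2 * - (tpi ^+ 2 / 24) +
    z ^+ 2 * (usum (fun n => usum (fun m => gt m n)) + (U (sR 0) - tpi / (2 * z))).
  rewrite -(zeta2 R) -eU -(usumD sc sU) -(usumZ (z ^+ 2) s_inv).
  have sD := asummableD sc sU; have sZ := asummableZ (z ^+ 2) s_inv; have sZD := asummableZ (z ^+ 2) sD.
  rewrite -(usumZ (z ^+ 2) sD) -(usumD sZ sZD); apply: eq_usum => n.
  by rewrite (g_col n).2 colE.
rewrite cols rows e0; move: (usum _) (U (sR 0)) (tpi) => S u t.
by move: zn0 => h; field.
Qed.

End EisensteinTwo.

(** * The eta function and its inversion law *)

Section EtaFunction.
Variable R : realType.
Local Notation C := (Cplx R).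
Local Notation nc := (@normc R).
Local Notation tpi := ((0 +i* (2 * pi))%C : C).

Section PowerTaylor.
Variables (q h : C) (r : R).
Hypotheses (r0 : 0 < r) (qr : nc q <= r) (qhr : nc (q + h) <= r).

Let qX n : nc q ^+ n <= r ^+ n.
Proof. by rewrite lerXn2r ?nnegrE ?nc_ge0 // ltW. Qed.

Lemma pow_diff_bound n : nc ((q + h) ^+ n.+1 - q ^+ n.+1) <= n.+1%:R * r ^+ n * nc h.
Proof.
elim: n => [|n IH]; first by rewrite !expr1 addrC addKr expr0 !mul1r.
rewrite (exprS (q + h)) (exprS q).
have -> : (q + h) * (q + h) ^+ n.+1 - q * q ^+ n.+1 =
   (q + h) * ((q + h) ^+ n.+1 - q ^+ n.+1) + q ^+ n.+1 * h by ring.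
rewrite (le_trans (ncD _ _)) // (ncM (q + h)) (ncM (q ^+ n.+1)) ncX -(natr1 n.+1) 2!mulrDl mul1r.
apply: lerD; last by rewrite ler_wpM2r ?nc_ge0.
apply: (@le_trans _ _ (r * (n.+1%:R * r ^+ n * nc h))); first by rewrite ler_pM ?nc_ge0.
by rewrite le_eqVlt; apply/orP; left; apply/eqP; rewrite exprS; ring.
Qed.

(** The natural bound has [r^(n-1)]; multiplying through by [r] keeps the exponent a natural
    number. *)
Lemma pow_taylor_bound n :
  r * nc ((q + h) ^+ n.+1 - q ^+ n.+1 - n.+1%:R * q ^+ n * h) <= n.+1%:R ^+ 2 * r ^+ n * nc h ^+ 2.
Proof.
have h2 : 0 <= nc h ^+ 2 by rewrite exprn_ge0 ?nc_ge0.
elim: n => [|n IH].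
  rewrite !expr1 expr0 !mul1r (_ : q + h - q - h = 0); last by ring.
  by rewrite nc0 mulr0 expr1n expr0 !mul1r.
have -> : (q + h) ^+ n.+2 - q ^+ n.+2 - n.+2%:R * q ^+ n.+1 * h =
   (q + h) * ((q + h) ^+ n.+1 - q ^+ n.+1 - n.+1%:R * q ^+ n * h) + n.+1%:R * q ^+ n * h ^+ 2.
  rewrite (exprS (q + h) n.+1) (exprS q n.+1) (exprS q n) -(natr1 n.+1).
  by move: ((q + h) ^+ n.+1) (q ^+ n) (n.+1%:R : C) => a b c; ring.
apply: (@le_trans _ _ (r * (r * nc ((q + h) ^+ n.+1 - q ^+ n.+1 - n.+1%:R * q ^+ n * h) +
   n.+1%:R * r ^+ n * nc h ^+ 2))).
  rewrite ler_pM2l // (le_trans (ncD _ _)) // (ncM (q + h)) (ncM (_ * q ^+ n)) (ncM n.+1%:R) !ncX nc_nat.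
  by apply: lerD; [rewrite ler_wpM2r ?nc_ge0|rewrite ler_wpM2r // ler_wpM2l].
apply: (@le_trans _ _ (r * (n.+1%:R ^+ 2 * r ^+ n * nc h ^+ 2 + n.+1%:R * r ^+ n * nc h ^+ 2))).
  by rewrite ler_pM2l // lerD2r.
rewrite -(natr1 n.+1) (exprS r n); have rn : 0 <= r ^+ n by rewrite exprn_ge0 // ltW.
have N0 : 0 <= n.+1%:R :> R by [].
move: (n.+1%:R : R) (r ^+ n) (nc h ^+ 2) N0 rn h2 => N p s N0 p0 s0.
rewrite -subr_ge0 (_ : _ - _ = (N + 1) * (r * p * s)); last by ring.
by rewrite !mulr_ge0 ?addr_ge0 // ltW.
Qed.

End PowerTaylor.

(** The two estimates are proved together: the second order one at [N + 1] uses the first order one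
    at [N]. *)
Lemma prod_one_sub_bound (d : nat -> C) (T : nat -> R) N :
  (forall j, nc (d j) <= T j) -> \sum_(0 <= j < N) T j <= 1 / 2 ->
  nc (\prod_(0 <= j < N) (1 - d j) - 1) <= 2 * \sum_(0 <= j < N) T j /\
  nc (\prod_(0 <= j < N) (1 - d j) - 1 + \sum_(0 <= j < N) d j) <= 2 * (\sum_(0 <= j < N) T j) ^+ 2.
Proof.
move=> dT; have T0 j : 0 <= T j := le_trans (nc_ge0 _) (dT j).
elim: N => [_|N IH].
  by rewrite !big_nil subrr addr0 nc0 mulr0 expr0n /= mulr0.
rewrite !big_nat_recr //=; set S := \sum_(0 <= j < N) T j; set P := \prod_(0 <= j < N) _; set D := \sum_(0 <= j < N) d j.
move=> hS; have S0 : 0 <= S by apply: sumr_ge0.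
have tN := T0 N; have dN := dT N.
have hS' : S <= 1 / 2 by lra.
have [h1 h2] := IH hS'.
have P2 : nc P <= 2 by rewrite -[P](subrK 1) (le_trans (ncD _ _)) // nc1; move: h1; rewrite -/S -/P; lra.
have k1 : nc (P * d N) <= 2 * T N by rewrite ncM ler_pM ?nc_ge0.
have k2 : nc ((P - 1) * d N) <= 2 * S * T N by rewrite ncM ler_pM ?nc_ge0.
split.
  have -> : P * (1 - d N) - 1 = (P - 1) - P * d N by ring.
  by apply: le_trans (ncB _ _) _; move: h1; rewrite -/S -/P; lra.
have -> : P * (1 - d N) - 1 + (D + d N) = (P - 1 + D) - (P - 1) * d N by ring.
apply: le_trans (ncB _ _) _; move: h2; rewrite -/S -/P -/D.
have : 0 <= S * T N by rewrite mulr_ge0.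
have : 0 <= T N ^+ 2 by rewrite sqr_ge0.
by rewrite sqrrD; move: k2; rewrite -mulrA -[S * T N *+ 2]mulr_natl; lra.
Qed.

(** Minus the logarithmic derivative of [(q;q)_oo] in [q], factor by factor. *)
Definition logderP (q : C) : C := usum (fun n => n.+1%:R * q ^+ n / (1 - q ^+ n.+1)).

(** Each factor at [q + h] is the factor at [q] times [1 - d j], so [prod_one_sub_bound] gives the
    finite products a quadratic remainder uniform in [N], which survives the limit. The radius
    allowed for [h] keeps the majorants of the [d j] below a total of 1/2. *)
Lemma cderiv_qpoch_oo (q : C) : nc q < 1 ->
  cderiv (fun x => qpoch_oo x x) q (- (qpoch_oo q q * logderP q)).
Proof.
move=> q1; pose rho := nc q; pose r := (1 + rho) / 2.
have rho0 : 0 <= rho by exact: nc_ge0.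
have rho1 : rho < 1 by [].
have r1 : r < 1 by rewrite /r; lra.
have rh : 1 / 2 <= r by rewrite /r; lra.
have r0 : 0 < r by lra.
have e0 : 0 < 1 - rho by lra.
have r01 : 0 <= r < 1 by rewrite ltW.
have [K [t [K0 t01 hK]]] := polygeo r01.
have sc : rsummable (fun j => j.+1%:R ^+ 2 * r ^+ j).
  exact: rsummable_le hK (rsummable_geo K0 t01).
pose c j := (1 - rho)^-1 * (j.+1%:R ^+ 2 * r ^+ j).
have c0 j : 0 <= c j.
  by rewrite mulr_ge0 ?invr_ge0 ?(ltW e0) // mulr_ge0 ?exprn_ge0 // ltW.
have sc' : rsummable c by apply: rsummableZ sc; rewrite invr_ge0 ltW.
have [M hM] := sc'.
have hMN N : \sum_(0 <= j < N) c j <= M.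
  by rewrite -(sum_fset_seq c (iota_uniq _ _)); exact: hM.
have M0 : 0 <= M by have := hMN 0%N; rewrite big_nil.
have den j : (nc (1 - q ^+ j.+1))^-1 <= (1 - rho)^-1.
  rewrite lef_pV2 ?posrE // ?nc_gt0 ?one_sub_neq0 ?nc_expr_lt1 //.
  have := nc_dist_ge 1 (q ^+ j.+1); rewrite nc1 ncX; apply: le_trans.
  by rewrite lerD2l lerN2 exprS ler_piMr // exprn_ile1 // ltW.
have dn0 j : 1 - q ^+ j.+1 != 0 by rewrite one_sub_neq0 // nc_expr_lt1.
pose lam j : C := j.+1%:R * q ^+ j / (1 - q ^+ j.+1).
have n1 j : 1 <= j.+1%:R :> R by rewrite ler1n.
have lam_c j : nc (lam j) <= c j.
  rewrite ncM ncV (ncM j.+1%:R) nc_nat ncX mulrC; apply: ler_pM; rewrite ?invr_ge0 ?mulr_ge0 ?exprn_ge0 ?nc_ge0 //.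
  apply: ler_pM; rewrite ?exprn_ge0 //; first by rewrite expr2 ler_peMl.
  by rewrite lerXn2r ?nnegrE ?(ltW r0) // /r; move: rho1; rewrite /rho; lra.
have sl : asummable lam := asummable_le lam_c sc'.
pose B := expR (rho / (1 - rho)).
apply: (@cderiv_bound _ _ _ _ (B * (2 * M ^+ 2 + 2 * M)) (Num.min ((1 - rho) / 2) (1 / (2 * (M + 1))))).
  by rewrite lt_min !divr_gt0 // mulr_gt0 // ltr_wpDl.
move=> h; rewrite lt_min => /andP[hr]; rewrite ltr_pdivlMr ?mulr_gt0 ?ltr_wpDl // => hM2.
have qhr : nc (q + h) <= r by apply: le_trans (ncD _ _) _; move: hr; rewrite /r -/rho; lra.
have qr : nc q <= r by rewrite -/rho /r; lra.
have qh1 : nc (q + h) < 1 by exact: le_lt_trans r1.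
have hh := nc_ge0 h.
pose d j : C := ((q + h) ^+ j.+1 - q ^+ j.+1) / (1 - q ^+ j.+1).
have d_c j : nc (d j) <= c j * nc h.
  rewrite ncM ncV mulrC -mulrA; apply: ler_pM; rewrite ?invr_ge0 ?nc_ge0 //.
  apply: le_trans (pow_diff_bound r0 qr qhr j) _.
  by rewrite ler_wpM2r // ler_wpM2r ?exprn_ge0 ?(ltW r0) // expr2 ler_peMl.
have d_lam j : nc (d j - lam j * h) <= 2 * c j * nc h ^+ 2.
  have -> : d j - lam j * h = ((q + h) ^+ j.+1 - q ^+ j.+1 - j.+1%:R * q ^+ j * h) / (1 - q ^+ j.+1).
    by rewrite /d /lam; move: (dn0 j) => hd; field.
  rewrite ncM ncV mulrC (_ : 2 * c j * nc h ^+ 2 = (1 - rho)^-1 * (2 * (j.+1%:R ^+ 2 * r ^+ j * nc h ^+ 2))); last by rewrite /c; ring.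
  apply: ler_pM; rewrite ?invr_ge0 ?nc_ge0 //.
  have gen (x y : R) : 0 <= x -> r * x <= y -> x <= 2 * y by move=> x0 hx; nra.
  exact: gen (nc_ge0 _) (pow_taylor_bound r0 qr qhr j).
have qpE (x : C) N : qpoch x x N = \prod_(0 <= j < N) (1 - x ^+ j.+1).
  by apply: eq_bigr => j _; rewrite exprS.
have prodE N : qpoch (q + h) (q + h) N = qpoch q q N * \prod_(0 <= j < N) (1 - d j).
  rewrite !qpE -big_split; apply: eq_bigr => j _ /=.
  by rewrite /d mulrBr mulr1 mulrCA mulfV // mulr1; ring.
have sumT N : \sum_(0 <= j < N) c j * nc h <= 1 / 2.
  rewrite -mulr_suml; apply: (@le_trans _ _ (M * nc h)); first by rewrite ler_wpM2r.
  by move: hM2; lra.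
have bN N : nc (qpoch (q + h) (q + h) N - qpoch q q N + qpoch q q N * (\sum_(0 <= j < N) lam j) * h)
    <= B * (2 * M ^+ 2 + 2 * M) * nc h ^+ 2.
  have [_ h2] := prod_one_sub_bound d_c (sumT N).
  rewrite prodE (_ : _ - _ + _ = qpoch q q N * ((\prod_(0 <= j < N) (1 - d j) - 1 + \sum_(0 <= j < N) d j)
     - \sum_(0 <= j < N) (d j - lam j * h))); last first.
    rewrite sumrB -mulr_suml; move: (\prod_(0 <= _ < _) _) (\sum_(0 <= _ < _) _) (\sum_(0 <= _ < _) _) (qpoch q q N).
    by move=> a b e f; ring.
  rewrite ncM -mulrA; apply: ler_pM; rewrite ?nc_ge0 //; first exact: qpoch_bound.
  apply: le_trans (ncB _ _) _; rewrite mulrDl; apply: lerD.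
    apply: le_trans h2 _; rewrite -mulr_suml exprMn mulrA ler_wpM2r ?exprn_ge0 // ler_wpM2l //.
    by rewrite lerXn2r ?nnegrE // sumr_ge0.
  apply: le_trans (nc_sum _ _ _) _; apply: (@le_trans _ _ (\sum_(0 <= j < N) 2 * c j * nc h ^+ 2)).
    by apply: ler_sum => j _; exact: d_lam.
  by rewrite -mulr_suml -mulr_sumr ler_wpM2r ?exprn_ge0 // ler_wpM2l.
rewrite mulNr opprK.
have c1 := qpoch_cvg qh1 (x := q + h); have c2 := qpoch_cvg q1 (x := q).
have c3 := asummable_cvgn sl.
have := cseqD (cseqB c1 c2) (cseqM (cseqM c2 c3) (cseq_cst (l := h))) => c4.
by apply: (cvg_nc_le c4); apply: nearW => N; exact: bN.
Qed.

Lemma usum_nat_geo (x : C) : nc x < 1 -> asummable (fun n => n.+1%:R * x ^+ n.+1) /\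
  usum (fun n => n.+1%:R * x ^+ n.+1) = x / (1 - x) ^+ 2.
Proof.
move=> x1; have x01 : 0 <= nc x < 1 by rewrite nc_ge0.
have [K [t [K0 t01 hK]]] := polygeo x01.
have s : asummable (fun n => n.+1%:R * x ^+ n.+1).
  apply: (asummable_le _ (rsummable_geo K0 t01)) => n; apply: le_trans (hK n).
  rewrite ncM nc_nat ncX expr2 -mulrA ler_pM ?exprn_ge0 ?nc_ge0 //.
  by rewrite exprS ler_pM ?exprn_ge0 ?nc_ge0 // (le_trans (ltW x1)) // ler1n.
split => //; have [s1 e1] := geo_sum x1.
have e : usum (fun n => n.+1%:R * x ^+ n.+1) = x + x * usum (fun n => n.+1%:R * x ^+ n.+1) + x * usum (fun n => x ^+ n.+1).
  rewrite {1}(usum_recl s) expr1 mul1r -addrA; congr (_ + _).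
  rewrite -(usumZ x s) -(usumZ x s1) -(usumD (asummableZ x s) (asummableZ x s1)).
  apply: eq_usum => n; rewrite -(natr1 n.+1) (exprS x n.+1).
  by move: (x ^+ n.+1) (n.+1%:R : C) => a b; ring.
rewrite e1 in e; have d0 := one_sub_neq0 x1; move: (usum _) e => S e.
apply: (mulfI d0); have -> : (1 - x) * S = S - x * S by ring.
rewrite {1}e; by field.
Qed.

(** Both sides are the double series of [n q^(n m)], summed over [m] first or over [n] first. *)
Lemma logderP_lambert (q : C) : nc q < 1 ->
  q * logderP q = usum (fun m => q ^+ m.+1 / (1 - q ^+ m.+1) ^+ 2).
Proof.
move=> q1; pose tau := Num.sqrt (nc q).
have tau0 : 0 <= tau by exact: sqrtr_ge0.
have t2 : nc q = tau ^+ 2 by rewrite sqr_sqrtr ?nc_ge0.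
have tau1 : tau < 1 by rewrite -(@expr_lt1 _ 2) // -t2.
have tau01 : 0 <= tau < 1 by rewrite tau0.
have [K [t [K0 t01 hK]]] := polygeo tau01.
pose f (p : nat * nat) : C := p.1.+1%:R * q ^+ (p.1.+1 * p.2.+1).
have sf : asummable f.
  have s1 : rsummable (fun n => n.+1%:R ^+ 2 * tau ^+ n) by exact: rsummable_le hK (rsummable_geo K0 t01).
  have s2 : rsummable (fun n => 1 * tau ^+ n) by exact: rsummable_geo.
  have h1 n : 0 <= n.+1%:R ^+ 2 * tau ^+ n by rewrite mulr_ge0 ?exprn_ge0.
  have h2 n : 0 <= 1 * tau ^+ n by rewrite mul1r exprn_ge0.
  apply: (asummable_le _ (rsummable_prod h1 h2 s1 s2)) => -[n m]; rewrite /f /=.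
  rewrite ncM nc_nat ncX t2 -exprM mul1r -mulrA -exprD expr2 -mulrA ler_wpM2l //.
  apply: (@le_trans _ _ (1 * tau ^+ (n + m))); last by rewrite ler_wpM2r ?exprn_ge0 // ler1n.
  by rewrite mul1r; apply: ler_wiXn2l => //; [exact: ltW|nia].
have <- : usum (fun m => usum (fun n => f (n, m))) = usum (fun m => q ^+ m.+1 / (1 - q ^+ m.+1) ^+ 2).
  apply: eq_usum => m; have [_ <-] := usum_nat_geo (nc_expr_lt1 m q1).
  by apply: eq_usum => n; rewrite /f /= -exprM mulnC.
rewrite -(@usum_swap _ _ _ (fun n m => f (n, m))); last first.
  by apply: (asummable_le _ sf) => -[n m].
have sl : asummable (fun n => n.+1%:R * q ^+ n / (1 - q ^+ n.+1)).
  have [q0|q0] := eqVneq q 0.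
    apply: (asummable_fin (A := [fset 0%N]%fset)) => n; rewrite inE => n0.
    by rewrite q0 expr0n (negbTE n0) mulr0 mul0r.
  apply: (asummable_le _ (asummableZ q^-1 (asummable_usum sf))) => n /=.
  rewrite /f /= (eq_usum (g := fun m => n.+1%:R * (q ^+ n.+1) ^+ m.+1)) => [|m]; last by rewrite exprM.
  have [s e] := geo_sum (nc_expr_lt1 n q1); rewrite (usumZ _ s) e exprS.
  rewrite (_ : q^-1 * (n.+1%:R * (q * q ^+ n / (1 - q * q ^+ n))) = n.+1%:R * q ^+ n / (1 - q * q ^+ n)) //.
  by move: (q ^+ n) (n.+1%:R : C) ((1 - q * q ^+ n)^-1) => a b c; field.
rewrite /logderP -(usumZ q sl); apply: eq_usum => n.
have [s e] := geo_sum (nc_expr_lt1 n q1).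
transitivity (n.+1%:R * usum (fun m => (q ^+ n.+1) ^+ m.+1)).
  by rewrite e exprS; move: (q ^+ n) (_^-1) (n.+1%:R : C) => a b c; ring.
by rewrite -(usumZ _ s); apply: eq_usum => m; rewrite /f /= exprM.
Qed.

Definition eta (z : C) : C := ez (24^-1 * z) * qpoch_oo (ez z) (ez z).

Lemma eta_neq0 (z : C) : 0 < complex.Im z -> eta z != 0.
Proof.
move=> z0; rewrite mulf_neq0 ?ez_neq0 // qpoch_oo_q_neq0 //; exact: nc_ez_lt1.
Qed.

(** [E_2(z)/24], the logarithmic derivative of [eta] divided by [2 pi i]. *)
Definition psi (z : C) : C := 24^-1 - usum (fun m => lipA (m.+1%:R * z)) / tpi ^+ 2.

Lemma cderiv_eta (z : C) : 0 < complex.Im z -> cderiv eta z (tpi * psi z * eta z).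
Proof.
move=> z0; have q1 := nc_ez_lt1 z0.
have d1 := cderiv_comp (cderiv_scale (24^-1) z) (cderiv_ez (24^-1 * z)).
have d2 := cderiv_comp (cderiv_ez z) (cderiv_qpoch_oo q1).
have := cderivM d1 d2; congr cderiv; rewrite /psi.
have -> : usum (fun m => lipA (m.+1%:R * z)) = tpi ^+ 2 * (ez z * logderP (ez z)).
  rewrite (logderP_lambert q1).
  have sl := lipA_summable z0.
  have ss : asummable (fun m => ez z ^+ m.+1 / (1 - ez z ^+ m.+1) ^+ 2).
    apply: (asummable_le _ (asummableZ (tpi ^+ 2)^-1 sl)) => m /=.
    by rewrite /lipA ez_nat mulKf // expf_neq0 // tpi_neq0.
  by rewrite -(usumZ _ ss); apply: eq_usum => m; rewrite /lipA ez_nat.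
rewrite (mulrAC (tpi ^+ 2)) mulfV ?expf_neq0 ?tpi_neq0 // mul1r /eta /=.
have alg (a b c d e : C) : e * d / 24 * a + d * (- (a * b) * (e * c)) = e * (24^-1 - c * b) * (d * a).
  by ring.
exact: alg.
Qed.

Lemma psi_S (z : C) : 0 < complex.Im z -> psi (- z^-1) = z ^+ 2 * psi z + z / (2 * tpi).
Proof.
move=> z0; rewrite /psi (eisenstein_two_S z0); have t0 := tpi_neq0 R.
by move: (usum _) (tpi) t0 => S t t0; field.
Qed.

Lemma im_segment (a b : C) (t : R) : 0 < complex.Im a -> 0 < complex.Im b -> 0 <= t <= 1 ->
  0 < complex.Im (a + t%:C%C * (b - a)).
Proof.
move=> a0 b0 /andP[t0 t1]; rewrite ImD ImZ ImD ImN.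
have -> : complex.Im a + t * (complex.Im b - complex.Im a) = (1 - t) * complex.Im a + t * complex.Im b by ring.
have [->|tn] := eqVneq t 0; first by rewrite subr0 mul1r mul0r addr0.
by rewrite ltr_wpDl ?mulr_ge0 ?mulr_gt0 ?subr_ge0 ?(ltW a0) // lt_neqAle eq_sym tn.
Qed.

(** [W] has derivative 0: the anomalous term of [psi_S] cancels the logarithmic derivative of the
    factor [x]. Its constant value is read off at the fixed point [i] of the inversion. *)
Lemma eta_S_sqr (z : C) : 0 < complex.Im z -> eta (- z^-1) ^+ 2 = (0 -i* 1)%C * z * eta z ^+ 2.
Proof.
move=> z0; pose W (x : C) := eta (- x^-1) ^+ 2 * (x * eta x ^+ 2)^-1.
have Wd (x : C) : 0 < complex.Im x -> cderiv W x 0.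
  move=> x0; have xn := im_neq0 x0; have ex := eta_neq0 x0; have sx := im_inv x0.
  have dS : cderiv (fun y => - y^-1) x (x^-1 ^+ 2).
    have := cderivM (cderiv_cst (-1) x) (cderiv_inv xn); rewrite mul0r add0r mulN1r opprK.
    by rewrite (_ : (fun y : C => -1 * y^-1) = (fun y => - y^-1)) //; apply/funext => y; rewrite mulN1r.
  have d1 := cderiv_comp dS (cderiv_eta sx).
  have d2 := cderivM d1 d1.
  have de := cderiv_eta x0.
  have d3 := cderivM (cderiv_id x) (cderivM de de).
  have n3 : x * (eta x * eta x) != 0 := mulf_neq0 xn (mulf_neq0 ex ex).
  have d4 := @cderivV R (fun y => y * (eta y * eta y)) x _ n3 d3.
  have := cderivM d2 d4; rewrite /= (psi_S x0).
  have t0 := tpi_neq0 R.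
  congr cderiv.
    by move: (eta x) (eta _) (psi x) (tpi) ex t0 => a b c e a0 t0; field; rewrite xn a0 t0.
have i0 : 0 < complex.Im (0 +i* 1 : C)%C by [].
have W1 : W z = W (0 +i* 1)%C.
  by apply: cderiv0_cst => t t01; apply: Wd; exact: im_segment.
have ii : (0 +i* 1)%C * (0 +i* 1)%C = -1 :> C by simpc.
have Wi : W (0 +i* 1)%C = (0 -i* 1)%C.
  have n0 : (0 +i* 1)%C != 0 :> C by exact: im_neq0.
  have inv : - (0 +i* 1)%C^-1 = (0 +i* 1)%C :> C.
    by apply: (mulfI n0); rewrite mulrN mulfV // ii.
  have alg (e y : C) : e != 0 -> y != 0 -> e ^+ 2 * (y * e ^+ 2)^-1 = y^-1.
    by move=> he hy; field; rewrite he hy.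
  rewrite /W inv (alg _ _ (eta_neq0 i0) n0).
  have iv : (0 +i* 1)%C^-1 = - (0 +i* 1)%C :> C by rewrite -[LHS]opprK inv.
  by rewrite iv -[LHS]/(Complex (- 0) (- 1)) oppr0.
have ez0' : z * eta z ^+ 2 != 0 by rewrite mulf_neq0 ?expf_neq0 ?eta_neq0 ?im_neq0.
by rewrite -mulrA -Wi -W1 /W divfK.
Qed.

End EtaFunction.

(** * Integer matrices on the half-plane and multiplier systems *)

Section IntegerMatrices.
Variable R : realType.
Local Notation C := (Cplx R).
Local Notation nc := (@normc R).
Implicit Types (g h : 'M[int]_2) (z : C).

Lemma ord2 (i : 'I_2) : i = 0 \/ i = 1.
Proof. by case: i => [[|[|//]] ?]; [left|right]; apply: val_inj. Qed.

Definition mat (a b c d : int) : 'M[int]_2 :=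
  \matrix_(i, j) if i == 0 then (if j == 0 then a else b) else (if j == 0 then c else d).

Lemma matE a b c d : (mat a b c d 0 0 = a) * (mat a b c d 0 1 = b) * (mat a b c d 1 0 = c) * (mat a b c d 1 1 = d).
Proof. by rewrite !mxE. Qed.

Lemma mat_eta g : g = mat (g 0 0) (g 0 1) (g 1 0) (g 1 1).
Proof. by apply/matrixP => i j; rewrite mxE; case: (ord2 i) => ->; case: (ord2 j) => ->. Qed.

Lemma mul22 g h i j : (g * h) i j = g i 0 * h 0 j + g i 1 * h 1 j.
Proof.
rewrite -[g * h]/(g *m h) mxE !big_ord_recl big_ord0 addr0.
by congr (g i _ * h _ j + g i _ * h _ j); apply: val_inj.
Qed.

Lemma mat_mul a b c d a' b' c' d' : mat a b c d * mat a' b' c' d' =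
  mat (a * a' + b * c') (a * b' + b * d') (c * a' + d * c') (c * b' + d * d').
Proof. by rewrite [LHS]mat_eta !mul22 !matE. Qed.

Lemma det22 g : \det g = g 0 0 * g 1 1 - g 0 1 * g 1 0.
Proof.
have l1 : lift 0 0 = 1 :> 'I_2 by apply: val_inj.
have l2 : lift 1 0 = 0 :> 'I_2 by apply: val_inj.
rewrite (expand_det_row g 0) !big_ord_recl big_ord0 addr0 /cofactor !det_mx11 !mxE /=.
rewrite -[ord0]/(0 : 'I_2) !l1 !l2 /= expr0 mul1r expr1 mulN1r mulrN.
by [].
Qed.

Lemma det_mat a b c d : \det (mat a b c d) = a * d - b * c.
Proof. by rewrite det22 !matE. Qed.

Lemma mat1 : (1 : 'M[int]_2) = mat 1 0 0 1.
Proof. by rewrite [LHS]mat_eta !mxE. Qed.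

Lemma SL2Z_adj g : SL2Z g -> g^-1 = mat (g 1 1) (- g 0 1) (- g 1 0) (g 0 0).
Proof.
rewrite /SL2Z /= det22 => dg; set h := mat _ _ _ _.
have gh : g * h = 1.
  by rewrite [g]mat_eta mat_mul mat1; congr mat; rewrite -?dg; ring.
have hg : h * g = 1.
  by rewrite [g]mat_eta mat_mul mat1; congr mat; rewrite -?dg; ring.
have gu : g \is a GRing.unit by apply/unitrP; exists h.
by apply: (mulrI gu); rewrite gh mulrV.
Qed.

Lemma denom_mat a b c d z : denom (mat a b c d) z = c%:~R * z + d%:~R.
Proof. by rewrite /denom !matE. Qed.

Lemma moebius_mat a b c d z : moebius (mat a b c d) z = (a%:~R * z + b%:~R) / (c%:~R * z + d%:~R).
Proof. by rewrite /moebius /denom !matE. Qed.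

Lemma intrC (n : int) : (n%:~R : C) = (n%:~R : R)%:C%C.
Proof. by rewrite rmorph_int. Qed.

Lemma im_denom g z : complex.Im (denom g z) = (g 1 0)%:~R * complex.Im z.
Proof. by rewrite /denom !intrC ImD ImZ /= addr0. Qed.

Lemma denom_neq0 g z : 0 < complex.Im z -> 0 < \det g -> denom g z != 0.
Proof.
move=> z0 dg; apply/negP => /eqP e.
have := im_denom g z; rewrite e /= => /esym/eqP.
rewrite mulf_eq0 (gt_eqF z0) orbF intr_eq0 => /eqP c0.
move: e; rewrite /denom c0 mul0r add0r => /eqP; rewrite intr_eq0 => /eqP d0.
by move: dg; rewrite det22 c0 d0 !mulr0 subrr ltxx.
Qed.

Lemma im_div (x y : C) : complex.Im (x / y) =
  (complex.Im x * complex.Re y - complex.Re x * complex.Im y) / nc y ^+ 2.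
Proof. by rewrite nc_sqr; case: x => a b; case: y => c d /=; rewrite !mulrN -mulNr; ring. Qed.

Lemma im_moebius g z :
  complex.Im (moebius g z) = (\det g)%:~R * complex.Im z / nc (denom g z) ^+ 2.
Proof.
rewrite /moebius im_div; congr (_ / _); rewrite det22 /denom !intrC !ReD !ImD !ReZ !ImZ /=.
by rewrite !addr0 intrB !intrM; ring.
Qed.

Lemma im_moebius_gt0 g z : 0 < complex.Im z -> 0 < \det g -> 0 < complex.Im (moebius g z).
Proof.
move=> z0 dg; rewrite im_moebius; apply: divr_gt0; first by rewrite mulr_gt0 ?ltr0z.
by rewrite exprn_gt0 // nc_gt0 denom_neq0.
Qed.

Lemma denomM g h z : denom h z != 0 -> denom (g * h) z = denom g (moebius h z) * denom h z.
Proof.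
move=> h0; rewrite {1 2}/denom mulrDl -mulrA divfK // !mul22 !(intrD, intrM) /denom.
by ring.
Qed.

Lemma moebiusM g h z : denom h z != 0 -> moebius (g * h) z = moebius g (moebius h z).
Proof.
move=> h0; have e : ((g * h) 0 0)%:~R * z + ((g * h) 0 1)%:~R =
   ((g 0 0)%:~R * moebius h z + (g 0 1)%:~R) * denom h z.
  rewrite mulrDl -[_ * moebius h z * _]mulrA divfK // !mul22 !(intrD, intrM) /denom.
  by ring.
by rewrite [LHS]/moebius e (denomM g h0) -mulf_div mulfV // mulr1.
Qed.

Lemma moebius_cderiv g z : 0 < complex.Im z -> 0 < \det g -> exists l, cderiv (moebius g) z l.
Proof.
move=> z0 dg; have d0 := denom_neq0 z0 dg.
have h1 (a b : C) : cderiv (fun x => a * x + b) z (a + 0).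
  exact: cderivD (cderiv_scale a z) (cderiv_cst b z).
eexists; apply: (cderivM (h1 _ _)); apply: cderivV (h1 _ _).
exact: d0.
Qed.

Lemma Re_sqrtc_ge0 (x : C) : 0 <= complex.Re (sqrtc x).
Proof. by case: x => a b /=; exact: sqrtr_ge0. Qed.

Lemma sqrtc_sqr (x : C) : sqrtc x * sqrtc x = x.
Proof. exact: sqr_sqrtc. Qed.

Lemma Re_sqrtc_gt0 (x : C) : complex.Im x != 0 -> 0 < complex.Re (sqrtc x).
Proof.
move=> h; rewrite lt_neqAle Re_sqrtc_ge0 andbT eq_sym; apply: contra h => /eqP h.
have := congr1 (@complex.Im R) (sqrtc_sqr x); case: (sqrtc x) h => a b /= ->.
by rewrite mul0r mulr0 addr0 => <-.
Qed.

(** For the principal roots [x] and [y] one has [|x - y| |x + y| = |u - l|], and [|x + y| >= Re y],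
    which is positive off the real axis. *)
Lemma sqrtc_clim (u : C -> C) (l : C) : complex.Im l != 0 -> clim0 u l ->
  clim0 (fun x => sqrtc (u x)) (sqrtc l).
Proof.
move=> l0 hu e e0; have s0 := Re_sqrtc_gt0 l0.
have [d d0 hd] := hu _ (mulr_gt0 e0 s0); exists d => // k0 /hd; set x := sqrtc (u k0); set y := sqrtc l.
have -> : u k0 - l = (x - y) * (x + y).
  by rewrite -{1}(sqrtc_sqr (u k0)) -{1}(sqrtc_sqr l) -/x -/y; ring.
rewrite ncM => k; have : complex.Re y <= nc (x + y).
  apply: le_trans (nc_Re _); rewrite ReD; apply: le_trans (ler_norm _).
  by rewrite lerDr; exact: Re_sqrtc_ge0.
move=> k2; rewrite -(ltr_pM2r s0); apply: le_lt_trans k.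
by rewrite ler_wpM2l ?nc_ge0.
Qed.

(** Along the segment from [z] to [w] the ratio of [F] to [F z] takes only the values 1 and -1. Its
    real part is continuous, and a change of sign would make it vanish somewhere. *)
Lemma clim_sqr_cst (F : C -> C) (K : C) : K != 0 ->
  (forall z, 0 < complex.Im z -> clim0 (fun x => F (z + x)) (F z)) ->
  (forall z, 0 < complex.Im z -> F z ^+ 2 = K) ->
  forall z w, 0 < complex.Im z -> 0 < complex.Im w -> F z = F w.
Proof.
move=> K0 Fc FK z w z0 w0.
have Fz0 : F z != 0 by apply: contra_neq K0 => e; rewrite -(FK z z0) e expr0n.
pose p (t : R) := z + t%:C%C * (w - z).
have pH t : 0 <= t <= 1 -> 0 < complex.Im (p t) by exact: im_segment.
have pm t : 0 <= t <= 1 -> F (p t) / F z = 1 \/ F (p t) / F z = -1.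
  move=> /pH pt; have : (F (p t) / F z) ^+ 2 = 1 by rewrite expr_div_n !FK // mulfV.
  by move=> /eqP; rewrite sqrf_eq1 => /orP[/eqP|/eqP]; [left|right].
pose u t := complex.Re (F (p t) / F z).
have uc : {within `[0, 1], continuous u}.
  apply: continuous_in_subspaceT => t; rewrite inE /= in_itv /= => t01.
  apply/cvgrPdist_lt => e e0.
  have e1 : 0 < e * nc (F z) by rewrite mulr_gt0 ?nc_gt0.
  have [d d0 hd] := Fc _ (pH _ t01) _ e1.
  have D0 : 0 < nc (w - z) + 1 by rewrite ltr_wpDl ?nc_ge0.
  near=> s.
  have hs : `|t - s| < d / (nc (w - z) + 1).
    near: s; have := @cvgr_dist_lt _ _ _ _ _ id t cvg_id.
    by apply; rewrite divr_gt0.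
  have ps : p s = p t + (s - t)%:C%C * (w - z) by rewrite /p rmorphB; ring.
  rewrite /u -ReN -ReD -mulrBl ps; apply: le_lt_trans (nc_Re _) _.
  rewrite ncM ncV ltr_pdivrMr ?nc_gt0 // nc_distC; apply: hd.
  rewrite ncM nc_real distrC; apply: (@le_lt_trans _ _ (`|t - s| * (nc (w - z) + 1))).
    by rewrite ler_wpM2l // lerDl.
  by rewrite -ltr_pdivlMr.
have p0 : p 0 = z by rewrite /p mul0r addr0.
have p1 : p 1 = w by rewrite /p mul1r addrC subrK.
have [h|h] := pm 1 (introT andP (conj ler01 (lexx 1))).
  by move: h; rewrite p1 => /(congr1 (fun x => x * F z)); rewrite divfK // mul1r.
have u0 : u 0 = 1 by rewrite /u p0 mulfV.
have u1 : u 1 = -1 by rewrite /u h.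
have hv : Num.min (u 0) (u 1) <= 0 <= Num.max (u 0) (u 1).
  by rewrite u0 u1 ge_min le_max ler01 lerN10 orbT.
have [t] := IVT ler01 uc hv.
rewrite in_itv /= => t01; rewrite /u; have [->|->] := pm _ t01.
  by move=> /eqP; rewrite oner_eq0.
by move=> /eqP; rewrite /= oppr_eq0 oner_eq0.
Unshelve. all: by end_near. Qed.

(** The transformation law up to sign: once squared it involves no root of [denom g z] and is
    multiplicative in [g]. The exponent 12 is the order of the constant that [eta^2] acquires under
    [z -> z + 1]. *)
Definition weak_half (f : C -> C) g := exists K : C, K ^+ 12 = 1 /\
  forall z, 0 < complex.Im z -> f (moebius g z) ^+ 2 = K * denom g z * f z ^+ 2.

Lemma det_gt0 g : SL2Z g -> 0 < \det g.
Proof. by rewrite /SL2Z /= => ->. Qed.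

Lemma nc_root1 (K : C) n : K ^+ n.+1 = 1 -> nc K = 1.
Proof.
move=> h; have : nc K ^+ n.+1 = 1 by rewrite -ncX h nc1.
by move=> /eqP; rewrite pexpr_eq1 ?nc_ge0 // => /eqP.
Qed.

Lemma denomN1 z : denom (-1) z = -1.
Proof. by rewrite (_ : -1 = mat (-1) 0 0 (-1)) ?denom_mat ?mul0r ?add0r // [LHS]mat_eta !mxE. Qed.

Lemma moebiusN1 z : moebius (-1) z = z.
Proof.
rewrite (_ : -1 = mat (-1) 0 0 (-1)) ?moebius_mat; last by rewrite [LHS]mat_eta !mxE.
by rewrite mul0r add0r addr0 mulN1r invrN invr1 mulrN1 opprK.
Qed.

Lemma sqrtcN1 : sqrtc (-1 : C) = (0 +i* 1)%C.
Proof.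
have h : complex.Im (-1 : C) = 0 by rewrite /= oppr0.
rewrite /sqrtc /= oppr0 eqxx expr0n addr0 sqrrN expr1n sqrtr1 subrr mul0r sqrtr0 mul1r opprK.
by rewrite -[1 + 1]/(2%:R) mulfV ?pnatr_eq0 // sqrtr1.
Qed.

(** [nu g] is the value at [i] of [f(gz)/(autfactor g z f(z))], and [clim_sqr_cst] makes this
    independent of the point. The cocycle relation follows on cancelling the nonvanishing [f]. *)
Lemma multiplier_of_weak (f : C -> C) (G : set 'M[int]_2) : subgroup_SL2Z G ->
  (forall z, 0 < complex.Im z -> f z != 0) ->
  (forall z, 0 < complex.Im z -> clim0 (fun x => f (z + x)) (f z)) ->
  (forall g, G g -> weak_half f g) ->
  exists nu : 'M[int]_2 -> C, [/\ multiplier_system G nu,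
    forall g z, G g -> upper_half z -> f (moebius g z) = nu g * autfactor g z * f z &
    forall g, G g -> nu g ^+ 24 = 1].
Proof.
move=> [GS G1 GM GV] f0 fc fw; pose ii : C := (0 +i* 1)%C.
have i0 : 0 < complex.Im ii by rewrite /= ltr01.
pose nu g := f (moebius g ii) / (autfactor g ii * f ii).
have a0 g z : G g -> 0 < complex.Im z -> autfactor g z != 0.
  move=> Gg z0; have := denom_neq0 z0 (det_gt0 (GS _ Gg)).
  by apply: contra_neq => h; rewrite -[denom g z]sqrtc_sqr -/(autfactor g z) h mul0r.
have aa g z : autfactor g z ^+ 2 = denom g z by exact: sqr_sqrtc.
pose F g z := f (moebius g z) * ((autfactor g z)^-1 * (f z)^-1).
have F2 g : G g -> exists K : C, K ^+ 12 = 1 /\ forall z, 0 < complex.Im z -> F g z ^+ 2 = K.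
  move=> Gg; have [K [K1 hK]] := fw _ Gg; exists K; split => // z z0.
  rewrite /F !exprMn (hK z z0) -aa !exprVn.
  have h1 := a0 _ _ Gg z0; have h2 := f0 _ z0.
  by move: (autfactor g z) (f z) h1 h2 => x y h1 h2; field; rewrite h1 h2.
have Fc g z : G g -> 0 < complex.Im z -> clim0 (fun x => F g (z + x)) (F g z).
  move=> Gg z0; have dg := det_gt0 (GS _ Gg); have gz0 := im_moebius_gt0 z0 dg.
  have inv_clim (v : C -> C) (l : C) : l != 0 -> clim0 v l -> clim0 (fun x => (v x)^-1) l^-1.
    move=> l0 hv; have := cderiv_conv (cderiv_inv l0).
    have hv' : clim0 (fun x => v x - l) 0.
      by rewrite -(subrr l); exact: clim0D hv (clim0_cst (- l)).
    move=> hc; have := clim0_comp hv' hc; rewrite (_ : (fun x => _) = (fun x => (v x)^-1)) //.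
    by apply/funext => x; rewrite addrC subrK.
  have [l dl] := moebius_cderiv z0 dg; have mc := cderiv_conv dl.
  apply: clim0M.
    have hm : clim0 (fun x => moebius g (z + x) - moebius g z) 0.
      by rewrite -(subrr (moebius g z)); exact: clim0D mc (clim0_cst (- moebius g z)).
    have := clim0_comp hm (fc _ gz0).
    rewrite (_ : (fun x => _) = (fun x => f (moebius g (z + x)))) //.
    by apply/funext => x; rewrite addrC subrK.
  apply: clim0M; last by apply: inv_clim (fc _ z0); exact: f0.
  apply: inv_clim; first exact: a0.
  (* If [g 1 0 = 0] the denominator is constant and may lie on the branch cut; otherwise its
     imaginary part is nonzero and [sqrtc_clim] applies. *)
  have [c0|c0] := eqVneq (g 1 0) 0.
    rewrite (_ : (fun x => _) = (fun=> autfactor g z)); first exact: clim0_cst.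
    by apply/funext => x; rewrite /autfactor /denom c0 !mul0r.
  apply: sqrtc_clim; first by rewrite im_denom; apply: mulf_neq0; [rewrite intr_eq0|exact: lt0r_neq0].
  rewrite /denom (_ : (fun x => _) = (fun x => (g 1 0)%:~R * x + ((g 1 0)%:~R * z + (g 1 1)%:~R))); last first.
    by apply/funext => x; ring.
  rewrite -[X in clim0 _ X]add0r -[X in clim0 _ (X + _)](mulr0 ((g 1 0)%:~R)).
  have hM := clim0M (clim0_cst ((g 1 0)%:~R : C)) (@clim0_id R).
  exact: (clim0D hM (clim0_cst _)).
have nuE g : nu g = F g ii by rewrite /nu /F -invfM.
have Fn g z : G g -> upper_half z -> F g z = nu g.
  move=> Gg z0; have [K [K1 hK]] := F2 _ Gg; rewrite nuE.
  have K0 : K != 0 by apply: contra_eq_neq K1 => ->; rewrite expr0n eq_sym oner_eq0.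
  exact: (@clim_sqr_cst (F g) K K0 (fun x x0 => Fc g x Gg x0) hK z ii z0 i0).
have tr g z : G g -> upper_half z -> f (moebius g z) = nu g * autfactor g z * f z.
  move=> Gg z0; rewrite -(Fn g z Gg z0) /F.
  have h1 := a0 _ _ Gg z0; have h2 := f0 _ z0.
  by move: (autfactor g z) (f z) h1 h2 => x y h1 h2; field; rewrite h1 h2.
have nu24 g : G g -> nu g ^+ 24 = 1.
  move=> Gg; have [K [K1 hK]] := F2 _ Gg.
  by rewrite nuE (exprM _ 2 12) hK.
exists nu; split => //; split => [g Gg|g h z Gg Gh z0|GN].
- by rewrite ncE (nc_root1 (nu24 _ Gg)).
- have dh := det_gt0 (GS _ Gh); have hz0 := im_moebius_gt0 z0 dh.
  have dz := denom_neq0 z0 dh.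
  have := tr (g * h) z (GM _ _ Gg Gh) z0; rewrite (moebiusM g dz) (tr g _ Gg hz0) (tr h _ Gh z0).
  move=> e; apply: (mulIf (f0 _ z0)); rewrite -e; move: (autfactor g _) (autfactor h z) (f z) => x y w; ring.
(* [-1] acts trivially and its denominator has principal root [i], which forces the value [- i]. *)
have := tr (-1) ii GN i0; rewrite moebiusN1 /autfactor denomN1 sqrtcN1 -/ii => e.
have fi := f0 _ i0; have : nu (-1) * ii = 1 by apply: (mulIf fi); rewrite mul1r -e.
move=> h; have ii1 : ii * (0 -i* 1)%C = 1 :> C by rewrite /ii; simpc.
by rewrite -[nu (-1)]mulr1 -ii1 mulrA h mul1r.
Qed.

Lemma weak_halfM (f : C -> C) g h : 0 < \det g -> 0 < \det h ->
  weak_half f g -> weak_half f h -> weak_half f (g * h).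
Proof.
move=> dg dh [K [K1 hK]] [L [L1 hL]]; exists (K * L); split; first by rewrite exprMn K1 L1 mulr1.
move=> z z0; have dz := denom_neq0 z0 dh; have hz0 := im_moebius_gt0 z0 dh.
by rewrite (moebiusM g dz) (hK _ hz0) (hL _ z0) (denomM g dz); ring.
Qed.

Lemma ez_int (n : int) : ez (n%:~R : C) = 1.
Proof.
case: n => n; first by rewrite -[_%:~R]/(n%:R : C) -[n%:R]mulr1 ez_nat ez1 expr1n.
have e : (Negz n)%:~R = - (n.+1%:R * 1) :> C by rewrite mulr1 NegzE mulrNz.
by rewrite e ezN ez_nat ez1 expr1n invr1.
Qed.

Lemma eta_shift (n : int) z : eta (z + n%:~R) = ez (24^-1 * n%:~R) * eta z.
Proof. by rewrite /eta mulrDr !ezD ez_int mulr1 [X in X * _ = _]mulrC mulrA. Qed.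

Lemma ez_shift24 (n : int) : ez (24^-1 * n%:~R : C) ^+ 24 = 1.
Proof. by rewrite -ez_nat mulrA mulfV ?pnatr_eq0 // mul1r ez_int. Qed.

Lemma weak_eta_T (n : int) : weak_half (@eta R) (mat 1 n 0 1).
Proof.
exists (ez (24^-1 * n%:~R) ^+ 2); split; first by rewrite -exprM ez_shift24.
move=> z z0; rewrite moebius_mat denom_mat mul1r mul0r add0r divr1 mulr1.
by rewrite eta_shift exprMn.
Qed.

Lemma weak_eta_N1 : weak_half (@eta R) (-1).
Proof.
exists (-1); split; first by rewrite -signr_odd expr0.
by move=> z z0; rewrite moebiusN1 denomN1 mulrNN !mul1r.
Qed.

(** This matrix has denominator [-z], hence the constant [i] in place of the [-i] of [eta_S_sqr]. *)
Lemma weak_eta_S : weak_half (@eta R) (mat 0 1 (-1) 0).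
Proof.
exists (0 +i* 1)%C; split.
  have i2 : (0 +i* 1)%C ^+ 2 = -1 :> C by rewrite expr2; simpc.
  by rewrite (exprM _ 2 6) i2 -signr_odd expr0.
move=> z z0.
have e1 : denom (mat 0 1 (-1) 0) z = - z.
  by rewrite denom_mat (_ : (-1)%:~R = -1 :> C) // (_ : 0%:~R = 0 :> C) // mulN1r addr0.
have e2 : moebius (mat 0 1 (-1) 0) z = - z^-1.
  rewrite moebius_mat (_ : (-1)%:~R = -1 :> C) // (_ : 0%:~R = 0 :> C) // (_ : 1%:~R = 1 :> C) //.
  by rewrite mul0r add0r addr0 mulN1r invrN mul1r.
have e3 : (0 -i* 1)%C = - (0 +i* 1)%C :> C by rewrite -[RHS]/(Complex (- 0) (- 1)) oppr0.
have e4 := eta_S_sqr z0; rewrite e3 in e4.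
transitivity (eta (- z^-1) ^+ 2); first by congr (eta _ ^+ 2).
rewrite e1; apply: etrans e4 _.
have alg (i x y : C) : - i * x * y = i * (- x) * y by ring.
exact: alg.
Qed.

(** Euclid's algorithm on the first column: with [k] the quotient of [g 0 0] by [g 1 0], [g] factors
    through the translation by [k], the inversion, and a [g'] whose lower left entry is the
    remainder. *)
Lemma weak_eta g : SL2Z g -> weak_half (@eta R) g.
Proof.
have [n] := ubnP (absz (g 1 0)%R); elim: n g => // n IH g gn Sg.
have dg : g 0 0 * g 1 1 - g 0 1 * g 1 0 = 1 by rewrite -det22.
have [c0|c0] := eqVneq (g 1 0) 0.
  rewrite c0 mulr0 subr0 in dg.
  have : (absz (g 0 0)%R * absz (g 1 1)%R)%N = 1%N by rewrite -abszM dg.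
  move=> /eqP; rewrite muln_eq1 => /andP[/eqP ha /eqP hd].
  have [a1|a1] : g 0 0 = 1 \/ g 0 0 = -1 by lia.
    have d1 : g 1 1 = 1 by move: dg; rewrite a1 mul1r.
    by rewrite [g]mat_eta c0 a1 d1; exact: weak_eta_T.
  have d1 : g 1 1 = -1 by move: dg; rewrite a1; lia.
  have -> : g = -1 * mat 1 (- g 0 1) 0 1.
    rewrite [LHS]mat_eta c0 a1 d1 (_ : -1 = mat (-1) 0 0 (-1)); last by rewrite [LHS]mat_eta !mxE.
    by rewrite mat_mul; congr mat; ring.
  have dN : 0 < \det (-1 : 'M[int]_2).
    by rewrite (_ : -1 = mat (-1) 0 0 (-1)) ?det_mat // [LHS]mat_eta !mxE.
  have dT : 0 < \det (mat 1 (- g 0 1) 0 1) by rewrite det_mat mulr1 mulr0 subr0.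
  exact: (weak_halfM dN dT weak_eta_N1 (weak_eta_T _)).
pose k := ((g 0 0)%R %/ (g 1 0)%R)%Z.
pose g' := mat (- g 1 0) (- g 1 1) (g 0 0 - k * g 1 0) (g 0 1 - k * g 1 1).
have Sg' : SL2Z g' by rewrite /SL2Z /= det_mat -[RHS]dg; ring.
have gE : g = mat 1 k 0 1 * (mat 0 1 (-1) 0 * g').
  by rewrite [LHS]mat_eta /g' !mat_mul; congr mat; ring.
have lt_c : (absz (g' 1 0)%R < n)%N.
  rewrite /g' matE; have e := divz_eq (g 0 0) (g 1 0).
  have h1 := modz_ge0 (g 0 0) c0; have h2 := ltz_mod (g 0 0) c0.
  have -> : g 0 0 - k * g 1 0 = ((g 0 0)%R %% (g 1 0)%R)%Z by rewrite {1}e /k addrC addKr.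
  by move: gn h1 h2; lia.
have Sm : 0 < \det (mat 0 1 (-1) 0) by rewrite det_mat.
rewrite gE; apply: weak_halfM; first by rewrite det_mat mulr1 mulr0 subr0.
- by rewrite det_mulmx mulr_gt0 // det_gt0.
- exact: weak_eta_T.
- by apply: weak_halfM => //; [exact: det_gt0|exact: weak_eta_S|exact: IH].
Qed.

End IntegerMatrices.

(** * Finite index, the group [Gamma16], and triangular forms *)

Section FiniteIndex.
Implicit Types (g h : 'M[int]_2) (G H : set 'M[int]_2).

Lemma SL2Z_unit g : SL2Z g -> g \is a GRing.unit.
Proof. by rewrite /SL2Z /= => dg; rewrite -[_ \is a _]/(g \in unitmx) unitmxE dg unitr1. Qed.

Lemma subgroup_SL2Z_full : subgroup_SL2Z SL2Z.
Proof.
split=> //; first by rewrite /SL2Z /= det1.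
  by move=> g h; rewrite /SL2Z /= det_mulmx => -> ->; rewrite mulr1.
by move=> g Sg; rewrite (SL2Z_adj Sg) /SL2Z /= det_mat -[RHS]Sg det22; ring.
Qed.

Lemma finite_index_full : finite_index SL2Z.
Proof.
exists [:: 1] => g Sg; exists g, 1; split=> //; first exact: mem_head.
by rewrite mulr1.
Qed.

(** One chosen element of [G] for each value of [inv] represents the cosets of [H] met by [G]. Used
    with reduction modulo 16, and with a character that has finitely many values. *)
Lemma finite_index_fibers (T : eqType) (G H : set 'M[int]_2) (inv : 'M[int]_2 -> T) (L : seq T) :
  G `<=` SL2Z -> finite_index G -> (forall g, G g -> inv g \in L) ->
  (forall g h, G g -> G h -> inv g = inv h -> H (g * h^-1)) -> finite_index H.
Proof.
move=> GS [s hs] hL hH; pose rep t := xget 1 [set g | G g /\ inv g = t].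
exists [seq rep t * h | t <- L, h <- s] => g /hs[g1 [g2 [G1 s2 ->]]].
have [Gr ir] : G (rep (inv g1)) /\ inv (rep (inv g1)) = inv g1.
  by apply: (@xgetPex _ 1 [set g | G g /\ inv g = inv g1]); exists g1.
exists (g1 * (rep (inv g1))^-1), (rep (inv g1) * g2); split.
- by apply: hH => //; rewrite ir.
- by apply/allpairsP; exists (inv g1, g2); split=> //; exact: hL.
- by rewrite mulrA mulrVK // SL2Z_unit //; exact: GS.
Qed.

(** Level 16 because the matrices placed inside [eta] later have determinants 1, 2, 8 and 16. *)
Definition Gamma16 : set 'M[int]_2 := [set g | SL2Z g /\ map_mx (intr : int -> 'Z_16) g = 1].

Lemma map_mxZ16M g h : map_mx (intr : int -> 'Z_16) (g * h) =
  map_mx (intr : int -> 'Z_16) g * map_mx (intr : int -> 'Z_16) h.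
Proof. exact: map_mxM. Qed.

Lemma map_mxZ16_1 : map_mx (intr : int -> 'Z_16) (1 : 'M[int]_2) = 1.
Proof. exact: map_mx1. Qed.

Lemma map_mxZ16_div g h : SL2Z h ->
  map_mx (intr : int -> 'Z_16) g = map_mx (intr : int -> 'Z_16) h ->
  map_mx (intr : int -> 'Z_16) (g * h^-1) = 1.
Proof. by move=> Sh e; rewrite map_mxZ16M e -map_mxZ16M mulrV ?map_mxZ16_1 // SL2Z_unit. Qed.

Lemma Gamma16_subgroup : subgroup_SL2Z Gamma16.
Proof.
have [_ S1 SM SV] := subgroup_SL2Z_full; split.
- by move=> g [].
- by split; [exact: S1|exact: map_mxZ16_1].
- move=> g h [Sg g1] [Sh h1]; split; first exact: SM.
  by rewrite map_mxZ16M g1 h1 mulr1.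
- move=> g [Sg g1]; split; first exact: SV.
  by rewrite -[g^-1]mul1r; apply: map_mxZ16_div => //; rewrite map_mxZ16_1.
Qed.

Lemma Gamma16_finite_index : finite_index Gamma16.
Proof.
apply: (@finite_index_fibers _ SL2Z _ (map_mx (intr : int -> 'Z_16)) (enum {: 'M['Z_16]_2})) => //.
- exact: finite_index_full.
- by move=> g _; rewrite mem_enum.
have [_ _ SM SV] := subgroup_SL2Z_full.
by move=> g h Sg Sh e; split; [apply: SM => //; exact: SV|exact: map_mxZ16_div].
Qed.

Lemma intr_Z16_eq0 (n : int) : n%:~R = 0 :> 'Z_16 -> exists m : int, n = 16 * m.
Proof.
have e := divz_eq n 16; have h1 := @modz_ge0 n 16 isT; have h2 := ltz_mod n (isT : (16 : int) != 0).
move: (n %/ 16)%Z (n %% 16)%Z e h1 h2 => m r -> h1 h2.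
rewrite intrD intrM (_ : 16%:~R = 0 :> 'Z_16); last exact: val_inj.
rewrite mulr0 add0r => h; exists m; rewrite mulrC; case: r h1 h2 h => // k _ k16.
rewrite -[_%:~R]/(k%:R : 'Z_16) Zp_nat => /(congr1 val) /=.
by rewrite modn_small // => ->; rewrite addr0.
Qed.

Lemma Gamma16E g : Gamma16 g -> exists x y z w : int,
  g = mat (1 + 16 * x) (16 * y) (16 * z) (1 + 16 * w).
Proof.
move=> [_ /matrixP e].
have [x hx] : exists m, g 0 0 - 1 = 16 * m.
  by apply: intr_Z16_eq0; have := e 0 0; rewrite !mxE /= rmorphB /= => ->; rewrite subrr.
have [y hy] : exists m, g 0 1 = 16 * m.
  by apply: intr_Z16_eq0; have := e 0 1; rewrite !mxE.
have [z hz] : exists m, g 1 0 = 16 * m.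
  by apply: intr_Z16_eq0; have := e 1 0; rewrite !mxE.
have [w hw] : exists m, g 1 1 - 1 = 16 * m.
  by apply: intr_Z16_eq0; have := e 1 1; rewrite !mxE /= rmorphB /= => ->; rewrite subrr.
exists x, y, z, w; rewrite [LHS]mat_eta -hx -hy -hz -hw.
by congr mat; ring.
Qed.

(** For [g = 1 + 16 X] and [m] of determinant [ad], [m g m^-1 = 1 + e m X adj(m)] is integral; [g']
    is this matrix written out. *)
Lemma Gamma16_conj g (a b d e : int) : 0 < a -> 0 < d -> a * d * e = 16 -> Gamma16 g ->
  exists2 g', SL2Z g' & mat a b 0 d * g = g' * mat a b 0 d.
Proof.
move=> a0 d0 ade Gg; have [x [y [z [w gE]]]] := Gamma16E Gg.
pose g' := mat (1 + e * ((a * x + b * z) * d)) (e * ((a * y + b * w) * a - (a * x + b * z) * b))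
  (e * (d * d * z)) (1 + e * (a * d * w - b * d * z)).
have eq : mat a b 0 d * g = g' * mat a b 0 d.
  by rewrite gE /g' !mat_mul -ade; congr mat; ring.
exists g' => //; have := congr1 determinant eq; rewrite !det_mulmx.
have [Sg _] := Gg; rewrite [\det g]Sg mulr1 det_mat mulr0 subr0 => h.
have ad0 : a * d != 0 by rewrite gt_eqF // mulr_gt0.
by apply: (mulIf ad0); rewrite /= -h mul1r.
Qed.

(* Hermite normal form. *)
Lemma upper_triangular_decomposition m : 0 < \det m -> exists g (B D : int),
  [/\ SL2Z g, 0 < gcdz (m 0 0) (m 1 0), gcdz (m 0 0) (m 1 0) * D = \det m &
      m = g * mat (gcdz (m 0 0) (m 1 0)) B 0 D].
Proof.
move=> m0; set A := gcdz _ _.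
have A0 : A != 0.
  apply/negP; rewrite gcdz_eq0 => /andP[/eqP ha /eqP hc].
  by move: m0; rewrite det22 ha hc mul0r mulr0 subrr ltxx.
have Ap : 0 < A by rewrite lt_neqAle eq_sym A0 /=.
have [u [v uv]] := Bezoutz (m 0 0) (m 1 0).
have [a ha] : exists a, m 0 0 = a * A by apply/dvdzP; exact: dvdz_gcdl.
have [c hc] : exists c, m 1 0 = c * A by apply/dvdzP; exact: dvdz_gcdr.
have b1 : u * a + v * c = 1.
  have uvA : u * m 0 0 + v * m 1 0 = A := uv.
  by apply: (mulIf A0); rewrite mul1r -[RHS]uvA ha hc; ring.
exists (mat a (- v) c u), (u * m 0 1 + v * m 1 1), (a * m 1 1 - c * m 0 1); split=> //.
- by rewrite /SL2Z /= det_mat -b1; ring.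
- by rewrite det22 ha hc; ring.
rewrite [LHS]mat_eta mat_mul ha hc; congr mat; try ring.
  by rewrite -[LHS]mul1r -b1; ring.
by rewrite -[LHS]mul1r -b1; ring.
Qed.

End FiniteIndex.

(** * Growth of eta quotients at the cusps *)

Section EtaBounds.
Variable R : realType.
Local Notation C := (Cplx R).
Local Notation nc := (@normc R).
Implicit Types (g m : 'M[int]_2) (z : C) (f : C -> C).

Lemma limr_le_bound (u : nat -> R) (l M : R) : u @ \oo --> l -> (forall n, u n <= M) -> l <= M.
Proof.
move=> c uM; rewrite -(cvg_lim (@Rhausdorff R) c); apply: limr_le; first exact: cvgP c.
exact: nearW.
Qed.

Lemma nc_intr (n : int) : 0 < n -> nc (n%:~R) = n%:~R :> R.
Proof. by move=> n0; rewrite intrC nc_real ger0_norm // ler0z ltW. Qed.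

Lemma nc_qpoch_oo_bounds (q : C) : nc q <= 1 / 2 ->
  nc (qpoch_oo q q) <= expR 1 /\ nc (qpoch_oo q q)^-1 <= expR 2.
Proof.
move=> q2; have q0 := nc_ge0 q; have q1 : nc q < 1 by lra.
have d1 : 1 / 2 <= 1 - nc q by lra.
have d0 : 0 < 1 - nc q by lra.
have b1 : nc q / (1 - nc q) <= 1 by rewrite ler_pdivrMr // mul1r; lra.
have b2 : nc q / (1 - nc q) / (1 - nc q) <= 2.
  by rewrite ler_pdivrMr //; apply: (le_trans b1); lra.
have c := qpoch_cvg q1 (x := q); have q00 := qpoch_oo_q_neq0 q1.
split.
  apply: (@limr_le_bound (fun n => nc (qpoch q q n))); first exact: cvg_ncr c.
  by move=> n; apply: (le_trans (qpoch_bound q1 q n)); rewrite ler_expR.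
apply: (@limr_le_bound (fun n => nc (qpoch q q n)^-1)); first exact: cvg_ncr (cseqV q00 c).
by move=> n; apply: (le_trans (qpochV_bound q1 n q1)); rewrite ler_expR.
Qed.

Lemma nc_ez24 z : nc (ez (24^-1 * z)) = expR (- (pi / 12 * complex.Im z)).
Proof.
rewrite nc_ez; congr expR; congr (- _).
have -> : (24^-1 : C) = (24^-1 : R)%:C%C by rewrite fmorphV rmorph_nat.
by rewrite ImZ; lra.
Qed.

(** For [Im z >= 1] one has [|ez z| <= 1/2], so the infinite product is bounded above and below and
    [eta] has the size of its first factor. *)
Lemma eta_bounds z : 1 <= complex.Im z ->
  nc (eta z) <= expR (- (pi / 12 * complex.Im z)) * expR 1 /\
  (nc (eta z))^-1 <= expR (pi / 12 * complex.Im z) * expR 2.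
Proof.
move=> z1; have pp := pi_ge2 R.
have q2 : nc (ez z) <= 1 / 2.
  rewrite nc_ez expRN mul1r lef_pV2 ?posrE ?expR_gt0 //.
  apply: le_trans (expR_ge1Dx _); have : 1 * 1 <= pi * complex.Im z by rewrite ler_pM //; lra.
  by lra.
have [b1 b2] := nc_qpoch_oo_bounds q2.
rewrite /eta ncM nc_ez24; split; first by rewrite ler_wpM2l ?expR_ge0.
by rewrite invfM -expRN opprK ler_wpM2l ?expR_ge0 // -ncV.
Qed.

Lemma nc_eta_sqr g z : SL2Z g -> 0 < complex.Im z ->
  nc (eta (moebius g z)) ^+ 2 = nc (denom g z) * nc (eta z) ^+ 2.
Proof.
move=> Sg z0; have [K [K1 /(_ z z0) h]] := weak_eta R Sg.
have gen (a d b : C) : a ^+ 2 = K * d * b ^+ 2 -> nc a ^+ 2 = nc d * nc b ^+ 2.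
  by move=> e; rewrite -ncX e (ncM (K * d) (b ^+ 2)) (ncM K d) (nc_root1 K1) mul1r (ncX b 2).
exact: gen h.
Qed.

Definition upper_tri m := m 1 0 = 0 /\ 0 < m 0 0 /\ 0 < m 1 1.

Lemma upper_tri_mat (a b d : int) : 0 < a -> 0 < d -> upper_tri (mat a b 0 d).
Proof. by move=> a0 d0; rewrite /upper_tri !matE. Qed.

Lemma upper_tri_det m : upper_tri m -> 0 < \det m.
Proof. by move=> [m0 [a0 d0]]; rewrite det22 m0 mulr0 subr0 mulr_gt0. Qed.

Lemma upper_tri_denom m z : upper_tri m -> denom m z = (m 1 1)%:~R.
Proof. by move=> [m0 _]; rewrite /denom m0 mul0r add0r. Qed.

Lemma upper_tri_im m z : upper_tri m ->
  complex.Im (moebius m z) = (m 0 0)%:~R / (m 1 1)%:~R * complex.Im z.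
Proof.
move=> um; have [m0 [a0 d0]] := um; rewrite im_moebius upper_tri_denom // det22 m0 mulr0 subr0.
have dR : 0 < (m 1 1)%:~R :> R by rewrite ltr0z.
rewrite (nc_intr d0) intrM.
move: (_%:~R : R) (_%:~R : R) dR => a d d0'; field; exact: lt0r_neq0.
Qed.

(* The size of eta composed with an integral matrix near a cusp is read off from
   the Hermite normal form of the product. *)
Lemma nc_eta_cusp m g : upper_tri m -> SL2Z g -> exists T (k : R),
  [/\ upper_tri T, \det T = \det m, T 0 0 = gcdz ((m * g) 0 0) ((m * g) 1 0), 0 < k &
      forall z, 0 < complex.Im z ->
      nc (eta (moebius m (moebius g z))) ^+ 2 =
      k * nc (denom g z) * nc (eta (moebius T z)) ^+ 2].
Proof.
move=> um Sg; have m0 := upper_tri_det um; have g0 := det_gt0 Sg.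
have mg0 : 0 < \det (m * g) by rewrite det_mulmx mulr_gt0.
have [h [B [D [Sh A0 AD e]]]] := upper_triangular_decomposition mg0.
set A := gcdz _ _ in A0 AD e *.
have dm : \det (m * g) = \det m by rewrite det_mulmx [\det g]Sg mulr1.
have D0 : 0 < D by rewrite -(pmulr_rgt0 _ A0) AD.
have uT := @upper_tri_mat A B D A0 D0; set T := mat A B 0 D in uT e *.
have [_ [_ d0]] := um.
have dR : 0 < (m 1 1)%:~R :> R by rewrite ltr0z.
have DR : 0 < D%:~R :> R by rewrite ltr0z.
exists T, ((m 1 1)%:~R / D%:~R); split=> //.
- by rewrite /T det_mat mulr0 subr0 AD.
- by rewrite /T matE.
- exact: divr_gt0.
move=> z z0; have dg := denom_neq0 z0 g0; have T0 := upper_tri_det uT.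
have dT := denom_neq0 z0 T0; have Tz0 := im_moebius_gt0 z0 T0.
have e1 : moebius m (moebius g z) = moebius h (moebius T z).
  by rewrite -(moebiusM m dg) e (moebiusM h dT).
have e2 : denom m (moebius g z) * denom g z = denom h (moebius T z) * denom T z.
  by rewrite -(denomM m dg) e (denomM h dT).
rewrite (upper_tri_denom _ um) (upper_tri_denom _ uT) {2}/T matE in e2.
have e3 := congr1 nc e2; rewrite !ncM (nc_intr d0) (nc_intr D0) in e3.
have DN := lt0r_neq0 DR.
have gen (x y a b : R) : b != 0 -> a * x = y * b -> y = a / b * x.
  by move=> b0 ab; apply: (mulIf b0); rewrite -ab; field.
apply: (etrans (congr1 (fun x => nc (eta x) ^+ 2) e1)); apply: (etrans (nc_eta_sqr Sh Tz0)).
exact: (congr1 (fun x => x * _) (gen _ _ _ _ DN e3)).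
Qed.

Definition cusp_bounded f := forall g, SL2Z g -> exists A B : R, 0 < A /\
  forall z, A <= complex.Im z -> nc (f (moebius g z) / autfactor g z) <= B.

(** The common shape of the forms needed: [eta] itself, with equal matrices, then [eta(z)^2/eta(2z)]
    and [eta(2z)^2/eta(z)], and the first of these quotients at [2z + 1/2]. *)
Definition eta_quotient m1 m2 z := eta (moebius m1 z) ^+ 2 / eta (moebius m2 z).

Lemma nc_autfactor g z : nc (autfactor g z) ^+ 2 = nc (denom g z).
Proof. by rewrite -ncX /autfactor expr2 sqrtc_sqr. Qed.

(** [t1] and [t2] are the moduli of [eta] at points of heights [Y1] and [Y2], and [Y2 <= 2 Y1] keeps
    [t1^2/t2] bounded. Only squared moduli are known, so [w^2] is bounded first and [w <= w^2 + 1]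
    concludes. *)
Lemma eta_quotient_ratio (k1 k2 E1 E2 t1 t2 af dn Y1 Y2 : R) :
  0 < k1 -> 0 < k2 -> 0 < dn -> 0 < t2 -> 0 <= t1 -> Y2 <= 2 * Y1 ->
  t1 <= expR (- (pi / 12 * Y1)) * expR 1 -> t2^-1 <= expR (pi / 12 * Y2) * expR 2 ->
  E1 ^+ 2 = k1 * dn * t1 ^+ 2 -> E2 ^+ 2 = k2 * dn * t2 ^+ 2 -> af ^+ 2 = dn ->
  E1 ^+ 2 / E2 / af <= k1 ^+ 2 / k2 * expR 8 + 1.
Proof.
move=> k10 k20 dn0 t20 t10 Y12 b1 b2 hE1 hE2 haf; have pp := pi_ge2 R.
have key : (E1 ^+ 2 / E2 / af) ^+ 2 = k1 ^+ 2 / k2 * (t1 ^+ 2 * t2^-1) ^+ 2.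
  rewrite !expr_div_n hE1 hE2 haf; field.
  by rewrite !lt0r_neq0.
set w := E1 ^+ 2 / E2 / af in key *.
have b3 : t1 ^+ 2 * t2^-1 <= expR 4.
  apply: (@le_trans _ _ ((expR (- (pi / 12 * Y1)) * expR 1) ^+ 2 *
    (expR (pi / 12 * Y2) * expR 2))).
    by rewrite ler_pM ?exprn_ge0 ?invr_ge0 ?(ltW t20) // lerXn2r ?nnegrE // mulr_ge0 ?expR_ge0.
  rewrite expr2 -!expRD ler_expR.
  have : pi / 12 * Y2 <= pi / 12 * (2 * Y1).
    by rewrite ler_wpM2l // divr_ge0 //; lra.
  by lra.
have b4 : w ^+ 2 <= k1 ^+ 2 / k2 * expR 8.
  rewrite key ler_wpM2l ?divr_ge0 ?exprn_ge0 ?(ltW k10) ?(ltW k20) //.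
  have -> : expR 8 = expR 4 ^+ 2 :> R by rewrite expr2 -expRD; congr expR; lra.
  by rewrite lerXn2r ?nnegrE ?expR_ge0 // mulr_ge0 ?exprn_ge0 // invr_ge0 ltW.
have : w * 2 <= w ^+ 2 + 1 by have := sqr_ge0 (w - 1); rewrite sqrrB expr1n mulr1 mulr_natr; lra.
have := sqr_ge0 w; lra.
Qed.

(** The gcd condition says that the order at every cusp is nonnegative. At the cusp of [g], [eta]
    composed with [m] vanishes to an order proportional to [A/D = A^2/det m], where [A] is the gcd
    of the first column of [m g]; the numerator counts twice. *)
Lemma eta_quotient_cusp m1 m2 : upper_tri m1 -> upper_tri m2 ->
  (forall g, SL2Z g -> \det m1 * gcdz ((m2 * g) 0 0) ((m2 * g) 1 0) ^+ 2 <=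
      2 * \det m2 * gcdz ((m1 * g) 0 0) ((m1 * g) 1 0) ^+ 2) ->
  cusp_bounded (eta_quotient m1 m2).
Proof.
move=> u1 u2 hg g Sg.
have [T1 [k1 [v1 det1 A1 k10 h1]]] := nc_eta_cusp u1 Sg.
have [T2 [k2 [v2 det2 A2 k20 h2]]] := nc_eta_cusp u2 Sg.
have := hg g Sg; rewrite -A1 -A2 -det1 -det2.
have [c1 [a1 d1]] := v1; have [c2 [a2 d2]] := v2.
rewrite !det22 c1 c2 !mulr0 !subr0 => hT.
have [x1 [y1 [x2 [y2 [e1 e2 e3 e4]]]]] : exists x1 y1 x2 y2 : R, [/\ x1 = (T1 0 0)%:~R,
  y1 = (T1 1 1)%:~R, x2 = (T2 0 0)%:~R & y2 = (T2 1 1)%:~R] by do 4 eexists; split.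
have x11 : 1 <= x1 by rewrite e1 ler1z.
have y11 : 1 <= y1 by rewrite e2 ler1z.
have x21 : 1 <= x2 by rewrite e3 ler1z.
have y21 : 1 <= y2 by rewrite e4 ler1z.
have hR : x2 / y2 <= 2 * (x1 / y1).
  have hT' : T2 0 0 * T1 1 1 <= 2 * T2 1 1 * T1 0 0.
    have aa : 0 < T1 0 0 * T2 0 0 by exact: mulr_gt0.
    by rewrite -(ler_pM2l aa); apply: le_trans (le_trans hT _); rewrite le_eqVlt; apply/orP; left; apply/eqP; ring.
  have h : x2 * y1 <= 2 * y2 * x1.
    by move: hT'; rewrite -(ler_int R) !intrM -e1 -e2 -e3 -e4.
  rewrite ler_pdivrMr; last lra.
  have alg (x y w : R) : 2 * (x / y) * w = 2 * w * x / y by ring.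
  rewrite alg.
  by rewrite ler_pdivlMr //; lra.
exists (y1 + y2), (k1 ^+ 2 / k2 * expR 8 + 1); split; first lra.
move=> z zy; have z0 : 0 < complex.Im z by lra.
have dg := denom_neq0 z0 (det_gt0 Sg); have den0 : 0 < nc (denom g z) by rewrite nc_gt0.
have im1 := upper_tri_im z v1; have im2 := upper_tri_im z v2.
rewrite -e1 -e2 in im1; rewrite -e3 -e4 in im2.
have Y1 : 1 <= complex.Im (moebius T1 z).
  rewrite im1 mulrAC ler_pdivlMr ?mul1r; last lra.
  have : 1 * y1 <= x1 * complex.Im z by apply: ler_pM; lra.
  by rewrite mul1r.
have Y2 : 1 <= complex.Im (moebius T2 z).
  rewrite im2 mulrAC ler_pdivlMr ?mul1r; last lra.
  have : 1 * y2 <= x2 * complex.Im z by apply: ler_pM; lra.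
  by rewrite mul1r.
have Y12 : complex.Im (moebius T2 z) <= 2 * complex.Im (moebius T1 z).
  by rewrite im1 im2 mulrA ler_wpM2r // ltW.
have [b1 _] := eta_bounds Y1; have [_ b2] := eta_bounds Y2.
have n20 : 0 < nc (eta (moebius T2 z)) by rewrite nc_gt0 eta_neq0 //; lra.
have en0 := nc_ge0 (eta (moebius T1 z)).
have := h1 z z0; have := h2 z z0; have := nc_autfactor g z.
have gen (a b c : C) : nc (a ^+ 2 / b / c) = nc a ^+ 2 / nc b / nc c.
  by rewrite (ncM (a ^+ 2 / b)) (ncM (a ^+ 2)) !ncV (ncX a 2).
rewrite [leLHS](_ : _ = nc (eta (moebius m1 (moebius g z))) ^+ 2
  / nc (eta (moebius m2 (moebius g z))) / nc (autfactor g z)); last exact: gen.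
move=> haf hE2 hE1.
exact: (eta_quotient_ratio k10 k20 den0 n20 (nc_ge0 _) Y12 b1 b2 hE1 hE2 haf).
Qed.

End EtaBounds.

(** * From eta quotients to modular forms *)

Section ModularForms.
Variable R : realType.
Local Notation C := (Cplx R).
Local Notation nc := (@normc R).
Implicit Types (g m : 'M[int]_2) (z : C) (f : C -> C).

(** Nonvanishing belongs to the record because the multipliers are defined as quotients of
    values. *)
Record theta_form f : Prop := ThetaForm {
  theta_form_neq0 : forall z, 0 < complex.Im z -> f z != 0;
  theta_form_cderiv : forall z, 0 < complex.Im z -> exists l, cderiv f z l;
  theta_form_weak : forall g, Gamma16 g -> weak_half f g;
  theta_form_cusp : cusp_bounded f }.

(** Conjugation by [m] carries [Gamma16] into [SL2Z], where the law of [eta] is known; the constant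
    denominators of [m] cancel. *)
Lemma weak_eta_moebius m : upper_tri m -> (\det m %| 16)%Z ->
  forall g, Gamma16 g -> weak_half (fun z => eta (moebius m z)) g.
Proof.
move=> um /dvdzP[e he] g Gg; have m0 := upper_tri_det um; have [c0 [a0 d0]] := um.
have em : m = mat (m 0 0) (m 0 1) 0 (m 1 1) by rewrite {1}[m]mat_eta c0.
have ade : m 0 0 * m 1 1 * e = 16.
  by transitivity (e * \det m); [rewrite det22 c0 mulr0 subr0 mulrC|exact: esym he].
have [g' Sg' eg] := Gamma16_conj (m 0 1) a0 d0 ade Gg; rewrite -em in eg.
have [K [K1 hK]] := weak_eta R Sg'; exists K; split; first exact: K1.
move=> z z0; have dg := denom_neq0 z0 (det_gt0 (proj1 Gg)); have dm := denom_neq0 z0 m0.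
have e1 : moebius m (moebius g z) = moebius g' (moebius m z).
  by rewrite -(moebiusM m dg) eg (moebiusM g' dm).
have e2 : denom m (moebius g z) * denom g z = denom g' (moebius m z) * denom m z.
  by rewrite -(denomM m dg) eg (denomM g' dm).
rewrite !(upper_tri_denom _ um) [RHS]mulrC in e2.
have d1 : (m 1 1)%:~R != 0 :> C by rewrite intr_eq0 gt_eqF.
have e3 := mulfI d1 e2.
apply: (etrans (congr1 (fun x => eta x ^+ 2) e1)).
apply: (etrans (hK _ (im_moebius_gt0 z0 m0))).
exact: (congr1 (fun x => K * x * _) (esym e3)).
Qed.

Lemma theta_form_eta_quotient m1 m2 : upper_tri m1 -> upper_tri m2 ->
  (\det m1 %| 16)%Z -> (\det m2 %| 16)%Z ->
  (forall g, SL2Z g -> \det m1 * gcdz ((m2 * g) 0 0) ((m2 * g) 1 0) ^+ 2 <=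
      2 * \det m2 * gcdz ((m1 * g) 0 0) ((m1 * g) 1 0) ^+ 2) ->
  theta_form (eta_quotient m1 m2 : C -> C).
Proof.
move=> u1 u2 v1 v2 hg; have m10 := upper_tri_det u1; have m20 := upper_tri_det u2.
have n m z : 0 < \det m -> 0 < complex.Im z -> eta (moebius m z) != 0.
  by move=> m0 z0; exact: (eta_neq0 (im_moebius_gt0 z0 m0)).
have d m z : 0 < \det m -> 0 < complex.Im z -> exists l, cderiv (fun x => eta (moebius m x)) z l.
  move=> m0 z0; have [l hl] := moebius_cderiv z0 m0; eexists.
  exact: (cderiv_comp hl (cderiv_eta (im_moebius_gt0 z0 m0))).
split.
- by move=> z z0; apply: mulf_neq0; [exact: (expf_neq0 2 (n _ _ m10 z0))|rewrite invr_eq0; exact: n].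
- move=> z z0.
  have -> : eta_quotient m1 m2 =
      (fun x : C => eta (moebius m1 x) * eta (moebius m1 x) * (eta (moebius m2 x))^-1).
    by apply/funext => x; rewrite /eta_quotient expr2.
  have [l1 h1] := d _ _ m10 z0; have [l2 h2] := d _ _ m20 z0.
  have h3 := @cderivV R (fun x => eta (moebius m2 x)) z l2 (n _ _ m20 z0) h2.
  have h := cderivM (cderivM h1 h1) h3; eexists; exact: h.
- move=> g Gg; have [K1 [k1 h1]] := weak_eta_moebius u1 v1 Gg.
  have [K2 [k2 h2]] := weak_eta_moebius u2 v2 Gg.
  have K20 : K2 != 0 by apply/negP => /eqP k0; move/eqP: k2; rewrite k0 expr0n /= eq_sym oner_eq0.
  exists (K1 ^+ 2 / K2); split.
    by rewrite expr_div_n -exprM mulnC exprM k1 k2 expr1n divr1.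
  move=> z z0; have := h1 z z0; have := h2 z z0.
  have dg := denom_neq0 z0 (det_gt0 (proj1 Gg)); have n2 := n _ _ m20 z0.
  have gen (a b c c' x : C) : K2 != 0 -> x != 0 -> c' != 0 -> c ^+ 2 = K2 * x * c' ^+ 2 ->
      a ^+ 2 = K1 * x * b ^+ 2 -> (a ^+ 2 / c) ^+ 2 = K1 ^+ 2 / K2 * x * (b ^+ 2 / c') ^+ 2.
    by move=> ? ? ? ec ea; rewrite !expr_div_n ec ea; field; do ?(apply/andP; split).
  exact: gen K20 dg n2.
exact: eta_quotient_cusp.
Qed.

(** The combination of theta forms describes [q_twist r F] on the half-plane only. The slope
    function is kept where [z + x] stays in it, in particular near [x = 0], and is a difference
    quotient elsewhere. *)
Lemma cderiv_upper_half f f' z l : (forall w, 0 < complex.Im w -> f w = f' w) -> 0 < complex.Im z ->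
  cderiv f z l -> cderiv f' z l.
Proof.
move=> ef z0 [p [p1 p2 p3]].
exists (fun x => if 0 < complex.Im (z + x) then p x else (f' (z + x) - f' z) / x); split.
- move=> x; case: ifP => h; first by rewrite -!ef.
  have [x0|x0] := eqVneq x 0; first by rewrite x0 addr0 mulr0 addr0.
  by rewrite divfK // [RHS]addrC subrK.
- by rewrite addr0 z0.
move=> e /p3[d d0 hd]; exists (Num.min d (complex.Im z)); first by rewrite lt_min d0.
move=> x; rewrite lt_min => /andP[/hd h xz].
have h2 : 0 < complex.Im (z + x).
  have := le_lt_trans (nc_Im x) xz; rewrite ImD ltr_norml => /andP[h1 _].
  by rewrite -(subrr (complex.Im z)) ltrD2l.
by rewrite h2.
Qed.

Lemma autfactor_neq0 g z : SL2Z g -> 0 < complex.Im z -> autfactor g z != 0.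
Proof.
move=> Sg z0; apply: contra_neq (denom_neq0 z0 (det_gt0 Sg)) => h.
by rewrite -[denom g z]sqrtc_sqr -/(autfactor g z) h mul0r.
Qed.

Lemma unity_roots_seq n : exists L : seq C, forall x : C, x ^+ n.+1 = 1 -> x \in L.
Proof.
have [L hL] := @closed_field_poly_normal (complex R) ('X^(n.+1) - 1).
exists L => x hx; have p0 : 'X^(n.+1) - 1 != 0 :> {poly complex R}.
  by rewrite -size_poly_eq0 -[1]/(1%:P) size_XnsubC.
have : root ('X^(n.+1) - 1 : {poly complex R}) x.
  apply/rootP; rewrite !hornerE; apply/eqP; rewrite subr_eq0; apply/eqP; exact: hx.
rewrite hL rootZ ?lead_coef_eq0 //.
by rewrite root_prod_XsubC.
Qed.

(** The automorphy factors are the same in both cocycle relations and cancel, so the ratio of two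
    multiplier systems is a character. *)
Lemma ratio_multiplier G (nu nu' : 'M[int]_2 -> C) : subgroup_SL2Z G ->
  multiplier_system G nu -> multiplier_system G nu' ->
  forall g h, G g -> G h -> nu (g * h) / nu' (g * h) = nu g / nu' g * (nu h / nu' h).
Proof.
move=> [GS _ GM _] [n1 n2 _] [n1' n2' _] g h Gg Gh; pose ii : C := (0 +i* 1)%C.
have i0 : upper_half ii by rewrite /upper_half /= ltr01.
have e := n2 _ _ _ Gg Gh i0; have e' := n2' _ _ _ Gg Gh i0.
have a0 := autfactor_neq0 (GS _ (GM _ _ Gg Gh)) i0.
have n0 (mu : 'M[int]_2 -> C) k : (forall g, G g -> `|mu g| = 1) -> G k -> mu k != 0.
  move=> hm Gk; apply/negP => /eqP k0; have := hm _ Gk; rewrite k0 normr0 => /eqP.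
  by rewrite eq_sym oner_eq0.
have b1 := n0 _ _ n1' Gg; have b2 := n0 _ _ n1' Gh; have b3 := n0 _ _ n1' (GM _ _ Gg Gh).
have gen (a u v w u' v' w' x y : C) : a != 0 -> v' != 0 -> w' != 0 -> u' != 0 ->
  u * a = v * w * x * y -> u' * a = v' * w' * x * y -> u / u' = v / v' * (w / w').
  move=> ha hv hw hu h1 h2; have xy : x * y = u' * a / (v' * w').
    by rewrite h2; field; apply/andP.
  apply: (mulIf ha); apply: (mulIf hu); rewrite mulrAC divfK // h1 -[v * w * x * y]mulrA xy.
  by field; apply/andP.
exact: (gen _ _ _ _ _ _ _ _ _ a0 b1 b2 b3 e e').
Qed.

(** On the kernel of the character [om] both forms share a multiplier, so their combinations
    transform alike; the finitely many values of [om] give the index. A single form is the case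
    [f' = f], [b = 0]. *)
Lemma modular_of_theta_forms (F : C -> C) (r : rat) (a b : C) f f' : theta_form f -> theta_form f' ->
  (forall z, 0 < complex.Im z -> q_twist r F z = a * f z + b * f' z) -> modular_up_to_q_power F.
Proof.
move=> [f0 fd fw fc] [f0' fd' fw' fc'] eF; have sG := Gamma16_subgroup.
have fl z : 0 < complex.Im z -> clim0 (fun x => f (z + x)) (f z).
  by move=> /fd[l /cderiv_conv].
have fl' z : 0 < complex.Im z -> clim0 (fun x => f' (z + x)) (f' z).
  by move=> /fd'[l /cderiv_conv].
have [nu [mu tr nu24]] := multiplier_of_weak sG f0 fl fw.
have [nu' [mu' tr' nu24']] := multiplier_of_weak sG f0' fl' fw'.
pose om g := nu g / nu' g.
have omM g h : Gamma16 g -> Gamma16 h -> om (g * h) = om g * om h.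
  exact: (ratio_multiplier sG mu mu').
have [GS G1 GM GV] := sG.
have om24 g : Gamma16 g -> om g ^+ 24 = 1.
  by move=> Gg; rewrite /om expr_div_n nu24 // nu24' // divr1.
have om0 g : Gamma16 g -> om g != 0.
  by move=> /om24 h; apply/negP => /eqP k0; move/eqP: h; rewrite k0 expr0n /= eq_sym oner_eq0.
have om1 : om 1 = 1.
  by apply: (mulIf (om0 _ G1)); rewrite -(omM _ _ G1 G1) !mul1r.
have omV g : Gamma16 g -> om g^-1 = (om g)^-1.
  move=> Gg; apply: (mulIf (om0 _ Gg)); rewrite -(omM _ _ (GV _ Gg) Gg) mulVf ?om0 //.
  by rewrite mulVr ?om1 // SL2Z_unit //; exact: GS.
pose K : set 'M[int]_2 := [set g | Gamma16 g /\ om g = 1].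
have nuK g : K g -> nu g = nu' g.
  move=> [Gg /eqP]; rewrite /om; have := om0 _ Gg; rewrite /om mulf_eq0 invr_eq0 negb_or => /andP[_ h].
  by rewrite -(inj_eq (mulIf h)) divfK // mul1r => /eqP.
exists r, K, nu; split; split.
- split=> //.
  + by move=> g [Gg _]; exact: GS.
  + move=> g h [Gg g1] [Gh h1]; split; first exact: GM.
    by rewrite omM // g1 h1 mulr1.
  + by move=> g [Gg g1]; split; [exact: GV|rewrite omV // g1 invr1].
- have [L hL] := unity_roots_seq 23.
  apply: (@finite_index_fibers C Gamma16 K om L) => //.
  + exact: Gamma16_finite_index.
  + by move=> g Gg; apply: hL; exact: om24.
  move=> g h Gg Gh e; split; first by apply: GM => //; exact: GV.
  by rewrite (omM _ _ Gg (GV _ Gh)) omV // e mulfV // om0.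
- have [m1 m2 m3] := mu; split.
  + by move=> g [Gg _]; exact: m1.
  + by move=> g h z [Gg _] [Gh _]; exact: m2.
  + by move=> [Gg _]; exact: m3.
- move=> z z0; have [l hl] := fd z z0; have [l' hl'] := fd' z z0.
  have h := cderivD (cderivM (cderiv_cst a z) hl) (cderivM (cderiv_cst b z) hl').
  apply: (@cderiv_derivable _ _ _ _ (cderiv_upper_half _ z0 h)).
  by move=> w w0; rewrite eF.
- move=> g z Kg z0; have Gg := proj1 Kg.
  rewrite (eF z z0) (eF _ (im_moebius_gt0 z0 (det_gt0 (GS _ Gg)))) (tr _ _ Gg z0) (tr' _ _ Gg z0).
  have gen (k x y v : C) : a * (k * v * x) + b * (k * v * y) = k * v * (a * x + b * y) by ring.
  by rewrite -(nuK _ Kg); exact: gen.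
move=> g Sg; have [A1 [B1 [A10 h1]]] := fc g Sg; have [A2 [B2 [A20 h2]]] := fc' g Sg.
exists (A1 + A2), (nc a * B1 + nc b * B2); split; first exact: addr_gt0.
move=> z zA; have z1 : A1 <= complex.Im z by lra.
have z2 : A2 <= complex.Im z by lra.
have z0 : 0 < complex.Im z by lra.
rewrite (eF _ (im_moebius_gt0 z0 (det_gt0 Sg))) ncE lecR.
have gen (x y v : C) : (a * x + b * y) / v = a * (x / v) + b * (y / v) by ring.
rewrite [X in nc X]gen; apply: (le_trans (ncD _ _)); rewrite (ncM a) (ncM b).
by apply: lerD; apply: ler_wpM2l; rewrite ?nc_ge0 //; [exact: h1|exact: h2].
Qed.

End ModularForms.

(** * The four theta functions as eta quotients *)

Section ThetaModularity.
Variable R : realType.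
Local Notation C := (Cplx R).
Local Notation nc := (@normc R).
Implicit Types (q z : C) (g : 'M[int]_2).

Lemma gcdn_eq0_and (m n : nat) : gcdn m n = 0%N -> m = 0%N /\ n = 0%N.
Proof.
move=> h; have := gcdn_gt0 m n; rewrite h ltnn => /esym/negbT.
by rewrite negb_or -!eqn0Ngt => /andP[/eqP -> /eqP ->].
Qed.

Lemma gcdz_double_le (x y : int) : gcdz (2 * x) y <= 2 * gcdz x y.
Proof.
rewrite /gcdz abszM /=; have [g0|g0] := posnP (gcdn `|x| `|y|).
  by have [-> ->] := gcdn_eq0_and g0; rewrite muln0.
rewrite -[2 : int]/(Posz 2) -PoszM lez_nat dvdn_leq ?muln_gt0 // muln_gcdr.
by rewrite dvdn_gcd dvdn_gcdl dvdn_mull // dvdn_gcdr.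
Qed.

Lemma gcdz_le_double (x y : int) : gcdz x y <= gcdz (2 * x) y.
Proof.
rewrite /gcdz abszM /= lez_nat; have [g0|g0] := posnP (gcdn (2 * `|x|) `|y|).
  by have [/eqP] := gcdn_eq0_and g0; rewrite muln_eq0 /= => /eqP -> ->.
by rewrite dvdn_leq // dvdn_gcd dvdn_gcdr dvdn_mull // dvdn_gcdl.
Qed.

Lemma gcdz_sqr_double (x y : int) : gcdz (2 * x) y ^+ 2 <= 4 * gcdz x y ^+ 2.
Proof.
have h1 := gcdz_double_le x y; have h0 : 0 <= gcdz (2 * x) y by [].
by rewrite (_ : 4 * _ = (2 * gcdz x y) ^+ 2) ?lerXn2r ?nnegrE ?mulr_ge0 // exprMn.
Qed.

Lemma col_mat (a b d : int) g : ((mat a b 0 d * g) 0 0 = a * g 0 0 + b * g 1 0) *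
  ((mat a b 0 d * g) 1 0 = d * g 1 0).
Proof. by rewrite !mul22 !matE mul0r add0r. Qed.

Let I1 := mat 1 0 0 1.
Let D2 := mat 2 0 0 1.

Lemma theta_form_eta : theta_form (eta_quotient I1 I1 : C -> C).
Proof.
apply: theta_form_eta_quotient; rewrite ?det_mat //; try exact: upper_tri_mat.
move=> g _; set G := gcdz _ _; have := sqr_ge0 G; rewrite mulr0 subr0 !mulr1 mul1r; lia.
Qed.

Lemma theta_form_theta4 : theta_form (eta_quotient I1 D2 : C -> C).
Proof.
apply: theta_form_eta_quotient; rewrite ?det_mat //; try exact: upper_tri_mat.
move=> g _; rewrite !col_mat !mul0r !addr0 !mul1r.
by have := gcdz_sqr_double (g 0 0) (g 1 0); move: (gcdz _ _ ^+ 2) (gcdz _ _ ^+ 2) => x y; lia.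
Qed.

Lemma theta_form_triangular : theta_form (eta_quotient D2 I1 : C -> C).
Proof.
apply: theta_form_eta_quotient; rewrite ?det_mat //; try exact: upper_tri_mat.
move=> g _; rewrite !col_mat !mul0r !addr0 !mul1r.
have h : gcdz (g 0 0) (g 1 0) ^+ 2 <= gcdz (2 * g 0 0) (g 1 0) ^+ 2.
  by rewrite lerXn2r ?nnegrE // gcdz_le_double.
by move: h; move: (gcdz _ _ ^+ 2) (gcdz _ _ ^+ 2) => x y; lia.
Qed.

(** The matrices stand for [w = (4z + 1)/2] and [2w = (8z + 2)/2]. The second is left unreduced:
    after multiplication by [g] its first column is that of the first matrix with the top entry
    doubled, which is what [gcdz_sqr_double] compares. *)
Lemma theta_form_theta3_double : theta_form (eta_quotient (mat 4 1 0 2) (mat 8 2 0 2) : C -> C).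
Proof.
apply: theta_form_eta_quotient; rewrite ?det_mat //; try exact: upper_tri_mat.
move=> g _; rewrite !col_mat.
have -> : 8 * g 0 0 + 2 * g 1 0 = 2 * (4 * g 0 0 + 1 * g 1 0) by ring.
have := gcdz_sqr_double (4 * g 0 0 + 1 * g 1 0) (2 * g 1 0).
by move: (gcdz _ _ ^+ 2) (gcdz _ _ ^+ 2) => x y; lia.
Qed.

Lemma eta_double z : 0 < complex.Im z ->
  eta (2 * z) = ez (24^-1 * z) ^+ 2 * (qpoch_oo (ez z) (ez z) * qpoch_oo (- ez z) (ez z)).
Proof.
move=> z0; rewrite /eta ez_nat (qpoch_oo_q2 (nc_ez_lt1 z0)).
have e : 24^-1 * (2 * z) = 2 * (24^-1 * z) :> C by ring.
by rewrite e ez_nat.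
Qed.

Lemma moebius_upper (a b d : int) z :
  moebius (mat a b 0 d) z = (a%:~R * z + b%:~R) / d%:~R.
Proof. by rewrite moebius_mat mul0r add0r. Qed.

Lemma moebiusI1 z : moebius I1 z = z.
Proof. by rewrite moebius_upper mul1r addr0 divr1. Qed.

Lemma moebiusD2 z : moebius D2 z = 2 * z.
Proof. by rewrite moebius_upper addr0 divr1. Qed.

Lemma theta4_eta z : 0 < complex.Im z ->
  eta z ^+ 2 / eta (2 * z) = qpoch_oo (ez z) (ez z) / qpoch_oo (- ez z) (ez z).
Proof.
move=> z0; rewrite (eta_double z0) /eta; have q1 := nc_ez_lt1 z0.
have gen (t P M : C) : t != 0 -> P != 0 -> M != 0 -> (t * P) ^+ 2 / (t ^+ 2 * (P * M)) = P / M.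
  by move=> ? ? ?; field; do ?(apply/andP; split).
exact: (gen _ _ _ (ez_neq0 _) (qpoch_oo_q_neq0 q1) (qpoch_oo_Nq_neq0 q1)).
Qed.

(** The power of [q] is [4/24 - 1/24 = 1/8]. *)
Lemma triangular_eta z : 0 < complex.Im z ->
  eta (2 * z) ^+ 2 / eta z = ez (8^-1 * z) *
    (qpoch_oo (ez z ^+ 2) (ez z ^+ 2) / qpoch_oo (ez z) (ez z ^+ 2)).
Proof.
move=> z0; have q1 := nc_ez_lt1 z0.
rewrite (eta_double z0) (qpoch_oo_q2 q1) (qpoch_oo_odd q1) invrK /eta.
have e : 8^-1 * z = 3 * (24^-1 * z) :> C by field.
rewrite e ez_nat.
have gen (t P M : C) : t != 0 -> P != 0 ->
    (t ^+ 2 * (P * M)) ^+ 2 / (t * P) = t ^+ 3 * (P * M * M).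
  by move=> ? ?; field; do ?(apply/andP; split).
exact: (gen _ _ _ (ez_neq0 _) (qpoch_oo_q_neq0 q1)).
Qed.

(** [n] and [n^2] have the same parity, so the sign [(-1)^n] cancels that of [(-q^2)^(n^2)]. *)
Lemma theta3_double_theta4 q : nc q < 1 ->
  usum (fun n : int => q ^ (2 * (n * n))) =
  qpoch_oo (- q ^+ 2) (- q ^+ 2) / qpoch_oo (- - q ^+ 2) (- q ^+ 2).
Proof.
move=> q1; have q2 : nc (- q ^+ 2) < 1 by rewrite ncN; exact: nc_sqr_lt1.
have [_ <-] := theta4 q2; congr usum; apply/funext => n.
rewrite exprN1z !exprz_ge0E ?mulzz_ge0 ?mul2zz_ge0 // !abszM.
move: (absz n) => m; rewrite (exprNn (q ^+ 2)) mulrA -exprD exprD signX_sqr -exprD addnn -signr_odd odd_double mul1r.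
by rewrite -exprM.
Qed.

Lemma theta3_double_eta z : 0 < complex.Im z ->
  eta_quotient (mat 4 1 0 2) (mat 8 2 0 2) z = usum (fun n : int => ez z ^ (2 * (n * n))).
Proof.
move=> z0; rewrite (theta3_double_theta4 (nc_ez_lt1 z0)); pose w : C := 2 * z + 2^-1.
have e1 : moebius (mat 4 1 0 2) z = w by rewrite moebius_upper /w; field.
have e2 : moebius (mat 8 2 0 2) z = 2 * w by rewrite moebius_upper /w; field.
have w0 : 0 < complex.Im w.
  have uM := @upper_tri_mat 4 1 2 isT isT; rewrite -e1.
  exact: (im_moebius_gt0 z0 (upper_tri_det uM)).
have ew : ez w = - ez z ^+ 2 by rewrite /w ezD ez_nat ez_half mulrN1.
apply: (etrans (y := eta w ^+ 2 / eta (2 * w))); first by rewrite /eta_quotient e1 e2.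
by apply: (etrans (theta4_eta w0)); rewrite ew.
Qed.

Lemma alternating_theta4 q : nc q < 1 ->
  asummable (fun n : int => (-1) ^ (n + 1) * q ^ (n * n)) /\
  usum (fun n : int => (-1) ^ (n + 1) * q ^ (n * n)) = - (qpoch_oo q q / qpoch_oo (- q) q).
Proof.
move=> q1; have [s e] := theta4 q1.
have -> : (fun n : int => (-1) ^ (n + 1) * q ^ (n * n)) =
    (fun n : int => -1 * ((-1) ^ n * q ^ (n * n))).
  apply/funext => n; have N0 : -1 != 0 :> C by rewrite oppr_eq0 oner_eq0.
  have gen (a b : C) : a * -1 * b = -1 * (a * b) by ring.
  by rewrite (expfzDr _ _ N0) expr1z; exact: gen.
by split; [exact: asummableZ|rewrite usumZ // e mulN1r].
Qed.

Lemma q_twistE (r : rat) (F : C -> C) z : q_twist r F z = ez (ratr r * z) * F (ez z).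
Proof. by rewrite /q_twist /ez mulrCA. Qed.

Lemma ratr_natV n : ratr n%:R^-1 = n%:R^-1 :> C.
Proof. by rewrite fmorphV; congr (_^-1); exact: rmorph_nat. Qed.

(** [eta] is treated as the degenerate quotient [eta^2/eta], with the power [q^(1/24)]. *)
Theorem modular_F1 : modular_up_to_q_power (@F1 R).
Proof.
apply: (@modular_of_theta_forms _ _ 24%:R^-1 1 0 _ _ theta_form_eta theta_form_eta) => z z0.
rewrite q_twistE ratr_natV mul1r mul0r addr0 /eta_quotient moebiusI1.
have [_ ->] := F1_sum (nc_ez_lt1 z0).
have gen (x : C) : x != 0 -> x = x ^+ 2 / x by move=> x0; rewrite expr2 mulfK.
exact: (gen _ (eta_neq0 z0)).
Qed.

Theorem modular_F2 : modular_up_to_q_power (@F2 R).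
Proof.
apply: (@modular_of_theta_forms _ _ 0 2^-1 0 _ _ theta_form_theta4 theta_form_theta4) => z z0.
rewrite q_twistE (_ : ratr 0 = 0 :> C); last by rewrite /ratr mul0r.
rewrite mul0r ez0 mul1r mul0r addr0 /eta_quotient moebiusI1 moebiusD2 (theta4_eta z0).
by have [_ ->] := F2_sum (nc_ez_lt1 z0).
Qed.

Theorem modular_F3 : modular_up_to_q_power (@F3 R).
Proof.
apply: (@modular_of_theta_forms _ _ 8%:R^-1 1 0 _ _ theta_form_triangular theta_form_triangular) => z z0.
rewrite q_twistE ratr_natV mul1r mul0r addr0 /eta_quotient moebiusI1 moebiusD2 (triangular_eta z0).
by have [_ ->] := F3_sum (nc_ez_lt1 z0).
Qed.

Theorem modular_F4 : modular_up_to_q_power (@F4 R).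
Proof.
apply: (@modular_of_theta_forms _ _ 0 (- 2^-1) 2^-1 _ _ theta_form_theta4 theta_form_theta3_double) => z z0.
rewrite q_twistE (_ : ratr 0 = 0 :> C); last by rewrite /ratr mul0r.
rewrite mul0r ez0 mul1r (theta3_double_eta z0) /eta_quotient moebiusI1 moebiusD2 (theta4_eta z0).
have [_ ->] := F4_sum (nc_ez_lt1 z0); have [_ ->] := alternating_theta4 (nc_ez_lt1 z0).
by rewrite mulrN mulNr.
Qed.

End ThetaModularity.

(** * The theta identities in the form of part (A) *)

Section Assembly.
Variable R : realType.
Local Notation C := (Cplx R).

Lemma theta_identities (q : C) : `|q| < 1 ->
  [/\ [/\ cvg_sum 0 (F1n ^~ q),
          cvg_usum (fun n : int => (-1) ^ n * q ^ (n * (3 * n + 1) %/ 2)%Z) &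
          F1 q = usum (fun n : int => (-1) ^ n * q ^ (n * (3 * n + 1) %/ 2)%Z)],
      [/\ cvg_sum 0 (F2n_reg ^~ q),
          cvg_usum (fun n : int => (-1) ^ n * q ^ (n * n)) &
          F2 q = 2^-1 * usum (fun n : int => (-1) ^ n * q ^ (n * n))],
      [/\ cvg_sum 0 (F3n ^~ q),
          cvg_usum (fun n : int => q ^ (n * (n + 1) %/ 2)%Z) &
          F3 q = 2^-1 * usum (fun n : int => q ^ (n * (n + 1) %/ 2)%Z)] &
      [/\ cvg_sum 0 (F4n ^~ q),
          cvg_usum (fun n : int => (-1) ^ (n + 1) * q ^ (n * n)),
          cvg_usum (fun n : int => q ^ (2 * (n * n))) &
          F4 q = 2^-1 * usum (fun n : int => (-1) ^ (n + 1) * q ^ (n * n))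
                 + 2^-1 * usum (fun n : int => q ^ (2 * (n * n)))]].
Proof.
rewrite nc_lt1 => q1.
have [c1 e1] := F1_sum q1; have [c2 e2] := F2_sum q1.
have [c3 e3] := F3_sum q1; have [c4 e4] := F4_sum q1.
have [s1 u1] := pentagonal_number q1; have [s2 u2] := theta4 q1.
have [s3 u3] := theta_triangular q1; have [s4 _] := alternating_theta4 q1.
split; split; first exact: c1.
- exact: asummable_cvg_usum s1.
- exact: (etrans e1 (esym u1)).
- exact: c2.
- exact: asummable_cvg_usum s2.
- exact: (etrans e2 (esym (congr1 ( *%R 2^-1) u2))).
- exact: c3.
- exact: asummable_cvg_usum s3.
- apply: (etrans e3); apply: etrans (esym (congr1 ( *%R 2^-1) u3)).
  have gen (x : C) : x = 2^-1 * (2 * x) by field.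
  exact: gen.
- exact: c4.
- exact: asummable_cvg_usum s4.
- exact: asummable_cvg_usum (theta3_double q1).
- exact: e4.
Qed.

End Assembly.

Unset Implicit Arguments.

Theorem theorem2p2 (R : realType) :
  (* (A) *)
  ((forall q : Cplx R, `|q| < 1 ->
     [/\ [/\ cvg_sum 0 (F1n ^~ q),
             cvg_usum (fun n : int => (-1) ^ n * q ^ (n * (3 * n + 1) %/ 2)%Z) &
             F1 q = usum (fun n : int => (-1) ^ n * q ^ (n * (3 * n + 1) %/ 2)%Z)],
         [/\ cvg_sum 0 (F2n_reg ^~ q),
             cvg_usum (fun n : int => (-1) ^ n * q ^ (n * n)) &
             F2 q = 2^-1 * usum (fun n : int => (-1) ^ n * q ^ (n * n))],
         [/\ cvg_sum 0 (F3n ^~ q),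
             cvg_usum (fun n : int => q ^ (n * (n + 1) %/ 2)%Z) &
             F3 q = 2^-1 * usum (fun n : int => q ^ (n * (n + 1) %/ 2)%Z)] &
         [/\ cvg_sum 0 (F4n ^~ q),
             cvg_usum (fun n : int => (-1) ^ (n + 1) * q ^ (n * n)),
             cvg_usum (fun n : int => q ^ (2 * (n * n))) &
             F4 q = 2^-1 * usum (fun n : int => (-1) ^ (n + 1) * q ^ (n * n))
                    + 2^-1 * usum (fun n : int => q ^ (2 * (n * n)))]]) /\
   [/\ modular_up_to_q_power (@F1 R), modular_up_to_q_power (@F2 R),
       modular_up_to_q_power (@F3 R) & modular_up_to_q_power (@F4 R)]) /\
  (* (B) *)
  (forall q : Cplx R, `|q| < 1 ->
     [/\ (* the limit terms and the ghosts, with the shadows equal to 0 *)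
         q != 0 ->
         [/\ [/\ cvgn (fun n => F1n n q^-1),
                 cvg_sum 0 (fun n => F1n n q^-1 - limit_term F1n q) &
                 ghost F1n (fun=> 0) q =
                 sum_from 0 (fun n => 1 / qpoch q q n - 1 / qpoch_oo q q)],
             [/\ cvgn (fun n => F2n n q^-1),
                 cvg_sum 0 (fun n => F2n n q^-1 - limit_term F2n q) &
                 ghost F2n (fun=> 0) q =
                 sum_from 0 (fun n => qpoch (- q) q n / qpoch q q n
                                      - qpoch_oo (- q) q / qpoch_oo q q)],
             [/\ cvgn (fun n => F3n n q^-1),
                 cvg_sum 0 (fun n => F3n n q^-1 - limit_term F3n q) &
                 ghost F3n (fun=> 0) q =
                 sum_from 0 (fun n =>
                   qpoch q (q ^+ 2) n / qpoch (q ^+ 2) (q ^+ 2) n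
                   - qpoch_oo q (q ^+ 2) / qpoch_oo (q ^+ 2) (q ^+ 2))] &
             [/\ cvgn (fun n => F4n n q^-1),
                 cvg_sum 0 (fun n => F4n n q^-1 - limit_term F4n q) &
                 ghost F4n (fun=> 0) q =
                 - sum_from 0 (fun n =>
                     qpoch (- q) q n / (qpoch q q n * (1 - q ^+ (2 * n).+1))
                     - qpoch_oo (- q) q / qpoch_oo q q)]],
         [/\ cvgn (qpoch q q), cvgn (qpoch (- q) q), cvgn (qpoch q (q ^+ 2)) &
             cvgn (qpoch (q ^+ 2) (q ^+ 2))],
         (* the evaluations of the ghosts *)
         [/\ cvg_sum 0 (fun n => 1 / qpoch q q n - 1 / qpoch_oo q q),
             cvg_sum 1 (fun n => q ^+ n / (1 - q ^+ n)) &
             sum_from 0 (fun n => 1 / qpoch q q n - 1 / qpoch_oo q q) =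
             - (1 / qpoch_oo q q) * sum_from 1 (fun n => q ^+ n / (1 - q ^+ n))] /\
         [/\ cvg_sum 0 (fun n => qpoch (- q) q n / qpoch q q n
                                 - qpoch_oo (- q) q / qpoch_oo q q),
             cvg_sum 1 (fun n => q ^+ n / (1 - q ^+ (2 * n))) &
             sum_from 0 (fun n => qpoch (- q) q n / qpoch q q n
                                  - qpoch_oo (- q) q / qpoch_oo q q) =
             - 2 * (qpoch_oo (- q) q / qpoch_oo q q)
             * sum_from 1 (fun n => q ^+ n / (1 - q ^+ (2 * n)))],
         [/\ cvg_sum 0 (fun n =>
               qpoch q (q ^+ 2) n / qpoch (q ^+ 2) (q ^+ 2) n
               - qpoch_oo q (q ^+ 2) / qpoch_oo (q ^+ 2) (q ^+ 2)),
             cvg_sum 1 (fun n => (-1) ^+ n.-1 * q ^+ n / (1 - q ^+ n)) &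
             sum_from 0 (fun n =>
               qpoch q (q ^+ 2) n / qpoch (q ^+ 2) (q ^+ 2) n
               - qpoch_oo q (q ^+ 2) / qpoch_oo (q ^+ 2) (q ^+ 2)) =
             qpoch_oo q (q ^+ 2) / qpoch_oo (q ^+ 2) (q ^+ 2)
             * sum_from 1 (fun n => (-1) ^+ n.-1 * q ^+ n / (1 - q ^+ n))] /\
         [/\ cvg_sum 0 (fun n =>
               qpoch (- q) q n / (qpoch q q n * (1 - q ^+ (2 * n).+1))
               - qpoch_oo (- q) q / qpoch_oo q q),
             cvg_sum 0 (h_term ^~ q) &
             - sum_from 0 (fun n =>
                 qpoch (- q) q n / (qpoch q q n * (1 - q ^+ (2 * n).+1))
                 - qpoch_oo (- q) q / qpoch_oo q q) =
             qpoch_oo (- q) q / qpoch_oo q q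
             * (2 * sum_from 1 (fun n => q ^+ n / (1 - q ^+ (2 * n))) - h_fun q)] &
         cvg_usum (fun I : @nonzero_ideals R =>
           (-1) ^+ ideal_norm (val I) * q ^+ ideal_norm (val I)) /\
         h_fun q = - usum (fun I : @nonzero_ideals R =>
           (-1) ^+ ideal_norm (val I) * q ^+ ideal_norm (val I))]).
Proof.
split.
  split; first exact: theta_identities.
  split; [exact: modular_F1|exact: modular_F2|exact: modular_F3|exact: modular_F4].
move=> q; rewrite nc_lt1 => q1; have q2 := nc_sqr_lt1 q1.
split.
- by move=> q0; exact: limit_terms.
- split; [exact: (cvgP _ (qpoch_cvg q1 (x := q)))|exact: (cvgP _ (qpoch_cvg q1 (x := - q)))|
    exact: (cvgP _ (qpoch_cvg q2 (x := q)))|exact: (cvgP _ (qpoch_cvg q2 (x := q ^+ 2)))].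
- by split; [exact: ghost1|exact: ghost2].
- by split; [exact: ghost3|exact: ghost4].
exact: h_fun_ideals.
Qed.
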